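(* Let $(N,\mathcal{D},J)$ be a compact manifold of dimension $2n+1$ with a CR structure of Sasaki type and let $\mathfrak{t}^+\subset\mathfrak{t}$ be its (reduced) Sasaki cone. When $\xi\in\mathfrak{t}^+$ tends to the boundary of $\mathfrak{t}^+$ away from $0$ (i.e. converges in $\mathfrak{t}$ to a nonzero boundary point of $\mathfrak{t}^+$), the total transversal scalar curvature $\mathbf{S}_\xi$ tends to $+\infty$.
   Context: $N$ is a (connected) compact manifold of dimension $2n+1$, $n\ge 1$. A CR structure $(\mathcal{D},J)$ of Sasaki type on $N$ is a co-oriented contact distribution $\mathcal{D}$ with an integrable complex structure $J$ on $\mathcal{D}$ such that there is a contact form $\eta$ (with $\ker\eta=\mathcal{D}$, compatible with the co-orientation) with $d\eta(\cdot,J\cdot)$ positive definite on $\mathcal{D}$ and whose Reeb vector field lies in $\mathfrak{cr}(\mathcal{D},J)$, the Lie algebra of the group $CR(\mathcal{D},J)$ of (co-orientation preserving) CR diffeomorphisms. Fix a maximal torus $T\subset CR(\mathcal{D},J)$ with Lie algebra $\mathfrak{t}$; $a\in\mathfrak{t}$ induces the vector field $X_a$ on $N$. The (reduced) Sasaki cone is the open convex cone $\mathfrak{t}^+=\{b\in\mathfrak{t} : \eta(X_b)>0 \text{ everywhere on } N\}$; we write $\xi=X_b$ and identify $b$ with $\xi$. For $\xi\in\mathfrak{t}^+$ put $\eta_\xi=\eta/\eta(\xi)$, the contact form of $\mathcal{D}$ with Reeb field $\xi$; let $\Phi_\xi$ be the endomorphism of $TN$ with $\Phi_\xi(\xi)=0$,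 $\Phi_\xi|_{\mathcal{D}}=J$, and $g_\xi=\frac12 d\eta_\xi(\cdot,\Phi_\xi\cdot)+\eta_\xi\otimes\eta_\xi$ the Sasaki metric. Transverse scalar curvature: locally $N\supset U\to V$ is the quotient by the flow of $\xi$, and $(g_\xi|_{\mathcal{D}},\frac12 d\eta_\xi,J)$ descends to a Kähler structure on $V$; the pull-backs to $N$ of the scalar curvatures of these Kähler metrics patch to a global function $s^T_\xi$ on $N$. The total transversal scalar curvature is $\mathbf{S}_\xi=\int_N s^T_\xi\,\frac{\eta_\xi\wedge(d\eta_\xi)^n}{n!}$. *)

(* Defs.v *)
From mathcomp Require Import all_boot all_order all_algebra perm.
From mathcomp Require Import all_classical all_reals all_analysis.

Set Implicit Arguments.
Unset Strict Implicit.
Unset Printing Implicit Defensive.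

Import Order.TTheory GRing.Theory Num.Theory.
Import numFieldTopology.Exports numFieldNormedType.Exports.

Local Open Scope classical_set_scope.
Local Open Scope ring_scope.

(* Conventions. Tangent vectors in a chart are row vectors, and linear maps act
   on the right, so the differential of a map f at x is v |-> v *m jacobian f x.
   A 1-form is a column vector of coefficients, an endomorphism A is the map
   v |-> v *m A, and a bilinear form B is (u, v) |-> u *m B *m v^T. Tensors on a
   manifold are given by their local expressions in all smooth charts; only the
   values on the codomain of the chart are meaningful. *)

Section Calculus.
Variable R : realType.

Definition pairing m (v : 'rV[R]_m) (a : 'cV[R]_m) : R := (v *m a) 0 0.

Definition bil m (B : 'M[R]_m) (u v : 'rV[R]_m) : R := (u *m B *m v^T) 0 0.

Definition partial m (W : normedModType R) (i : 'I_m) (f : 'rV[R]_m -> W) :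
  'rV[R]_m -> W := fun x => 'D_(delta_mx 0 i) f x.

Fixpoint Ck_on m (W : normedModType R) (k : nat) (U : set 'rV[R]_m)
    (f : 'rV[R]_m -> W) : Prop :=
  (forall x, U x -> {for x, continuous f}) /\
  match k with
  | 0 => True
  | k'.+1 => forall i : 'I_m,
      (forall x, U x -> derivable f x (delta_mx 0 i)) /\
      Ck_on k' U (partial i f)
  end.

Definition smooth_on m (W : normedModType R) (U : set 'rV[R]_m)
  (f : 'rV[R]_m -> W) : Prop := forall k, Ck_on k U f.

Definition bracket m (X Y : 'rV[R]_m -> 'rV[R]_m) : 'rV[R]_m -> 'rV[R]_m :=
  fun x => 'D_(X x) Y x - 'D_(Y x) X x.

(* Integral over R^m as an iterated Lebesgue integral; it is only applied to
   continuous functions with compact support. *)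
Fixpoint iterated_integral m : ('rV[R]_m -> R) -> R :=
  match m return ('rV[R]_m -> R) -> R with
  | 0 => fun f => f 0
  | m'.+1 => fun f => Rintegral lebesgue_measure setT
      (fun t : R => iterated_integral
         (fun v : 'rV[R]_m' => f (row_mx (t%:M : 'M[R]_1) v)))
  end.

Section ScalarCurvature.
Variables (d : nat) (h : 'rV[R]_d -> 'M[R]_d).

Definition christoffel (k i j : 'I_d) (y : 'rV[R]_d) : R :=
  2^-1 * \sum_l invmx (h y) k l *
    (partial i (fun z => h z j l) y + partial j (fun z => h z i l) y
     - partial l (fun z => h z i j) y).

Definition ricci (i j : 'I_d) (y : 'rV[R]_d) : R :=
  \sum_k (partial k (christoffel k i j) y - partial j (christoffel k i k) y
    + \sum_l (christoffel k k l y * christoffel l i j y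
              - christoffel k j l y * christoffel l i k y)).

Definition scalar_curvature (y : 'rV[R]_d) : R :=
  \sum_i \sum_j invmx (h y) i j * ricci i j y.

End ScalarCurvature.
End Calculus.

Section Manifolds.
Variable R : realType.

Record chart (T : topologicalType) (m : nat) := Chart {
  cdom : set T;
  ccod : set 'rV[R]_m;
  cmap :> T -> 'rV[R]_m;
  cinv : 'rV[R]_m -> T;
  chart_open_dom : open cdom;
  chart_open_cod : open ccod;
  chart_map_cod : forall p, cdom p -> ccod (cmap p);
  chart_inv_dom : forall x, ccod x -> cdom (cinv x);
  chart_mapK : forall p, cdom p -> cinv (cmap p) = p;
  chart_invK : forall x, ccod x -> cmap (cinv x) = x;
  chart_map_cont : {within cdom, continuous cmap};
  chart_inv_cont : {within ccod, continuous cinv} }.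

Definition local_dom (T : topologicalType) m (f : T -> T) (c c' : chart T m) :
  set 'rV[R]_m := [set x | ccod c x /\ cdom c' (f (cinv c x))].

Definition local_map (T : topologicalType) m (f : T -> T) (c c' : chart T m) :
  'rV[R]_m -> 'rV[R]_m := fun x => c' (f (cinv c x)).

Definition compatible (T : topologicalType) m (c c' : chart T m) : Prop :=
  smooth_on (local_dom idfun c c') (local_map idfun c c') /\
  smooth_on (local_dom idfun c' c) (local_map idfun c' c).

Record manifold (m : nat) := Manifold {
  mcarrier :> topologicalType;
  atlas : set (chart mcarrier m);
  manifold_hausdorff : hausdorff_space mcarrier;
  manifold_second_countable : @second_countable mcarrier;
  atlas_cover : forall p, exists2 c, atlas c & cdom c p;
  atlas_compatible : forall c c', atlas c -> atlas c' -> compatible c c' }.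

Section Tensors.
Variables (m : nat) (M : manifold m).

(* the maximal smooth atlas *)
Definition smooth_chart (c : chart M m) : Prop :=
  forall c', atlas c' -> compatible c c'.

Definition smooth_function (f : M -> R) : Prop :=
  forall c, smooth_chart c -> smooth_on (ccod c) (fun x => f (cinv c x) : R).

Definition smooth_map (f : M -> M) : Prop :=
  forall c c', smooth_chart c -> smooth_chart c' ->
    open (local_dom f c c') /\ smooth_on (local_dom f c c') (local_map f c c').

Definition diffeomorphism (f : M -> M) : Prop :=
  smooth_map f /\ exists g, [/\ smooth_map g, cancel f g & cancel g f].

Record one_form := OneForm {
  form_loc :> chart M m -> 'rV[R]_m -> 'cV[R]_m;
  form_smooth : forall c, smooth_chart c -> smooth_on (ccod c) (form_loc c);
  form_change : forall c c' x, smooth_chart c -> smooth_chart c' ->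
    local_dom idfun c c' x ->
    form_loc c x = jacobian (local_map idfun c c') x
                     *m form_loc c' (local_map idfun c c' x) }.

Record endomorphism := Endomorphism {
  endo_loc :> chart M m -> 'rV[R]_m -> 'M[R]_m;
  endo_smooth : forall c, smooth_chart c -> smooth_on (ccod c) (endo_loc c);
  endo_change : forall c c' x, smooth_chart c -> smooth_chart c' ->
    local_dom idfun c c' x ->
    endo_loc c x *m jacobian (local_map idfun c c') x
      = jacobian (local_map idfun c c') x
          *m endo_loc c' (local_map idfun c c' x) }.

Definition ext_deriv (eta : chart M m -> 'rV[R]_m -> 'cV[R]_m)
    (c : chart M m) (x : 'rV[R]_m) : 'M[R]_m :=
  \matrix_(i, j) (partial i (fun y => eta c y j 0) x
                  - partial j (fun y => eta c y i 0) x).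

(* Smooth actions of the additive group R^k on M; for k = 1 these are the
   complete flows. *)
Definition smooth_action k (rho : 'rV[R]_k -> M -> M) : Prop :=
  [/\ forall p, rho 0 p = p,
      forall a b p, rho (a + b) p = rho a (rho b p) &
      forall c c', smooth_chart c -> smooth_chart c' ->
        let U := [set z : 'rV[R]_(k + m) | ccod c (rsubmx z) /\
                    cdom c' (rho (lsubmx z) (cinv c (rsubmx z)))] in
        open U /\
        smooth_on U (fun z => c' (rho (lsubmx z) (cinv c (rsubmx z))))].

(* local expression of the vector field X_a induced by a *)
Definition fundamental_field k (rho : 'rV[R]_k -> M -> M) (a : 'rV[R]_k)
    (c : chart M m) (x : 'rV[R]_m) : 'rV[R]_m :=
  derive1 (fun t : R => c (rho (t *: a) (cinv c x))) 0.

(* I is the integral over M of f * omega, where omega is a nowhere vanishing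
   top-degree form with local densities [vol], and M is oriented by omega: only
   the charts in which the density is positive are used. *)
Definition is_integral (vol : chart M m -> 'rV[R]_m -> R) (f : M -> R)
    (I : R) : Prop :=
  exists (r : nat) (c : 'I_r -> chart M m) (chi : 'I_r -> M -> R),
    [/\ forall i, smooth_chart (c i) /\
          (forall x, ccod (c i) x -> 0 < vol (c i) x),
        forall i, [/\ smooth_function (chi i), forall p, 0 <= chi i p &
          closure [set p | chi i p != 0] `<=` cdom (c i)],
        forall p, \sum_i chi i p = 1 &
        I = \sum_i iterated_integral (fun x =>
              if `[< ccod (c i) x >]
              then chi i (cinv (c i) x) * f (cinv (c i) x) * vol (c i) x
              else 0)].

Definition integral_over (vol : chart M m -> 'rV[R]_m -> R) (f : M -> R) : R :=
  xget 0 [set I | is_integral vol f I].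

End Tensors.
End Manifolds.

Section CR.
Variables (R : realType) (n : nat) (M : manifold R n.*2.+1).
Local Notation E := 'rV[R]_(n.*2.+1).
Local Notation chartM := (chart R M n.*2.+1).

(* coefficient of eta /\ (d eta)^n on the coordinate frame of the chart *)
Definition contact_volume (eta : chartM -> E -> 'cV[R]_(n.*2.+1))
    (c : chartM) (x : E) : R :=
  (2 ^+ n)^-1 * \sum_(s : 'S_(n.*2.+1)) (-1) ^+ s * eta c x (s ord0) 0 *
     \prod_(k < n) ext_deriv eta c x (s (inord k.*2.+1)) (s (inord k.*2.+2)).

(* eta is a contact form with kernel D, positive on the side P of D *)
Definition contact_form (D P : chartM -> E -> set E) (eta : one_form M) : Prop :=
  forall c x, smooth_chart c -> ccod c x ->
    [/\ forall v, D c x v <-> pairing v (eta c x) = 0,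
        forall v, P c x v <-> 0 < pairing v (eta c x) &
        contact_volume eta c x != 0].

Definition integrable_structure (D : chartM -> E -> set E)
    (J : endomorphism M) : Prop :=
  forall c (X Y : E -> E), smooth_chart c ->
    smooth_on (ccod c) X -> smooth_on (ccod c) Y ->
    (forall x, ccod c x -> D c x (X x) /\ D c x (Y x)) ->
    let JX := fun x => X x *m J c x in
    let JY := fun x => Y x *m J c x in
    forall x, ccod c x ->
      D c x (bracket JX Y x + bracket X JY x) /\
      bracket JX JY x - bracket X Y x
        = (bracket JX Y x + bracket X JY x) *m J c x.

(* The complex structure on the contact distribution [cr_dist] is the
   restriction of [cr_J]; the values of [cr_J] off the distribution are
   irrelevant. The co-orientation is given by [cr_pos], the open half-space of
   positive vectors in each tangent space. *)
Record CR_structure := CRStructure {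
  cr_dist : chartM -> E -> set E;
  cr_pos : chartM -> E -> set E;
  cr_J : endomorphism M;
  cr_contact : exists eta, contact_form cr_dist cr_pos eta;
  cr_J_stable : forall c x v, smooth_chart c -> ccod c x -> cr_dist c x v ->
    cr_dist c x (v *m cr_J c x);
  cr_J_sqr : forall c x v, smooth_chart c -> ccod c x -> cr_dist c x v ->
    v *m cr_J c x *m cr_J c x = - v;
  cr_J_integrable : integrable_structure cr_dist cr_J }.

Variable S : CR_structure.

Definition CR_contact_form (eta : one_form M) : Prop :=
  contact_form (cr_dist S) (cr_pos S) eta.

Definition CR_diffeomorphism (f : M -> M) : Prop :=
  diffeomorphism f /\
  forall c c' x, smooth_chart c -> smooth_chart c' -> local_dom f c c' x ->
    let y := local_map f c c' x in
    let df := jacobian (local_map f c c') x in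
    [/\ forall v, cr_dist S c x v <-> cr_dist S c' y (v *m df),
        forall v, cr_pos S c x v <-> cr_pos S c' y (v *m df) &
        forall v, cr_dist S c x v ->
          v *m cr_J S c x *m df = v *m df *m cr_J S c' y].

(* the Lie algebra cr(D, J) of the group of CR diffeomorphisms: generators of
   its one-parameter subgroups *)
Definition CR_field (X : chartM -> E -> E) : Prop :=
  exists rho : 'rV[R]_1 -> M -> M,
    [/\ smooth_action rho, forall a, CR_diffeomorphism (rho a) &
        forall c x, smooth_chart c -> ccod c x ->
          X c x = fundamental_field rho (const_mx 1) c x].

Definition Reeb_field (eta : one_form M) (X : chartM -> E -> E) : Prop :=
  forall c x, smooth_chart c -> ccod c x ->
    pairing (X c x) (eta c x) = 1 /\
    forall v, bil (ext_deriv eta c x) (X c x) v = 0.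

Definition Sasaki_type : Prop :=
  exists (eta : one_form M) (X : chartM -> E -> E),
    [/\ CR_contact_form eta,
        forall c x v, smooth_chart c -> ccod c x -> cr_dist S c x v -> v != 0 ->
          0 < bil (ext_deriv eta c x) v (v *m cr_J S c x),
        Reeb_field eta X &
        CR_field X].

(* A k-dimensional torus in the group of CR diffeomorphisms, as an action of
   its Lie algebra R^k whose kernel is exactly the lattice Z^k. *)
Definition CR_torus k (rho : 'rV[R]_k -> M -> M) : Prop :=
  [/\ smooth_action rho, forall a, CR_diffeomorphism (rho a) &
      forall a, (forall p, rho a p = p) <-> (forall i, a 0 i \is a Num.int)].

Definition maximal_CR_torus k (rho : 'rV[R]_k -> M -> M) : Prop :=
  CR_torus rho /\
  forall l (sigma : 'rV[R]_l -> M -> M), CR_torus sigma ->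
    range rho `<=` range sigma -> range sigma = range rho.

Section SasakiCone.
Variables (k : nat) (rho : 'rV[R]_k -> M -> M) (eta : one_form M).

Definition Sasaki_cone : set 'rV[R]_k :=
  [set b | forall c x, smooth_chart c -> ccod c x ->
     0 < pairing (fundamental_field rho b c x) (eta c x)].

Variable b : 'rV[R]_k.
Local Notation xi := (fundamental_field rho b).

Definition eta_xi (c : chartM) (x : E) : 'cV[R]_(n.*2.+1) :=
  (pairing (xi c x) (eta c x))^-1 *: eta c x.

(* Phi_xi v = J (v - eta_xi(v) xi) *)
Definition Phi_xi (c : chartM) (x : E) : 'M[R]_(n.*2.+1) :=
  (1%:M - eta_xi c x *m xi c x) *m cr_J S c x.

Definition Sasaki_metric (c : chartM) (x : E) : 'M[R]_(n.*2.+1) :=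
  2^-1 *: (ext_deriv eta_xi c x *m (Phi_xi c x)^T)
    + eta_xi c x *m (eta_xi c x)^T.

(* On the domain U of the chart c, the map q (read in c) is the quotient of U
   by the flow of xi, onto an open subset of R^2n carrying the metric h to
   which the restriction of g_xi to D descends. *)
Definition local_quotient (c : chartM) (q : E -> 'rV[R]_(n.*2))
    (h : 'rV[R]_(n.*2) -> 'M[R]_(n.*2)) : Prop :=
  [/\ smooth_chart c,
      smooth_on (ccod c) q /\
        (forall x, ccod c x -> \rank (jacobian q x) = n.*2),
      forall x y, ccod c x -> ccod c y ->
        (q x = q y <-> exists t : R,
           (forall r : R, 0 <= r <= 1 ->
              cdom c (rho ((r * t) *: b) (cinv c x))) /\
           rho (t *: b) (cinv c x) = cinv c y) &
      forall x u v, ccod c x -> cr_dist S c x u -> cr_dist S c x v ->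
        bil (Sasaki_metric c x) u v
          = bil (h (q x)) (u *m jacobian q x) (v *m jacobian q x)].

Definition transverse_scalar_curvature (p : M) : R :=
  xget 0 [set s | exists c q h, [/\ local_quotient c q h, cdom c p &
                    s = scalar_curvature h (q (c p))]].

Definition total_transverse_scalar_curvature : R :=
  integral_over (contact_volume eta_xi)
    (fun p => transverse_scalar_curvature p / n`!%:R).

End SasakiCone.
End CR.

(* Main.v *)
(** Fix a Reeb field b1 in the cone and put f_b = eta_{b1}(X_b), which is linear in b. In charts
adapted to the flow of b1 everything descends to a transverse slice with Kaehler metric h, where
[s_b = f s_1 + (2n + 2) Lap f - (2n + 2) (2n + 4) / 4 |df|^2 / f] for [f = f_b], and the volume
form of b is [f^(-n-1)] times that of b1. Subtracting a multiple of the divergence of [f^(-n-1)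
grad f], whose integral vanishes, bounds the integral of [s_b] from below by that of [f^(-n-1)
(c Lap f - C f)].
For b0 on the boundary, [f_b0 >= 0] has zeros, and [Lap f_b0 > 0] at each of them: otherwise the
2-jet of [f_b0], hence the 1-jet of X_b0, vanishes there, and X_b0, a Killing field of the
metric of b1, is zero on the connected manifold, so [b0 = 0]. By compactness [c Lap f_b >= 1 - C
f_b] for b near b0. Finally [f_b <= C r^2] on a cube of radius r around a zero of [f_b0] once b
is close to b0, so the integral of [f_b^(-n-1)] is at least of order [r^(2n+1) r^(-2n-2) = 1 /
r]. *)

(* The curvature and the integral in the statement are defined by choice, the former through any
   local quotient, the latter through any partition of unity, so both must be shown independent of
   the choice. For the curvature, the formula is derived for an arbitrary quotient map. For the
   integral, the change of variables formula is proved by homotopy to the linear part: the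
   derivative of the transported density is a divergence. The divergence subtracted from s_b is
   taken chart by chart with cut-offs. Cut-offs and volume density contribute terms linear in df.
   The multiple must therefore exceed n + 2, which leaves a positive multiple of |df|^2 / f to
   absorb them, and stay below 2n + 2, which keeps a positive multiple of Lap f; n + 5/2 is possible
   because n > 0. The cut-off enters as psi^4: its derivative carries psi^3, and completing the
   square against psi^4 |df|^2 / f leaves psi^2 f. With the weight f^(-n-1) this is an error of
   order f^(-n), which a small multiple of the integral of f^(-n-1) dominates. *)
From HB Require Import structures.
Require Import Defs.
From mathcomp Require Import all_boot all_order all_algebra perm.
From mathcomp Require Import all_classical all_reals all_analysis.
From mathcomp Require Import ring lra.

Set Implicit Arguments.
Unset Strict Implicit.
Unset Printing Implicit Defensive.

Import Order.TTheory GRing.Theory Num.Theory.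
Import numFieldTopology.Exports numFieldNormedType.Exports.

Local Open Scope classical_set_scope.
Local Open Scope ring_scope.

(** * Elementary calculus on row vectors *)

Section NormMatrix.
Variables (R : realType) (m n : nat).
Implicit Types (x : 'M[R]_(m, n)) (e : R).

Lemma coord_le_norm x i j : `|x i j| <= `|x|.
Proof. by rewrite [leRHS]/Num.Def.normr/= mx_normrE; exact: (le_bigmax _ _ (i, j)). Qed.

Lemma norm_le_coord x e : 0 <= e -> (forall i j, `|x i j| <= e) -> `|x| <= e.
Proof.
move=> e0 h; rewrite [leLHS]/Num.Def.normr/= mx_normrE.
by apply: bigmax_le => // -[i j] _; exact: h.
Qed.

Lemma norm_lt_coord x e : 0 < e -> (forall i j, `|x i j| < e) -> `|x| < e.
Proof.
move=> e0 h; rewrite [ltLHS]/Num.Def.normr/= mx_normrE.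
by apply: bigmax_lt => // -[i j] _; exact: h.
Qed.

Lemma continuous_mxP (T : topologicalType) (f : T -> 'M[R]_(m, n)) (t : T) :
  {for t, continuous f} <-> forall i j, {for t, continuous (fun s => f s i j : R)}.
Proof.
split=> [cf i j|cf].
  apply/cvgrPdist_lt => e e0; move/cvgrPdist_lt: cf => /(_ e e0); apply: filterS => s.
  by apply: le_lt_trans; have := coord_le_norm (f t - f s) i j; rewrite !mxE.
apply/cvgrPdist_lt => e e0.
have : \forall s \near t, forall ij : 'I_m * 'I_n, `|f t ij.1 ij.2 - f s ij.1 ij.2| < e.
  by apply: filter_forall => -[i j] /=; exact: (cvgrPdist_lt _ _).1 (cf i j) e e0.
by apply: filterS => s h; apply: norm_lt_coord => // i j; rewrite !mxE; exact: (h (i, j)).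
Qed.

End NormMatrix.

Section LineDerivative.
Variables (R : realType) (V : normedModType R).

Lemma line_derive (W : normedModType R) (f : V -> W) x v s :
  'D_1 (fun t : R => f (x + t *: v)) s = 'D_v f (x + s *: v) /\
  (derivable f (x + s *: v) v -> derivable (fun t : R => f (x + t *: v)) s 1).
Proof.
have E : (fun h => h^-1 *: (((fun t : R => f (x + t *: v)) \o shift s) (h *: (1 : R))
     - f (x + s *: v)))
  = (fun h => h^-1 *: ((f \o shift (x + s *: v)) (h *: v) - f (x + s *: v))).
  apply/funext => h /=; congr (_ *: (f _ - _)).
  by rewrite [h *: 1]mulr1 scalerDl addrCA.
by rewrite /derivable /derive E.
Qed.

(** One statement serves both signs of [t]; the intermediate point is located only by [|s| <= |t|],
    which is all that estimates on balls require. *)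
Lemma line_MVT (f : V -> R) x v (t : R) :
  (forall s : R, `|s| <= `|t| -> derivable f (x + s *: v) v) ->
  exists2 s : R, `|s| <= `|t| & f (x + t *: v) - f x = t * 'D_v f (x + s *: v).
Proof.
move=> df; pose g (s : R) := f (x + s *: v).
have dg (s : R) : `|s| <= `|t| -> is_derive s 1 g ('D_v f (x + s *: v)).
  move=> st; have [<- d] := line_derive f x v s; exact/derivableP/d/df.
have g0 : g 0 = f x by rewrite /g scale0r addr0.
have [t0|t0] := leP 0 t.
  have [s|s|s + E] := @MVT_segment R g (fun s => 'D_v f (x + s *: v)) 0 t t0.
  - rewrite in_itv/= => /andP[a b]; apply: dg.
    by rewrite !ger0_norm ?(ltW b)// ltW.
  - apply: derivable_within_continuous => r; rewrite in_itv/= => /andP[a b].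
    by case: (dg r) => //; rewrite !ger0_norm.
  - rewrite in_itv/= => /andP[a b]; exists s; first by rewrite !ger0_norm.
    by move: E; rewrite -g0 subr0 mulrC.
have [s|s|s + E] := @MVT_segment R g (fun s => 'D_v f (x + s *: v)) t 0 (ltW t0).
- rewrite in_itv/= => /andP[a b]; apply: dg.
  by rewrite !ler0_norm ?(ltW b) ?(ltW t0)// lerN2 ltW.
- apply: derivable_within_continuous => r; rewrite in_itv/= => /andP[a b].
  by case: (dg r) => //; rewrite !ler0_norm ?(ltW t0)// lerN2.
- rewrite in_itv/= => /andP[a b]; exists s; first by rewrite !ler0_norm ?(ltW t0)// lerN2.
  by move: E; rewrite -g0 sub0r mulrN mulrC => /(congr1 -%R); rewrite opprB opprK.
Qed.

End LineDerivative.

Lemma continuous_sum (R : realType) (T : topologicalType) (t : T) (I : Type) (r : seq I)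
    (P : pred I) (f : I -> T -> R) : (forall i, {for t, continuous (f i)}) ->
  {for t, continuous (fun s => \sum_(i <- r | P i) f i s)}.
Proof.
move=> cf; elim: r => [|i r IH].
  by rewrite (_ : (fun _ => _) = cst 0); [exact: cst_continuous|apply/funext => s; rewrite big_nil].
rewrite (_ : (fun _ => _) = if P i then (fun s => f i s + \sum_(i <- r | P i) f i s)
   else (fun s => \sum_(i <- r | P i) f i s)); last first.
  by apply/funext => s; rewrite big_cons; case: ifP.
by case: ifP => // _; exact: (cvgD (cf i) IH).
Qed.

Section PairingLinear.
Variables (R : realType) (m : nat) (a : 'cV[R]_m).

(** The pairing with a covector, equipped below with a linear structure so that it can serve as the
    differential in [diff_unique]. *)
Definition linear_form (v : 'rV[R]_m) : R := \sum_i v 0 i * a i 0.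

Lemma linear_form_is_linear : linear linear_form.
Proof.
move=> c u v; rewrite /linear_form scaler_sumr -big_split; apply: eq_bigr => i _ /=.
by rewrite !mxE mulrDl -mulrA.
Qed.

HB.instance Definition _ :=
  GRing.isLinear.Build R 'rV[R]_m R _ linear_form linear_form_is_linear.

Lemma linear_form_continuous : continuous linear_form.
Proof.
move=> v; apply: continuous_sum => i.
apply: (@continuousM R 'rV[R]_m (fun v => v 0 i) (fun=> a i 0)); last exact: cst_continuous.
exact: coord_continuous.
Qed.

End PairingLinear.

Section C1.
Variables (R : realType) (m : nat).
Local Notation E := 'rV[R]_m.

Lemma row_sum_partialP (h : E) (k : 'I_m) :
  (\row_i (if (i < k.+1)%N then h 0 i else 0) : E)
  = \row_i (if (i < k)%N then h 0 i else 0) + h 0 k *: delta_mx 0 k.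
Proof.
apply/rowP => i; rewrite !mxE eqxx ltnS leq_eqVlt.
have [->|ik] := eqVneq i k; first by rewrite eqxx ltnn add0r mulr1.
by rewrite mulr0 addr0 (_ : (i == k :> nat) = false) //; apply/negbTE.
Qed.

(** The increment from [x] to [x + h] is split along the broken line of truncations [p k] of [h],
    whose segments are parallel to the axes. The mean value theorem on each segment compares the
    increment with the partial derivative at [x], and the sup norm keeps the broken line inside the
    ball. *)
Lemma partial_continuous_differentiable (f : E -> R) (x : E) :
  (\forall y \near x, forall i, derivable f y (delta_mx 0 i)) ->
  (forall i, {for x, continuous (partial i f)}) -> differentiable f x.
Proof.
move=> df cf; pose L := linear_form (\col_i partial i f x).
suff E : f \o shift x = cst (f x) + (L : E -> R) +o_ (0 : E) id.
  have D := diff_unique (@linear_form_continuous _ _ _) E.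
  by apply/diff_locallyP; rewrite D; split => //; exact: linear_form_continuous.
apply/eqaddoP => e e0.
(* Each of the [m] segments may contribute e / (m + 1); the extra one avoids a division by zero in
   dimension 0. *)
have : \forall y \near x, (forall i, derivable f y (delta_mx 0 i)) /\
    forall i, `|partial i f x - partial i f y| <= e / m.+1%:R.
  near=> y; split; first by near: y.
  near: y; apply: filter_forall => i.
  by move/cvgrPdist_le : (cf i); apply; rewrite divr_gt0.
move=> /nbhs_ballP[d /= d0 hd].
apply/nbhs_ballP; exists d => //= h; rewrite -ball_normE /= sub0r normrN => hlt.
pose p k : E := \row_i (if (i < k)%N then h 0 i else 0).
have inball (k : 'I_m) s : `|s| <= `|h 0 k| -> ball x d (x + p k + s *: delta_mx 0 k).
  move=> sh; rewrite -ball_normE /= -addrA opprD addNKr normrN.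
  apply: norm_lt_coord => // i j; rewrite !mxE ord1 eqxx/=.
  have [->|jk] := eqVneq j k.
    by rewrite ltnn add0r mulr1 (le_lt_trans sh)// (le_lt_trans _ hlt)// coord_le_norm.
  rewrite mulr0 addr0; case: ifP => _; last by rewrite normr0.
  by rewrite (le_lt_trans _ hlt)// coord_le_norm.
have Eh : f (h + x) - f x = \sum_(k < m) (f (x + p k.+1) - f (x + p k)).
  rewrite -(big_mkord xpredT (fun k => f (x + p k.+1) - f (x + p k))).
  rewrite telescope_sumr//; congr (f _ - f _).
    by rewrite addrC; congr (_ + _); apply/rowP => i; rewrite mxE ltn_ord.
  by rewrite [p 0](_ : _ = 0) ?addr0//; apply/rowP => i; rewrite !mxE.
change (`|f (h + x) - (f x + L h)| <= e * `|h|); rewrite opprD addrA.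
rewrite Eh /L /linear_form -sumrB.
apply: le_trans (ler_norm_sum _ _ _) _.
apply: (@le_trans _ _ (\sum_(k < m) (e / m.+1%:R * `|h|))).
  apply: ler_sum => k _; rewrite mxE.
  have [s|s sh] := @line_MVT R _ f (x + p k) (delta_mx 0 k) (h 0 k).
    move=> /inball /hd[]; exact.
  rewrite -addrA -row_sum_partialP => ->; rewrite -mulrBr normrM mulrC.
  apply: ler_pM => //; last exact: coord_le_norm.
  by rewrite distrC; case: (hd _ (inball k s sh)) => _; exact.
rewrite -mulr_suml sumr_const card_ord ler_wpM2r// -[_ *+ m]mulr_natr -mulrA ler_piMr ?(ltW e0)//.
by rewrite mulrC ler_pdivrMr// mul1r ler_nat.
Unshelve. all: by end_near. Qed.

End C1.

Section PartialRules.
Variables (R : realType) (m : nat).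
Local Notation E := 'rV[R]_m.

Lemma near_open (T : topologicalType) (U : set T) (P : T -> Prop) x :
  open U -> U x -> (forall y, U y -> P y) -> \forall y \near x, P y.
Proof. by move=> oU Ux h; apply: (filterS h); exact: open_nbhs_nbhs. Qed.

Lemma partial_ext (W : normedModType R) (U : set E) (f g : E -> W) i x :
  open U -> U x -> (forall y, U y -> f y = g y) -> partial i f x = partial i g x.
Proof. by move=> oU Ux h; apply: near_eq_derive; exact: near_open h. Qed.

Lemma derivable_ext (W : normedModType R) (U : set E) (f g : E -> W) v x :
  open U -> U x -> (forall y, U y -> f y = g y) -> derivable f x v -> derivable g x v.
Proof. by move=> oU Ux h; apply: near_eq_derivable; exact: near_open h. Qed.

Lemma continuous_ext (T T' : topologicalType) (U : set T) (f g : T -> T') x :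
  open U -> U x -> (forall y, U y -> f y = g y) -> {for x, continuous f} -> {for x, continuous g}.
Proof.
move=> oU Ux h cf; rewrite /prop_for /continuous_at -(h x Ux) => A /cf fA.
change (\forall y \near x, A (g y)).
by near=> y; rewrite -h; [near: y; exact: fA|near: y; exact: open_nbhs_nbhs].
Unshelve. all: by end_near. Qed.

End PartialRules.

Section ChainRule.
Variables (R : realType) (m p : nat).

Lemma differentiable_rowP (g : 'rV[R]_m -> 'rV[R]_p) x :
  (forall j, differentiable (fun y => g y 0 j : R) x) -> differentiable g x.
Proof.
move=> dg.
have -> : g = \sum_(j < p) (fun y => g y 0 j *: (delta_mx 0 j : 'rV[R]_p)).
  by apply/funext => y; rewrite fct_sumE {1}(row_sum_delta (g y)).
by apply: differentiable_sum => j; exact: differentiableZl.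
Qed.

Lemma chain_rule (f : 'rV[R]_p -> R) (g : 'rV[R]_m -> 'rV[R]_p) x v :
  differentiable f (g x) -> (forall j, differentiable (fun y => g y 0 j : R) x) ->
  differentiable (fun y => f (g y)) x /\
  'D_v (fun y => f (g y)) x
    = \sum_j partial j f (g x) * 'D_v (fun y => g y 0 j : R) x.
Proof.
move=> df dg; have dG := differentiable_rowP dg.
have dfg : differentiable (f \o g) x by exact: differentiable_comp.
split; first exact: dfg.
have dGE : 'd g x v = 'D_v g x by rewrite deriveE.
rewrite [LHS](@deriveE _ _ _ (f \o g))// diff_comp//= dGE derive_mx; last exact: diff_derivable.
rewrite [X in 'd f _ X]row_sum_delta linear_sum /=; apply: eq_bigr => j _.
by rewrite linearZ mxE /= /partial (deriveE _ df); exact: mulrC.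
Qed.

End ChainRule.

(** * Calculus of C^k and smooth functions *)

Section CkCalculus.
Variables (R : realType) (m : nat).
Local Notation E := 'rV[R]_m.
Implicit Types (U V : set E) (k : nat).

Lemma Ck_on_subset (W : normedModType R) k U V (f : E -> W) :
  V `<=` U -> Ck_on k U f -> Ck_on k V f.
Proof.
move=> VU; elim: k f => [|k IH] f [cf df]; (split; first by move=> x /VU /cf) => // i.
by have [d c] := df i; split=> [x /VU /d|] //; exact: IH.
Qed.

Lemma Ck_on_ext (W : normedModType R) k U (f g : E -> W) :
  open U -> (forall x, U x -> f x = g x) -> Ck_on k U f -> Ck_on k U g.
Proof.
move=> oU; elim: k f g => [|k IH] f g fg [cf df];
  (split; first by move=> x Ux; exact: (continuous_ext oU Ux fg (cf x Ux))) => // i.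
have [d c] := df i; split=> [x Ux|]; first exact: derivable_ext fg (d x Ux).
by apply: IH c => x Ux; exact: partial_ext fg.
Qed.

Lemma Ck_onS (W : normedModType R) k U (f : E -> W) : Ck_on k.+1 U f -> Ck_on k U f.
Proof.
elim: k f => [|k IH] f [cf df]; split=> // i; have [d c] := df i; split=> //; exact: IH.
Qed.

Lemma Ck_on_differentiable k U (f : E -> R) x :
  open U -> Ck_on k.+1 U f -> U x -> differentiable f x.
Proof.
move=> oU [cf df] Ux; apply: partial_continuous_differentiable.
  by apply: near_open oU Ux _ => y Uy i; case: (df i) => + _; apply.
by move=> i; case: (df i) => _; case: k {df} => [|k] [c _]; exact: c.
Qed.

Lemma Ck_on_cst (W : normedModType R) k U (w : W) : Ck_on k U (fun=> w).
Proof.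
elim: k w => [|k IH] w; (split; first by move=> x _; exact: cst_continuous) => // i.
split=> [x _|]; first exact: derivable_cst.
rewrite (_ : partial i _ = fun=> 0) //; apply/funext => x; exact: derive_cst.
Qed.

Lemma Ck_onD k U (f g : E -> R) : open U -> Ck_on k U f -> Ck_on k U g ->
  Ck_on k U (fun x => f x + g x).
Proof.
move=> oU; elim: k f g => [|k IH] f g [cf df] [cg dg];
  (split; first by move=> x Ux; exact: (continuousD (cf x Ux) (cg x Ux))) => // i.
have [d c] := df i; have [d' c'] := dg i.
split=> [x Ux|]; first exact: (derivableD (d x Ux) (d' x Ux)).
apply: Ck_on_ext (IH _ _ c c') => // x Ux.
by rewrite /partial -deriveD//; [exact: d|exact: d'].
Qed.

Lemma Ck_onM k U (f g : E -> R) : open U -> Ck_on k U f -> Ck_on k U g ->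
  Ck_on k U (fun x => f x * g x).
Proof.
move=> oU; elim: k f g => [|k IH] f g Cf Cg; have [cf df] := Cf; have [cg dg] := Cg;
  (split; first by move=> x Ux; exact: (continuousM (cf x Ux) (cg x Ux))) => // i.
have [d c] := df i; have [d' c'] := dg i.
split=> [x Ux|]; first exact: (derivableM (d x Ux) (d' x Ux)).
apply: Ck_on_ext (Ck_onD oU (IH _ _ (Ck_onS Cf) c') (IH _ _ c (Ck_onS Cg))) => // x Ux.
rewrite /partial -[in RHS](_ : f * g = fun x => f x * g x)// deriveM//; [|exact: d|exact: d'].
by congr (_ + _); exact: mulrC.
Qed.

Lemma Ck_onN k U (f : E -> R) : open U -> Ck_on k U f -> Ck_on k U (fun x => - f x).
Proof.
move=> oU Cf; apply: Ck_on_ext (Ck_onM oU (Ck_on_cst k U (-1 : R)) Cf) => // x _.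
by rewrite mulN1r.
Qed.

Lemma Ck_onV k U (f : E -> R) : open U -> (forall x, U x -> f x != 0) ->
  Ck_on k U f -> Ck_on k U (fun x => (f x)^-1).
Proof.
move=> oU f0; elim: k => [|k IH] Cf; have [cf df] := Cf;
  (split; first by move=> x Ux; exact: (cvgV (f0 x Ux) (cf x Ux))) => // i.
have [d c] := df i; have IHf := IH (Ck_onS Cf).
split=> [x Ux|]; first exact: (derivableV (f0 x Ux) (d x Ux)).
apply: Ck_on_ext (Ck_onN oU (Ck_onM oU (Ck_onM oU IHf IHf) c)) => // x Ux.
rewrite /partial deriveV//; [|exact: f0|exact: d].
by rewrite -[RHS]/(- (f x ^+ 2)^-1 * 'D_(delta_mx 0 i) f x) expr2 invfM mulNr.
Qed.

Lemma Ck_on_sum k U (I : Type) (r : seq I) (P : pred I) (f : I -> E -> R) : open U ->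
  (forall i, P i -> Ck_on k U (f i)) -> Ck_on k U (fun x => \sum_(i <- r | P i) f i x).
Proof.
move=> oU Cf; elim: r => [|i r IH].
  by apply: Ck_on_ext (Ck_on_cst k U (0 : R)) => // x _; rewrite big_nil.
have [Pi|Pi] := boolP (P i).
  by apply: Ck_on_ext (Ck_onD oU (Cf i Pi) IH) => // x _; rewrite big_cons Pi.
by apply: Ck_on_ext IH => // x _; rewrite big_cons (negbTE Pi).
Qed.

Lemma Ck_on_prod k U (I : Type) (r : seq I) (P : pred I) (f : I -> E -> R) : open U ->
  (forall i, P i -> Ck_on k U (f i)) -> Ck_on k U (fun x => \prod_(i <- r | P i) f i x).
Proof.
move=> oU Cf; elim: r => [|i r IH].
  by apply: Ck_on_ext (Ck_on_cst k U (1 : R)) => // x _; rewrite big_nil.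
have [Pi|Pi] := boolP (P i).
  by apply: Ck_on_ext (Ck_onM oU (Cf i Pi) IH) => // x _; rewrite big_cons Pi.
by apply: Ck_on_ext IH => // x _; rewrite big_cons (negbTE Pi).
Qed.

Lemma Ck_on_mxP k U p q (f : E -> 'M[R]_(p, q)) : open U ->
  Ck_on k U f <-> forall i j, Ck_on k U (fun x => f x i j : R).
Proof.
move=> oU; elim: k f => [|k IH] f.
  split=> [[cf _] i j|cf]; split=> // x Ux; first exact: (continuous_mxP _ _).1 (cf x Ux) i j.
  by apply/continuous_mxP => i j; case: (cf i j) => + _; apply.
split=> [[cf df] i j|Cf].
  split=> [x Ux|l]; first exact: (continuous_mxP _ _).1 (cf x Ux) i j.
  have [d c] := df l; split=> [x Ux|]; first exact: (derivable_mxP _ _ _).1 (d x Ux) i j.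
  apply: Ck_on_ext ((IH _).1 c i j) => // x Ux.
  by rewrite {1}/partial derive_mx ?mxE//; exact: d.
split=> [x Ux|l]; first by apply/continuous_mxP => i j; case: (Cf i j) => + _; apply.
have d x : U x -> derivable f x (delta_mx 0 l).
  by move=> Ux; apply/derivable_mxP => i j; case: (Cf i j) => _ /(_ l)[+ _]; apply.
split=> //; apply/IH => i j; case: (Cf i j) => _ /(_ l)[_ c].
apply: Ck_on_ext c => // x Ux.
by rewrite {2}/partial derive_mx ?mxE//; exact: d.
Qed.

Lemma Ck_on_coord k U i : Ck_on k U (fun x => x 0 i : R).
Proof.
case: k => [|k]; (split; first by move=> x _; exact: coord_continuous) => // j.
split=> [x _|]; first by apply: diff_derivable; exact: differentiable_coord.
rewrite (_ : partial j _ = fun=> ((i == j)%:R : R)); first exact: Ck_on_cst.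
apply/funext => x; rewrite /partial -[RHS]/((i == j)%:R : R).
have /= := @derive_mx R E 1 m id x (delta_mx 0 j) (@derivable_id _ _ _ _).
by rewrite derive_id => /rowP /(_ i); rewrite !mxE.
Qed.

End CkCalculus.

(** By the chain rule the partial derivatives of the composite are sums of products of [partial j f]
    composed with [g] and of derivatives of [g], so the induction on [k] runs over all [f] at
    once. *)
Lemma Ck_on_comp (R : realType) (m p k : nat) (U : set 'rV[R]_m) (V : set 'rV[R]_p)
    (f : 'rV[R]_p -> R) (g : 'rV[R]_m -> 'rV[R]_p) : open U -> open V ->
  (forall x, U x -> V (g x)) -> Ck_on k V f -> (forall j, Ck_on k U (fun x => g x 0 j : R)) ->
  Ck_on k U (fun x => f (g x)).
Proof.
move=> oU oV gUV; elim: k f => [|k IH] f Cf Cg; have [cf df] := Cf.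
  split=> // x Ux; apply: (@continuous_comp _ _ _ g f); last exact: cf (gUV x Ux).
  by apply/continuous_mxP => i j; rewrite ord1; case: (Cg j) => + _; apply.
have dif j x : U x -> differentiable (fun x => g x 0 j : R) x.
  by move=> Ux; exact: Ck_on_differentiable (Cg j) Ux.
have ch x v (Ux : U x) := chain_rule v (Ck_on_differentiable oV Cf (gUV x Ux)) (fun j => dif j x Ux).
split=> [x Ux|i].
  by apply: differentiable_continuous; case: (ch x 0 Ux).
split=> [x Ux|]; first by apply: diff_derivable; case: (ch x 0 Ux).
have C : Ck_on k U (fun x => \sum_j partial j f (g x) * partial i (fun y => g y 0 j : R) x).
  apply: Ck_on_sum => // j _; apply: Ck_onM => //.
    by apply: IH => [|l]; [case: (df j)|exact: Ck_onS (Cg l)].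
  by case: (Cg j) => _ /(_ i)[].
by apply: Ck_on_ext C => // x Ux; case: (ch x (delta_mx 0 i) Ux).
Qed.

(* Sealed copies: unification must not unfold partial derivatives and Jacobians. *)
HB.lock Definition pd (R : realType) m (W : normedModType R) (i : 'I_m) (f : 'rV[R]_m -> W) :=
  partial i f.
HB.lock Definition jac (R : realType) m p (f : 'rV[R]_m -> 'rV[R]_p) (x : 'rV[R]_m) : 'M[R]_(m, p) :=
  jacobian f x.

Lemma pdE (R : realType) m (W : normedModType R) : @partial R m W = @pd R m W.
Proof. by rewrite pd.unlock. Qed.

Lemma jacE (R : realType) m p : @jacobian m p R = @jac R m p.
Proof. by rewrite jac.unlock. Qed.

Section SmoothOn.
Variables (R : realType) (m : nat).
Local Notation E := 'rV[R]_m.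
Implicit Types (U V : set E).

Lemma smooth_subset (W : normedModType R) U V (f : E -> W) :
  V `<=` U -> smooth_on U f -> smooth_on V f.
Proof. by move=> VU sf k; exact: Ck_on_subset (sf k). Qed.

Lemma smooth_ext (W : normedModType R) U (f g : E -> W) :
  open U -> (forall x, U x -> f x = g x) -> smooth_on U f -> smooth_on U g.
Proof. by move=> oU fg sf k; exact: Ck_on_ext (sf k). Qed.

Lemma smooth_cst (W : normedModType R) U (w : W) : smooth_on U (fun=> w).
Proof. by move=> k; exact: Ck_on_cst. Qed.

Lemma smoothD U (f g : E -> R) : open U -> smooth_on U f -> smooth_on U g ->
  smooth_on U (fun x => f x + g x).
Proof. by move=> oU sf sg k; exact: Ck_onD. Qed.

Lemma smoothM U (f g : E -> R) : open U -> smooth_on U f -> smooth_on U g ->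
  smooth_on U (fun x => f x * g x).
Proof. by move=> oU sf sg k; exact: Ck_onM. Qed.

Lemma smoothN U (f : E -> R) : open U -> smooth_on U f -> smooth_on U (fun x => - f x).
Proof. by move=> oU sf k; exact: Ck_onN. Qed.

Lemma smoothB U (f g : E -> R) : open U -> smooth_on U f -> smooth_on U g ->
  smooth_on U (fun x => f x - g x).
Proof. by move=> oU sf sg; apply: smoothD => //; exact: smoothN. Qed.

Lemma smoothV U (f : E -> R) : open U -> (forall x, U x -> f x != 0) ->
  smooth_on U f -> smooth_on U (fun x => (f x)^-1).
Proof. by move=> oU f0 sf k; exact: Ck_onV. Qed.

Lemma smoothX U (f : E -> R) n : open U -> smooth_on U f -> smooth_on U (fun x => f x ^+ n).
Proof.
move=> oU sf; elim: n => [|n IH]; first exact: smooth_cst.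
by apply: smooth_ext (smoothM oU sf IH) => // x _; rewrite exprS.
Qed.

Lemma smooth_sum U (I : Type) (r : seq I) (P : pred I) (f : I -> E -> R) : open U ->
  (forall i, smooth_on U (f i)) -> smooth_on U (fun x => \sum_(i <- r | P i) f i x).
Proof. by move=> oU sf k; apply: Ck_on_sum => // i _; exact: sf. Qed.

Lemma smooth_prod U (I : Type) (r : seq I) (P : pred I) (f : I -> E -> R) : open U ->
  (forall i, smooth_on U (f i)) -> smooth_on U (fun x => \prod_(i <- r | P i) f i x).
Proof. by move=> oU sf k; apply: Ck_on_prod => // i _; exact: sf. Qed.

Lemma smooth_coord U i : smooth_on U (fun x => x 0 i : R).
Proof. by move=> k; exact: Ck_on_coord. Qed.

Lemma smooth_mxP U p q (f : E -> 'M[R]_(p, q)) : open U ->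
  smooth_on U f <-> forall i j, smooth_on U (fun x => f x i j : R).
Proof.
move=> oU; split=> [sf i j k|sf k]; first exact: (Ck_on_mxP _ _ oU).1 (sf k) i j.
by apply/Ck_on_mxP => // i j; exact: sf.
Qed.

Lemma smooth_id U : open U -> smooth_on U (fun x : E => x).
Proof.
by move=> oU; apply/smooth_mxP => // i j; rewrite ord1; exact: smooth_coord.
Qed.

Lemma pd_ext (W : normedModType R) U (f g : E -> W) i x :
  open U -> U x -> (forall y, U y -> f y = g y) -> pd i f x = pd i g x.
Proof. by rewrite -pdE; exact: partial_ext. Qed.

Lemma smooth_on_pd (W : normedModType R) U (f : E -> W) i :
  smooth_on U f -> smooth_on U (pd i f).
Proof. by rewrite -pdE; move=> sf k; case: (sf k.+1) => _ /(_ i)[]. Qed.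

Lemma smooth_derivable (W : normedModType R) U (f : E -> W) x i :
  smooth_on U f -> U x -> derivable f x (delta_mx 0 i).
Proof. by move=> /(_ 1%N)[_ /(_ i)[d _]]; exact: d. Qed.

Lemma smooth_cont (W : normedModType R) U (f : E -> W) x :
  smooth_on U f -> U x -> {for x, continuous f}.
Proof. by move=> /(_ 0%N)[c _]; exact: c. Qed.

Lemma smooth_differentiable U (f : E -> R) x :
  open U -> smooth_on U f -> U x -> differentiable f x.
Proof. by move=> oU sf; exact: (Ck_on_differentiable oU (sf 1%N)). Qed.

Lemma smoothDmx U p q (f g : E -> 'M[R]_(p, q)) : open U ->
  smooth_on U f -> smooth_on U g -> smooth_on U (fun x => f x + g x).
Proof.
move=> oU /(smooth_mxP _ oU) sf /(smooth_mxP _ oU) sg.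
apply/smooth_mxP => // i j; apply: smooth_ext (smoothD oU (sf i j) (sg i j)) => //.
by move=> x _; rewrite mxE.
Qed.

Lemma smoothNmx U p q (f : E -> 'M[R]_(p, q)) : open U ->
  smooth_on U f -> smooth_on U (fun x => - f x).
Proof.
move=> oU /(smooth_mxP _ oU) sf; apply/smooth_mxP => // i j.
by apply: smooth_ext (smoothN oU (sf i j)) => // x _; rewrite mxE.
Qed.

Lemma smoothZmx U p q (c : E -> R) (f : E -> 'M[R]_(p, q)) : open U ->
  smooth_on U c -> smooth_on U f -> smooth_on U (fun x => c x *: f x).
Proof.
move=> oU sc /(smooth_mxP _ oU) sf; apply/smooth_mxP => // i j.
by apply: smooth_ext (smoothM oU sc (sf i j)) => // x _; rewrite mxE.
Qed.

Lemma smooth_mulmx U p q r (f : E -> 'M[R]_(p, q)) (g : E -> 'M[R]_(q, r)) : open U ->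
  smooth_on U f -> smooth_on U g -> smooth_on U (fun x => f x *m g x).
Proof.
move=> oU /(smooth_mxP _ oU) sf /(smooth_mxP _ oU) sg; apply/smooth_mxP => // i j.
apply: (@smooth_ext _ _ (fun x => \sum_k f x i k * g x k j)) => // [x _|].
  by rewrite mxE.
by apply: smooth_sum => // k; exact: smoothM.
Qed.

Lemma smooth_trmx U p q (f : E -> 'M[R]_(p, q)) : open U ->
  smooth_on U f -> smooth_on U (fun x => (f x)^T).
Proof.
move=> oU /(smooth_mxP _ oU) sf; apply/smooth_mxP => // i j.
by apply: smooth_ext (sf j i) => // x _; rewrite mxE.
Qed.

Lemma smooth_det U p (f : E -> 'M[R]_p) : open U ->
  smooth_on U f -> smooth_on U (fun x => \det (f x)).
Proof.
move=> oU /(smooth_mxP _ oU) sf; apply: smooth_sum => // s.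
by apply: smoothM => //; [exact: smooth_cst|exact: smooth_prod].
Qed.

(** Cramer's rule: the adjugate and the determinant are polynomial in the entries. *)
Lemma smooth_invmx U p (f : E -> 'M[R]_p) : open U -> (forall x, U x -> f x \in unitmx) ->
  smooth_on U f -> smooth_on U (fun x => invmx (f x)).
Proof.
move=> oU fu sf; have sd : smooth_on U (fun x => (\det (f x))^-1).
  apply: smoothV => // [x /fu|]; last exact: smooth_det.
  by rewrite unitmxE unitfE.
apply: (@smooth_ext _ _ (fun x => (\det (f x))^-1 *: \adj (f x))) => // [x Ux|].
  by rewrite /invmx fu.
apply: smoothZmx => //; apply/smooth_mxP => // i j.
apply: (@smooth_ext _ _ (fun x => (-1) ^+ (j + i) * \det (row' j (col' i (f x))))) => // [x _|].
  by rewrite mxE.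
apply: smoothM => //; first exact: smooth_cst.
apply: smooth_det => //; move/(smooth_mxP _ oU) : sf => sf.
apply/smooth_mxP => // a b; apply: smooth_ext (sf (lift j a) (lift i b)) => // x _.
by rewrite !mxE.
Qed.

End SmoothOn.

Lemma smooth_comp (R : realType) (m p : nat) (U : set 'rV[R]_m) (V : set 'rV[R]_p)
    (f : 'rV[R]_p -> R) (g : 'rV[R]_m -> 'rV[R]_p) : open U -> open V ->
  (forall x, U x -> V (g x)) -> smooth_on V f -> smooth_on U g ->
  smooth_on U (fun x => f (g x)).
Proof.
move=> oU oV UV sf /(smooth_mxP _ oU) sg k.
by apply: (Ck_on_comp oU oV UV) => // j; exact: sg.
Qed.

Lemma smooth_comp_mx (R : realType) (m p a b : nat) (U : set 'rV[R]_m) (V : set 'rV[R]_p)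
    (f : 'rV[R]_p -> 'M[R]_(a, b)) (g : 'rV[R]_m -> 'rV[R]_p) : open U -> open V ->
  (forall x, U x -> V (g x)) -> smooth_on V f -> smooth_on U g ->
  smooth_on U (fun x => f (g x)).
Proof.
move=> oU oV UV /(smooth_mxP _ oV) sf sg; apply/smooth_mxP => // i j.
exact: (smooth_comp oU oV UV (sf i j) sg).
Qed.

Section PointRules.
Variables (R : realType) (m : nat) (i : 'I_m).
Local Notation E := 'rV[R]_m.
Local Notation e := (delta_mx 0 i : E).

Lemma pdD (f g : E -> R) x : derivable f x e -> derivable g x e ->
  pd i (fun y => f y + g y) x = pd i f x + pd i g x.
Proof. by rewrite -pdE; move=> df dg; exact: (deriveD df dg). Qed.

Lemma pdN (f : E -> R) x : derivable f x e ->
  pd i (fun y => - f y) x = - pd i f x.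
Proof. by rewrite -pdE; move=> df; exact: (deriveN df). Qed.

Lemma pdB (f g : E -> R) x : derivable f x e -> derivable g x e ->
  pd i (fun y => f y - g y) x = pd i f x - pd i g x.
Proof. by rewrite -pdE; move=> df dg; exact: (deriveB df dg). Qed.

Lemma pdM (f g : E -> R) x : derivable f x e -> derivable g x e ->
  pd i (fun y => f y * g y) x = pd i f x * g x + f x * pd i g x.
Proof.
rewrite -pdE => df dg; apply: etrans (deriveM df dg) _; rewrite addrC.
by congr (_ + _); exact: mulrC.
Qed.

Lemma pdV (f : E -> R) x : f x != 0 -> derivable f x e ->
  pd i (fun y => (f y)^-1) x = - (pd i f x / f x ^+ 2).
Proof.
by move=> f0 df; rewrite -pdE /partial deriveV// -[LHS]/(- (f x ^+ 2)^-1 * _) mulNr mulrC.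
Qed.

Lemma pd_sum (I : Type) (r : seq I) (P : pred I) (f : I -> E -> R) x :
  (forall j, derivable (f j) x e) ->
  pd i (fun y => \sum_(j <- r | P j) f j y) x = \sum_(j <- r | P j) pd i (f j) x /\
  derivable (fun y => \sum_(j <- r | P j) f j y) x e.
Proof.
move=> df; elim: r => [|j r [IH dr]].
  rewrite (_ : (fun _ => _) = fun=> 0 : R); last by apply/funext => y; rewrite big_nil.
  by rewrite big_nil -pdE; split; [exact: derive_cst|exact: derivable_cst].
rewrite (_ : (fun _ => _) = if P j then (fun y => f j y + \sum_(j <- r | P j) f j y)
   else (fun y => \sum_(j <- r | P j) f j y)); last first.
  by apply/funext => s; rewrite big_cons; case: ifP.
rewrite big_cons; case: ifP => // _; split; last exact: (derivableD (df j) dr).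
by rewrite (pdD (df j) dr) IH.
Qed.

Lemma pd_coord j x : pd i (fun y : E => y 0 j : R) x = (j == i)%:R.
Proof.
rewrite -pdE; have /= := @derive_mx R E 1 m id x e (@derivable_id _ _ _ _).
by rewrite derive_id => /rowP /(_ j); rewrite !mxE.
Qed.

Lemma pd_mx p q (F : E -> 'M[R]_(p, q)) x a b : derivable F x e ->
  pd i F x a b = pd i (fun y => F y a b : R) x.
Proof. by move=> dF; rewrite -!pdE {1}/partial derive_mx// mxE. Qed.

Lemma derivable_coord p q (F : E -> 'M[R]_(p, q)) x a b : derivable F x e ->
  derivable (fun y => F y a b : R) x e.
Proof. by move=> dF; exact: (derivable_mxP _ _ _).1 dF a b. Qed.

Lemma pd_mulmx p q r (F : E -> 'M[R]_(p, q)) (G : E -> 'M[R]_(q, r)) x :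
  derivable F x e -> derivable G x e ->
  pd i (fun y => F y *m G y) x = pd i F x *m G x + F x *m pd i G x /\
  derivable (fun y => F y *m G y) x e.
Proof.
move=> dF dG.
have d a b k : derivable (fun y => F y a k * G y k b) x e.
  by apply: derivableM; exact: derivable_coord.
have EE a b : (fun y => (F y *m G y) a b) = fun y => \sum_k F y a k * G y k b.
  by apply/funext => y; rewrite mxE.
have D : derivable (fun y => F y *m G y) x e.
  by apply/derivable_mxP => a b; rewrite EE; exact: (pd_sum _ _ (d a b)).2.
split=> //; apply/matrixP => a b; rewrite pd_mx// EE (pd_sum _ _ (d a b)).1 !mxE.
rewrite -big_split; apply: eq_bigr => k _ /=.
by rewrite pdM ?pd_mx//; exact: derivable_coord.
Qed.

End PointRules.

(** * Mean value bounds and symmetry of second derivatives *)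

Section MeanValue.
Variables (R : realType) (m : nat).
Local Notation E := 'rV[R]_m.

Lemma derive_translate (V W : normedModType R) (f : V -> W) c x v :
  'D_v (fun y => f (y + c)) x = 'D_v f (x + c) /\
  (derivable f (x + c) v -> derivable (fun y => f (y + c)) x v).
Proof.
have E0 : (fun h : R => h^-1 *: (((fun y => f (y + c)) \o shift x) (h *: v) - f (x + c)))
  = (fun h => h^-1 *: ((f \o shift (x + c)) (h *: v) - f (x + c))).
  by apply/funext => h /=; rewrite addrA.
by rewrite /derive /derivable E0.
Qed.

Lemma derive_sum_pd (f : E -> R) x v :
  differentiable f x -> 'D_v f x = \sum_i v 0 i * pd i f x.
Proof.
move=> df; rewrite deriveE// {1}(row_sum_delta v) linear_sum; apply: eq_bigr => i _.
by rewrite linearZ /= -pdE /partial deriveE.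
Qed.

Lemma ball_segment (c x y : E) (r t : R) : `|t| <= 1 -> 0 <= t ->
  ball c r x -> ball c r y -> ball c r (x + t *: (y - x)).
Proof.
rewrite -ball_normE /= => + t0; rewrite ger0_norm// => t1 cx cy.
have -> : c - (x + t *: (y - x)) = (1 - t) *: (c - x) + t *: (c - y).
  by rewrite !scalerBr !scalerBl !scale1r; apply/rowP => i; rewrite !mxE; ring.
apply: le_lt_trans (ler_normD _ _) _; rewrite !normrZ !ger0_norm ?subr_ge0//.
have -> : r = (1 - t) * r + t * r by ring.
have [->|t0'] := eqVneq t 0; first by rewrite !mul0r !addr0 subr0 !mul1r.
apply: ler_ltD; first by rewrite ler_wpM2l ?subr_ge0 ?(ltW cx).
by rewrite ltr_pM2l// lt_def t0'.
Qed.

Lemma mean_value_bound (f : E -> R) (c : E) (r C : R) x y :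
  (forall z, ball c r z -> differentiable f z /\ forall i, `|pd i f z| <= C) ->
  ball c r x -> ball c r y -> `|f x - f y| <= m%:R * C * `|x - y|.
Proof.
move=> df bx byy; pose v := x - y.
pose g t := f (y + t *: v).
have b t : 0 <= t -> t <= 1 -> ball c r (y + t *: v).
  by move=> t0 t1; apply: ball_segment => //; rewrite ger0_norm.
have d z w : ball c r z -> derivable f z w.
  by move=> /df[+ _]; exact: diff_derivable.
have [| |t] := @MVT_segment R g (fun t => 'D_v f (y + t *: v)) 0 1 ler01.
- move=> t; rewrite in_itv/= => /andP[t0 t1]; have [<- h] := line_derive f y v t.
  by apply/derivableP/h/d/b; exact: ltW.
- apply: derivable_within_continuous => t; rewrite in_itv/= => /andP[t0 t1].
  by have [_ h] := line_derive f y v t; apply/h/d/b.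
rewrite in_itv/= => /andP[t0 t1].
rewrite /g scale1r scale0r addr0 subr0 mulr1 /v addrCA subrr addr0 => ->.
have [dt bt] := df _ (b t t0 t1); rewrite derive_sum_pd//.
apply: le_trans (ler_norm_sum _ _ _) _.
rewrite -mulrA -[X in X%:R]card_ord mulr_natl -sumr_const; apply: ler_sum => i _.
by rewrite normrM mulrC ler_pM// coord_le_norm.
Qed.

Lemma line_MVT_pd (f : E -> R) x i (t : R) :
  (forall s : R, `|s| <= `|t| -> derivable f (x + s *: delta_mx 0 i) (delta_mx 0 i)) ->
  exists2 s : R, `|s| <= `|t| &
    f (x + t *: delta_mx 0 i) - f x = t * pd i f (x + s *: delta_mx 0 i).
Proof. by rewrite -pdE; exact: line_MVT. Qed.

Lemma dist_le_of_close (a p q d : R) : `|a - p| < d / 2 -> `|a - q| < d / 2 -> `|p - q| <= d.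
Proof.
by rewrite !ltr_norml ler_norml => /andP[a1 a2] /andP[b1 b2]; apply/andP; split; lra.
Qed.

(** The second difference of [f] over a square of side t is symmetric in the two directions. Two
    successive applications of the mean value theorem, in either order, identify its quotient by t^2
    with a mixed derivative at a nearby point, so both mixed derivatives are its limit as t tends to
    0 from the right. *)
Lemma schwarz (U : set E) (f : E -> R) i j x : open U -> smooth_on U f -> U x ->
  pd i (pd j f) x = pd j (pd i f) x.
Proof.
move=> oU sf Ux.
have /nbhs_ballP[r /= r0 rU] : nbhs x U by exact: open_nbhs_nbhs.
have main a b (t : R) : 0 < t -> t + t < r -> exists s s', [/\ `|s| <= t, `|s'| <= t &
   f (x + t *: delta_mx 0 a + t *: delta_mx 0 b) - f (x + t *: delta_mx 0 a)
   - (f (x + t *: delta_mx 0 b) - f x)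
   = t * (t * pd b (pd a f) (x + s *: delta_mx 0 a + s' *: delta_mx 0 b))].
  move=> t0 tr.
  have inU s s' c : `|s| <= t -> `|s'| <= t ->
      U (x + s *: delta_mx 0 a + s' *: (delta_mx 0 c : E)).
    move=> st st'; apply: rU; rewrite -ball_normE /= -addrA opprD addNKr normrN.
    apply: le_lt_trans tr; apply: le_trans (ler_normD _ _) _; rewrite !normrZ.
    by apply: lerD; rewrite -[leRHS]mulr1 ler_pM//; apply: norm_le_coord => // k l;
      rewrite mxE normr_nat; case: (_ && _).
  have nt : `|t| = t by rewrite ger0_norm// ltW.
  have inU0 s : `|s| <= t -> U (x + s *: (delta_mx 0 a : E)).
    by move=> st; have := inU s 0 a st; rewrite scale0r addr0 normr0; apply; exact: ltW.
  pose g y := f (y + t *: delta_mx 0 b) - f y.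
  have dg s : `|s| <= t -> is_derive (x + s *: delta_mx 0 a) (delta_mx 0 a) g
     (pd a f (x + s *: delta_mx 0 a + t *: delta_mx 0 b) - pd a f (x + s *: delta_mx 0 a)).
    move=> st; apply: is_deriveB; last first.
      by rewrite -pdE; apply/derivableP; apply: smooth_derivable sf _; exact: inU0.
    have Ut : U (x + s *: delta_mx 0 a + t *: delta_mx 0 b) by apply: inU => //; rewrite nt.
    rewrite -pdE /partial; have [<- h] := derive_translate f (t *: delta_mx 0 b) (x + s *: delta_mx 0 a) (delta_mx 0 a).
    by apply/derivableP/h; exact: smooth_derivable sf _.
  have [s st Es] : exists2 s : R, `|s| <= `|t| &
     g (x + t *: delta_mx 0 a) - g x = t * 'D_(delta_mx 0 a) g (x + s *: delta_mx 0 a).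
    by apply: line_MVT => s; rewrite nt => /dg[].
  rewrite nt in st; have [_ Dg] := dg s st.
  have [s' st' Es'] : exists2 s' : R, `|s'| <= `|t| &
    pd a f (x + s *: delta_mx 0 a + t *: delta_mx 0 b) - pd a f (x + s *: delta_mx 0 a)
    = t * pd b (pd a f) (x + s *: delta_mx 0 a + s' *: delta_mx 0 b).
    apply: line_MVT_pd => s'; rewrite nt => st'.
    by apply: (smooth_derivable (i := b) (smooth_on_pd a sf)); exact: inU.
  rewrite nt in st'; exists s, s'; split=> //.
  by rewrite -[LHS]/(g _ - g _) Es Dg Es'.
have key a b (d : R) : 0 < d -> \forall t \near (0 : R)^'+,
    `|(f (x + t *: delta_mx 0 a + t *: delta_mx 0 b) - f (x + t *: delta_mx 0 a)
   - (f (x + t *: delta_mx 0 b) - f x)) / (t * t) - pd b (pd a f) x| < d.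
  move=> d0; have /(_ x Ux) := @smooth_cont _ _ _ U _ _ (smooth_on_pd b (smooth_on_pd a sf)).
  move=> /cvgrPdist_lt /(_ d d0) /nbhs_ballP[q /= q0 hq].
  near=> t; have t0 : 0 < t by near: t; exact: nbhs_right_gt.
  have [||s [s' [st st' ->]]] := main a b t => //.
    suff : t < r / 2 by move=> h; lra.
    by near: t; apply: nbhs_right_lt; lra.
  rewrite mulrA [_ * _ / _]mulrC mulKf ?mulf_neq0 ?gt_eqF//.
  rewrite distrC; apply: hq; rewrite -ball_normE /= -addrA opprD addNKr normrN.
  apply: (@le_lt_trans _ _ (t + t)).
    apply: le_trans (ler_normD _ _) _; rewrite !normrZ.
    by apply: lerD; rewrite -[leRHS]mulr1 ler_pM//; apply: norm_le_coord => // k l;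
      rewrite mxE normr_nat; case: (_ && _).
  suff : t < q / 2 by move=> h; lra.
  by near: t; apply: nbhs_right_lt; lra.
apply/eqP; rewrite -subr_eq0 -normr_le0; apply/ler_addgt0Pl => d d0; rewrite addr0.
have d2 : 0 < d / 2 by lra.
have [t [/= h1 h2]] := filter_ex (filterI (key j i _ d2) (key i j _ d2)).
have EA : f (x + t *: delta_mx 0 i + t *: delta_mx 0 j) - f (x + t *: delta_mx 0 i)
    - (f (x + t *: delta_mx 0 j) - f x)
  = f (x + t *: delta_mx 0 j + t *: delta_mx 0 i) - f (x + t *: delta_mx 0 j)
    - (f (x + t *: delta_mx 0 i) - f x).
  by rewrite [x + _ + _]addrAC; ring.
by rewrite EA in h2; exact: dist_le_of_close h1 h2.
Unshelve. all: by end_near. Qed.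

End MeanValue.

(** * Jacobians, product coordinates, rules for first and second derivatives *)

Section Jacobian.
Variable R : realType.

Lemma smooth_differentiable_row m p (U : set 'rV[R]_m) (f : 'rV[R]_m -> 'rV[R]_p) x :
  open U -> smooth_on U f -> U x -> differentiable f x.
Proof.
move=> oU /(smooth_mxP _ oU) sf Ux; apply: differentiable_rowP => j.
exact: smooth_differentiable (sf 0 j) Ux.
Qed.

Lemma jac_entry m p (f : 'rV[R]_m -> 'rV[R]_p) x i j : differentiable f x ->
  jac f x i j = pd i (fun y => f y 0 j : R) x.
Proof.
move=> df; rewrite -jacE /jacobian mxE -deriveE// -pd_mx; last exact: diff_derivable.
by rewrite -pdE.
Qed.

Lemma jac_comp m p q (f : 'rV[R]_m -> 'rV[R]_p) (g : 'rV[R]_p -> 'rV[R]_q) x :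
  differentiable f x -> differentiable g (f x) ->
  jac (fun y => g (f y)) x = jac f x *m jac g (f x).
Proof.
move=> df dg; rewrite -!jacE; apply/row_matrixP => i; rewrite !rowE mulmxA !mul_rV_lin1.
by rewrite (@diff_comp _ _ _ _ f g).
Qed.

Lemma jac_ext m p (U : set 'rV[R]_m) (f g : 'rV[R]_m -> 'rV[R]_p) x :
  open U -> U x -> (forall y, U y -> f y = g y) ->
  differentiable f x -> differentiable g x -> jac f x = jac g x.
Proof.
move=> oU Ux fg df dg; apply/matrixP => i j.
apply: etrans (jac_entry i j df) _; apply: etrans _ (esym (jac_entry i j dg)).
by apply: (pd_ext i oU Ux) => y Uy; rewrite (fg y Uy).
Qed.

Lemma smooth_jac m p (U : set 'rV[R]_m) (f : 'rV[R]_m -> 'rV[R]_p) :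
  open U -> smooth_on U f -> smooth_on U (jac f).
Proof.
move=> oU sf; apply/smooth_mxP => // i j.
apply: (@smooth_ext _ _ _ _ (pd i (fun y => f y 0 j : R))) => // [x Ux|].
  by rewrite jac_entry//; exact: smooth_differentiable_row sf Ux.
by apply: smooth_on_pd; exact: (smooth_mxP _ oU).1.
Qed.

End Jacobian.

(** Time comes first. The same splitting serves the parameter of a flow, the parameter of a homotopy
    and the first coordinate of a flow box; [n.*2.+1] and [1 + n.*2] are convertible, so it also
    applies to the charts of the contact manifold. *)
Notation pt s x := (row_mx (s%:M : 'M[_]_1) x : 'rV[_]_(1 + _)).

Section RowPoint.
Variables (R : realType) (m : nat).

Lemma norm_pt_lt (s : R) (x : 'rV[R]_m) r : `|s| < r -> `|x| < r -> `|pt s x| < r.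
Proof.
move=> sr xr; apply: norm_lt_coord => [|i j]; first exact: le_lt_trans sr.
rewrite mxE ord1; case: fintype.split => k; first by rewrite ord1 mxE eqxx.
exact: le_lt_trans (coord_le_norm _ _ _) xr.
Qed.

Lemma norm_pt_le (s : R) (x : 'rV[R]_m) r : `|s| <= r -> `|x| <= r -> `|pt s x| <= r.
Proof.
move=> sr xr; apply: norm_le_coord => [|i j]; first exact: le_trans sr.
rewrite mxE ord1; case: fintype.split => k; first by rewrite ord1 mxE eqxx.
exact: le_trans (coord_le_norm _ _ _) xr.
Qed.

Lemma ptB (s t : R) (x y : 'rV[R]_m) : pt s x - pt t y = pt (s - t) (x - y).
Proof. by rewrite opp_row_mx add_row_mx raddfB. Qed.

Lemma delta_lshift : (delta_mx 0 (lshift m 0) : 'rV[R]_(1 + m)) = pt 1 0.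
Proof.
apply/rowP => j; rewrite !mxE eqxx /=; case: splitP => k jk.
  by rewrite ord1 mxE eqxx -val_eqE /= jk ord1.
by rewrite mxE -val_eqE /= jk.
Qed.

Lemma ptD (s t : R) (x y : 'rV[R]_m) : pt s x + pt t y = pt (s + t) (x + y).
Proof. by rewrite add_row_mx raddfD. Qed.

Lemma ptZ (a s : R) (x : 'rV[R]_m) : a *: pt s x = pt (a * s) (a *: x).
Proof. by rewrite scale_row_mx scale_scalar_mx. Qed.

Lemma pt_shift_time (s t : R) (x : 'rV[R]_m) :
  pt s x + t *: delta_mx 0 (lshift m 0) = pt (s + t) x.
Proof. by rewrite delta_lshift ptZ ptD mulr1 scaler0 addr0. Qed.

Lemma smooth_pt p (U : set 'rV[R]_p) (s : 'rV[R]_p -> R) (x : 'rV[R]_p -> 'rV[R]_m) : open U ->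
  smooth_on U s -> smooth_on U x -> smooth_on U (fun y => pt (s y) (x y)).
Proof.
move=> oU ss /(smooth_mxP _ oU) sx; apply/smooth_mxP => // i j; rewrite ord1.
rewrite [X in smooth_on U X](_ : _ =
  match fintype.split j with inl _ => s | inr k => fun y => x y 0 k end).
  by case: fintype.split => k; [exact: ss|exact: sx].
by apply/funext => y; rewrite mxE; case: fintype.split => k //; rewrite ord1 mxE eqxx.
Qed.

End RowPoint.

Lemma pd_chain (R : realType) (m p : nat) (f : 'rV[R]_p -> R) (g : 'rV[R]_m -> 'rV[R]_p) x i :
  differentiable f (g x) -> (forall j, differentiable (fun y => g y 0 j : R) x) ->
  pd i (fun y => f (g y)) x = \sum_j pd j f (g x) * pd i (fun y => g y 0 j : R) x.
Proof. by rewrite -!pdE => df dg; case: (chain_rule (delta_mx 0 i) df dg). Qed.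

Lemma pd_cst (R : realType) (d : nat) (W : normedModType R) (w : W) i (y : 'rV[R]_d) :
  pd i (fun=> w) y = 0.
Proof. by rewrite -pdE; exact: derive_cst. Qed.

Lemma smooth_entry (R : realType) d (U : set 'rV[R]_d) p q (F : 'rV[R]_d -> 'M[R]_(p, q)) i j :
  open U -> smooth_on U F -> smooth_on U (fun z => F z i j : R).
Proof. by move=> oU /(smooth_mxP _ oU). Qed.

Section Jets.
Variables (R : realType) (d : nat).
Local Notation E := 'rV[R]_d.
Variables (U : set E) (y : E).
Hypotheses (oU : open U) (Uy : U y).

Lemma smooth_pd (W : normedModType R) (F : E -> W) i : smooth_on U F ->
  derivable F y (delta_mx 0 i).
Proof. by move=> sF; exact: smooth_derivable sF Uy. Qed.

Lemma jet1D (F G : E -> R) k : smooth_on U F -> smooth_on U G ->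
  pd k (fun z => F z + G z) y = pd k F y + pd k G y.
Proof. by move=> sF sG; rewrite (pdD (smooth_pd sF) (smooth_pd sG)). Qed.

Lemma jet1B (F G : E -> R) k : smooth_on U F -> smooth_on U G ->
  pd k (fun z => F z - G z) y = pd k F y - pd k G y.
Proof. by move=> sF sG; rewrite (pdB (smooth_pd sF) (smooth_pd sG)). Qed.

Lemma jet1M (F G : E -> R) k : smooth_on U F -> smooth_on U G ->
  pd k (fun z => F z * G z) y = pd k F y * G y + F y * pd k G y.
Proof. by move=> sF sG; rewrite (pdM (smooth_pd sF) (smooth_pd sG)). Qed.

Lemma jet1V (F : E -> R) k : (forall z, U z -> F z != 0) -> smooth_on U F ->
  pd k (fun z => (F z)^-1) y = - (pd k F y / F y ^+ 2).
Proof. by move=> F0 sF; rewrite (pdV (F0 y Uy) (smooth_pd sF)). Qed.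

Lemma jet1_sum (I : Type) (r : seq I) (F : I -> E -> R) k : (forall i, smooth_on U (F i)) ->
  pd k (fun z => \sum_(i <- r) F i z) y = \sum_(i <- r) pd k (F i) y.
Proof. by move=> sF; rewrite (pd_sum r xpredT (fun i => smooth_pd (sF i))).1. Qed.

End Jets.

Section Jets2.
Variables (R : realType) (d : nat).
Local Notation E := 'rV[R]_d.
Variables (U : set E) (y : E).
Hypotheses (oU : open U) (Uy : U y).

Lemma jet2D (F G : E -> R) k l : smooth_on U F -> smooth_on U G ->
  pd l (pd k (fun w => F w + G w)) y = pd l (pd k F) y + pd l (pd k G) y.
Proof.
move=> sF sG; rewrite -(jet1D Uy l (smooth_on_pd k sF) (smooth_on_pd k sG)).
by apply: (pd_ext l oU Uy) => z Uz; exact: (jet1D Uz _ sF sG).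
Qed.

Lemma jet2B (F G : E -> R) k l : smooth_on U F -> smooth_on U G ->
  pd l (pd k (fun w => F w - G w)) y = pd l (pd k F) y - pd l (pd k G) y.
Proof.
move=> sF sG; rewrite -(jet1B Uy l (smooth_on_pd k sF) (smooth_on_pd k sG)).
by apply: (pd_ext l oU Uy) => z Uz; exact: (jet1B Uz _ sF sG).
Qed.

Lemma jet2M (F G : E -> R) k l : smooth_on U F -> smooth_on U G ->
  pd l (pd k (fun w => F w * G w)) y = pd l (pd k F) y * G y + pd k F y * pd l G y
    + pd l F y * pd k G y + F y * pd l (pd k G) y.
Proof.
move=> sF sG; have sF' := smooth_on_pd k sF; have sG' := smooth_on_pd k sG.
transitivity (pd l (fun z => pd k F z * G z + F z * pd k G z) y).
  by apply: (pd_ext l oU Uy) => z Uz; exact: (jet1M Uz _ sF sG).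
rewrite (jet1D Uy l (smoothM oU sF' sG) (smoothM oU sF sG')).
by rewrite (jet1M Uy l sF' sG) (jet1M Uy l sF sG') addrA.
Qed.

Lemma jet2V (F : E -> R) k l : (forall z, U z -> F z != 0) -> smooth_on U F ->
  pd l (pd k (fun z => (F z)^-1)) y
  = - (pd l (pd k F) y / F y ^+ 2) + 2 * (pd k F y * pd l F y / F y ^+ 3).
Proof.
move=> F0 sF; have sV := smoothV oU F0 sF; have sF' := smooth_on_pd k sF.
have sVV := smoothM oU sV sV.
transitivity (pd l (fun z => 0 - pd k F z * ((F z)^-1 * (F z)^-1)) y).
  apply: (pd_ext l oU Uy) => z Uz; rewrite (jet1V Uz k F0 sF) sub0r.
  by rewrite -invfM expr2.
rewrite (jet1B Uy l (smooth_cst _ _) (smoothM oU sF' sVV)) pd_cst sub0r.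
rewrite (jet1M Uy l sF' sVV) (jet1M Uy l sV sV) (jet1V Uy l F0 sF).
have := F0 y Uy; move: (pd l (pd k F) y) (pd k F y) (pd l F y) (F y) => a b c e e0.
by field.
Qed.

End Jets2.

Section SplitRow.
Variables (R : realType) (m : nat).

(** With a constant [tau] this says that freezing the time commutes with the spatial derivatives,
    which is its most frequent use. *)
Lemma pd_graph (N : set 'rV[R]_(1 + m)) (U : set 'rV[R]_m) (F : 'rV[R]_(1 + m) -> R)
    (tau : 'rV[R]_m -> R) y i :
  open N -> open U -> smooth_on N F -> smooth_on U tau -> U y -> N (pt (tau y) y) ->
  pd i (fun x => F (pt (tau x) x)) y = pd (lshift m 0) F (pt (tau y) y) * pd i tau y
    + pd (rshift 1 i) F (pt (tau y) y).
Proof.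
move=> oN oU sF st Uy Ny.
have sg : smooth_on U (fun x => pt (tau x) x) by apply: smooth_pt => //; exact: smooth_id.
have dF := smooth_differentiable oN sF Ny.
rewrite (pd_chain (g := fun x => pt (tau x) x) i dF); last first.
  by move=> j; exact: smooth_differentiable oU ((smooth_mxP _ oU).1 sg 0 j) Uy.
rewrite big_split_ord /= big_ord1; congr (_ * _ + _).
  by apply: (pd_ext i oU Uy) => x _; rewrite row_mxEl mxE eqxx.
rewrite (bigD1 i)//= big1 ?addr0 => [|j ji].
  rewrite (_ : (fun x : 'rV[R]_m => _) = fun x => x 0 i : R); last by apply/funext => x; rewrite row_mxEr.
  by rewrite pd_coord eqxx mulr1.
rewrite (_ : (fun x : 'rV[R]_m => _) = fun x => x 0 j : R); last by apply/funext => x; rewrite row_mxEr.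
by rewrite pd_coord (negbTE ji) mulr0.
Qed.

End SplitRow.

Lemma smooth_row_mx (R : realType) (k p q : nat) (U : set 'rV[R]_k)
    (f : 'rV[R]_k -> 'rV[R]_p) (g : 'rV[R]_k -> 'rV[R]_q) : open U ->
  smooth_on U f -> smooth_on U g -> smooth_on U (fun x => row_mx (f x) (g x)).
Proof.
move=> oU /(smooth_mxP _ oU) sf /(smooth_mxP _ oU) sg; apply/(smooth_mxP _ oU) => i j.
rewrite (_ : (fun x => _) = match fintype.split j with inl l => fun x => f x i l
   | inr l => fun x => g x i l end); first by case: fintype.split.
by apply/funext => x; rewrite mxE; case: fintype.split.
Qed.

Lemma open_ball_sub (R : realType) (m : nat) (U : set 'rV[R]_m) x : open U -> U x ->
  exists2 r : R, 0 < r & ball x r `<=` U.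
Proof.
by move=> oU Ux; have /nbhs_ballP[r /= r0 h] : nbhs x U; [exact: open_nbhs_nbhs|exists r].
Qed.

Lemma smooth_linear (R : realType) m p (M : 'M[R]_(m, p)) U : open U -> smooth_on U (fun x : 'rV[R]_m => x *m M).
Proof. by move=> oU; apply: (smooth_mulmx oU); [exact: smooth_id|exact: smooth_cst]. Qed.

Lemma jac_linear (R : realType) (m p : nat) (N : 'M[R]_(m, p)) x : jac (fun x : 'rV[R]_m => x *m N) x = N.
Proof.
apply/matrixP => i j; rewrite jac_entry; last first.
  by apply: (smooth_differentiable_row openT) => //; exact: smooth_linear openT.
rewrite (pd_ext (g := fun x : 'rV[R]_m => \sum_k x 0 k * N k j) _ openT Logic.I) => [|z _]; last by rewrite mxE.
rewrite (jet1_sum (Logic.I : setT x)) => [|k]; last by apply: smoothM openT _ _; [exact: smooth_coord|exact: smooth_cst].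
rewrite (bigD1 i) //= big1 ?addr0 => [|k ki]; rewrite (jet1M (Logic.I : setT x)) ?pd_cst ?pd_coord ?mulr0 ?addr0;
  by [rewrite eqxx mul1r|rewrite (negPf ki) mul0r|exact: smooth_coord|exact: smooth_cst].
Qed.

Section Translation.
Variables (R : realType) (m : nat) (v : 'rV[R]_m).
Local Notation T := (fun x : 'rV[R]_m => x + v).

Lemma smooth_translate : smooth_on setT T.
Proof. by apply: smoothDmx => //; [exact: openT|exact: smooth_id openT|exact: smooth_cst]. Qed.

Lemma jac_translate x : jac T x = 1%:M.
Proof.
apply/matrixP => i j; rewrite jac_entry; last exact: smooth_differentiable_row openT smooth_translate Logic.I.
rewrite (pd_ext (g := fun y : 'rV[R]_m => y 0 j + v 0 j) _ openT Logic.I) => [|y _]; last by rewrite mxE.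
rewrite (jet1D (Logic.I : setT x)) ?pd_coord ?pd_cst ?mxE ?addr0 1?eq_sym //; [exact: smooth_coord|exact: smooth_cst].
Qed.
End Translation.

Section ProductRule.
Variables (R : realType) (d : nat).
Local Notation E := 'rV[R]_d.
Variables (U : set E) (y : E).
Hypotheses (oU : open U) (Uy : U y).

Lemma jet1_prod (J : eqType) (r : seq J) (F : J -> E -> R) k : uniq r -> (forall i, smooth_on U (F i)) ->
  pd k (fun z => \prod_(i <- r) F i z) y = \sum_(j <- r) pd k (F j) y * \prod_(i <- r | i != j) F i y.
Proof.
move=> + sF; elim: r => [|a r IH] /= => [_|/andP[ar ur]].
  by rewrite big_nil (_ : (fun z => _) = fun=> 1) ?pd_cst //; apply/funext => z; rewrite big_nil.
rewrite (_ : (fun z => _) = fun z => F a z * \prod_(i <- r) F i z); last by apply/funext => z; rewrite big_cons.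
rewrite (jet1M Uy) //; last exact: smooth_prod.
rewrite IH // !big_cons eqxx /= mulr_sumr; congr (_ * _ + _).
  rewrite big_seq_cond [RHS]big_seq_cond; apply: eq_bigl => i.
  by rewrite andbT; have [ir|//] := boolP (i \in r); rewrite (memPn ar).
rewrite [LHS]big_seq [RHS]big_seq; apply: eq_bigr => j jr.
by rewrite big_cons eq_sym (memPn ar) // mulrCA.
Qed.

Lemma jet1_invmx p (M : E -> 'M[R]_p) k : smooth_on U M -> (forall z, U z -> M z \in unitmx) ->
  pd k (fun z => invmx (M z)) y = - (invmx (M y) *m pd k M y *m invmx (M y)).
Proof.
move=> sM uM; have sI := smooth_invmx oU uM sM.
have [E1 _] := pd_mulmx (smooth_derivable sM Uy) (smooth_derivable sI Uy) (i := k).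
have E0 : pd k (fun z => M z *m invmx (M z)) y = 0.
  by rewrite (pd_ext (g := fun=> 1%:M) k oU Uy) ?pd_cst // => z Uz; rewrite mulmxV ?uM.
have := congr1 (mulmx (invmx (M y))) E1; rewrite E0 mulmx0 mulmxDr mulKmx ?uM // mulmxA.
by move/esym/eqP; rewrite addrC addr_eq0 => /eqP.
Qed.

(** Jacobi's formula. Differentiating one factor of each product in the Leibniz expansion produces
    the cofactor expansions of all rows, that is, the trace of the adjugate times the derivative. *)
Lemma pd_det p (M : E -> 'M[R]_p) k : smooth_on U M -> M y \in unitmx ->
  pd k (fun z => \det (M z)) y = \det (M y) * \tr (invmx (M y) *m pd k M y).
Proof.
move=> sM uM; have sMe i j : smooth_on U (fun z => M z i j : R) by exact: smooth_entry.
have sP (s : 'S_p) : smooth_on U (fun z => \prod_i M z i (s i)) by exact: smooth_prod.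
rewrite /determinant (jet1_sum Uy) => [|s]; last by apply: smoothM => //; exact: smooth_cst.
transitivity (\tr (\adj (M y) *m pd k M y)); last first.
  by rewrite /invmx uM -scalemxAl mxtraceZ mulrA mulfV ?mul1r // -unitfE -unitmxE.
transitivity (\sum_i \sum_j pd k M y i j * cofactor (M y) i j); last first.
  rewrite exchange_big; apply: eq_bigr => j _ /=; rewrite mxE; apply: eq_bigr => i _.
  by rewrite mulrC mxE.
under [RHS]eq_bigr do under eq_bigr do rewrite expand_cofactor mulr_sumr.
under [RHS]eq_bigr do rewrite (exchange_big_dep xpredT) //=.
rewrite exchange_big; apply: eq_bigr => s _ /=.
rewrite (jet1M Uy) // ?pd_cst ?mul0r ?add0r; last exact: smooth_cst.
rewrite (jet1_prod _ (index_enum_uniq _)) // mulr_sumr; apply: eq_bigr => i _.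
rewrite [RHS](big_pred1 (s i)) => [|j]; last exact: eq_sym.
rewrite mulrCA (pd_mx _ _ (smooth_derivable sM Uy)); congr (_ * (_ * _)).
by apply: eq_bigl => j; rewrite eq_sym.
Qed.
End ProductRule.

Ltac open_set := lazymatch goal with
  | |- open setT => exact: openT
  | |- open (ball _ _) => by exact: ball_open
  | |- open (ccod _) => exact: chart_open_cod
  | |- _ => assumption
  end.

(* Syntax-directed smoothness prover; hypotheses are only matched up to beta. *)
Ltac smooth := first
  [ match goal with H : _ |- smooth_on _ _ => solve [simple apply H; trivial] end
  | simple apply smooth_cst
  | lazymatch goal with
    | |- smooth_on _ (fun x => x) => simple apply smooth_id; open_set
    | |- smooth_on _ (fun x => x 0 ?i) => simple apply smooth_coord
    | |- smooth_on _ (fun x => - (@?f x)) => first [simple apply smoothN | simple apply smoothNmx]; [open_set|smooth]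
    | |- smooth_on _ (fun x => (@?f x) - (@?g x)) => simple apply smoothB; [open_set|smooth|smooth]
    | |- smooth_on _ (fun x => (@?f x) + (@?g x)) =>
        first [simple apply smoothD | simple apply smoothDmx]; [open_set|smooth|smooth]
    | |- smooth_on _ (fun x => (@?f x) * (@?g x)) => simple apply smoothM; [open_set|smooth|smooth]
    | |- smooth_on _ (fun x => (@?f x) ^+ _) => simple apply smoothX; [open_set|smooth]
    | |- smooth_on _ (fun x => (@?f x) *: (@?g x)) => simple apply smoothZmx; [open_set|smooth|smooth]
    | |- smooth_on _ (fun x => (@?f x) *m (@?g x)) => simple apply smooth_mulmx; [open_set|smooth|smooth]
    | |- smooth_on _ (fun x => (@?f x)^T) => simple apply smooth_trmx; [open_set|smooth]
    | |- smooth_on _ (fun x => \sum_(i <- _ | _) _) => simple apply smooth_sum; [open_set|intros; smooth]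
    | |- smooth_on _ (fun x => \prod_(i <- _ | _) _) => simple apply smooth_prod; [open_set|intros; smooth]
    | |- smooth_on _ (fun x => \det (@?f x)) => simple apply smooth_det; [open_set|smooth]
    | |- smooth_on _ (fun x => invmx (@?f x)) => simple apply smooth_invmx; [open_set|assumption|smooth]
    | |- smooth_on _ (pd _ _) => simple apply smooth_on_pd; smooth
    | |- smooth_on _ (fun x => pd ?i ?f x) => simple apply (smooth_on_pd (f := f) i); smooth
    | |- smooth_on _ (jac _) => simple apply smooth_jac; [open_set|smooth]
    | |- smooth_on _ (fun x => jac ?f x) => simple apply (smooth_jac (f := f)); [open_set|smooth]
    | |- smooth_on _ (fun x => fun_of_matrix (@?f x) ?i ?j) => simple apply (smooth_entry (F := f) i j); [open_set|smooth]
    end].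
(* Smoothness, differentiability and derivability become side conditions closed by [by []]: the
   domain [U] is found among the hypotheses about the base point. *)
#[export] Hint Extern 0 (smooth_on _ _) => solve [smooth] : core.
#[export] Hint Extern 0 (differentiable ?f ?x) => match goal with
  | oU : open ?U, Ux : ?U x |- _ =>
    first [simple apply (smooth_differentiable (U := U)) | simple apply (smooth_differentiable_row (U := U))];
    [exact oU|solve [smooth]|exact Ux] end : core.
#[export] Hint Extern 0 (derivable ?f ?x (delta_mx 0 ?i)) => match goal with
  | Ux : ?U x |- _ => simple apply (smooth_derivable (U := U)); [solve [smooth]|exact Ux] end : core.

(** * The inverse function theorem *)

Lemma is_derive_of_bound (R : realType) (V : normedModType R) (f : V -> R) (x v : V) (l : R) :
  (forall e, 0 < e -> exists2 d, 0 < d & forall h, `|h| < d -> `|f (x + h *: v) - f x - h * l| <= e * `|h|) ->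
  is_derive x v f l.
Proof.
move=> H; have E1 : (fun h : R => h^-1 *: (f (h *: v + x) - f x)) @ 0^' --> l.
  apply/cvgrPdist_le => e e0; have [d d0 Hd] := H e e0; near=> h.
  have h0 : h != 0 by near: h; exact: nbhs_dnbhs_neq.
  have hd : `|h| < d by near: h; apply: dnbhs0_lt.
  have -> : l - h^-1 *: (f (h *: v + x) - f x) = - (h^-1 * (f (h *: v + x) - f x - h * l)).
    by rewrite [_ *: _]/(_ * _) [in RHS]mulrBr mulKf // opprB.
  by have := Hd h hd; rewrite normrN normrM normfV ler_pdivrMl ?normr_gt0 // [x + _]addrC [e * _]mulrC.
have dv : derivable f x v by apply/cvg_ex; exists l.
exact: DeriveDef dv (cvg_lim (@norm_hausdorff _ _) E1).
Unshelve. all: by end_near. Qed.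

Lemma norm_mulmx (R : realType) k m p (x : 'M[R]_(k, m)) (A : 'M[R]_(m, p)) : `|x *m A| <= m%:R * `|x| * `|A|.
Proof.
apply: norm_le_coord => [|i j] //.
rewrite mxE; apply: le_trans (ler_norm_sum _ _ _) _.
rewrite -mulrA -[X in X%:R](card_ord m) mulrC mulr_natr -sumr_const; apply: ler_sum => l _.
by rewrite normrM ler_pM // coord_le_norm.
Qed.

(** A vector v in the kernel satisfies v = - v D, and the smallness of [D] makes the right side
    strictly shorter unless v = 0. *)
Lemma unitmx_near1 (R : realType) m (D : 'M[R]_m) : m%:R * `|D| < 1 -> 1%:M + D \in unitmx.
Proof.
move=> D1; rewrite -row_free_unit -kermx_eq0; apply/eqP/row_matrixP => i; rewrite row0.
have /eqP : row i (kermx (1%:M + D)) *m (1%:M + D) = 0 by rewrite -row_mul mulmx_ker row0.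
rewrite mulmxDr mulmx1 addr_eq0 => /eqP h; apply/eqP; rewrite -normr_eq0 eq_le normr_ge0 andbT leNgt.
apply/negP => v0; have := norm_mulmx (row i (kermx (1%:M + D))) D.
by rewrite -normrN -h mulrAC mulrC leNgt gtr_pMr // D1.
Qed.

HB.instance Definition _ (R : realType) (m : nat) := Complete.on 'rV[R]_m.

Section InverseFunction.
Variables (R : realType) (m : nat).
Local Notation E := 'rV[R]_m.
Variables (U : set E) (F : E -> E) (oU : open U) (sF : smooth_on U F).

Lemma linear_approximation x0 e : U x0 -> 0 < e ->
  exists2 r, 0 < r & ball x0 r `<=` U /\ forall x, ball x0 r x ->
    m%:R * `|jac F x - jac F x0| <= e /\
    forall x', ball x0 r x' -> `|F x - F x' - (x - x') *m jac F x0| <= e * `|x - x'|.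
Proof.
move=> Ux0 e0; set A := jac F x0; pose S j (x : E) : R := F x 0 j - (x *m A) 0 j.
have sF_ j : smooth_on U (fun x => F x 0 j : R) by [].
have sA j : smooth_on U (fun x => (x *m A) 0 j : R) := smooth_entry 0 j oU (smooth_linear A oU).
have sS j : smooth_on U (S j) by apply: smoothB.
have pS i j x : U x -> pd i (S j) x = (jac F x - A) i j.
  move=> Ux; rewrite (jet1B Ux) // mxE [in RHS]mxE -{2}(jac_linear A x).
  by rewrite !jac_entry //.
pose e' := e / m.+1%:R; have e'0 : 0 < e' by rewrite divr_gt0.
have me : m%:R * e' <= e by rewrite /e' mulrCA ger_pMr // ler_pdivrMr // mul1r ler_nat.
have n1 : \forall x \near x0, U x by exact: open_nbhs_nbhs.
have n2 : \forall x \near x0, `|jac F x - A| < e'.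
  have /cvgrPdist_lt/(_ _ e'0) := smooth_cont (smooth_jac oU sF) Ux0.
  by apply: filterS => x; rewrite distrC.
have [r /= r0 Hr] := (nbhs_ballP _ _).1 (filterI n1 n2).
exists r => //; split=> [x /Hr[]//|x bx]; have [_ /ltW hx] := Hr x bx; split.
  by apply: le_trans me; rewrite ler_wpM2l.
move=> x' bx'; apply: norm_le_coord => [|i j]; first by rewrite mulr_ge0 // ltW.
rewrite ord1 (_ : _ 0 j = S j x - S j x'); last by rewrite mulmxBl /S !mxE; ring.
apply: le_trans (_ : m%:R * e' * `|x - x'| <= _); last by rewrite ler_wpM2r.
apply: (@mean_value_bound R m (S j) x0 r) => // z bz; have [Uz hz] := Hr z bz.
split=> [|i'] //.
by rewrite pS //; apply: le_trans (coord_le_norm _ _ _) (ltW hz).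
Qed.

(** Followed by [B], the inverse of the Jacobian at [x0], the map is a Lipschitz perturbation of the
    identity. This gives injectivity through [expand], and openness of the image by a fixed point
    argument. *)
Theorem inverse_function x0 : U x0 -> jac F x0 \in unitmx -> exists r G,
  [/\ 0 < r, ball x0 r `<=` U, open (F @` ball x0 r), smooth_on (F @` ball x0 r) G &
      forall x, ball x0 r x -> G (F x) = x].
Proof.
move=> Ux0; set A := jac F x0 => uA; pose B := invmx A; pose C := m%:R * `|B|.
have C0 : 0 <= C by exact: mulr_ge0.
have nB k (x : 'M[R]_(k, m)) : `|x *m B| <= C * `|x| by rewrite /C mulrAC; exact: norm_mulmx.
(* With this accuracy C e <= 1/2, so [F] followed by [B] differs from the identity by a map of
   Lipschitz constant 1/2. *)
pose e := (2 * (C + 1))^-1; have e0 : 0 < e by rewrite invr_gt0 mulr_gt0 // ltr_wpDl.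
have Ce : C * e <= 2^-1.
  by rewrite /e invfM mulrCA ger_pMr // ler_pdivrMr ?ltr_wpDl // mul1r lerDl.
have [r r0 [rU Hr]] := linear_approximation Ux0 e0; set b := ball x0 r in rU Hr.
have uJ x : b x -> jac F x \in unitmx.
  move=> /Hr[h _]; rewrite -[jac F x](mulmxKV uA) unitmx_mul uA andbT.
  have -> : jac F x *m B = 1%:M + (jac F x - A) *m B by rewrite mulmxBl mulmxV // addrC subrK.
  apply: unitmx_near1; apply: le_lt_trans (_ : C * (m%:R * `|jac F x - A|) < 1).
    by rewrite mulrCA ler_wpM2l.
  by apply: le_lt_trans (ler_wpM2l C0 h) (le_lt_trans Ce _); lra.
have near_id x x' : b x -> b x' -> `|F x *m B - F x' *m B - (x - x')| <= 2^-1 * `|x - x'|.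
  move=> bx bx'; have [_ /(_ x' bx') h] := Hr x bx.
  have -> : F x *m B - F x' *m B - (x - x') = (F x - F x' - (x - x') *m A) *m B by rewrite [RHS]mulmxBl mulmxK // mulmxBl.
  apply: le_trans (nB _ _) _; apply: le_trans (ler_wpM2l C0 h) _.
  by rewrite mulrA ler_wpM2r.
have expand x x' : b x -> b x' -> `|x - x'| <= 2 * C * `|F x - F x'|.
  move=> bx bx'; have h := near_id _ _ bx bx'; have := nB _ (F x - F x'); rewrite mulmxBl.
  have := ler_normB (F x *m B - F x' *m B) (F x *m B - F x' *m B - (x - x')); rewrite subKr.
  move: h; rewrite -mulrA; lra.
pose G y := xget x0 [set x | b x /\ F x = y].
have GF x : b x -> G (F x) = x.
  move=> bx; rewrite /G; case: xgetP => [x' _ [bx' Fx']|/(_ x)[]//].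
  apply/eqP; rewrite -subr_eq0 -normr_eq0 eq_le normr_ge0 andbT.
  by apply: le_trans (expand _ _ bx' bx) _; rewrite Fx' subrr normr0 mulr0.
have oA : open (F @` b).
  rewrite openE => _ [x bx <-]; rewrite /interior /=.
  have xr : `|x0 - x| < r by move: bx; rewrite /b -ball_normE.
  pose rho := (r - `|x0 - x|) / 2; have rho0 : 0 < rho by rewrite divr_gt0 // subr_gt0.
  pose K := closed_ball x rho; have Kb z : K z -> b z.
    rewrite /K closed_ballE // /closed_ball_ /b -ball_normE /= => h.
    by have := ler_normD (x0 - x) (x - z); rewrite addrA subrK; rewrite /rho in h rho0 *; lra.
  apply/nbhs_ballP; exists (rho / 2 / (C + 1)) => [|y]; first by rewrite /= divr_gt0 ?ltr_wpDl // divr_gt0.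
  rewrite -ball_normE /= distrC ltr_pdivlMr ?ltr_wpDl // => hy.
  (* The fixed points of this contraction of the closed ball [K] are the solutions of F z = y. *)
  pose f z := z - F z *m B + y *m B.
  have hf z z' : K z -> K z' -> `|f z - f z'| <= 2^-1 * `|z - z'|.
    move=> /Kb bz /Kb bz'; rewrite -normrN (_ : - _ = F z *m B - F z' *m B - (z - z')); first exact: near_id.
    by rewrite /f; apply/rowP => j; rewrite !mxE; ring.
  have Kx : K x by exact: closed_ballxx.
  have fK : set_fun K K f.
    move=> z Kz; rewrite /K closed_ballE // /closed_ball_ /= distrC.
    have -> : f z - x = f z - f x + (y - F x) *m B by rewrite mulmxBl /f; apply/rowP => j; rewrite !mxE; ring.
    have h1 := hf z x Kz Kx; have h2 := nB _ (y - F x).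
    have h3 : `|z - x| <= rho by move: Kz; rewrite /K closed_ballE // /closed_ball_ /= distrC.
    apply: le_trans (ler_normD _ _) _; move: hy; rewrite mulrDr mulr1 [_ * C]mulrC.
    by have := normr_ge0 (y - F x); lra.
  have ctr : is_contraction (mkfun_fun fK).
    exists (2^-1)%:nng; split=> [|[z z'] [Kz Kz']]; first by rewrite /= invf_lt1 ?ltr1n.
    exact: hf.
  have [z Kz /= zE] := banach_fixed_point ctr (@closed_ball_closed _ _ x rho) (ex_intro _ x Kx).
  exists z; first exact: Kb.
  have : F z *m B = y *m B by move: zE => /(congr1 (fun w => w - z + F z *m B)); rewrite subrr add0r /f => ->;
    apply/rowP => j; rewrite !mxE; ring.
  by move=> /(congr1 (mulmx^~ A)); rewrite !mulmxKV.
exists r, G; split=> //.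
have Glip y y' : (F @` b) y -> (F @` b) y' -> `|G y - G y'| <= 2 * C * `|y - y'|.
  by move=> [x bx <-] [x' bx' <-]; rewrite !GF //; exact: expand.
have FG y : (F @` b) y -> F (G y) = y by move=> [x bx <-]; rewrite GF.
have cG y : (F @` b) y -> {for y, continuous G}.
  move=> Ay; apply/(@cvgrPdist_lt _ _ _ _ (nbhs_filter y)) => d d0; have C10 : 0 < 2 * C + 1 by rewrite ltr_wpDl // mulr_ge0.
  have n1 := open_nbhs_nbhs (conj oA Ay); apply: filterS2 n1 (nbhsx_ballx y _ (divr_gt0 d0 C10)) => y' Ay'.
  rewrite -ball_normE /= ltr_pdivlMr // => h; apply: le_lt_trans (Glip _ _ Ay Ay') _.
  by apply: le_lt_trans h; rewrite mulrC ler_wpM2l // lerDl.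
have dG y i j : (F @` b) y -> is_derive y (delta_mx 0 i : E) (fun y => G y 0 j : R) (invmx (jac F (G y)) i j).
  move=> Ay; have [x bx xE] := Ay; set J := jac F (G y).
  have xG : G y = x by rewrite -xE GF.
  have UG : U (G y) by rewrite xG; exact: rU.
  (* [Q] exceeds by one the product of the Lipschitz constant of [G] and the bound for the inverse
     Jacobian, so the remainder ends up with the factor (Q - 1) / Q, which is at most 1. *)
  apply: is_derive_of_bound => d d0; pose Q := m%:R * `|invmx J| * (2 * C) + 1.
  have Q0 : 0 < Q by rewrite ltr_wpDl // !mulr_ge0.
  have [s s0 [_ Hs]] := linear_approximation UG (divr_gt0 d0 Q0).
  have [t t0 tA] := open_ball_sub oA Ay; have C10 : 0 < 2 * C + 1 by rewrite ltr_wpDl // mulr_ge0.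
  exists (Num.min t (s / (2 * C + 1))) => [|h]; first by rewrite lt_min t0 divr_gt0.
  rewrite lt_min ltr_pdivlMr // => /andP[ht hs]; set y' := y + h *: delta_mx 0 i.
  have yE : y' - y = h *: delta_mx 0 i by rewrite /y' addrC addKr.
  have yy : `|y' - y| <= `|h|.
    rewrite yE; apply: norm_le_coord => // a c; rewrite !mxE normrM ler_piMr //.
    by case: (_ && _); rewrite ?normr1 ?normr0.
  have Ay' : (F @` b) y' by apply: tA; rewrite -ball_normE /= distrC; exact: le_lt_trans ht.
  have zy : `|G y' - G y| <= 2 * C * `|h|.
    by apply: le_trans (Glip _ _ Ay' Ay) _; rewrite ler_wpM2l // mulr_ge0.
  have bz : ball (G y) s (G y').
    rewrite -ball_normE /= distrC; apply: le_lt_trans zy (le_lt_trans _ hs).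
    by rewrite mulrC ler_wpM2l // lerDl.
  have [_ /(_ _ (ballxx _ s0))] := Hs _ bz; rewrite -/J !FG // => hw.
  set w := y' - y - _ in hw.
  have -> : G y' 0 j - G y 0 j - h * invmx J i j = - (w *m invmx J) 0 j.
    have -> : w *m invmx J = h *: row i (invmx J) - (G y' - G y).
      by rewrite /w yE mulmxBl mulmxK -?scalemxAl -?rowE // /J xG uJ.
    by rewrite !mxE; ring.
  rewrite normrN; apply: le_trans (coord_le_norm _ _ _) (le_trans (norm_mulmx _ _) _).
  have h1 : `|w| <= d / Q * (2 * C * `|h|).
    by apply: le_trans hw _; rewrite ler_wpM2l // ltW // divr_gt0.
  apply: le_trans (_ : m%:R * (d / Q * (2 * C * `|h|)) * `|invmx J| <= _).
    by rewrite ler_wpM2r // ler_wpM2l.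
  have -> : m%:R * (d / Q * (2 * C * `|h|)) * `|invmx J| = d * `|h| * ((Q - 1) / Q).
    by rewrite /Q addrK; ring.
  by rewrite ler_piMr ?mulr_ge0 ?(ltW d0) // ler_pdivrMr // mul1r lerBlDr lerDl.
have ob : open b by exact: ball_open.
(* The derivative of [G] is the inverse Jacobian of [F] composed with [G], so each order of
   regularity of [G] yields the next. *)
have CG k j : Ck_on k (F @` b) (fun y => G y 0 j : R).
  elim: k j => [|k IH] j; (split; first by move=> y Ay; apply: (@continuous_comp _ _ _ G (fun x : E => x 0 j)); [exact: cG|exact: coord_continuous]) => // i.
  split=> [y Ay|]; first by case: (dG y i j Ay).
  have sJ : smooth_on b (fun x => invmx (jac F x) i j : R).
    by apply: smooth_entry => //; apply: smooth_invmx => //; apply: smooth_jac => //; exact: smooth_subset rU sF.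
  apply: (Ck_on_ext oA (f := fun y => invmx (jac F (G y)) i j)) => [y Ay|].
    by case: (dG y i j Ay).
  apply: (Ck_on_comp (f := fun x => invmx (jac F x) i j) (g := G) oA ob _ (sJ k) IH) => _ [x bx <-].
  by rewrite GF.
by apply/smooth_mxP => // i j k; rewrite ord1.
Qed.
End InverseFunction.

(** * Connection, curvature, Hessian and Laplacian of a metric in coordinates *)

Section Tensors.
Variables (R : realType) (d : nat).
Local Notation E := 'rV[R]_d.
Implicit Types (h : E -> 'M[R]_d) (f : E -> R) (y : E).

(** The Christoffel symbols as one matrix for each direction [j] of differentiation, so that the
    transformation laws become matrix identities. *)
Definition connection h (j : 'I_d) y : 'M[R]_d := \matrix_(i, k) christoffel h k i j y.

Definition lower_connection h (j : 'I_d) y : 'M[R]_d := \matrix_(i, l)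
  (2^-1 * (pd i (fun z => h z j l) y + pd j (fun z => h z i l) y
           - pd l (fun z => h z i j) y)).

(** The curvature operator of the directions i and j. The products appear in reversed order because
    matrices act on row vectors from the right. *)
Definition curvature h (i j : 'I_d) y : 'M[R]_d :=
  pd i (connection h j) y - pd j (connection h i) y
  + (connection h j y *m connection h i y - connection h i y *m connection h j y).

Definition gradient f y : 'cV[R]_d := \col_i pd i f y.

Definition hessian h f y : 'M[R]_d := \matrix_(i, j)
  (pd j (fun z => pd i f z) y - \sum_k connection h j y i k * pd k f y).

Definition laplacian h f y : R := \tr (invmx (h y) *m hessian h f y).

Definition gradient_sqr h f y : R := ((gradient f y)^T *m invmx (h y) *m gradient f y) 0 0.

Lemma christoffelE h k i j y : christoffel h k i j y = 2^-1 * \sum_l invmx (h y) k l *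
  (pd i (fun z => h z j l) y + pd j (fun z => h z i l) y - pd l (fun z => h z i j) y).
Proof. by rewrite /christoffel pdE. Qed.

Lemma connectionE h j y : (h y)^T = h y ->
  connection h j y = lower_connection h j y *m invmx (h y).
Proof.
move=> sy; have sI : (invmx (h y))^T = invmx (h y) by rewrite trmx_inv sy.
apply/matrixP => i k; rewrite !mxE christoffelE mulr_sumr; apply: eq_bigr => l _.
by rewrite mxE -[in RHS]sI mxE; ring.
Qed.

Lemma smooth_lower_connection (U : set E) h j : open U -> smooth_on U h ->
  smooth_on U (lower_connection h j).
Proof.
move=> oU sh; apply/smooth_mxP => // i l.
apply: (@smooth_ext _ _ _ _ (fun y => 2^-1 * (pd i (fun z => h z j l) y +
   pd j (fun z => h z i l) y - pd l (fun z => h z i j) y))) => // y _.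
  by rewrite mxE.
Qed.

Lemma smooth_connection (U : set E) h j : open U -> smooth_on U h ->
  (forall y, U y -> (h y)^T = h y) -> (forall y, U y -> h y \in unitmx) ->
  smooth_on U (connection h j).
Proof.
move=> oU sh sy hu.
apply: (@smooth_ext _ _ _ _ (fun y => lower_connection h j y *m invmx (h y))) => //.
  by move=> y Uy; rewrite connectionE// sy.
by apply: smooth_mulmx => //; exact: smooth_lower_connection.
Qed.

Lemma christoffel_sym (U : set E) h k i j y : open U -> U y ->
  (forall y, U y -> (h y)^T = h y) -> christoffel h k i j y = christoffel h k j i y.
Proof.
move=> oU Uy sy; rewrite !christoffelE; congr (_ * _); apply: eq_bigr => l _; congr (_ * (_ - _)).
  exact: addrC.
by apply: (pd_ext _ oU Uy) => z Uz; rewrite -{1}(sy z Uz) mxE.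
Qed.

Lemma pdDW (W : normedModType R) (f g : E -> W) i x :
  derivable f x (delta_mx 0 i) -> derivable g x (delta_mx 0 i) ->
  pd i (fun y => f y + g y) x = pd i f x + pd i g x.
Proof. by rewrite -pdE => df dg; exact: (deriveD df dg). Qed.

Lemma ricciE (U : set E) h i j y : open U -> smooth_on U h ->
  (forall y, U y -> (h y)^T = h y) -> (forall y, U y -> h y \in unitmx) -> U y ->
  ricci h i j y = \sum_k curvature h k j y i k.
Proof.
move=> oU sh sy hu Uy; rewrite /ricci pdE; apply: eq_bigr => k _.
have D a b : derivable (connection h a) y (delta_mx 0 b).
  exact: smooth_derivable (smooth_connection a oU sh sy hu) Uy.
have pE a b : pd b (connection h a) y i k = pd b (christoffel h k i a) y.
  rewrite (pd_mx _ _ (D a b)); congr (pd b _ y).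
  by apply/funext => z; rewrite mxE.
rewrite /curvature !mxE !pE; congr (_ + _).
rewrite -sumrB; apply: eq_bigr => l _; rewrite !mxE.
rewrite (christoffel_sym k k l oU Uy sy) (christoffel_sym k j l oU Uy sy).
by congr (_ - _); exact: mulrC.
Qed.

Lemma scalar_curvatureE h y : scalar_curvature h y
  = \tr (invmx (h y) *m (\matrix_(i, j) ricci h i j y)^T).
Proof.
rewrite /scalar_curvature /mxtrace; apply: eq_bigr => i _; rewrite mxE.
by apply: eq_bigr => j _; rewrite !mxE.
Qed.

End Tensors.

(** * Naturality of the tensors under local diffeomorphisms *)

Section Pullback.
Variables (R : realType) (d : nat).
Local Notation E := 'rV[R]_d.
Variables (U V : set E) (h : E -> 'M[R]_d) (u : E -> E).
Hypotheses (oU : open U) (oV : open V) (sh : smooth_on U h) (su : smooth_on V u).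
Hypotheses (VU : forall y, V y -> U (u y)) (sym : forall x, U x -> (h x)^T = h x).
Hypotheses (hu : forall x, U x -> h x \in unitmx).
Hypothesis Ju : forall y, V y -> jac u y \in unitmx.

Local Notation J := (jac u).
Definition pullback_metric (y : E) : 'M[R]_d := J y *m h (u y) *m (J y)^T.
Local Notation H := pullback_metric.

Lemma pullback_sym y : V y -> (H y)^T = H y.
Proof. by move=> Vy; rewrite /pullback_metric !trmx_mul trmxK (sym (VU Vy)) mulmxA. Qed.

Lemma pullback_unit y : V y -> H y \in unitmx.
Proof. by move=> Vy; rewrite !unitmx_mul unitmx_tr Ju// hu//; exact: VU. Qed.

Lemma pullback_invmx y : V y -> invmx (H y) *m J y = invmx (J y)^T *m invmx (h (u y)).
Proof.
move=> Vy; rewrite -[RHS](mulKmx (pullback_unit Vy)); congr (_ *m _).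
by rewrite /H mulmxA mulmxK ?unitmx_tr ?Ju // mulmxK //; exact/hu/VU.
Qed.

Let sJ : smooth_on V J. Proof. done. Qed.

Lemma smooth_pull p q (F : E -> 'M[R]_(p, q)) : smooth_on U F -> smooth_on V (fun y => F (u y)).
Proof. by move=> sF; exact: (smooth_comp_mx oV oU VU sF su). Qed.

Lemma pullback_smooth : smooth_on V H.
Proof.
apply: smooth_mulmx => //.
by apply: smooth_mulmx => //; exact: smooth_pull.
Qed.

Lemma partial_pull (F : E -> R) i y : smooth_on U F -> V y ->
  pd i (fun z => F (u z)) y = \sum_a J y i a * pd a F (u y).
Proof.
move=> sF Vy; have dF : differentiable F (u y) by exact: smooth_differentiable sF (VU Vy).
have du : differentiable u y by [].
rewrite pd_chain//.
by apply: eq_bigr => a _; rewrite mulrC (jac_entry _ _ du).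
Qed.

Lemma partial_pull_mx p q (F : E -> 'M[R]_(p, q)) i y : smooth_on U F -> V y ->
  pd i (fun z => F (u z)) y = \sum_a J y i a *: pd a F (u y).
Proof.
move=> sF Vy; apply/matrixP => a b; rewrite summxE.
rewrite pd_mx; last exact: smooth_derivable (smooth_pull sF) Vy.
rewrite (partial_pull _ (smooth_entry a b oU sF) Vy); apply: eq_bigr => k _.
by rewrite mxE (pd_mx a b (smooth_derivable sF (VU Vy))).
Qed.

Lemma jacobian_sym i j k y : V y -> pd i J y j k = pd j J y i k.
Proof.
move=> Vy; have du z : V z -> differentiable u z by move=> Vz.
have D a : derivable J y (delta_mx 0 a) by [].
have pE a b : pd a J y b k = pd a (pd b (fun z => u z 0 k : R)) y.
  rewrite (pd_mx b k (D a)); apply: (pd_ext _ oV Vy) => z Vz.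
  exact: jac_entry (du z Vz).
rewrite !pE; exact: schwarz oV (smooth_entry 0 k oV su) Vy.
Qed.

Definition pulled_connection (j : 'I_d) (y : E) : 'M[R]_d := \sum_b J y j b *: connection h b (u y).
Local Notation A := pulled_connection.

(* Both sides are torsion free and compatible with [H]. *)
Lemma lower_connection_pullback j y : V y -> lower_connection H j y =
  J y *m (\sum_b J y j b *: lower_connection h b (u y)) *m (J y)^T + pd j J y *m h (u y) *m (J y)^T.
Proof.
move=> Vy; have sy := sym (VU Vy); pose C j := J y *m (\sum_b J y j b *: lower_connection h b (u y)) *m (J y)^T
  + pd j J y *m h (u y) *m (J y)^T.
have Dh k : derivable (fun z => h (u z)) y (delta_mx 0 k) by exact: smooth_derivable (smooth_pull sh) Vy.
have DJ k : derivable J y (delta_mx 0 k) by [].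
have DJT k : derivable (fun z => (J z)^T) y (delta_mx 0 k) by [].
have hs k p q : pd k (fun z => h z p q) (u y) = pd k (fun z => h z q p) (u y).
  by apply: pd_ext oU (VU Vy) _ => z Uz; rewrite -{1}(sym Uz) mxE.
have lowS b p q : lower_connection h b (u y) p q = lower_connection h p (u y) b q.
  by rewrite !mxE (hs q p b) [_ + pd b _ _]addrC.
have lowT b : lower_connection h b (u y) + (lower_connection h b (u y))^T = pd b h (u y).
  apply/matrixP => p q; rewrite !mxE (pd_mx p q (smooth_derivable sh (VU Vy))) (hs b q p) (hs p b q) (hs q p b).
  by move: (pd p _ _) (pd b _ _) (pd q _ _) => a1 a2 a3; field.
have HC k : pd k H y = C k + (C k)^T.
  have [E1 D1] := pd_mulmx (DJ k) (Dh k); have [-> _] := pd_mulmx D1 (DJT k).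
  have -> : pd k (fun z => (J z)^T) y = (pd k J y)^T.
    by apply/matrixP => a b; rewrite (pd_mx a b (DJT k)) mxE (pd_mx b a (DJ k)); congr (pd k _ y); apply/funext => z; rewrite mxE.
  have SL : \sum_a J y k a *: pd a h (u y) = \sum_b J y k b *: lower_connection h b (u y)
     + (\sum_b J y k b *: lower_connection h b (u y))^T.
    by rewrite linear_sum -big_split; apply: eq_bigr => a _; rewrite linearZ /= -scalerDr lowT.
  rewrite E1 (partial_pull_mx k sh Vy) SL /C [(_ + _)^T]linearD /= !trmx_mul !trmxK sy !mulmxA !mulmxDl mulmxDr mulmxDl.
  by rewrite [X in X + _ = _]addrCA -!addrA.
have CS a b l : C a b l = C b a l.
  rewrite /C !mxE; congr (_ + _); apply: eq_bigr => q _; congr (_ * _); rewrite !mxE; last first.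
    by apply: eq_bigr => p _; rewrite jacobian_sym.
  under eq_bigr do rewrite summxE mulr_sumr; rewrite exchange_big; apply: eq_bigr => p _ /=.
  by rewrite summxE mulr_sumr; apply: eq_bigr => c _; rewrite mxE [in RHS]mxE lowS mulrCA.
apply/matrixP => i l; rewrite [LHS]mxE -/(C j).
have E1 k p q : pd k (fun z => H z p q) y = C k p q + C k q p.
  rewrite -(pd_mx p q) ?HC 1?[LHS]mxE ?[(_^T) _ _]mxE //; exact: smooth_derivable pullback_smooth Vy.
by rewrite !E1 (CS i j l) (CS l j i) (CS l i j); field.
Qed.

(** The gauge transformation law of the connection; the derivative of the Jacobian is its
    inhomogeneous term. *)
Lemma connection_pullback j y : V y ->
  connection H j y *m J y = J y *m A j y + pd j J y.
Proof.
move=> Vy; rewrite connectionE ?pullback_sym// lower_connection_pullback//.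
rewrite -mulmxDl -!mulmxA pullback_invmx // mulKVmx ?unitmx_tr ?Ju // mulmxDl mulmxK; last exact/hu/VU.
congr (_ + _); rewrite -mulmxA mulmx_suml; congr (_ *m _); apply: eq_bigr => b _.
by rewrite -scalemxAl connectionE// sym//; exact: VU.
Qed.

Let sA j : smooth_on V (A j).
Proof.
apply/smooth_mxP => // a b.
apply: (@smooth_ext _ _ _ _ (fun y => \sum_k J y j k * connection h k (u y) a b)) => // [y _|].
  by rewrite /pulled_connection summxE; apply: eq_bigr => k _; rewrite [RHS]mxE.
apply: smooth_sum => // k; apply: smoothM => //.
apply: (smooth_comp oV oU VU (f := fun x => connection h k x a b) _ su).
exact/smooth_entry/smooth_connection.
Qed.

Lemma partial_pulled_connection i j y : V y -> pd i (A j) y =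
  \sum_b (pd i J y j b *: connection h b (u y)
          + J y j b *: \sum_a J y i a *: pd a (connection h b) (u y)).
Proof.
move=> Vy; apply/matrixP => p q; rewrite (pd_mx p q (smooth_derivable (sA j) Vy)) summxE.
have sc b : smooth_on V (fun z => connection h b (u z) p q : R).
  apply: (smooth_comp oV oU VU (f := fun x => connection h b x p q) _ su).
  exact/smooth_entry/smooth_connection.
have D1 b : derivable (fun z => J z j b : R) y (delta_mx 0 i).
  done.
have D2 b : derivable (fun z => connection h b (u z) p q : R) y (delta_mx 0 i).
  done.
rewrite (_ : (fun z => A j z p q) = fun z => \sum_b J z j b * connection h b (u z) p q); last first.
  by apply/funext => z; rewrite /pulled_connection summxE; apply: eq_bigr => b _; rewrite [LHS]mxE.
rewrite (pd_sum _ _ (fun b => derivableM (D1 b) (D2 b))).1; apply: eq_bigr => b _.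
rewrite (pdM (D1 b) (D2 b)) [RHS]mxE [X in _ = X + _]mxE [X in _ = _ + X]mxE; congr (_ + _).
  by congr (_ * _); rewrite (pd_mx j b (smooth_derivable sJ Vy)).
have sb := smooth_connection b oU sh sym hu.
congr (_ * _); rewrite summxE (partial_pull i (smooth_entry p q oU sb) Vy).
apply: eq_bigr => a _; rewrite [RHS]mxE.
by rewrite (pd_mx p q (smooth_derivable sb (VU Vy))).
Qed.

(** The transformation law of the connection is differentiated once more and antisymmetrised. The
    second derivatives of the Jacobian are symmetric and cancel, and so do the products with its
    first derivatives. *)
Lemma curvature_pullback i j y : V y -> curvature H i j y *m J y =
  J y *m \sum_a \sum_b (J y i a * J y j b) *: curvature h a b (u y).
Proof.
move=> Vy; have sC := smooth_connection _ oV pullback_smooth pullback_sym pullback_unit.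
have DJ k : derivable J y (delta_mx 0 k) by [].
have G k l : pd k (connection H l) y *m J y + connection H l y *m pd k J y
   = pd k J y *m A l y + J y *m pd k (A l) y + pd k (pd l J) y.
  have DC : derivable (connection H l) y (delta_mx 0 k) by [].
  have DA : derivable (A l) y (delta_mx 0 k) by exact: smooth_derivable (sA l) Vy.
  have DP : derivable (pd l J) y (delta_mx 0 k).
    exact: smooth_derivable (smooth_on_pd l sJ) Vy.
  have [<- _] := pd_mulmx DC (DJ k); have [<- D2] := pd_mulmx (DJ k) DA.
  rewrite -(pdDW D2 DP); apply: (pd_ext _ oV Vy) => z Vz.
  exact: connection_pullback.
have S : pd i (pd j J) y = pd j (pd i J) y.
  apply/matrixP => a b.
  have pE k l : pd k (pd l J) y a b = pd k (pd l (fun z => J z a b : R)) y.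
    rewrite (pd_mx a b (smooth_derivable (smooth_on_pd l sJ) Vy)).
    apply: (pd_ext _ oV Vy) => z Vz.
    exact: (pd_mx a b (smooth_derivable sJ Vz)).
  rewrite !pE; exact: schwarz oV (smooth_entry a b oV sJ) Vy.
have -> : \sum_a \sum_b (J y i a * J y j b) *: curvature h a b (u y)
    = pd i (A j) y - pd j (A i) y + (A j y *m A i y - A i y *m A j y).
  have Q k l : A k y *m A l y = \sum_a \sum_b (J y l a * J y k b) *: (connection h b (u y) *m connection h a (u y)).
    rewrite mulmx_suml exchange_big; apply: eq_bigr => b _.
    rewrite mulmx_sumr; apply: eq_bigr => a _.
    by rewrite -scalemxAl -scalemxAr scalerA mulrC.
  have P k l : pd k (A l) y = \sum_b pd k J y l b *: connection h b (u y)
      + \sum_a \sum_b (J y k a * J y l b) *: pd a (connection h b) (u y).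
    rewrite partial_pulled_connection// big_split exchange_big; congr (_ + _); apply: eq_bigr => b _ /=.
    by rewrite scaler_sumr; apply: eq_bigr => a _; rewrite scalerA mulrC.
  rewrite !P (Q j i).
  have -> : \sum_a \sum_b (J y j a * J y i b) *: pd a (connection h b) (u y)
     = \sum_a \sum_b (J y i a * J y j b) *: pd b (connection h a) (u y).
    by rewrite exchange_big; apply: eq_bigr => a _; apply: eq_bigr => b _; rewrite mulrC.
  have -> : A i y *m A j y = \sum_a \sum_b (J y i a * J y j b) *: (connection h a (u y) *m connection h b (u y)).
    by rewrite Q exchange_big; apply: eq_bigr => a _; apply: eq_bigr => b _; rewrite mulrC.
  have -> : \sum_b pd i J y j b *: connection h b (u y) = \sum_b pd j J y i b *: connection h b (u y).
    by apply: eq_bigr => b _; rewrite jacobian_sym.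
  have AA (t a b c : 'M[R]_d) : (t + a) - (t + b) + c = a - b + c.
    by rewrite opprD addrACA subrr add0r.
  rewrite AA -!sumrB -big_split; apply: eq_bigr => a _.
  rewrite -!sumrB -big_split; apply: eq_bigr => b _ /=.
  by rewrite /curvature -!scalerBr -scalerDr.
rewrite /curvature mulmxDl !mulmxBl -[connection H j y *m _ *m _]mulmxA -[connection H i y *m _ *m _]mulmxA.
rewrite !connection_pullback// !mulmxDr !mulmxA !connection_pullback//.
have Gi := G i j; have Gj := G j i; rewrite -S in Gj.
have Ei : pd i (connection H j) y *m J y = pd i J y *m A j y + J y *m pd i (A j) y
   + pd i (pd j J) y - connection H j y *m pd i J y by rewrite -Gi addrK.
have Ej : pd j (connection H i) y *m J y = pd j J y *m A i y + J y *m pd j (A i) y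
   + pd i (pd j J) y - connection H i y *m pd j J y by rewrite -Gj addrK.
rewrite Ei Ej !mulmxDl !mulmxN !mulmxA.
move: (pd i J y *m A j y) (J y *m pd i (A j) y) (pd i (pd j J) y) => P1 P2 P3.
move: (connection H j y *m pd i J y) (pd j J y *m A i y) (J y *m pd j (A i) y) => P4 Q1 Q2.
move: (connection H i y *m pd j J y) (J y *m A j y *m A i y) (J y *m A i y *m A j y) => Q4 M1 M2.
by apply/matrixP => a b; rewrite !mxE; ring.
Qed.

Lemma ricci_pullback y : V y ->
  \matrix_(i, j) ricci H i j y = J y *m (\matrix_(i, j) ricci h i j (u y)) *m (J y)^T.
Proof.
move=> Vy; have Juy := Ju Vy; apply/matrixP => i j; rewrite mxE.
rewrite (ricciE _ _ oV pullback_smooth pullback_sym pullback_unit Vy).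
pose Rm a b := curvature h a b (u y).
have CE k : curvature H k j y i k = \sum_a \sum_b J y j b * ((J y *m Rm a b *m invmx (J y)) i k * J y k a).
  have -> : curvature H k j y = J y *m (\sum_a \sum_b (J y k a * J y j b) *: Rm a b) *m invmx (J y).
    by rewrite -curvature_pullback// -mulmxA mulmxV// mulmx1.
  rewrite mulmx_sumr mulmx_suml summxE; apply: eq_bigr => a _; rewrite mulmx_sumr mulmx_suml summxE.
  by apply: eq_bigr => b _; rewrite -scalemxAr -scalemxAl mxE; ring.
rewrite (eq_bigr _ (fun k _ => CE k)) exchange_big [RHS]mxE; under eq_bigr do rewrite exchange_big.
rewrite exchange_big; apply: eq_bigr => b _ /=; rewrite [RHS]mulrC mxE.
have -> : (J y *m (\matrix_(i, j) ricci h i j (u y))) i b = \sum_a (J y *m Rm a b) i a.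
  rewrite mxE; under [RHS]eq_bigr do rewrite mxE; rewrite exchange_big; apply: eq_bigr => p _.
  by rewrite mxE (ricciE _ _ oU sh sym hu (VU Vy)) mulr_sumr.
rewrite mulr_sumr; apply: eq_bigr => a _; rewrite -mulr_sumr; congr (_ * _).
by rewrite -[J y *m Rm a b in RHS](mulmxKV Juy) [RHS]mxE.
Qed.

Lemma trace_pullback (X : 'M[R]_d) y : V y ->
  \tr (invmx (H y) *m (J y *m X *m (J y)^T)) = \tr (invmx (h (u y)) *m X).
Proof.
move=> Vy; rewrite !mulmxA pullback_invmx // mxtrace_mulC.
by rewrite !mulmxA mulmxV ?unitmx_tr ?Ju // mul1mx.
Qed.

Theorem scalar_curvature_pullback y : V y ->
  scalar_curvature H y = scalar_curvature h (u y).
Proof.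
move=> Vy; rewrite !scalar_curvatureE ricci_pullback//.
by rewrite !trmx_mul trmxK mulmxA trace_pullback.
Qed.

Variable f : E -> R.
Hypothesis sf : smooth_on U f.

Lemma gradient_pullback y : V y -> gradient (fun z => f (u z)) y = J y *m gradient f (u y).
Proof.
move=> Vy; apply/colP => i; rewrite !mxE partial_pull//.
by apply: eq_bigr => a _; rewrite mxE.
Qed.

Lemma hessian_pullback y : V y ->
  hessian H (fun z => f (u z)) y = J y *m hessian h f (u y) *m (J y)^T.
Proof.
move=> Vy; apply/matrixP => i j; rewrite mxE.
have sfi b : smooth_on U (pd b f) by [].
have D1 b : derivable (fun z => J z i b : R) y (delta_mx 0 j).
  done.
have D2 b : derivable (fun z => pd b f (u z) : R) y (delta_mx 0 j).
  exact: smooth_derivable (smooth_comp oV oU VU (sfi b) su) Vy.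
have -> : pd j (fun z => pd i (fun z => f (u z)) z) y
   = \sum_b (pd j J y i b * pd b f (u y)
       + J y i b * \sum_a J y j a * pd a (pd b f) (u y)).
  rewrite (_ : pd j _ y = pd j (fun z => \sum_b J z i b * pd b f (u z)) y); last first.
    by apply: (pd_ext _ oV Vy) => z Vz; exact: partial_pull.
  rewrite (pd_sum _ _ (fun b => derivableM (D1 b) (D2 b))).1; apply: eq_bigr => b _.
  rewrite (pdM (D1 b) (D2 b)); congr (_ + _ * _).
    by rewrite (pd_mx i b (smooth_derivable sJ Vy)).
  exact: partial_pull.
have -> : \sum_k connection H j y i k * pd k (fun z => f (u z)) y
   = ((J y *m A j y + pd j J y) *m gradient f (u y)) i 0.
  rewrite -connection_pullback// -mulmxA -gradient_pullback// mxE.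
  by apply: eq_bigr => k _; rewrite !mxE.
rewrite mulmxDl mxE big_split /= -mulmxA.
have -> : (pd j J y *m gradient f (u y)) i 0 = \sum_b pd j J y i b * pd b f (u y).
  by rewrite mxE; apply: eq_bigr => b _; rewrite mxE.
rewrite [X in _ - X]addrC opprD addrACA subrr add0r.
rewrite mxE -sumrB [RHS]mxE.
transitivity (\sum_b \sum_a J y i b * J y j a * hessian h f (u y) b a).
  apply: eq_bigr => b _; rewrite -mulrBr.
  have -> : \sum_a J y i b * J y j a * hessian h f (u y) b a =
     J y i b * \sum_a J y j a * hessian h f (u y) b a.
    by rewrite mulr_sumr; apply: eq_bigr => a _; rewrite mulrA.
  congr (_ * _); rewrite /A mulmx_suml summxE -sumrB; apply: eq_bigr => a _.
  rewrite -scalemxAl mxE -mulrBr [hessian _ _ _ _ _]mxE; congr (_ * (_ - _)).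
  by rewrite [LHS]mxE; apply: eq_bigr => k _; congr (_ * _); rewrite mxE.
rewrite exchange_big; apply: eq_bigr => a _; rewrite !mxE mulr_suml; apply: eq_bigr => b _.
by rewrite mulrAC.
Qed.

Theorem laplacian_pullback y : V y ->
  laplacian H (fun z => f (u z)) y = laplacian h f (u y).
Proof. by move=> Vy; rewrite /laplacian hessian_pullback// trace_pullback. Qed.

Theorem gradient_sqr_pullback y : V y ->
  gradient_sqr H (fun z => f (u z)) y = gradient_sqr h f (u y).
Proof.
move=> Vy; have Juy := Ju Vy; have hy := hu (VU Vy).
rewrite /gradient_sqr gradient_pullback//.
have E1 (X : 'cV[R]_d) (B : 'M[R]_d) : (X^T *m B *m X) 0 0 = \tr (B *m (X *m X^T)).
  by rewrite mulmxA mxtrace_mulC mulmxA /mxtrace big_ord1.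
rewrite !E1 trmx_mul -[RHS](trace_pullback _ Vy) !mulmxA.
by [].
Qed.

End Pullback.

(** * Scalar curvature at a point in terms of the 2-jet of the metric *)

Section PointFormula.
Variables (R : realType) (d : nat).
Local Notation E := 'rV[R]_d.
Variables (U : set E) (h : E -> 'M[R]_d) (y : E).
Hypotheses (oU : open U) (sh : smooth_on U h) (Uy : U y).
Hypotheses (sym : forall x, U x -> (h x)^T = h x) (hu : forall x, U x -> h x \in unitmx).

Definition metric_jet2 i j k l : R := pd l (pd k (fun w => h w i j)) y.

Definition lower_christoffel l i j : R := 2^-1 * (pd i (fun z => h z j l) y
  + pd j (fun z => h z i l) y - pd l (fun z => h z i j) y).

Local Notation h2 := metric_jet2.
Local Notation C := lower_christoffel.

Lemma metric_derivE a l k : pd a (fun z => h z l k) y = C k a l + C l a k.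
Proof.
have S i j b : pd b (fun z => h z i j) y = pd b (fun z => h z j i) y.
  by apply: (pd_ext b oU Uy) => z Uz; rewrite -{1}(sym Uz) mxE.
rewrite /C (S k l a) (S a l k) (S a k l).
move: (pd a _ _) (pd l _ _) (pd k _ _) => p q r; by field.
Qed.

Lemma pd_christoffel c a k i j : h y = c%:M -> c != 0 ->
  pd a (christoffel h k i j) y = c^-1 * (2^-1 * (h2 j k i a + h2 i k j a - h2 i j k a))
    - c^-2 * \sum_l C l i j * pd a (fun z => h z l k) y.
Proof.
move=> hc c0.
have sL := smooth_lower_connection j oU sh.
have DL : derivable (lower_connection h j) y (delta_mx 0 a) by [].
have DI : derivable (fun z => invmx (h z)) y (delta_mx 0 a).
  exact: smooth_derivable (smooth_invmx oU hu sh) Uy.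
have Ic : invmx (h y) = c^-1%:M by rewrite hc invmx_scalar.
have [E1 D1] := pd_mulmx DL DI.
transitivity (pd a (fun z => lower_connection h j z *m invmx (h z)) y i k).
  rewrite (pd_mx i k D1); apply: (pd_ext a oU Uy) => z Uz.
  by rewrite -connectionE ?sym// mxE.
rewrite E1 (jet1_invmx oU Uy _ sh hu) Ic mxE; congr (_ + _).
  rewrite mul_mx_scalar mxE (pd_mx i k DL); congr (_ * _).
  rewrite (pd_ext (g := fun z => 2^-1 * (pd i (fun z => h z j k) z + pd j (fun z => h z i k) z
    - pd k (fun z => h z i j) z)) a oU Uy); last by move=> z _; rewrite mxE.
  have sp b p q : smooth_on U (pd b (fun z => h z p q : R)).
    by [].
  have dp b p q : derivable (pd b (fun z => h z p q : R)) y (delta_mx 0 a).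
    done.
  have ds : derivable (fun z => pd i (fun z => h z j k) z + pd j (fun z => h z i k) z) y (delta_mx 0 a).
    by [].
  have dt : derivable (fun z => pd i (fun z => h z j k) z + pd j (fun z => h z i k) z
    - pd k (fun z => h z i j) z) y (delta_mx 0 a).
    by [].
  rewrite (pdM (f := fun=> 2^-1) (derivable_cst _ _ _) dt).
  by rewrite pd_cst mul0r add0r (pdB ds (dp _ _ _)) (pdD (dp _ _ _) (dp _ _ _)).
rewrite mul_scalar_mx mul_mx_scalar scalerA mulmxN mxE; congr (- _).
rewrite -scalemxAr mxE -invfM -expr2; congr (_ * _); rewrite mxE; apply: eq_bigr => l _.
by rewrite (pd_mx l k (smooth_derivable sh Uy)) mxE.
Qed.

(** Where the metric is a multiple of the identity all index raisings are scalars. The formula is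
    used with c = 1 for the metric in normal coordinates and with c = 1 / f for its twist at the
    same point. *)
Lemma scalar_curvature_point c : h y = c%:M -> c != 0 ->
  scalar_curvature h y = c^-2 * (\sum_i \sum_k (h2 i k i k - h2 i i k k))
  + c^-3 * (\sum_i \sum_k \sum_l C l i k ^+ 2 - \sum_l (\sum_i C l i i) ^+ 2).
Proof.
move=> hc c0; have Ic : invmx (h y) = c^-1%:M by rewrite hc invmx_scalar.
have chE k i j : christoffel h k i j y = c^-1 * C k i j.
  rewrite christoffelE Ic mulrCA /C; congr (_ * _); rewrite (bigD1 k)//= big1 ?addr0.
    by rewrite mxE eqxx.
  by move=> l lk; rewrite mxE eq_sym (negbTE lk) mul0r.
transitivity (c^-1 * \sum_i ricci h i i y).
  rewrite /scalar_curvature mulr_sumr; apply: eq_bigr => i _.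
  rewrite (bigD1 i)//= big1 ?addr0; first by rewrite Ic mxE eqxx.
  by move=> l li; rewrite Ic mxE eq_sym (negbTE li) mul0r.
transitivity (c^-1 * \sum_i \sum_k (c^-1 * (h2 i k i k - 2^-1 * h2 i i k k - 2^-1 * h2 k k i i)
   + c^-2 * \sum_l (C l i k ^+ 2 - C l i i * C l k k))).
  congr (_ * _); apply: eq_bigr => i _; rewrite /ricci pdE; apply: eq_bigr => k _.
  rewrite !(pd_christoffel _ _ _ _ hc c0).
  have -> : h2 i k k i = h2 i k i k.
    exact: (schwarz i k oU (smooth_entry i k oU sh) Uy).
  have -> : \sum_l C l i i * pd k (fun z => h z l k) y = \sum_l C l i i * (C k k l + C l k k).
    by apply: eq_bigr => l _; rewrite metric_derivE.
  have -> : \sum_l C l i k * pd i (fun z => h z l k) y = \sum_l C l i k * (C k i l + C l i k).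
    by apply: eq_bigr => l _; rewrite metric_derivE.
  have -> : \sum_l (christoffel h k k l y * christoffel h l i i y
      - christoffel h k i l y * christoffel h l i k y)
    = c^-2 * \sum_l (C k k l * C l i i - C k i l * C l i k).
    by rewrite mulr_sumr; apply: eq_bigr => l _; rewrite !chE -exprVn; ring.
  have -> : \sum_l (C l i k ^+ 2 - C l i i * C l k k) = \sum_l C l i k * (C k i l + C l i k)
     - \sum_l C l i i * (C k k l + C l k k) + \sum_l (C k k l * C l i i - C k i l * C l i k).
    by rewrite -sumrB -big_split; apply: eq_bigr => l _ /=; ring.
  move: (\sum_l _) (\sum_l _) (\sum_l _) (h2 _ _ _ _) (h2 _ _ _ _) (h2 _ _ _ _) => a b e p q r.
  by rewrite -exprVn; field.
transitivity (c^-1 * (c^-1 * (\sum_i \sum_k (h2 i k i k - h2 i i k k)) +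
   c^-2 * \sum_i \sum_k \sum_l (C l i k ^+ 2 - C l i i * C l k k))); last first.
  have -> : \sum_i \sum_k \sum_l (C l i k ^+ 2 - C l i i * C l k k)
     = \sum_i \sum_k \sum_l C l i k ^+ 2 - \sum_l (\sum_i C l i i) ^+ 2.
    transitivity (\sum_i \sum_k \sum_l C l i k ^+ 2 - \sum_i \sum_k \sum_l C l i i * C l k k).
      rewrite -sumrB; apply: eq_bigr => i _; rewrite -sumrB; apply: eq_bigr => k _.
      by rewrite -sumrB.
    congr (_ - _).
    transitivity (\sum_i \sum_l \sum_k C l i i * C l k k).
      by apply: eq_bigr => i _; exact: exchange_big.
    rewrite exchange_big; apply: eq_bigr => l _ /=.
    rewrite expr2 mulr_suml; apply: eq_bigr => i _.
    by rewrite mulr_sumr.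
  by move: (\sum_i _) (\sum_i _ - _) => a b; rewrite -!exprVn; ring.
congr (_ * _).
have -> : \sum_i \sum_k (h2 i k i k - h2 i i k k)
   = \sum_i \sum_k (h2 i k i k - 2^-1 * h2 i i k k - 2^-1 * h2 k k i i).
  transitivity (\sum_i \sum_k (h2 i k i k - 2^-1 * h2 i i k k) - \sum_i \sum_k 2^-1 * h2 i i k k).
    rewrite -sumrB; apply: eq_bigr => i _; rewrite -sumrB; apply: eq_bigr => k _.
    by move: (h2 i k i k) (h2 i i k k) => p q; by field.
  rewrite [X in _ - X]exchange_big -sumrB; apply: eq_bigr => i _.
  by rewrite -sumrB.
rewrite !mulr_sumr -big_split; apply: eq_bigr => i _ /=.
by rewrite !mulr_sumr -big_split.
Qed.

End PointFormula.

(** * Algebra of the twist at one point *)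

Section TwistAlgebra.
(** At the base point, in an orthonormal frame, [a] is half the transverse two-form, [v] is the
    differential of f and [k] is the transverse Hamiltonian field. The hypotheses say that [a] is an
    orthogonal complex structure and that [k] is Hamiltonian for [v]. *)
Variables (R : realType) (d : nat) (a : 'I_d -> 'I_d -> R) (v k : 'I_d -> R).
Hypothesis asym : forall i j, a i j = - a j i.
Hypothesis orth : forall i j, \sum_l a i l * a j l = (i == j)%:R.
Hypothesis hk : forall j, \sum_i k i * a i j = - (v j / 2).

Lemma sum_delta (F : 'I_d -> R) i : \sum_j F j * (i == j)%:R = F i.
Proof.
rewrite (bigD1 i)//= eqxx mulr1 big1 ?addr0// => j /negbTE ji.
by rewrite eq_sym ji mulr0.
Qed.

Lemma orthC i j : \sum_l a l i * a l j = (i == j)%:R.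
Proof.
rewrite -orth; apply: eq_bigr => l _.
by rewrite asym [a l j]asym mulrNN.
Qed.

Lemma twist_av l : \sum_j a l j * v j = - 2 * k l.
Proof.
transitivity (\sum_j \sum_i - 2 * k i * (a l j * a i j)).
  apply: eq_bigr => j _; have -> : v j = - 2 * \sum_i k i * a i j by rewrite hk; field.
  by rewrite mulrCA !mulr_sumr; apply: eq_bigr => i _; ring.
rewrite exchange_big /= -(sum_delta (fun i => - 2 * k i) l); apply: eq_bigr => i _.
by rewrite -orth mulr_sumr.
Qed.

Lemma twist_ak l : \sum_j a l j * k j = v l / 2.
Proof.
rewrite -[RHS]opprK -hk -sumrN; apply: eq_bigr => j _.
by rewrite asym mulNr mulrC.
Qed.

Local Notation q := (\sum_i v i ^+ 2).

Lemma twist_kk : \sum_i k i ^+ 2 = q / 4.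
Proof.
transitivity (\sum_l k l * (- 2^-1 * \sum_j a l j * v j)).
  by apply: eq_bigr => l _; rewrite twist_av; field.
transitivity (\sum_l \sum_j - 2^-1 * v j * (k l * a l j)).
  by apply: eq_bigr => l _; rewrite mulrCA !mulr_sumr; apply: eq_bigr => j _; ring.
rewrite exchange_big mulr_suml; apply: eq_bigr => j _ /=.
by rewrite -mulr_sumr hk; field.
Qed.

(** Up to the factor - f^(-2) / 2, the Christoffel symbols of the first kind of the twisted metric
    at the base point. Its trace and its square sum are the two contractions in the point
    formula. *)
Definition twist_jet l i j : R := v i * (l == j)%:R + v j * (l == i)%:R - v l * (i == j)%:R
  - 2 * (k j * a l i) - 2 * (k i * a l j).

Lemma twist_jet_trace l : \sum_i twist_jet l i i = - d%:R * v l.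
Proof.
have -> : \sum_i twist_jet l i i = 2 * (\sum_i v i * (l == i)%:R) - \sum_(i < d) v l
    - 4 * \sum_i a l i * k i.
  rewrite !mulr_sumr -!sumrB; apply: eq_bigr => i _; rewrite /twist_jet eqxx.
  by rewrite mulr1; ring.
rewrite sum_delta sumr_const card_ord twist_ak -[v l *+ d]mulr_natl.
by field.
Qed.

Lemma twist_jet_sqr : \sum_i \sum_j \sum_l twist_jet l i j ^+ 2 = (5 * d%:R + 8) * q.
Proof.
have aii i : a i i = 0 by have := asym i i; lra.
have va i : \sum_l v l * a l i = 2 * k i.
  rewrite -[RHS]opprK -mulNr -twist_av -sumrN; apply: eq_bigr => l _; by rewrite asym mulrN mulrC.
have const (c : R) : \sum_(j < d) c = d%:R * c by rewrite sumr_const card_ord mulr_natl.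
(* The products are sorted by the Kronecker delta that they carry; the others collapse by
   orthogonality of [a]. *)
have row i j : \sum_l twist_jet l i j ^+ 2 = v i ^+ 2 + v j ^+ 2 + 4 * k i ^+ 2 + 4 * k j ^+ 2
    + 4 * v i * (a i j * k j) + (- 4) * k i * (a i j * v j) + (q - 2 * v i * v j + 24 * k i * k j) * (i == j)%:R.
  rewrite (eq_bigr (fun l => (v i ^+ 2 + 2 * v i * v j * (l == i)%:R - 2 * v i * v l * (i == j)%:R - 4 * v i * k j * a l i
      - 4 * v i * k i * a l j) * (j == l)%:R
    + (v j ^+ 2 - 2 * v j * v l * (i == j)%:R - 4 * v j * k j * a l i - 4 * v j * k i * a l j) * (i == l)%:R
    + ((i == j)%:R * v l ^+ 2 + 4 * k j ^+ 2 * (a l i * a l i) + 4 * k i ^+ 2 * (a l j * a l j)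
    + 4 * (i == j)%:R * k j * (v l * a l i) + 4 * (i == j)%:R * k i * (v l * a l j) + 8 * k i * k j * (a l i * a l j)))) => [|l _].
    rewrite !big_split /= !sum_delta -!mulr_sumr !orthC !va !eqxx [j == i]eq_sym !aii [a j i]asym.
    by case: eqP => _; rewrite /= ?mulr1n ?mulr0n; ring.
  rewrite /twist_jet [j == l]eq_sym [i == l]eq_sym.
  by case: (l == j); case: (l == i); case: (i == j); rewrite /= ?mulr1n ?mulr0n; ring.
transitivity (\sum_i (d%:R * v i ^+ 2 + 4 * d%:R * k i ^+ 2 + 3 * q + 32 * k i ^+ 2)).
  apply: eq_bigr => i _; under eq_bigr do rewrite row.
  rewrite !big_split /= !sum_delta -!mulr_sumr !const twist_ak twist_av twist_kk.
  by move: q d%:R => Q D; field.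
by rewrite !big_split /= -!mulr_sumr const twist_kk; field.
Qed.

(* Codifferential of an almost Kaehler form: O c is the derivative of the form
   in direction c at a point where the metric has vanishing derivatives. *)
Lemma coclosed (O : 'I_d -> 'I_d -> 'I_d -> R) :
  (forall c i j, O c i j = - O c j i) ->
  (forall c i j, O c i j + O i j c + O j c i = 0) ->
  (forall c i l, \sum_j (O c i j * a l j + a i j * O c l j) = 0) ->
  forall m, \sum_i O i i m = 0.
Proof.
move=> Oas cyc orthO m.
have tr c : \sum_i \sum_j a i j * O c i j = 0.
  have : 2 * (\sum_i \sum_j a i j * O c i j) = 0.
    transitivity (\sum_i \sum_j (O c i j * a i j + a i j * O c i j)); last by rewrite big1.
    rewrite mulr_sumr; apply: eq_bigr => i _; rewrite mulr_sumr; apply: eq_bigr => j _; ring.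
  by move/eqP; rewrite mulf_eq0 pnatr_eq0 => /eqP.
have tr2 c : \sum_i \sum_j a i j * O i j c = 0.
  have : \sum_i \sum_j a i j * O c i j + \sum_i \sum_j a i j * O i j c
       + \sum_i \sum_j a i j * O j c i = 0.
    rewrite -!big_split big1// => i _; rewrite -!big_split big1// => j _ /=.
    by rewrite -!mulrDr cyc mulr0.
  have -> : \sum_i \sum_j a i j * O j c i = \sum_i \sum_j a i j * O i j c.
    rewrite exchange_big; apply: eq_bigr => i _; apply: eq_bigr => j _.
    by rewrite asym Oas mulrNN.
  by rewrite tr add0r; lra.
have key l : \sum_j (\sum_i O i i j) * a l j = 0.
  transitivity (\sum_i \sum_j (O i i j * a l j + a i j * O i l j)); last first.
    by rewrite big1// => i _.
  transitivity (\sum_i \sum_j O i i j * a l j + \sum_i \sum_j a i j * O i l j).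
    have -> : \sum_i \sum_j a i j * O i l j = 0.
      apply: oppr_inj; rewrite oppr0 -[RHS](tr2 l) -sumrN; apply: eq_bigr => i _; rewrite -sumrN.
      by apply: eq_bigr => j _; rewrite (Oas i l j) mulrN opprK.
    rewrite addr0 exchange_big; apply: eq_bigr => j _.
    by rewrite mulr_suml.
  by rewrite -big_split; apply: eq_bigr => i _; rewrite -big_split.
transitivity (\sum_j (\sum_i O i i j) * (m == j)%:R); first by rewrite sum_delta.
transitivity (\sum_l (\sum_j (\sum_i O i i j) * a l j) * a l m); last first.
  by rewrite big1// => l _; rewrite key mul0r.
transitivity (\sum_j \sum_l (\sum_i O i i j) * (a l m * a l j)).
  by apply: eq_bigr => j _; rewrite -mulr_sumr orthC.
rewrite exchange_big; apply: eq_bigr => l _; rewrite mulr_suml.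
by apply: eq_bigr => j _; rewrite mulrA mulrAC.
Qed.

End TwistAlgebra.

(** * Scalar curvature of the twisted metric at a well chosen point *)

Section Twist.
Variables (R : realType) (d : nat).
Local Notation E := 'rV[R]_d.

Definition exterior (al : E -> 'cV[R]_d) (z : E) : 'M[R]_d :=
  \matrix_(i, j) (pd i (fun w => al w j 0 : R) z - pd j (fun w => al w i 0 : R) z).

(** In a flow box of b1 the contact form is (1, al) and X_b has transverse part K. A slice vector is
    projected to the contact distribution along X_b, and this map gives the transverse part of the
    result. *)
Definition twist_map (al : E -> 'cV[R]_d) (K : E -> 'rV[R]_d) (f : E -> R) (z : E) : 'M[R]_d :=
  1%:M - (f z)^-1 *: (al z *m K z).

(** On the contact distribution the metric of b is f^(-1) times that of b1. Hence this is the
    transverse metric of b, read on the slice of b1. *)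
Definition twisted (h : E -> 'M[R]_d) al K f (z : E) : 'M[R]_d :=
  (f z)^-1 *: (twist_map al K f z *m h z *m (twist_map al K f z)^T).

Variables (U : set E) (h : E -> 'M[R]_d) (al : E -> 'cV[R]_d) (K : E -> 'rV[R]_d) (f : E -> R).
Variable y : E.
Hypotheses (oU : open U) (Uy : U y).
Hypotheses (sh : smooth_on U h) (sal : smooth_on U al) (sK : smooth_on U K) (sf : smooth_on U f).
Hypotheses (sym : forall z, U z -> (h z)^T = h z) (hu : forall z, U z -> h z \in unitmx).
Hypothesis f0 : forall z, U z -> f z != 0.
Hypothesis HK : forall z, U z -> K z *m exterior al z = - (gradient f z)^T.
Hypothesis HO : forall z, U z ->
  exterior al z *m invmx (h z) *m (exterior al z)^T = 4 *: h z.
Hypotheses (h1 : h y = 1%:M) (dh : forall k i j, pd k (fun z => h z i j) y = 0).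
Hypotheses (al0 : al y = 0)
  (alas : forall i j, pd i (fun z => al z j 0 : R) y = - pd j (fun z => al z i 0 : R) y).

(** Coefficients of the twisted metric as a polynomial in [al]: [ka] is K with its index lowered,
    [m] belongs to the linear terms and [g] to the quadratic one. As [al] vanishes at the point, few
    of their derivatives survive there. *)
Let u z : R := (f z)^-1.
Let ka i z : R := \sum_l h z i l * K z 0 l.
Let m i z : R := u z * u z * ka i z.
Let g z : R := u z * u z * u z * \sum_i K z 0 i * ka i z.
Let A i z : R := al z i 0.

Let sA i : smooth_on U (A i). Proof. exact: smooth_entry. Qed.
Let su : smooth_on U u. Proof. exact: smoothV. Qed.
Let ska i : smooth_on U (ka i).
Proof. by apply: smooth_sum => // l. Qed.
Let sm i : smooth_on U (m i).
Proof. by apply: smoothM => //. Qed.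
Let sg : smooth_on U g.
Proof.
apply: smoothM => //.
Qed.
Let shij i j : smooth_on U (fun z => h z i j : R). Proof. done. Qed.

Lemma twistedE z i j : U z -> twisted h al K f z i j =
  u z * h z i j - (A i z * m j z + A j z * m i z) + g z * (A i z * A j z).
Proof.
move=> Uz; have -> : twisted h al K f z = u z *: h z - (u z * u z) *: (al z *m (h z *m (K z)^T)^T)
   - (u z * u z) *: ((h z *m (K z)^T) *m (al z)^T)
   + (u z * u z * u z) *: (al z *m (K z *m (h z *m (K z)^T)) *m (al z)^T).
  rewrite /twisted /twist_map -/(u z).
  have -> : (1%:M - u z *: (al z *m K z))^T = 1%:M - u z *: ((K z)^T *m (al z)^T).
    by rewrite linearB /= trmx1 linearZ /= trmx_mul.
  rewrite trmx_mul trmxK (sym Uz) mulmxBl mul1mx mulmxBr mulmx1 mulmxBl.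
  rewrite -!scalemxAl -!scalemxAr !mulmxA.
  move: (al z *m K z *m h z *m (K z)^T *m (al z)^T) (al z *m K z *m h z) (h z *m (K z)^T *m (al z)^T) => r p q.
  by apply/matrixP => a b; rewrite !mxE; ring.
have kaE a b : (h z *m (K z)^T) a b = ka a z.
  by rewrite mxE; apply: eq_bigr => l _; rewrite mxE ord1.
have E1 : (al z *m (h z *m (K z)^T)^T) i j = A i z * ka j z.
  by rewrite mxE big_ord1 [X in _ * X]mxE kaE.
have E2 : (h z *m (K z)^T *m (al z)^T) i j = ka i z * A j z.
  by rewrite mxE big_ord1 [X in _ * X]mxE kaE.
have E3 : (al z *m (K z *m (h z *m (K z)^T)) *m (al z)^T) i j
   = A i z * (\sum_l K z 0 l * ka l z) * A j z.
  rewrite mxE big_ord1 mxE big_ord1 [(al z)^T 0 j]mxE; congr (_ * _ * _).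
  by rewrite mxE; apply: eq_bigr => l _; rewrite kaE.
have ME (X Y Z T : 'M[R]_d) a b c e : (a *: X - b *: Y - c *: Z + e *: T) i j
   = a * X i j - b * Y i j - c * Z i j + e * T i j by rewrite !mxE.
rewrite ME E1 E2 E3 /m /g.
move: (\sum_l _) (u z) (h z i j) (ka i z) (ka j z) (A i z) (A j z) => s a b c e p q.
by ring.
Qed.

Lemma twisted_smooth : smooth_on U (twisted h al K f).
Proof.
apply/smooth_mxP => // i j; apply: (@smooth_ext _ _ _ _ (fun z =>
  u z * h z i j - (A i z * m j z + A j z * m i z) + g z * (A i z * A j z))) => //.
  by move=> z Uz; rewrite twistedE.
Qed.

Local Notation a i j := (pd i (A j) y).
Let Ay i : A i y = 0. Proof. by rewrite /A al0 mxE. Qed.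

Lemma twisted_jet1 k i j : pd k (fun z => twisted h al K f z i j) y
  = pd k u y * (i == j)%:R - (a k i * m j y + a k j * m i y).
Proof.
have s1 i' j' : smooth_on U (fun z => A i' z * m j' z) by [].
have s2 : smooth_on U (fun z => A i z * A j z) by [].
have s3 : smooth_on U (fun z => g z * (A i z * A j z)) by [].
have s4 : smooth_on U (fun z => u z * h z i j) by [].
have s5 : smooth_on U (fun z => A i z * m j z + A j z * m i z) by [].
rewrite (pd_ext k oU Uy (fun z => @twistedE z i j)) (jet1D Uy k (smoothB oU s4 s5) s3) (jet1B Uy k s4 s5).
rewrite (jet1D Uy k (s1 i j) (s1 j i)) (jet1M Uy k su (shij i j)) (jet1M Uy k (sA i) (sm j)).
rewrite (jet1M Uy k (sA j) (sm i)) (jet1M Uy k sg s2) (jet1M Uy k (sA i) (sA j)) dh h1 !Ay mxE.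
by ring.
Qed.

Lemma twisted_jet2 i j k l : pd l (pd k (fun z => twisted h al K f z i j)) y
  = pd l (pd k u) y * (i == j)%:R + u y * pd l (pd k (fun z => h z i j)) y
   - (pd l (pd k (A i)) y * m j y + a k i * pd l (m j) y + a l i * pd k (m j) y
      + (pd l (pd k (A j)) y * m i y + a k j * pd l (m i) y + a l j * pd k (m i) y))
   + g y * (a k i * a l j + a l i * a k j).
Proof.
have s1 i' j' : smooth_on U (fun z => A i' z * m j' z) by [].
have s2 : smooth_on U (fun z => A i z * A j z) by [].
have s3 : smooth_on U (fun z => g z * (A i z * A j z)) by [].
have s4 : smooth_on U (fun z => u z * h z i j) by [].
have s5 : smooth_on U (fun z => A i z * m j z + A j z * m i z) by [].
transitivity (pd l (pd k (fun z =>
    u z * h z i j - (A i z * m j z + A j z * m i z) + g z * (A i z * A j z))) y).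
  by apply: (pd_ext l oU Uy) => z Uz; apply: (pd_ext k oU Uz) => w Uw; exact: twistedE.
rewrite (jet2D oU Uy k l (smoothB oU s4 s5) s3) (jet2B oU Uy k l s4 s5).
rewrite (jet2D oU Uy k l (s1 i j) (s1 j i)) (jet2M oU Uy k l su (shij i j)).
rewrite (jet2M oU Uy k l (sA i) (sm j)) (jet2M oU Uy k l (sA j) (sm i)) (jet2M oU Uy k l sg s2).
rewrite (jet2M oU Uy k l (sA i) (sA j)) (jet1M Uy k (sA i) (sA j)) (jet1M Uy l (sA i) (sA j)).
rewrite !dh h1 !Ay mxE.
move: (pd l (pd k _) y) (pd l (pd k _) y) (pd l (pd k _) y) (pd l (pd k _) y) => p1 p2 p3 p4.
by ring.
Qed.

Local Notation fd i := (pd i f y).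
Local Notation fdd i j := (pd j (pd i f) y).

Let aas i j : a i j = - a j i. Proof. exact: alas. Qed.

Let exteriorE z i j : exterior al z i j = pd i (A j) z - pd j (A i) z.
Proof. by rewrite mxE. Qed.

Let ext_y i j : exterior al y i j = 2 * a i j.
Proof. by rewrite exteriorE [X in _ - X]aas; ring. Qed.

Let aorth i j : \sum_l a i l * a j l = (i == j)%:R.
Proof.
have := HO Uy; rewrite h1 invmx1 mulmx1 => /matrixP /(_ i j).
have -> : (4 *: 1%:M : 'M[R]_d) i j = 4 * (i == j)%:R by rewrite !mxE.
have -> : (exterior al y *m (exterior al y)^T) i j = 4 * \sum_l a i l * a j l.
  rewrite mxE mulr_sumr; apply: eq_bigr => l _; rewrite [(_^T) _ _]mxE !ext_y.
  by ring.
by move=> E0; apply: (@mulfI _ 4).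
Qed.

Let K_y i : K y 0 i = ka i y.
Proof.
transitivity (\sum_l K y 0 l * (i == l)%:R); first by rewrite sum_delta.
by apply: eq_bigr => l _; rewrite h1 mxE mulrC.
Qed.

Let ka_a j : \sum_i ka i y * a i j = - (fd j / 2).
Proof.
have := HK Uy => /rowP /(_ j); rewrite !mxE => E0.
apply: (@mulfI _ 2); rewrite ?pnatr_eq0// mulrN mulrCA mulfV ?pnatr_eq0// mulr1 -E0 mulr_sumr.
by apply: eq_bigr => i _; rewrite ext_y K_y; ring.
Qed.

Let sext i j : smooth_on U (fun z => exterior al z i j : R).
Proof.
apply: (@smooth_ext _ _ _ _ (fun z => pd i (A j) z - pd j (A i) z)) => //.
Qed.

Let O k i j := pd k (fun z => exterior al z i j) y.

Let OE k i j : O k i j = pd k (pd i (A j)) y - pd k (pd j (A i)) y.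
Proof.
rewrite -(jet1B Uy k (smooth_on_pd i (sA j)) (smooth_on_pd j (sA i))).
by apply: (pd_ext k oU Uy) => z _.
Qed.

(** The cyclic identity demanded by [coclosed] is dd = 0. The orthogonality identity is the
    derivative of [HO] at the point, where the first derivatives of the metric vanish. *)
Let O_coclosed j : \sum_i O i i j = 0.
Proof.
apply: (coclosed aas aorth) => [c i l|c i l|c i l].
- by rewrite !OE opprB.
- rewrite !OE (schwarz i c oU (sA l) Uy) (schwarz i l oU (sA c) Uy) (schwarz l c oU (sA i) Uy).
  by ring.
have smx : smooth_on U (exterior al) by apply/(smooth_mxP _ oU).
have dI : pd c (fun z => invmx (h z)) y = 0.
  rewrite (jet1_invmx oU Uy _ sh hu) (_ : pd c h y = 0) ?mulmx0 ?mul0mx ?oppr0//.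
  by apply/matrixP => p q; rewrite (pd_mx p q (smooth_pd Uy sh)) dh mxE.
have D1 := smooth_pd (i := c) Uy smx; have D2 := smooth_pd (i := c) Uy (smooth_invmx oU hu sh).
have D3 := smooth_pd (i := c) Uy (smooth_trmx oU smx).
have [E1 D4] := pd_mulmx D1 D2; have [E2 _] := pd_mulmx D4 D3.
have : pd c (fun z => exterior al z *m invmx (h z) *m (exterior al z)^T) y = 0.
  rewrite (pd_ext c oU Uy HO); apply/matrixP => p q.
  rewrite (pd_mx p q (smooth_pd Uy (smoothZmx oU (smooth_cst _ _) sh))).
  rewrite (_ : (fun z => _) = fun z => 4 * h z p q); last by apply/funext => z; rewrite mxE.
  by rewrite (jet1M Uy c (smooth_cst _ _) (shij p q)) pd_cst dh mul0r mulr0 addr0 mxE.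
rewrite E2 E1 dI h1 invmx1 mulmx0 addr0 !mulmx1 => /matrixP /(_ i l).
rewrite mxE [X in X + _]mxE [X in _ + X]mxE [RHS]mxE -big_split /= => E0.
apply: (@mulfI _ 2); rewrite ?pnatr_eq0// mulr0 -[RHS]E0 mulr_sumr; apply: eq_bigr => p _.
rewrite (pd_mx i p D1) -/(O c i p) [(exterior al y)^T p l]mxE !ext_y (pd_mx p l D3).
have -> : pd c (fun z => (exterior al z)^T p l) y = O c l p.
  by apply: (pd_ext c oU Uy) => z _; rewrite mxE.
by ring.
Qed.

(** Differentiate the Hamiltonian equation [HK] and take the trace: the terms that contain
    derivatives of the two-form vanish by [O_coclosed]. *)
Let ka_div : \sum_k \sum_i a k i * pd k (ka i) y = (\sum_k fdd k k) / 2.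
Proof.
have kad k i : pd k (ka i) y = pd k (fun z => K z 0 i) y.
  have sKl l : smooth_on U (fun z => K z 0 l : R) by [].
  rewrite (jet1_sum Uy _ k (fun l => smoothM oU (shij i l) (sKl l))).
  transitivity (\sum_l pd k (fun z => K z 0 l) y * (i == l)%:R); last by rewrite sum_delta.
  apply: eq_bigr => l _; rewrite (jet1M Uy k (shij i l) (sKl l)) dh h1 mxE.
  by rewrite mul0r add0r mulrC.
have eqk k : \sum_i (pd k (ka i) y * (2 * a i k) + ka i y * O k i k) = - fdd k k.
  have sKl l : smooth_on U (fun z => K z 0 l : R) by [].
  have <- : pd k (fun z => \sum_i K z 0 i * exterior al z i k) y = - fdd k k.
    rewrite (pd_ext (g := fun z => 0 - pd k f z) k oU Uy).
      by rewrite (jet1B Uy k (smooth_cst _ _) (smooth_on_pd k sf)) pd_cst sub0r.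
    by move=> z Uz; have := HK Uz => /rowP /(_ k); rewrite !mxE sub0r.
  rewrite (jet1_sum Uy _ k (fun l => smoothM oU (sKl l) (sext l k))); apply: eq_bigr => i _.
  by rewrite (jet1M Uy k (sKl i) (sext i k)) -kad ext_y K_y.
have key : \sum_k \sum_i (pd k (ka i) y * (2 * a i k) + ka i y * O k i k) = - \sum_k fdd k k.
  by rewrite -sumrN; apply: eq_bigr => k _.
have Z : \sum_k \sum_i ka i y * O k i k = 0.
  rewrite exchange_big big1// => i _; rewrite -mulr_sumr.
  suff -> : \sum_k O k i k = 0 by rewrite mulr0.
  apply: oppr_inj; rewrite oppr0 -[RHS](O_coclosed i) -sumrN; apply: eq_bigr => k _.
  by rewrite !OE opprB.
have key2 : \sum_k \sum_i pd k (ka i) y * (2 * a i k) = - \sum_k fdd k k.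
  rewrite -key -[LHS]addr0 -[X in _ + X = _]Z -big_split; apply: eq_bigr => k _ /=.
  by rewrite -big_split.
have -> : \sum_k fdd k k = 2 * \sum_k \sum_i a k i * pd k (ka i) y; last by field.
rewrite -[LHS]opprK -key2 -sumrN mulr_sumr; apply: eq_bigr => k _.
rewrite -sumrN mulr_sumr; apply: eq_bigr => i _; rewrite [in RHS]aas.
by ring.
Qed.

Local Notation q := (\sum_i fd i ^+ 2).
Local Notation lap := (\sum_i fdd i i).

Lemma twisted_sym z : U z -> (twisted h al K f z)^T = twisted h al K f z.
Proof.
move=> Uz; apply/matrixP => i j; rewrite mxE !twistedE// -{1}(sym Uz) mxE.
by ring.
Qed.

Hypothesis twu : forall z, U z -> twisted h al K f z \in unitmx.

(** The point formula is applied to both metrics. As [a] is orthogonal and coclosed, every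
    contraction of the 2-jet of the twisted metric reduces to |df|^2, the trace of the second
    derivatives of f and the second order term of [h]. *)
Lemma scalar_curvature_twisted_point : scalar_curvature (twisted h al K f) y
  = f y * scalar_curvature h y + (d%:R + 2) * lap
    - (d%:R + 2) * (d%:R + 4) / 4 * q / f y.
Proof.
have fy := f0 Uy; have uy : u y != 0 by rewrite invr_eq0.
have twy : twisted h al K f y = (u y)%:M.
  apply/matrixP => i j; rewrite twistedE// !Ay h1 !mxE.
  by rewrite !mul0r addr0 subr0 mulr0 addr0 mulr_natr.
rewrite (scalar_curvature_point oU twisted_smooth Uy twisted_sym twu twy uy).
have one1 : (1 : R) != 0 by [].
rewrite (scalar_curvature_point oU sh Uy sym hu h1 one1).
have u1 k : pd k u y = - (u y ^+ 2 * fd k).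
  by rewrite (jet1V Uy k f0 sf) /u exprVn mulrC.
have kak := twist_kk aorth ka_a.
have ak := twist_ak aas ka_a.
have lowE l i j : lower_christoffel (twisted h al K f) y l i j
    = - (u y ^+ 2 / 2) * twist_jet (fun i j => a i j) (fun i => fd i) (fun i => ka i y) l i j.
  rewrite /lower_christoffel !twisted_jet1 !u1 /twist_jet /m.
  rewrite [in a i j]aas [in a i l]aas [in a j l]aas [j == l]eq_sym [i == l]eq_sym.
  by move: (_ == _)%:R (_ == _)%:R (_ == _)%:R => e1 e2 e3; field.
have -> : \sum_i \sum_k \sum_l lower_christoffel (twisted h al K f) y l i k ^+ 2
    = u y ^+ 4 / 4 * ((5 * d%:R + 8) * q).
  rewrite -(twist_jet_sqr aas aorth ka_a) mulr_sumr; apply: eq_bigr => i _.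
  rewrite mulr_sumr; apply: eq_bigr => k _; rewrite mulr_sumr; apply: eq_bigr => l _.
  by rewrite lowE; field.
have -> : \sum_l (\sum_i lower_christoffel (twisted h al K f) y l i i) ^+ 2
    = u y ^+ 4 / 4 * (d%:R ^+ 2 * q).
  rewrite !mulr_sumr; apply: eq_bigr => l _.
  under eq_bigr => i _ do rewrite lowE.
  by rewrite -mulr_sumr (twist_jet_trace aas ka_a); field.
have low0 l i j : lower_christoffel h y l i j = 0.
  by rewrite /lower_christoffel !dh addr0 subr0 mulr0.
have -> : \sum_i \sum_k \sum_l lower_christoffel h y l i k ^+ 2 = 0.
  by do 3![rewrite big1// => ? _]; rewrite low0 expr0n.
have -> : \sum_l (\sum_i lower_christoffel h y l i i) ^+ 2 = 0.
  by rewrite big1// => l _; rewrite big1 ?expr0n// => i _.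
have aii i : a i i = 0 by have := aas i i; lra.
(* Whatever enters antisymmetrised in i and k can be left unspecified as [W], because its double sum
   is zero. *)
have comb (P Q M N V W : 'I_d -> 'I_d -> R) c e : \sum_i \sum_k (P i k * (i == k)%:R + (-1) * P k k + c * Q i k
    + (-2) * M i k + 6 * N i k + e * V i k + (W i k - W k i)) = (1 - d%:R) * (\sum_k P k k)
    + c * (\sum_i \sum_k Q i k) - 2 * (\sum_i \sum_k M i k) + 6 * (\sum_i \sum_k N i k) + e * (\sum_i \sum_k V i k).
  have asy : \sum_i \sum_k W i k + \sum_i \sum_k - W k i = 0.
    rewrite [X in _ + X]exchange_big -big_split big1 // => i _; rewrite -big_split big1 // => k _; exact: subrr.
  under eq_bigr do rewrite !big_split /= -!mulr_sumr sum_delta.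
  rewrite !big_split /= -!mulr_sumr asy sumr_const card_ord -[_ *+ d]mulr_natl.
  by move: (\sum_i P i i) => p; ring.
have [W jet] : exists W, forall i k : 'I_d,
   metric_jet2 (twisted h al K f) y i k i k - metric_jet2 (twisted h al K f) y i i k k
   = pd k (pd i u) y * (i == k)%:R + (-1) * pd k (pd k u) y + u y * (metric_jet2 h y i k i k - metric_jet2 h y i i k k)
     + (-2) * (m k y * O i k i) + 6 * (a k i * pd k (m i) y) + (-3 * g y) * (a k i * a k i) + (W i k - W k i).
  exists (fun i k => 2 * pd k (pd k (A i)) y * m i y - pd k (pd i (A k)) y * m i y - a k i * pd i (m k) y) => i k.
  rewrite /metric_jet2 !twisted_jet2 eqxx mulr1 !aii OE (schwarz i k oU (sA i) Uy) (aas i k).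
  move: (pd k (pd i (A i)) y) (pd k (pd i (A k)) y) (pd k (pd k (A i)) y) (pd i (pd i (A k)) y) => p1 p2 p3 p8.
  move: (pd k (pd i u) y) (pd k (pd k u) y) (pd k (pd i _) y) (pd k (pd k _) y) => p4 p5 p6 p7.
  by ring.
have X1 : \sum_i \sum_k m k y * O i k i = 0.
  rewrite exchange_big big1 // => k _; rewrite -mulr_sumr -[X in _ * X]opprK -sumrN.
  by under eq_bigr do rewrite OE opprB -OE; rewrite O_coclosed oppr0 mulr0.
have X3 : \sum_i \sum_k a k i * pd k (m i) y = - (u y ^+ 3) * q + u y ^+ 2 / 2 * lap.
  transitivity (\sum_k (- (2 * u y ^+ 3) * fd k * \sum_i a k i * ka i y + u y ^+ 2 * \sum_i a k i * pd k (ka i) y)).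
    rewrite exchange_big; apply: eq_bigr => k _; rewrite !mulr_sumr -big_split; apply: eq_bigr => i _ /=.
    rewrite (jet1M Uy k (smoothM oU su su) (ska i)) (jet1M Uy k su su) u1.
    by move: (pd k (ka i) y) => x; ring.
  rewrite big_split /= -mulr_sumr ka_div; congr (_ + _); last by field.
  by rewrite mulr_sumr; apply: eq_bigr => k _; rewrite ak; field.
rewrite (eq_bigr _ (fun i _ => eq_bigr _ (fun k _ => jet i k))).
rewrite (comb (fun i k => pd k (pd i u) y) _ (fun i k => m k y * O i k i) (fun i k => a k i * pd k (m i) y)
  (fun i k => a k i * a k i)) X1 X3.
have -> : \sum_i \sum_k a k i * a k i = d%:R.
  by under eq_bigr do rewrite (orthC aas aorth) eqxx; rewrite sumr_const card_ord.
have -> : \sum_k pd k (pd k u) y = - (u y ^+ 2) * lap + 2 * u y ^+ 3 * q.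
  rewrite !mulr_sumr -big_split; apply: eq_bigr => k _ /=; rewrite (jet2V oU Uy k k f0 sf) /u.
  by move: (pd k (pd k f) y) => x; field.
have -> : g y = u y ^+ 3 * (q / 4).
  rewrite /g -kak; congr (_ * _); first by rewrite !exprS expr0 mulr1 mulrA.
  by apply: eq_bigr => i _; rewrite K_y expr2.
rewrite /u; move: (\sum_i \sum_k _) q lap d%:R (f y) fy => s Q L D x x0.
by field.
Qed.

End Twist.

(** * Orthonormal frames and normal coordinates to second order *)

Section OrthonormalBasis.
Variable R : realType.

Definition positive_form d (h : 'M[R]_d) := forall v : 'rV[R]_d, v != 0 -> 0 < (v *m h *m v^T) 0 0.

(** Induction through the Schur complement [S] of the corner entry, which is again symmetric and
    positive definite. *)
Lemma orthonormal_basis d (h : 'M[R]_d) : h^T = h -> positive_form h ->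
  exists B : 'M[R]_d, B *m h *m B^T = 1%:M.
Proof.
elim: d h => [|d IH] h sym pos; first by exists 1%:M; exact: thinmx0 || (apply/matrixP => -[]).
pose a : R := h 0 0; pose w : 'M[R]_(1, d) := @ursubmx _ 1 d 1 d h.
pose D : 'M[R]_d := @drsubmx _ 1 d 1 d h.
have hE : h = block_mx (a%:M : 'M[R]_1) w w^T D :> 'M[R]_(1 + d).
  have wT : w^T = @dlsubmx _ 1 d 1 d h by rewrite /w trmx_ursub sym.
  rewrite wT -[LHS](@submxK _ 1 d 1 d); congr (@block_mx _ 1 d 1 d _ _ _ _).
  apply/matrixP => i j; rewrite !ord1 !mxE eqxx mulr1n; congr (h _ _); exact: val_inj.
have a0 : 0 < a.
  have := pos (delta_mx 0 0); rewrite -rowE trmx_delta -colE !mxE; apply.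
  by apply/eqP => /rowP /(_ 0); rewrite !mxE !eqxx => /eqP; rewrite oner_eq0.
have DT : D^T = D by rewrite /D trmx_drsub sym.
pose S := D - a^-1 *: (w^T *m w).
have symS : S^T = S by rewrite /S linearB /= linearZ /= trmx_mul trmxK DT.
pose M (B' : 'M[R]_d) : 'M[R]_(d, 1) := - a^-1 *: (B' *m w^T).
have b1 B' : M B' *m (a%:M : 'M[R]_1) + B' *m w^T = 0.
  by rewrite mul_mx_scalar scalerA mulrN divff ?gt_eqF// scaleN1r addNr.
have b2 B' : M B' *m w + B' *m D = B' *m S.
  by rewrite /S mulmxBr -scalemxAl -scalemxAr mulmxA addrC scaleNr.
have posS : positive_form S.
  move=> v v0.
  pose x : 'M[R]_1 := - a^-1 *: (v *m w^T).
  have := pos (row_mx x v : 'rV[R]_(1 + d)).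
  have E : ((row_mx x v : 'rV[R]_(1 + d)) *m h *m (row_mx x v : 'rV[R]_(1 + d))^T) = v *m S *m v^T.
    rewrite hE (@mul_row_block _ 1 1 d 1 d) tr_row_mx (@mul_row_col _ 1 1 d 1).
    have -> : x *m (a%:M : 'M[R]_1) + v *m w^T = 0.
      by rewrite /x mul_mx_scalar scalerA mulrN divff ?gt_eqF// scaleN1r addNr.
    rewrite mul0mx add0r /S mulmxBr /x -scalemxAl scaleNr -scalemxAr mulmxA.
    by rewrite [- _ + _]addrC.
  rewrite E; apply; apply: contra v0 => /eqP /rowP vz; apply/eqP/rowP => j.
  by have := vz (rshift 1 j); rewrite (@row_mxEr _ 1 1 d) !mxE.
have [B' HB] := IH S symS posS.
pose r : R := (Num.sqrt a)^-1.
have ra : r * a * r = 1.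
  have s0 : Num.sqrt a != 0 by rewrite gt_eqF// sqrtr_gt0.
  have s2 : Num.sqrt a * Num.sqrt a = a by rewrite -expr2 sqr_sqrtr// ltW.
  by rewrite /r -{2}s2; field.
exists (block_mx (r%:M : 'M[R]_1) 0 (M B') B' : 'M[R]_(1 + d)).
rewrite hE (@mulmx_block _ 1 d 1 d 1 d) (@tr_block_mx _ 1 d 1 d) (@mulmx_block _ 1 d 1 d 1 d).
rewrite b1 b2 !mul0mx !addr0 !trmx0 !mulmx0 !addr0 !add0r HB.
transitivity (1%:M : 'M[R]_(1 + d)); last by [].
rewrite scalar_mx_block; congr (@block_mx _ 1 d 1 d _ _ _ _).
- by rewrite tr_scalar_mx -!scalar_mxM ra.
- have -> : (M B')^T = - a^-1 *: (w *m B'^T) by rewrite /M linearZ /= trmx_mul trmxK.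
  rewrite -scalemxAr -!mulmxA !mul_scalar_mx !scalerA -scalerDl.
  by rewrite (_ : _ + r = 0) ?scale0r//; field; rewrite gt_eqF.
Qed.

End OrthonormalBasis.

Lemma open_preim (R : realType) (m : nat) (T : topologicalType) (W : set 'rV[R]_m) (A : set T)
    (g : 'rV[R]_m -> T) : open W -> open A -> (forall z, W z -> {for z, continuous g}) ->
  open [set z | W z /\ A (g z)].
Proof.
move=> oW oA cg; rewrite openE => z [Wz Agz]; rewrite /interior.
have := open_nbhs_nbhs (conj oW Wz); have := cg z Wz A (open_nbhs_nbhs (conj oA Agz)).
by move=> h1 h2; near=> x; split; near: x.
Unshelve. all: by end_near.
Qed.

Section Ext.
Variables (R : realType) (d : nat).
Local Notation E := 'rV[R]_d.
Variables (U : set E) (h h' : E -> 'M[R]_d).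
Hypotheses (oU : open U) (hh' : forall y, U y -> h y = h' y).

Lemma christoffel_ext k i j y : U y -> christoffel h k i j y = christoffel h' k i j y.
Proof.
move=> Uy; rewrite !christoffelE hh' //; congr (_ * _); apply: eq_bigr => l _.
by congr (_ * (_ + _ - _)); apply: (pd_ext _ oU) => // z Uz; rewrite hh'.
Qed.

Lemma scalar_curvature_ext y : U y -> scalar_curvature h y = scalar_curvature h' y.
Proof.
move=> Uy; apply: eq_bigr => i _; apply: eq_bigr => j _.
rewrite (hh' Uy); congr (_ * _).
have E1 a k' i' j' : pd a (christoffel h k' i' j') y = pd a (christoffel h' k' i' j') y.
  by apply: (pd_ext _ oU) => // z Uz; apply: christoffel_ext.
have E2 k' i' j' : christoffel h k' i' j' y = christoffel h' k' i' j' y by apply: christoffel_ext.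
rewrite /ricci; move: E1 E2; move: (christoffel h) (christoffel h') => C C'; rewrite pdE => E1 E2.
apply: eq_bigr => k _; rewrite !E1; congr (_ + _); apply: eq_bigr => l _.
by rewrite !E2.
Qed.
End Ext.

Section Quadratic.
Variables (R : realType) (d : nat).
Local Notation E := 'rV[R]_d.
Variables (c : R) (b : 'I_d -> R) (s : 'I_d -> 'I_d -> R).

Definition quadratic (z : E) : R :=
  c + \sum_i z 0 i * b i + 2^-1 * \sum_i \sum_j z 0 i * z 0 j * s i j.

Lemma smooth_linear_sum (a : 'I_d -> R) : smooth_on setT (fun z : E => \sum_i z 0 i * a i).
Proof.
done.
Qed.

Lemma pd_linear_sum (a : 'I_d -> R) l (z : E) : pd l (fun z : E => \sum_i z 0 i * a i) z = a l.
Proof.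
have oT : open [set: E] by exact: openT.
have Tz : [set: E] z by [].
rewrite (jet1_sum Tz) //.
rewrite -[RHS](sum_delta a l); apply: eq_bigr => i _.
rewrite (jet1M Tz) ?pd_cst ?pd_coord //.
by rewrite mulr0 addr0 mulrC eq_sym.
Qed.

Lemma smooth_quadratic : smooth_on setT quadratic.
Proof.
have oT : open [set: E] by exact: openT.
apply: smoothD => //.
Qed.

Lemma quadratic0 : quadratic 0 = c.
Proof.
rewrite /quadratic !big1 ?mulr0 ?addr0 // => i _; last by rewrite mxE mul0r.
by rewrite big1 // => j _; rewrite mxE !mul0r.
Qed.

Hypothesis sym : forall i j, s i j = s j i.

Lemma pd_quadratic l (z : E) : pd l quadratic z = b l + \sum_j z 0 j * s l j.
Proof.
have oT : open [set: E] by exact: openT.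
have sc := @smooth_coord R d [set: E]; have sk := @smooth_cst R d R [set: E].
have Tz : [set: E] z by [].
have sl := smooth_linear_sum.
have s1 i : smooth_on setT (fun z : E => z 0 i * \sum_j z 0 j * s i j) by [].
have s2 : smooth_on setT (fun z : E => \sum_i z 0 i * \sum_j z 0 j * s i j) by [].
have -> : quadratic = fun z : E => (c + \sum_i z 0 i * b i)
    + 2^-1 * \sum_i z 0 i * \sum_j z 0 j * s i j.
  apply/funext => w; rewrite /quadratic; congr (_ + _ * _); apply: eq_bigr => i _.
  by rewrite mulr_sumr; apply: eq_bigr => j _; rewrite mulrA.
rewrite (jet1D Tz) //.
rewrite (jet1D Tz _ (sk _) (sl _)) pd_cst pd_linear_sum add0r.
rewrite (jet1M Tz _ (sk _) s2) pd_cst mul0r add0r.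
rewrite (jet1_sum Tz _ _ s1); congr (_ + _).
have -> : \sum_i pd l (fun z0 : E => z0 0 i * (\sum_j z0 0 j * s i j)) z
  = \sum_i ((\sum_j z 0 j * s i j) * (l == i)%:R + z 0 i * s l i).
  apply: eq_bigr => i _; rewrite (jet1M Tz _ (sc _) (sl _)) pd_coord pd_linear_sum.
  by rewrite (sym l) mulrC eq_sym.
rewrite big_split /= sum_delta; set A := \sum_(_ < _) _.
by field.
Qed.

Lemma pd2_quadratic l m (z : E) : pd m (pd l quadratic) z = s l m.
Proof.
have oT : open [set: E] by exact: openT.
have Tz : [set: E] z by [].
rewrite (pd_ext (g := fun z : E => b l + \sum_j z 0 j * s l j) _ oT) //; last by move=> y _; exact: pd_quadratic.
rewrite (jet1D Tz) ?pd_cst ?pd_linear_sum ?add0r //.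
Qed.
End Quadratic.

Section NormalCoordinates.
Variables (R : realType) (d : nat).
Local Notation E := 'rV[R]_d.
Variables (U : set E) (h : E -> 'M[R]_d) (y0 : E) (B : 'M[R]_d).
Hypotheses (oU : open U) (Uy : U y0) (sh : smooth_on U h).
Hypotheses (sym : forall x, U x -> (h x)^T = h x) (hu : forall x, U x -> h x \in unitmx).
Hypothesis HB : B *m h y0 *m B^T = 1%:M.

(** Minus the Christoffel symbols in the frame [B]: with these second derivatives the inhomogeneous
    term in the transformation law cancels the connection at 0. *)
Definition normal_jet (k i j : 'I_d) : R :=
  - \sum_a \sum_b B i a * B j b * christoffel h k a b y0.
Definition normal_map (z : E) : E :=
  \row_k quadratic (y0 0 k) (fun i => B i k) (normal_jet k) z.
Local Notation phi := normal_map.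

Lemma normal_jet_sym k i j : normal_jet k i j = normal_jet k j i.
Proof.
rewrite /normal_jet; congr (- _); rewrite exchange_big; apply: eq_bigr => a _; apply: eq_bigr => b _.
by rewrite (christoffel_sym _ _ _ oU Uy sym); congr (_ * _); rewrite mulrC.
Qed.

Lemma smooth_normal_map : smooth_on setT phi.
Proof.
apply/smooth_mxP => [|a k]; first exact: openT.
apply: smooth_ext (smooth_quadratic _ _ _); first exact: openT.
by move=> z _; rewrite mxE.
Qed.

Lemma normal_map0 : phi 0 = y0.
Proof. by apply/rowP => k; rewrite mxE quadratic0. Qed.

Lemma jac_normal_map z i k : jac phi z i k = pd i (quadratic (y0 0 k) (fun i => B i k) (normal_jet k)) z.
Proof.
have oT : open [set: E] by exact: openT.
rewrite jac_entry; last exact: (smooth_differentiable_row oT smooth_normal_map).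
by apply: (pd_ext _ oT) => // y _; rewrite mxE.
Qed.

Lemma jac_normal_map0 : jac phi 0 = B.
Proof.
apply/matrixP => i k; rewrite jac_normal_map pd_quadratic; last exact: normal_jet_sym.
by rewrite big1 ?addr0 // => j _; rewrite mxE mul0r.
Qed.

Lemma pd_jac_normal_map j : pd j (jac phi) 0 = - (B *m \sum_b B j b *: connection h b y0).
Proof.
have oT : open [set: E] by exact: openT.
have sJ := smooth_jac oT smooth_normal_map.
apply/matrixP => i k; rewrite pd_mx; last exact: (smooth_derivable (i := j) sJ).
rewrite (pd_ext (g := pd i (quadratic (y0 0 k) (fun i => B i k) (normal_jet k))) _ oT) //.
  rewrite pd2_quadratic /normal_jet; last exact: normal_jet_sym.
  rewrite [RHS]mxE; congr (- _); rewrite mxE; apply: eq_bigr => a _; rewrite summxE mulr_sumr; apply: eq_bigr => b _.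
  by rewrite 2!mxE mulrA.
by move=> z _; rewrite jac_normal_map.
Qed.

Definition normal_dom : set E := [set z | [set z | setT z /\ U (phi z)] z /\ \det (jac phi z) != 0].
Local Notation V := normal_dom.
Local Notation H := (pullback_metric h phi).

Lemma normal_dom_spec : [/\ open V, V 0, smooth_on V phi, (forall z, V z -> U (phi z)) &
  forall z, V z -> jac phi z \in unitmx].
Proof.
have oT : open [set: E] by exact: openT.
have Bu : B \in unitmx.
  have : \det (B *m h y0 *m B^T) != 0 by rewrite HB det1 oner_eq0.
  by rewrite !det_mulmx unitmxE unitfE !mulf_eq0 !negb_or => /andP[/andP[]].
split.
- apply: (open_preim (A := [set x : R | x != 0])).
  + apply: open_preim => // z _; exact: (smooth_cont smooth_normal_map).
  + by [].
  + move=> z _; apply: (smooth_cont (U := setT)) => //.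
    by apply: smooth_det => //; apply: smooth_jac => //; exact: smooth_normal_map.
- by split; rewrite /= ?normal_map0 // jac_normal_map0 -unitfE -unitmxE.
- exact: smooth_subset (@subsetT _ _) smooth_normal_map.
- by move=> z [[]].
- by move=> z [_]; rewrite unitmxE unitfE.
Qed.

Lemma normal_pullback0 : H 0 = 1%:M.
Proof. by rewrite /pullback_metric jac_normal_map0 normal_map0. Qed.

Lemma normal_connection0 j : connection H j 0 = 0.
Proof.
have [oV V0 sphi VU Ju] := normal_dom_spec.
have /= := connection_pullback oU oV sh sphi VU sym hu Ju j V0.
rewrite pd_jac_normal_map /pulled_connection normal_map0 jac_normal_map0 subrr => E0.
have Bu : B \in unitmx by rewrite -jac_normal_map0; exact: Ju.
by rewrite -[LHS](mulmxK Bu) E0 mul0mx.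
Qed.

Lemma normal_metric_jet1 k i j : pd k (fun z => H z i j) 0 = 0.
Proof.
have [oV V0 sphi VU Ju] := normal_dom_spec.
have sH := pullback_smooth oU oV sh sphi VU.
have symH z : V z -> (H z)^T = H z by apply: (pullback_sym VU sym).
have L a b c : lower_christoffel H 0 a b c = 0.
  have : lower_connection H c 0 = 0.
    have := connectionE c (symH 0 V0); rewrite normal_connection0 normal_pullback0 invmx1 mulmx1.
    by [].
  by move=> /matrixP/(_ b a); rewrite !mxE.
by rewrite (metric_derivE oV V0 symH) !L addr0.
Qed.
End NormalCoordinates.

(** * Scalar curvature of an arbitrary local quotient *)

Section QuotientFormula.
Variables (R : realType) (d : nat).
Local Notation E := 'rV[R]_d.

Lemma normal_hessian (H : E -> 'M[R]_d) (f : E -> R) y : H y = 1%:M ->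
  (forall j, connection H j y = 0) ->
  laplacian H f y = \sum_i pd i (pd i f) y /\ gradient_sqr H f y = \sum_i pd i f y ^+ 2.
Proof.
move=> H1 c0; split.
  rewrite /laplacian H1 invmx1 mul1mx; apply: eq_bigr => i _.
  by rewrite mxE c0 big1 ?subr0 // => k _; rewrite mxE mul0r.
rewrite /gradient_sqr H1 invmx1 mulmx1 mxE; apply: eq_bigr => i _.
by rewrite !mxE expr2.
Qed.

Lemma jac_pt (V : set E) (s : E -> R) (x : E -> E) z : open V -> V z ->
  smooth_on V s -> smooth_on V x ->
  jac (fun z => pt (s z) (x z)) z = row_mx (gradient s z) (jac x z).
Proof.
move=> oV Vz ss sx; have spt := smooth_pt oV ss sx.
apply/matrixP => i k; rewrite jac_entry //.
case: (fintype.split_ordP k) => j ->; rewrite ?row_mxEl ?row_mxEr.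
  rewrite ord1 mxE; apply: (pd_ext _ oV) => // w Vw.
  by rewrite row_mxEl mxE eqxx mulr1n.
rewrite jac_entry //.
by apply: (pd_ext _ oV) => // w Vw; rewrite row_mxEr.
Qed.

(** Exterior differentiation commutes with pull-back and kills the gradient, so the contact form may
    be normalised at a point by a gauge term without touching its curvature. *)
Lemma exterior_gauge_pullback (U V : set E) (al : E -> 'cV[R]_d) (phi : E -> E) (psi : E -> R) z :
  open U -> open V -> smooth_on U al -> smooth_on V phi -> smooth_on V psi ->
  (forall z, V z -> U (phi z)) -> V z ->
  exterior (fun z => jac phi z *m al (phi z) + gradient psi z) z
    = jac phi z *m exterior al (phi z) *m (jac phi z)^T.
Proof.
move=> oU oV sal sphi spsi VU Vz; have sJ := smooth_jac oV sphi.
have sa b : smooth_on V (fun z => al (phi z) b 0 : R).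
  by apply: smooth_entry => //; apply: (smooth_comp_mx oV oU VU sal).
have sJb i b : smooth_on V (fun z => jac phi z i b : R) by [].
have E1 i j : pd i (fun w => (jac phi w *m al (phi w) + gradient psi w) j 0 : R) z
  = \sum_b (pd i (jac phi) z j b * al (phi z) b 0
      + jac phi z j b * \sum_a jac phi z i a * pd a (fun w => al w b 0 : R) (phi z))
    + pd i (pd j psi) z.
  rewrite (pd_ext (g := fun w => \sum_b jac phi w j b * al (phi w) b 0 + pd j psi w) _ oV) //; last first.
    by move=> w _; rewrite 3!mxE.
  have sb b : smooth_on V (fun w => jac phi w j b * al (phi w) b 0 : R) by [].
  rewrite (jet1D Vz) //.
  rewrite (jet1_sum Vz) //; congr (_ + _); apply: eq_bigr => b _.
  rewrite (jet1M Vz) // pd_mx //.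
  by rewrite (partial_pull oU oV sphi VU i (F := fun w => al w b 0 : R) (smooth_entry _ _ oU sal) Vz).
apply/matrixP => i j; rewrite mxE !E1 (schwarz i j oV spsi Vz) opprD addrACA subrr addr0.
rewrite !big_split /= opprD addrACA.
have -> : \sum_i0 pd j (jac phi) z i i0 * al (phi z) i0 0 = \sum_i0 pd i (jac phi) z j i0 * al (phi z) i0 0.
  by apply: eq_bigr => b _; rewrite (jacobian_sym oV sphi j i b Vz).
rewrite subrr add0r !mxE.
have -> : \sum_i0 jac phi z i i0 * (\sum_a jac phi z j a * pd a (fun w => al w i0 0) (phi z))
  = \sum_b jac phi z j b * (\sum_a jac phi z i a * pd b (fun w => al w a 0 : R) (phi z)).
  under eq_bigr do rewrite mulr_sumr; rewrite exchange_big; apply: eq_bigr => b _.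
  by rewrite mulr_sumr; apply: eq_bigr => a _; rewrite mulrCA.
rewrite -sumrB; apply: eq_bigr => b _; rewrite -mulrBr -sumrB !mxE mulrC; congr (_ * _).
by apply: eq_bigr => a _; rewrite -mulrBr mxE.
Qed.

Variables (U : set E) (h : E -> 'M[R]_d) (al : E -> 'cV[R]_d) (K : E -> 'rV[R]_d) (f : E -> R).
Hypotheses (oU : open U).
Hypotheses (sh : smooth_on U h) (sal : smooth_on U al) (sK : smooth_on U K) (sf : smooth_on U f).
Hypotheses (sym : forall z, U z -> (h z)^T = h z) (pos : forall z, U z -> positive_form (h z)).
Hypothesis f0 : forall z, U z -> f z != 0.
Hypothesis HK : forall z, U z -> K z *m exterior al z = - (gradient f z)^T.
Hypothesis HO : forall z, U z ->
  exterior al z *m invmx (h z) *m (exterior al z)^T = 4 *: h z.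
Variables (N : set 'rV[R]_(1 + d)) (Q : 'rV[R]_(1 + d) -> E) (hq : E -> 'M[R]_d).
Variables (t0 : R) (y0 : E).
Hypotheses (oN : open N) (N0 : N (pt t0 y0)) (sQ : smooth_on N Q).
Hypothesis NU : forall t y, N (pt t y) -> U y.
Hypothesis HQ : forall t y, N (pt t y) ->
  jac Q (pt t y) *m hq (Q (pt t y)) *m (jac Q (pt t y))^T
  = (f y)^-1 *: (col_mx (- (f y)^-1 *: K y) (twist_map al K f y) *m h y
                 *m (col_mx (- (f y)^-1 *: K y) (twist_map al K f y))^T).

Lemma positive_form_unit (g : 'M[R]_d) : g^T = g -> positive_form g -> g \in unitmx.
Proof.
move=> gs gp; have [B HB] := orthonormal_basis gs gp.
have : \det (B *m g *m B^T) != 0 by rewrite HB det1 oner_eq0.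
by rewrite !det_mulmx unitmxE unitfE !mulf_eq0 !negb_or => /andP[/andP[]].
Qed.

Let Uy : U y0 := NU N0.
Let hu x : U x -> h x \in unitmx.
Proof. by move=> Ux; apply: positive_form_unit; [exact: sym|exact: pos]. Qed.

(** Normal coordinates and a gauge change produce the situation of [scalar_curvature_twisted_point];
    naturality of each term carries the result back to the slice on one side and to the quotient on
    the other. *)
Theorem scalar_curvature_quotient : scalar_curvature hq (Q (pt t0 y0))
  = f y0 * scalar_curvature h y0 + (d%:R + 2) * laplacian h f y0
    - (d%:R + 2) * (d%:R + 4) / 4 * gradient_sqr h f y0 / f y0.
Proof.
have [B HB] := orthonormal_basis (sym Uy) (pos Uy).
set phi := normal_map h y0 B; set V0 := normal_dom U h y0 B.
have [oV0 V00 sphi0 VU0 Ju0] := normal_dom_spec oU Uy sym HB.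
set J := jac phi; pose be z := J z *m al (phi z).
have sJ0 : smooth_on V0 J by apply: smooth_jac.
have sbe0 : smooth_on V0 be.
  by apply: smooth_mulmx => //; apply: (smooth_comp_mx oV0 oU VU0 sal).
(* The slice is deformed to the graph of [psi], which adds the gradient of [psi] to the form. The
   linear part of [psi] cancels the form at 0, and the quadratic part cancels the symmetric part of
   its derivative there. *)
pose S i j : R := - 2^-1 * (pd i (fun z => be z j 0 : R) 0 + pd j (fun z => be z i 0 : R) 0).
have Ssym i j : S i j = S j i by rewrite /S addrC.
pose psi := quadratic t0 (fun j => - be 0 j 0) S.
have spsi W : smooth_on W psi by apply: smooth_subset (smooth_quadratic _ _ _).
pose al' z := be z + gradient psi z.
pose K' z := K (phi z) *m invmx (J z); pose f' z := f (phi z).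
pose H := pullback_metric h phi.
have oT : open [set: E] by exact: openT.
have sgrad W : smooth_on W (gradient psi).
  apply: (smooth_subset (@subsetT _ W)); apply/smooth_mxP => // i j.
  apply: smooth_ext (smooth_on_pd i (spsi setT)) => // z _; by rewrite mxE.
have sK0 : smooth_on V0 K'.
  by apply: smooth_mulmx => //; apply: (smooth_comp_mx oV0 oU VU0 sK).
have sf0 : smooth_on V0 f' by apply: (smooth_comp oV0 oU VU0).
have sal0 : smooth_on V0 al' by apply: smoothDmx.
pose tm := twist_map al' K' f'.
have f'0 z : V0 z -> f' z != 0 by move=> Vz; apply: f0; apply: VU0.
have stm : smooth_on V0 tm.
  by apply: smoothDmx => //; apply: smoothNmx => //; apply: smoothZmx => //; exact: smoothV.
have al'0 : al' 0 = 0.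
  apply/colP => j; rewrite mxE [X in _ + X]mxE [RHS]mxE (pd_quadratic _ _ Ssym) big1 ?addr0 ?addrN // => i _.
  by rewrite mxE mul0r.
pose V1 := [set z | [set z | V0 z /\ N (pt (psi z) (phi z))] z /\ \det (tm z) != 0].
have oV1 : open V1.
  apply: (open_preim (A := [set x : R | x != 0])); last first.
  - move=> z [Vz _]; apply: (smooth_cont (U := V0)) => //; exact: smooth_det.
  - exact: open_neq.
  apply: (open_preim (g := fun z => pt (psi z) (phi z))) => // z Vz.
  by apply: (smooth_cont (U := V0)) => //; apply: smooth_pt.
have phi0 : phi 0 = y0 by exact: normal_map0.
have psi0 : psi 0 = t0 by exact: quadratic0.
have V10 : V1 0.
  split; first by split => //=; rewrite phi0 psi0.
  by rewrite /= /tm /twist_map al'0 mul0mx scaler0 subr0 det1 oner_eq0.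
have V1V0 : V1 `<=` V0 by move=> z [[]].
have V1U z : V1 z -> U (phi z) by move=> /V1V0/VU0.
have V1J z : V1 z -> J z \in unitmx by move=> /V1V0/Ju0.
have sphi : smooth_on V1 phi by apply: smooth_subset sphi0.
(* The deformed slice parametrises the quotient, and [hq] pulls back along [u] to the twisted metric
   of the normalised data. *)
pose u z := Q (pt (psi z) (phi z)).
have spt : smooth_on V1 (fun z => pt (psi z) (phi z)) by apply: smooth_pt.
have su : smooth_on V1 u.
  by apply: (smooth_comp_mx oV1 oN) => // z [[]].
have key z : V1 z -> jac u z *m hq (u z) *m (jac u z)^T = twisted H al' K' f' z.
  move=> Vz; have Nz : N (pt (psi z) (phi z)) by case: Vz => [[]].
  have Ez : jac u z = row_mx (gradient psi z) (J z) *m jac Q (pt (psi z) (phi z)).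
    by rewrite /u jac_comp ?(jac_pt oV1 Vz) //; apply: (smooth_differentiable_row oN).
  have Mz : row_mx (gradient psi z) (J z) *m col_mx (- (f' z)^-1 *: K (phi z)) (twist_map al K f (phi z))
      = tm z *m J z.
    rewrite mul_row_col /tm /twist_map mulmxBr mulmxBl mulmx1 mul1mx -/(f' z).
    have KJ : K' z *m J z = K (phi z) by rewrite /K' mulmxKV ?V1J.
    rewrite -!scalemxAr -scalemxAl -[al' z *m _ *m _]mulmxA KJ /al' mulmxDl /be -[J z *m al _ *m _]mulmxA.
    move: (gradient _ _ *m _) (J z *m (_ *m _)) => A1 A2.
    by rewrite scaleNr scalerDr opprD addrCA [- _ - _]addrC.
  rewrite Ez trmx_mul -mulmxA [hq _ *m _]mulmxA -[_ *m _ *m _]mulmxA [jac Q _ *m (_ *m _)]mulmxA.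
  rewrite [jac Q _ *m _]mulmxA HQ // -scalemxAl -scalemxAr !mulmxA Mz -!mulmxA -trmx_mul Mz.
  by rewrite /twisted /H /pullback_metric trmx_mul !mulmxA.
have H1 : H 0 = 1%:M by exact: (normal_pullback0 oU Uy sym HB).
have sH0 : smooth_on V0 H by apply: (pullback_smooth oU).
have symH z : V0 z -> (H z)^T = H z by apply: (pullback_sym VU0 sym).
have uH z : V0 z -> H z \in unitmx by apply: (pullback_unit VU0 hu Ju0).
have twu z : V1 z -> twisted H al' K' f' z \in unitmx.
  move=> Vz; have Vz0 := V1V0 _ Vz; have tu : tm z \in unitmx by rewrite unitmxE unitfE; case: Vz.
  rewrite /twisted -/(tm z) unitmxZ ?unitfE ?invr_eq0 ?f'0 //.
  by rewrite [_ \in _]unitmx_mul [X in X && _]unitmx_mul unitmx_tr tu uH.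
have Juu z : V1 z -> jac u z \in unitmx.
  move=> Vz; have := twu z Vz; rewrite -key // unitmxE !det_mulmx det_tr unitfE !mulf_eq0 !negb_or.
  by move=> /andP[/andP[]]; rewrite unitmxE unitfE.
have [r [X [r0 VV1 oB sX XF]]] := inverse_function oV1 su V10 (Juu 0 V10).
pose V := ball (0 : E) r; pose Bq := u @` V; rewrite -/Bq in oB sX.
have uX w : Bq w -> V1 (X w) /\ u (X w) = w by move=> [z Vz <-]; rewrite XF //; split=> //; exact: VV1.
have stw0 : smooth_on V1 (twisted H al' K' f').
  apply: twisted_smooth => //; try (by apply: smooth_subset; eassumption).
  - by move=> z /V1V0/symH.
  - by move=> z /V1V0; apply: f'0.
(* The smoothness and symmetry of [hq] are obtained from this expression, through the local inverse
   [X] of [u]. *)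
have hqE w : Bq w -> hq w = invmx (jac u (X w)) *m twisted H al' K' f' (X w) *m (invmx (jac u (X w)))^T.
  move=> /uX[VX uXw]; rewrite -key // uXw !mulmxA mulVmx ?mul1mx ?Juu //.
  by rewrite -mulmxA -trmx_mul mulVmx ?trmx1 ?mulmx1 ?Juu.
have shq : smooth_on Bq hq.
  apply: (smooth_ext oB (f := fun w => invmx (jac u (X w)) *m twisted H al' K' f' (X w)
     *m (invmx (jac u (X w)))^T)) => [w Bw|]; first by rewrite hqE.
  have BV w : Bq w -> V1 (X w) by move=> /uX[].
  have s1 : smooth_on Bq (fun w => invmx (jac u (X w))).
    apply: (smooth_comp_mx oB oV1 BV (f := fun z => invmx (jac u z))) => //.
  by do 2 apply: smooth_mulmx => //; apply: (smooth_comp_mx oB oV1 BV).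
have symtw z : V1 z -> (twisted H al' K' f' z)^T = twisted H al' K' f' z.
  move=> Vz; apply: (twisted_sym (U := V0)) => //; exact: V1V0.
have symq w : Bq w -> (hq w)^T = hq w.
  move=> Bw; rewrite hqE // !trmx_mul trmxK symtw ?mulmxA //; by case: (uX _ Bw).
have uq w : Bq w -> hq w \in unitmx.
  move=> Bw; have [VX _] := uX _ Bw; rewrite hqE // !unitmx_mul unitmx_tr unitmx_inv Juu //.
  by rewrite twu.
have oV : open V by exact: ball_open.
have V_0 : V 0 by exact: ballxx.
have VB z : V z -> Bq (u z) by exists z.
have suV : smooth_on V u by apply: smooth_subset su.
have -> : Q (pt t0 y0) = u 0 by rewrite /u phi0 psi0.
rewrite -(scalar_curvature_pullback oB oV shq suV VB symq uq (fun z Vz => Juu z (VV1 z Vz)) V_0).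
rewrite (scalar_curvature_ext oV (h' := twisted H al' K' f')) //; last by move=> z /VV1; exact: key.
have VV0 : V `<=` V0 by move=> z /VV1/V1V0.
have sV (W : normedModType R) (F : E -> W) : smooth_on V0 F -> smooth_on V F by exact: smooth_subset.
have extE z : V z -> exterior al' z = J z *m exterior al (phi z) *m (J z)^T.
  by move=> /VV0 Vz; exact: (exterior_gauge_pullback oU oV0 sal sphi0 (spsi V0) VU0 Vz).
have HKV z : V z -> K' z *m exterior al' z = - (gradient f' z)^T.
  move=> Vz; have Vz0 := VV0 _ Vz; rewrite extE // /K' !mulmxA mulmxKV ?Ju0 // HK; last exact: VU0.
  by rewrite (gradient_pullback oU oV0 sphi0 VU0 sf Vz0) trmx_mul mulNmx.
have HOV z : V z -> exterior al' z *m invmx (H z) *m (exterior al' z)^T = 4 *: H z.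
  move=> Vz; have Vz0 := VV0 _ Vz; have Jz := Ju0 _ Vz0; have hz := hu (VU0 _ Vz0).
  have iH : invmx (H z) = invmx (J z)^T *m invmx (h (phi z)) *m invmx (J z).
    have : H z *m (invmx (J z)^T *m invmx (h (phi z)) *m invmx (J z)) = 1%:M.
      by rewrite /H /pullback_metric !mulmxA mulmxK ?unitmx_tr // mulmxK // mulmxV.
    by move=> E1; rewrite -[LHS]mulmx1 -E1 mulKmx ?uH.
  rewrite extE // iH !trmx_mul trmxK !mulmxA mulmxK ?unitmx_tr // mulmxKV //.
  have := HO (VU0 _ Vz0); rewrite -/phi -!mulmxA => HO1.
  rewrite [invmx _ *m (_ *m _)]mulmxA [exterior _ _ *m (_ *m _)]mulmxA.
  by rewrite [exterior _ _ *m _]mulmxA -[exterior _ _ *m _ *m _]mulmxA HO1 -scalemxAl -scalemxAr /H /pullback_metric mulmxA.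
have dH k i j : pd k (fun z => H z i j) 0 = 0 by exact: (normal_metric_jet1 oU Uy sh sym hu HB).
have alas i j : pd i (fun z => al' z j 0 : R) 0 = - pd j (fun z => al' z i 0 : R) 0.
  have pal k l : pd k (fun z => al' z l 0 : R) 0 = pd k (fun z => be z l 0 : R) 0 + S l k.
    rewrite (pd_ext (g := fun z => be z l 0 + pd l psi z) _ oV0) //; last by move=> z _; rewrite !mxE.
    by rewrite (jet1D V00) ?(pd2_quadratic _ _ Ssym).
  by rewrite !pal /S; move: (pd i _ _) (pd j _ _) => p q; field.
rewrite (scalar_curvature_twisted_point oV V_0 (sV _ _ sH0) (sV _ _ sal0) (sV _ _ sK0) (sV _ _ sf0)
  (fun z Vz => symH z (VV0 _ Vz)) (fun z Vz => uH z (VV0 _ Vz)) (fun z Vz => f'0 z (VV0 _ Vz))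
  HKV HOV H1 dH al'0 alas (fun z Vz => twu z (VV1 _ Vz))).
have c0 j : connection H j 0 = 0 by exact: (normal_connection0 oU Uy sh sym hu HB).
have [<- <-] := normal_hessian f' H1 c0.
rewrite (scalar_curvature_pullback oU oV0 sh sphi0 VU0 sym hu Ju0 V00).
rewrite (laplacian_pullback oU oV0 sh sphi0 VU0 sym hu Ju0 sf V00).
by rewrite (gradient_sqr_pullback oU oV0 sphi0 VU0 hu Ju0 sf V00) -/phi /f' phi0.
Qed.
End QuotientFormula.

(** * Integration of compactly supported functions *)

Section IntegralLine.
Variable R : realType.
Local Notation mu := (@lebesgue_measure R).
Implicit Types (F G : R -> R) (A : R).

Definition supported1 A F := continuous F /\ forall t, A <= `|t| -> F t = 0.
Local Notation I1 F := (Rintegral mu setT F).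

Lemma supported1_mkcond A F : supported1 A F -> F = F \_ (`[- A, A]%classic).
Proof.
move=> [_ F0]; apply/funext => t; rewrite /patch; case: ifPn => // nt; apply: F0.
move: nt; apply: contraNT; rewrite -ltNge => /ltW; rewrite ler_norml => /andP[h1 h2].
by rewrite inE /= in_itv /= h1 h2.
Qed.

Lemma integrable_segment F (a b : R) : continuous F -> mu.-integrable `[a, b] (EFin \o F).
Proof.
move=> cF; apply: continuous_compact_integrable; first exact: segment_compact.
exact: continuous_subspaceT.
Qed.

Lemma supported1_integrable A F : supported1 A F -> mu.-integrable setT (EFin \o F).
Proof.
move=> sF; rewrite (supported1_mkcond sF) -restrict_EFin -integrable_mkcond //.
by apply: integrable_segment; case: sF.
Qed.

Lemma segment_measure (z r : R) : 0 <= r -> fine (mu `[z - r, z + r]) = 2 * r.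
Proof.
move=> r0; rewrite lebesgue_measure_itv /= lte_fin.
case: ifPn => [_|]; first by rewrite -EFinB /=; ring.
by rewrite -leNgt => h /=; lra.
Qed.

Lemma integral1_upper A F (a z r : R) : 0 <= r -> supported1 A F -> (forall t, F t <= a) ->
  (forall t, r < `|t - z| -> F t = 0) -> I1 F <= a * (2 * r).
Proof.
move=> r0 sF Fa F0; have cF := sF.1.
have -> : F = F \_ (`[z - r, z + r]%classic).
  apply/funext => t; rewrite /patch; case: ifPn => // nt; apply: F0.
  move: nt; apply: contraNT; rewrite -leNgt ler_distl => /andP[h1 h2].
  by rewrite inE /= in_itv /= h1 h2.
rewrite -Rintegral_mkcond -(segment_measure z r0) -Rintegral_cst //.
apply: le_Rintegral => //; first exact: integrable_segment.
by apply: integrable_segment => t; exact: cst_continuous.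
Qed.

Lemma integral1_lower A F (a z r : R) : 0 <= r -> supported1 A F -> (forall t, 0 <= F t) ->
  (forall t, `|t - z| <= r -> a <= F t) -> a * (2 * r) <= I1 F.
Proof.
move=> r0 sF F0 Fa; have cF := sF.1.
rewrite -(segment_measure z r0) -Rintegral_cst //.
apply: (@le_trans _ _ (\int[mu]_(x in `[z - r, z + r]) F x)).
  apply: le_Rintegral => //; last first.
  - by move=> t /=; rewrite in_itv /= => /andP[h1 h2]; apply: Fa; rewrite ler_distl h1.
  - exact: integrable_segment.
  by apply: integrable_segment => t; exact: cst_continuous.
rewrite Rintegral_mkcond; apply: le_Rintegral => //; last 2 first.
- exact: supported1_integrable sF.
- by move=> t _; rewrite /patch; case: ifP.
rewrite -restrict_EFin -integrable_mkcond //; exact: integrable_segment.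
Qed.

Lemma integral1_lin A F G (c : R) : supported1 A F -> supported1 A G ->
  I1 (fun t => F t + c * G t) = I1 F + c * I1 G.
Proof.
move=> sF sG; have iG := supported1_integrable sG.
have scG : supported1 A (fun t => c * G t).
  split => [t|t At]; last by rewrite sG.2 ?mulr0.
  by apply: cvgM; [exact: cst_continuous|exact: sG.1].
rewrite RintegralD // ?RintegralZl //; [exact: supported1_integrable sF|exact: supported1_integrable scG].
Qed.

Lemma integral1_derive A F (dF : R -> R) : 0 < A -> supported1 A F -> continuous dF ->
  (forall t, A <= `|t| -> dF t = 0) -> (forall t, is_derive (t : R) (1 : R) F (dF t)) -> I1 dF = 0.
Proof.
move=> A0 [cF F0] cdF dF0 FdF; rewrite (@supported1_mkcond A dF) // -Rintegral_mkcond /Rintegral.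
have dR t : derivable F t 1 by [].
rewrite (@continuous_FTC2 _ dF F) //=; last 4 first.
- lra.
- exact: continuous_subspaceT.
- split => //.
  + by apply: cvg_at_right_filter; exact: cF.
  + by apply: cvg_at_left_filter; exact: cF.
- by move=> t _; rewrite derive1E; apply: derive_val.
by rewrite !F0 ?subrr // ?normrN ger0_norm // ltW.
Qed.
End IntegralLine.

Section CompactlySupported.
Variable R : realType.

Definition supported m A (f : 'rV[R]_m -> R) := continuous f /\ forall x, A <= `|x| -> f x = 0.

Lemma supported_linear m A (f g : 'rV[R]_m -> R) c : supported A f -> supported A g ->
  supported A (fun x => f x + c * g x).
Proof.
move=> [cf f0] [cg g0]; split=> [x|x Ax]; last by rewrite f0 // g0 // mulr0 addr0.
exact: (continuousD (cf x) (continuousM (@cst_continuous _ _ c x) (cg x))).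
Qed.

Lemma closed_ball_norm_compact m (A : R) : compact [set x : 'rV[R]_m | `|x| <= A].
Proof.
apply: bounded_closed_compact.
  by exists A; split; [exact: num_real|move=> B AB x /= xA; rewrite (le_trans xA) // ltW].
rewrite (_ : [set x | _] = Num.norm @^-1` [set t : R | t <= A]) //.
apply: preimage_closed => [x _|] //.
exact: norm_continuous.
Qed.

(** For properties that are monotone in a constant: local constants over a compact set are replaced
    by one, together with one set of parameters from [F] that works for all its points. *)
Lemma compact_uniform_near (T : topologicalType) (J : Type) (F : set_system J) (K : set T)
    (P : R -> J -> T -> Prop) : ProperFilter F -> compact K ->
  (forall c c' i x, P c i x -> c <= c' -> P c' i x) ->
  (forall x, K x -> exists C, \near x & F, P C F x) ->
  exists C, 0 < C /\ \near F, forall x, K x -> P C F x.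
Proof.
move=> FF /compact_near_coveringP cK mono loc.
(* The constant is treated as one more parameter, tending to infinity, so that compactness is used
   only once. *)
have := cK _ (filter_prod (+oo%R : set_system R) F) (fun ci x => P ci.1 ci.2 x) _.
case=> [x Kx|[A B] /= [Aoo FB] AB].
  have [C [[V B] /= [Vx FB] VB]] := loc x Kx.
  exists (V, [set c : R | C <= c] `*` B) => /=.
    split => //; exists ([set c | C <= c], B) => //=; split => //; exists C; split; [exact: num_real|by move=> c /ltW].
  by move=> [x' [c i]] /= [Vx' [Cc Bi]]; apply: mono (VB (x', i) (conj Vx' Bi)) Cc.
have [c [Ac c0]] : exists c, A c /\ 0 < c.
  have [M [_ HM]] := Aoo; exists (Num.max M 0 + 1); split; [apply: HM|].
    by rewrite (le_lt_trans (_ : M <= Num.max M 0)) ?le_max ?lexx // ltrDl.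
  by rewrite ltr_wpDl // le_max lexx orbT.
exists c; split => //; apply: filterS FB => i Bi x Kx; exact: (AB (c, i) (conj Ac Bi)).
Qed.

Lemma compact_uniform (T : topologicalType) (K : set T) (P : R -> T -> Prop) : compact K ->
  (forall c c' x, P c x -> c <= c' -> P c' x) ->
  (forall x, K x -> exists C, \forall x' \near x, P C x') ->
  exists C, 0 < C /\ forall x, K x -> P C x.
Proof.
move=> cK mono loc.
have [||C [C0 HC]] := @compact_uniform_near _ unit (globally setT) K (fun c _ => P c)
   (@globally_properfilter _ setT tt Logic.I) cK.
- by move=> c c' _; exact: mono.
- move=> x /loc[C HC]; exists C; exists ([set y | P C y], setT) => //=; by move=> [y i] [].
by exists C; split => // x; exact: (HC tt Logic.I x).
Qed.

Lemma supported_uniform m A (f : 'rV[R]_m -> R) : supported A f -> forall e, 0 < e ->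
  exists2 d, 0 < d & forall x y, `|x - y| < d -> `|f x - f y| <= e.
Proof.
move=> [cf f0] e e0.
have [|c c' x [c0 H] cc'|x _|C [C0 HC]] := @compact_uniform _ [set x : 'rV[R]_m | `|x| <= A + 1]
    (fun C x => 0 < C /\ forall y, `|x - y| < C^-1 -> `|f x - f y| <= e).
- exact: closed_ball_norm_compact.
- have c'0 := lt_le_trans c0 cc'; split => // y xy; apply: H; apply: lt_le_trans xy _.
  by rewrite lef_pV2.
- have /cvgrPdist_lt/(_ (e / 2)) := cf x.
  rewrite divr_gt0 // => /(_ isT)/nbhs_ballP[r /= r0 Hr].
  exists (2 / r); apply/nbhs_ballP; exists (r / 2) => /=; first by rewrite divr_gt0.
  move=> x' xx'; split => [|y]; first by rewrite divr_gt0.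
  rewrite invf_div => x'y.
  have h1 : `|f x - f x'| < e / 2.
    by apply: Hr; apply: le_ball xx'; rewrite ler_pdivrMr // ler_peMr ?ler1n // ltW.
  have h2 : `|f x - f y| < e / 2.
    apply: Hr; rewrite (splitr r); apply: ball_triangle xx' _.
    by rewrite -ball_normE.
  exact: dist_le_of_close h1 h2.
(* The bound 1 matters when [x] lies outside the ball of radius A + 1: then [y] is outside the
   support too. *)
exists (Num.min C^-1 1); first by rewrite lt_min invr_gt0 C0 ltr01.
move=> x y; rewrite lt_min => /andP[h1 h2].
have [xA|xA] := lerP `|x| (A + 1); first exact: (HC x xA).2.
rewrite !f0 ?subrr ?normr0 ?ltW //; last by rewrite (le_lt_trans _ xA) // lerDl.
have := ler_normD (x - y) y; rewrite subrK => h3; lra.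
Qed.
End CompactlySupported.

Section IteratedIntegral.
Variable R : realType.
Local Notation mu := (@lebesgue_measure R).
Local Notation I1 F := (Rintegral mu setT F).
Local Notation I f := (iterated_integral f).

Definition slice m (f : 'rV[R]_(1 + m) -> R) (t : R) : 'rV[R]_m -> R := fun v => f (pt t v).

Lemma iterated_integralS m (f : 'rV[R]_(1 + m) -> R) :
  iterated_integral (m := m.+1) f = I1 (fun t => I (slice f t)).
Proof. by []. Qed.

Lemma norm_pt_geR m (s : R) (x : 'rV[R]_m) : `|s| <= `|pt s x|.
Proof.
by have := coord_le_norm (pt s x) 0 (lshift m (0 : 'I_1)); rewrite row_mxEl mxE eqxx mulr1n.
Qed.

Lemma norm_pt_ge m (s : R) (x : 'rV[R]_m) : `|x| <= `|pt s x|.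
Proof.
apply: norm_le_coord => // i j; have := coord_le_norm (pt s x) i (rshift 1 j).
by rewrite row_mxEr.
Qed.

Lemma pt_surj m (z : 'rV[R]_(1 + m)) : exists s x, z = pt s x.
Proof.
by exists (lsubmx z 0 0), (rsubmx z); rewrite -mx11_scalar hsubmxK.
Qed.

Lemma continuous_slice m (f : 'rV[R]_(1 + m) -> R) t : continuous f -> continuous (slice f t).
Proof.
move=> cf v; apply: (@continuous_comp _ _ _ (fun v => pt t v) f); last exact: cf.
by apply: (smooth_cont (U := setT)) => //; apply: smooth_pt; [exact: openT|exact: smooth_cst|exact: smooth_id openT].
Qed.

Lemma supported_slice m A (f : 'rV[R]_(1 + m) -> R) t : supported A f -> supported A (slice f t).
Proof.
move=> [cf f0]; split=> x Ax; first exact: continuous_slice.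
by apply: f0; apply: le_trans Ax (norm_pt_ge _ _).
Qed.

Lemma iterated_integral_eq0 m (f : 'rV[R]_m -> R) : (forall x, f x = 0) -> I f = 0.
Proof.
elim: m f => [|m IH] f f0; first exact: f0.
rewrite iterated_integralS (_ : (fun t => _) = fun=> 0) ?Rintegral_cst ?mul0r //.
by apply/funext => t; apply: IH => v; apply: f0.
Qed.

Lemma iterated_integral_ge0 m (f : 'rV[R]_m -> R) : (forall x, 0 <= f x) -> 0 <= I f.
Proof.
elim: m f => [|m IH] f f0; first exact: f0.
by rewrite iterated_integralS; apply: Rintegral_ge0 => t _; apply: IH => v; apply: f0.
Qed.

Let linear_at m := forall A (f g : 'rV[R]_m -> R) c, supported A f -> supported A g ->
  I (fun x => f x + c * g x) = I f + c * I g.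
Let bounded_at m := forall A (f : 'rV[R]_m -> R) e, 0 < A -> supported A f -> 0 <= e ->
  (forall x, `|f x| <= e) -> `|I f| <= e * (2 * A) ^+ m.

Let slice_supported m A (f : 'rV[R]_(1 + m) -> R) : linear_at m -> bounded_at m -> 0 < A ->
  supported A f -> supported1 A (fun t => I (slice f t)).
Proof.
move=> lin bnd A0 sf; split => [t|t At]; last first.
  apply: iterated_integral_eq0 => v; apply: sf.2; exact: le_trans At (norm_pt_geR _ _).
apply/cvgrPdist_le => e e0; have A20 : 0 < (2 * A) ^+ m by rewrite exprn_gt0 // mulr_gt0.
have [d d0 Hd] := supported_uniform sf (divr_gt0 e0 A20).
exists d => //= s /= ts.
have -> : I (slice f t) - I (slice f s) = I (fun v => slice f t v + (-1) * slice f s v).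
  by rewrite (lin A) ?mulN1r //; exact: supported_slice.
have sd : supported A (fun v => slice f t v + (-1) * slice f s v).
  exact: supported_linear (supported_slice _ sf) (supported_slice _ sf).
have := bnd A _ (e / (2 * A) ^+ m) A0 sd; rewrite mulfVK ?gt_eqF //; apply; first by rewrite ltW ?divr_gt0.
by move=> v; rewrite mulN1r; apply: Hd; rewrite ptB subrr norm_pt_lt // normr0.
Qed.

(** The two properties need a joint induction: in dimension m they give the continuity of the
    integral over slices, hence its integrability, on which both rest in dimension m + 1. *)
Let linear_and_bounded m : linear_at m /\ bounded_at m.
Proof.
elim: m => [|m [lin bnd]].
  by split=> [A f g c _ _|A f e _ _ _ fe] //; rewrite expr0 mulr1; exact: fe.
have lS : linear_at m.+1.
  move=> A f g c sf sg; pose B := Num.max A 1.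
  (* The radius [A] may be negative here, while the continuity of the slice integrals needs a
     positive one. *)
  have up h : supported A h -> supported B h.
    by move=> [ch h0]; split => // x; rewrite ge_max => /andP[/h0].
  have B0 : 0 < B by rewrite lt_max ltr01 orbT.
  rewrite !iterated_integralS -(integral1_lin (A := B)); last 2 first.
  - exact: (slice_supported lin bnd B0 (up _ _ sf)).
  - exact: (slice_supported lin bnd B0 (up _ _ sg)).
  apply: eq_Rintegral => t _; apply: lin; [exact: supported_slice (t) sf|exact: supported_slice (t) sg].
split => // A f e A0 sf e0 fe; rewrite iterated_integralS.
have A20 : 0 <= (2 * A) ^+ m by rewrite exprn_ge0 // mulr_ge0 // ltW.
have sF := slice_supported lin bnd A0 sf.
have Fe t : `|I (slice f t)| <= e * (2 * A) ^+ m.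
  by apply: (bnd A) => //; [exact: supported_slice|move=> v; exact: fe].
have out t : A < `|t - 0| -> I (slice f t) = 0 by rewrite subr0 => /ltW; exact: sF.2.
rewrite exprSr mulrA ler_norml; apply/andP; split; last first.
  by apply: (integral1_upper (z := 0)) sF _ out; rewrite ?ltW // => t; exact: le_trans (ler_norm _) (Fe t).
rewrite lerNl; have -> : - I1 (fun t => I (slice f t)) = I1 (fun t => 0 + -1 * I (slice f t)).
  rewrite (integral1_lin (A := A)) ?Rintegral_cst ?mul0r ?add0r ?mulN1r //.
  by split => // t; exact: cst_continuous.
apply: (integral1_upper (A := A) (z := 0)); rewrite ?ltW //.
- split=> [t|t At]; last by rewrite sF.2 // mulr0 addr0.
  by apply: cvgD; [exact: cst_continuous|apply: cvgM; [exact: cst_continuous|exact: sF.1]].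
- by move=> t; rewrite add0r mulN1r; apply: le_trans (Fe t); rewrite -normrN ler_norm.
- by move=> t h; rewrite out // mulr0 addr0.
Qed.

Lemma iterated_integral_linear m A (f g : 'rV[R]_m -> R) c : supported A f -> supported A g ->
  I (fun x => f x + c * g x) = I f + c * I g.
Proof. exact: (linear_and_bounded m).1. Qed.

Lemma iterated_integral_bound m A (f : 'rV[R]_m -> R) e : 0 < A -> supported A f -> 0 <= e ->
  (forall x, `|f x| <= e) -> `|I f| <= e * (2 * A) ^+ m.
Proof. exact: (linear_and_bounded m).2. Qed.

Lemma supported1_slice m A (f : 'rV[R]_(1 + m) -> R) : 0 < A -> supported A f ->
  supported1 A (fun t => I (slice f t)).
Proof. by case: (linear_and_bounded m) => *; exact: slice_supported. Qed.

Lemma iterated_integral_mono m A (f g : 'rV[R]_m -> R) : supported A f -> supported A g ->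
  (forall x, f x <= g x) -> I f <= I g.
Proof.
move=> sf sg fg; rewrite -subr_ge0.
have -> : I g - I f = I (fun x => g x + -1 * f x) by rewrite (iterated_integral_linear _ sg sf) mulN1r.
by apply: iterated_integral_ge0 => x; rewrite mulN1r subr_ge0.
Qed.

Lemma iterated_integral_lower m A (f : 'rV[R]_m -> R) (a r : R) z : 0 < A -> supported A f ->
  0 <= r -> (forall x, 0 <= f x) -> (forall x, `|x - z| <= r -> a <= f x) ->
  a * (2 * r) ^+ m <= I f.
Proof.
move=> A0; elim: m f z => [|m IH] f z sf r0 f0 fa.
  by rewrite expr0 mulr1; apply: fa; rewrite (_ : _ - z = 0) ?normr0 //; apply/rowP => -[].
rewrite iterated_integralS exprSr mulrA.
have [s0 [z2 zE]] := pt_surj (z : 'rV[R]_(1 + m)); subst z.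
apply: (integral1_lower (z := s0) r0 (supported1_slice A0 sf)).
  by move=> t; apply: iterated_integral_ge0 => v; exact: f0.
move=> t rt; apply: (IH _ z2) => //; [exact: supported_slice|by move=> v; exact: f0|].
by move=> v rv; apply: fa; rewrite ptB norm_pt_le.
Qed.

Section ParameterDerivative.
Variables (m : nat) (T : set R) (G : 'rV[R]_(1 + m) -> R) (A : R).
Local Notation o := (lshift m (0 : 'I_1)).
Local Notation S := [set z : 'rV[R]_(1 + m) | T (z 0 o)].
Hypotheses (oT : open T) (A0 : 0 < A) (sG : smooth_on S G).
Hypothesis G0 : forall s x, T s -> A <= `|x| -> G (pt s x) = 0.

Lemma open_parameter_strip : open S.
Proof. by apply: open_comp oT => z _; exact: coord_continuous. Qed.

(** Differentiation under the integral sign. The time derivative is uniformly continuous near the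
    compact slice, so the remainder of the difference quotient is uniformly small on the support. *)
Lemma iterated_integral_parameter s : T s ->
  is_derive s (1 : R) (fun s => I (fun x => G (pt s x))) (I (fun x => pd o G (pt s x))).
Proof.
move=> Ts; pose H := pd o G; have sH : smooth_on S H by exact: smooth_on_pd.
have Spt u x : T u -> S (pt u x) by rewrite /= row_mxEl mxE eqxx.
have cpt (K : 'rV[R]_(1 + m) -> R) u : T u -> smooth_on S K -> continuous (fun x => K (pt u x)).
  move=> Tu sK x; have sc : smooth_on setT (fun x : 'rV[R]_m => pt u x).
    by apply: (smooth_pt openT); [exact: smooth_cst|exact: smooth_id openT].
  apply: (smooth_cont (U := setT)) => //.
  exact: (smooth_comp openT open_parameter_strip (fun x _ => Spt u x Tu) sK sc).
have sg u : T u -> supported A (fun x => G (pt u x)).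
  by move=> Tu; split; [exact: cpt|move=> x; exact: G0].
have [d d0 hd] : exists2 d, 0 < d & forall h : R, `|h| < d -> T (s + h).
  have /nbhs_ballP[d /= d0 hd] := open_nbhs_nbhs (conj oT Ts); exists d => // h hh; apply: hd.
  by rewrite -ball_normE /= opprD addrA subrr sub0r normrN.
(* At such [x] the function vanishes for all nearby times, and the derivative is along time only, so
   the closed condition is enough. *)
have H0 x : A <= `|x| -> H (pt s x) = 0.
  move=> hx; rewrite /H -pdE /partial delta_lshift.
  have [] := @line_derive R _ R G (pt s x) (pt 1 0) 0; rewrite scale0r addr0 => <- _.
  have [] : is_derive (0 : R) (1 : R) (fun t : R => G (pt s x + t *: pt 1 0)) 0; last by move=> _ ->.
  apply: is_derive_of_bound => e e0; exists d => // h hh.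
  rewrite add0r mulr0 subr0 [h *: _]mulr1 !ptZ !ptD !mulr1 !scaler0 !addr0.
  by rewrite !G0 // ?subrr ?normr0 ?mulr_ge0 // ?ltW //; exact: hd.
apply: is_derive_of_bound => e e0; pose e' := e / (2 * A) ^+ m.
have A2 : 0 < (2 * A) ^+ m by rewrite exprn_gt0 // mulr_gt0.
have e'0 : 0 < e' by rewrite divr_gt0.
have [C [C0 HC]] : exists C, 0 < C /\ forall x : 'rV[R]_m, `|x| <= A ->
    forall t : R, `|t| * C < 1 -> `|H (pt (s + t) x) - H (pt s x)| <= e'.
  apply: (compact_uniform (P := fun C x => forall t : R, `|t| * C < 1 -> `|H (pt (s + t) x) - H (pt s x)| <= e')).
  - exact: closed_ball_norm_compact.
  - by move=> c c' x h cc' t tc; apply: h; apply: le_lt_trans tc; exact: ler_wpM2l.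
  move=> x _; have /cvgrPdist_lt /(_ (e' / 2)) := smooth_cont sH (Spt _ x Ts).
  rewrite divr_gt0 // => /(_ isT) /nbhs_ballP[r /= r0 Hr].
  exists r^-1; apply/nbhs_ballP; exists r => //= x'.
  rewrite -ball_normE /= => xx' t; rewrite ltr_pdivrMr // mul1r => tr.
  have h1 : `|H (pt s x) - H (pt (s + t) x')| < e' / 2.
    by apply: Hr; rewrite -ball_normE /= ptB; apply: norm_pt_lt => //; rewrite opprD addrA subrr sub0r normrN.
  have h2 : `|H (pt s x) - H (pt s x')| < e' / 2.
    by apply: Hr; rewrite -ball_normE /= ptB; apply: norm_pt_lt => //; rewrite subrr normr0.
  exact: dist_le_of_close h1 h2.
exists (Num.min d C^-1) => [|h]; first by rewrite lt_min d0 invr_gt0.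
rewrite lt_min [h *: _]mulr1 => /andP[hd' hC].
have hC' : `|h| * C < 1 by rewrite -ltr_pdivlMr // div1r.
have sH' : supported A (fun x => H (pt s x)) by split; [exact: cpt|exact: H0].
have s1 := supported_linear (-1) (sg _ (hd h hd')) (sg _ Ts).
have -> : I (fun x => G (pt (s + h) x)) - I (fun x => G (pt s x)) - h * I (fun x => H (pt s x))
    = I (fun x => G (pt (s + h) x) + -1 * G (pt s x) + - h * H (pt s x)).
  by rewrite (iterated_integral_linear _ s1 sH') (iterated_integral_linear _ (sg _ (hd h hd')) (sg _ Ts)) mulN1r mulNr.
have -> : e * `|h| = e' * `|h| * (2 * A) ^+ m by rewrite mulrAC divfK // gt_eqF.
apply: iterated_integral_bound => //; [exact: supported_linear|by rewrite mulr_ge0 // ltW|].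
move=> x; have [xA|xA] := leP `|x| A; last first.
  rewrite (G0 (hd h hd') (ltW xA)) (G0 Ts (ltW xA)) (H0 x (ltW xA)) !mulr0 !addr0 normr0.
  by rewrite mulr_ge0 // ltW.
have [|t th] := @line_MVT_pd R (1 + m) G (pt s x) o h.
  move=> t th; rewrite pt_shift_time; apply: smooth_derivable sG _.
  by apply/Spt/hd; exact: le_lt_trans th hd'.
rewrite !pt_shift_time mulN1r => ->; rewrite mulNr -mulrBr normrM mulrC ler_wpM2r //.
by apply: HC => //; apply: le_lt_trans hC'; rewrite ler_wpM2r // ltW.
Qed.
End ParameterDerivative.

(** A derivative in a later variable is integrated slice by slice, by induction. A derivative in the
    first variable is that of the slice integral, to which the fundamental theorem of calculus
    applies. *)
Lemma iterated_integral_pd m A (f : 'rV[R]_m -> R) i : 0 < A -> smooth_on setT f ->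
  (forall x, A <= `|x| -> f x = 0) -> I (pd i f) = 0.
Proof.
move=> A0; elim: m f i => [|m IH] f i sf f0; first by case: i.
have oT k : open [set: 'rV[R]_k] by exact: openT.
have cf : continuous f by move=> x; exact: (smooth_cont sf).
(* The radius grows because a partial derivative vanishes only where [f] does on a whole
   neighbourhood. *)
have spf j : supported (A + 1) (pd j f).
  split=> x Ax; first exact: (smooth_cont (smooth_on_pd j sf)).
  rewrite (pd_ext (U := [set y | A < `|y|]) (g := fun=> 0)) ?pd_cst //.
  - rewrite (_ : [set y | _] = Num.norm @^-1` [set t : R | A < t]) //.
    by apply: open_comp; [move=> ? _; exact: norm_continuous|exact: open_gt].
  - by rewrite /=; apply: lt_le_trans Ax; rewrite ltrDl.
  - by move=> y /ltW/f0.
have A10 : 0 < A + 1 by rewrite addr_gt0.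
have sS t : smooth_on setT (slice f t).
  apply: (smooth_comp (oT m) (oT (1 + m)) _ sf) => //.
  by apply: smooth_pt => //.
rewrite iterated_integralS; case: (fintype.split_ordP (i : 'I_(1 + m))) => j ->; last first.
  rewrite (_ : (fun t => _) = fun=> 0) ?Rintegral_cst ?mul0r //.
  apply/funext => t; rewrite -[RHS](IH (slice f t) j (sS t)); last first.
    by move=> x Ax; apply: f0; apply: le_trans Ax (norm_pt_ge _ _).
  congr iterated_integral; apply/funext => v.
  have := pd_graph j (oT _) (oT _) sf (smooth_cst setT t) (y := v) Logic.I Logic.I.
  by rewrite pd_cst mulr0 add0r => ->.
rewrite ord1; apply: (integral1_derive A10 (F := fun t => I (slice f t))).
- apply: supported1_slice => //; split => // x Ax; apply: f0; apply: le_trans Ax; by rewrite lerDl.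
- by have [] := supported1_slice A10 (spf (lshift m (0 : 'I_1))).
- by have [_ h t At] := supported1_slice A10 (spf (lshift m (0 : 'I_1))); apply: h.
move=> t; apply: (iterated_integral_parameter (T := setT) openT A0 sf) => // s x _ Ax; apply: f0.
exact: le_trans Ax (norm_pt_ge _ _).
Qed.
End IteratedIntegral.

Section Comparison.
Variables (R : realType) (m : nat).
Local Notation E := 'rV[R]_m.
Local Notation I f := (iterated_integral f).

Lemma iterated_integral_sum (J : finType) A (f : J -> E -> R) : (forall j, supported A (f j)) ->
  I (fun x => \sum_j f j x) = \sum_j I (f j) /\ supported A (fun x => \sum_j f j x).
Proof.
move=> sf; elim: (index_enum J) => [|j s [IH1 IH2]].
  rewrite big_nil; have E0 : (fun x : E => \sum_(j <- [::]) f j x) = fun=> 0.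
    by apply/funext => x; rewrite big_nil.
  rewrite E0 iterated_integral_eq0 //; split=> //; split=> // x; exact: cst_continuous.
have E1 : (fun x : E => \sum_(i <- j :: s) f i x) = fun x => f j x + 1 * \sum_(i <- s) f i x.
  by apply/funext => x; rewrite big_cons mul1r.
rewrite E1 (iterated_integral_linear _ (sf j) IH2) big_cons mul1r IH1; split=> //.
exact: supported_linear.
Qed.

End Comparison.

(** * Gluing of smooth functions, bump functions *)

Section SmoothGluing.
Variables (R : realType) (m : nat).
Local Notation E := 'rV[R]_m.

Lemma smooth_local (W : normedModType R) (V : set E) (f : E -> W) :
  (forall x, V x -> exists U, [/\ open U, U x & smooth_on U f]) -> smooth_on V f.
Proof.
move=> loc k; have {}loc x : V x -> exists U, [/\ open U, U x & Ck_on k U f].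
  by move=> /loc[U [oU Ux /(_ k) Uf]]; exists U.
elim: k f loc => [|k IH] f loc.
  by split=> // x Vx; have [U [oU Ux [cf _]]] := loc x Vx; exact: cf.
split=> [x Vx|i]; first by have [U [oU Ux [cf _]]] := loc x Vx; exact: cf.
split=> [x Vx|]; first by have [U [oU Ux [_ /(_ i)[df _]]]] := loc x Vx; exact: df.
apply: IH => x Vx; have [U [oU Ux [_ /(_ i)[_ df]]]] := loc x Vx; by exists U.
Qed.

Lemma smooth_zero_extension (U K : set E) (f : E -> R) : open U -> closed K -> K `<=` U ->
  smooth_on U f -> (forall x, ~ K x -> f x = 0) -> smooth_on setT f.
Proof.
move=> oU cK KU sf f0; apply: smooth_local => x _.
have [Kx|nKx] := pselect (K x); first by exists U; split => //; exact: KU.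
exists (~` K); split => //; first exact: closed_openC.
apply: (smooth_ext (f := fun=> 0)); [exact: closed_openC|by move=> y /f0|exact: smooth_cst].
Qed.
End SmoothGluing.

Section FlatFunction.
Variable R : realType.

(** The functions t^(-n) exp (-1/t), extended by zero. The linear span of this family is closed
    under differentiation, so its smoothness follows by induction from the first derivative
    alone. *)
Definition flat (n : nat) (t : R) : R := if 0 < t then t^-1 ^+ n * expR (- t^-1) else 0.

Lemma flat_ge0 n t : 0 <= flat n t.
Proof.
rewrite /flat; case: ifPn => // t0; rewrite mulr_ge0 ?expR_ge0 // exprn_ge0 // invr_ge0 ltW //.
Qed.

Lemma flatS n t : flat n t = t * flat n.+1 t.
Proof.
rewrite /flat; case: ifPn => t0; last by rewrite mulr0.
by rewrite exprS !mulrA mulfV ?mul1r // gt_eqF.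
Qed.

Lemma flat_bound n t : flat n t <= n`!%:R.
Proof.
rewrite /flat; case: ifPn => t0 //.
have u0 : 0 < t^-1 by rewrite invr_gt0.
rewrite expRN ler_pdivrMr ?expR_gt0 //.
case: n => [|n]; first by rewrite expr0 fact0 mul1r (le_trans _ (expR_ge1Dx _)) // lerDl ltW.
have f0 : 0 < n.+1`!%:R :> R by [].
rewrite -ler_pdivrMl // mulrC; apply: le_trans (expR_ge1Dxn n (ltW u0)); by rewrite lerDr.
Qed.

(** At 0 the difference quotient is h times the function of index n + 2, which is bounded. *)
Lemma flat_derive n (t : R) : is_derive t (1 : R) (flat n) (flat n.+2 t - n%:R * flat n.+1 t).
Proof.
have [t0|t0|t0] := ltgtP t 0.
- apply: (@near_eq_is_derive _ _ _ (fun=> 0)).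
  + near=> s; rewrite /flat ifN // -leNgt ltW //.
    by near: s; exact: lt_nbhsl.
  + rewrite /flat !ifN -?leNgt ?ltW // mulr0 subr0; exact: is_derive_cst.
- have t00 : t != 0 by rewrite gt_eqF.
  apply: (@near_eq_is_derive _ _ _ (fun s : R => s^-1 ^+ n * expR (- s^-1))).
  + near=> s; rewrite /flat ifT //.
    by near: s; exact: lt_nbhsr.
  + have dV := @is_deriveV R id t 1 1 t00 (is_derive_id _ _).
    have dN := is_deriveN dV; have dE := is_derive1_comp (is_derive_expR _) dN.
    have := is_deriveM (is_deriveX n dV) dE.
    rewrite (_ : _ * (_ \o _) = fun s : R => s^-1 ^+ n * expR (- s^-1)); last first.
      by apply/funext => s; rewrite !fctE.
    move=> h; apply: (is_derive_eq h).
    rewrite /flat !t0 !fctE /= /GRing.scale /= !mulr1; move: (expR _) => u.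
    rewrite -exprVn; move: t^-1 => w; case: (n) => [|k]; first by ring.
    by rewrite /= !exprS; ring.
rewrite t0 /flat ltxx mulr0 subr0 -/(flat n).
have key : (fun h : R => h^-1 *: (flat n (h *: (1 : R) + 0) - flat n 0)) @ 0^' --> (0 : R).
  apply/cvgrPdist_le => e e0; have f0 : 0 < n.+2`!%:R :> R by rewrite ltr0n fact_gt0.
  exists (e / n.+2`!%:R) => /=; first by rewrite divr_gt0.
  move=> h /=; rewrite sub0r normrN => hd h0; rewrite sub0r normrN addr0 {2}/flat ltxx subr0.
  rewrite (_ : h *: (1 : R) = h); last by rewrite /GRing.scale /= mulr1.
  rewrite flatS flatS /GRing.scale /= mulKf // normrM (ger0_norm (flat_ge0 _ _)).
  by rewrite (le_trans (ler_wpM2l _ (flat_bound _ _))) // -ler_pdivlMr // ltW.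
have dF : derivable (flat n) (0 : R) (1 : R) by apply/cvg_ex; exists (0 : R).
by apply: DeriveDef => //; apply: cvg_lim.
Unshelve. all: by end_near.
Qed.

Lemma flat_continuous n : continuous (flat n).
Proof.
move=> t; apply: differentiable_continuous; apply/derivable1_diffP.
by case: (flat_derive n t).
Qed.

Lemma smooth_flat n m (U : set 'rV[R]_m) (f : 'rV[R]_m -> R) : open U -> smooth_on U f ->
  smooth_on U (fun x => flat n (f x)).
Proof.
move=> oU sf; have o1 : open [set: 'rV[R]_1] by exact: openT.
have Dg k (z : 'rV[R]_1) (i : 'I_1) :
    is_derive z (delta_mx 0 i) (fun z : 'rV[R]_1 => flat k (z 0 0)) (flat k.+2 (z 0 0) - k%:R * flat k.+1 (z 0 0)).
  have zE (h : R) : (h *: delta_mx 0 i + z) 0 0 = h *: (1 : R) + z 0 0.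
    by rewrite !mxE !ord1 !eqxx mulr1 /GRing.scale /= mulr1.
  have [df vf] := flat_derive k (z 0 0).
  have E1 : (fun h : R => h^-1 *: ((fun z : 'rV[R]_1 => flat k (z 0 0)) (h *: delta_mx 0 i + z) - flat k (z 0 0)))
     = (fun h : R => h^-1 *: (flat k (h *: (1 : R) + z 0 0) - flat k (z 0 0))).
    by apply/funext => h; rewrite zE.
  apply: DeriveDef; first by rewrite /derivable E1.
  by rewrite /derive E1.
suff sg : smooth_on setT (fun z : 'rV[R]_1 => flat n (z 0 0)).
  have := smooth_comp oU o1 (g := fun x => (f x)%:M) _ sg.
  move=> h; apply: (smooth_ext oU _ (h _ _)) => //; first by move=> x _; rewrite mxE eqxx mulr1n.
  apply/smooth_mxP => // i j; apply: smooth_ext sf => // x _; by rewrite !ord1 mxE eqxx mulr1n.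
move=> k; elim: k n => [|k IH] j.
  split=> // z _; apply: (@continuous_comp _ _ _ (fun z : 'rV[R]_1 => z 0 0) (flat j)).
    exact: (smooth_cont (smooth_coord setT 0)).
  exact: flat_continuous.
split=> [z _|i].
  apply: (@continuous_comp _ _ _ (fun z : 'rV[R]_1 => z 0 0) (flat j)).
    exact: (smooth_cont (smooth_coord setT 0)).
  exact: flat_continuous.
split=> [z _|] //.
apply: (Ck_on_ext o1 (f := fun z : 'rV[R]_1 => flat j.+2 (z 0 0) + - (j%:R * flat j.+1 (z 0 0)))).
  by move=> z _; rewrite /partial; case: (Dg j z i) => _ ->.
apply: Ck_onD => //; apply: Ck_onN => //; apply: Ck_onM => //; exact: Ck_on_cst.
Qed.
End FlatFunction.

Section Bump.
Variables (R : realType) (m : nat).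
Local Notation E := 'rV[R]_m.

(** The Euclidean distance is used because the sup norm is not smooth; the Euclidean ball lies in
    the sup-norm ball of the same radius. *)
Definition bump (a : E) (r : R) (x : E) : R := flat 0 (r ^+ 2 - \sum_i (x 0 i - a 0 i) ^+ 2).

Lemma smooth_bump a r : smooth_on setT (bump a r).
Proof.
have oT : open [set: E] by exact: openT.
apply: smooth_flat => //.
Qed.

Lemma bump_ge0 a r x : 0 <= bump a r x. Proof. exact: flat_ge0. Qed.

Lemma bump_gt0 a r : 0 < r -> 0 < bump a r a.
Proof.
move=> r0; rewrite /bump big1 => [|i _]; last by rewrite subrr expr0n.
by rewrite subr0 /flat exprn_gt0 // expr0 mul1r expR_gt0.
Qed.

Lemma bump_support a r x : 0 < r -> bump a r x != 0 -> `|x - a| <= r.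
Proof.
move=> r0; rewrite /bump /flat; case: ifPn => [h _|]; last by rewrite eqxx.
apply: norm_le_coord => [|i j]; first exact: ltW.
rewrite -(@ler_pXn2r _ 2) ?nnegrE ?normr_ge0 ?(ltW r0) // real_normK ?num_real // !mxE !ord1.
rewrite subr_gt0 in h; apply: le_trans (ltW h).
by rewrite (bigD1 j) //= lerDl sumr_ge0 // => k _; rewrite sqr_ge0.
Qed.
End Bump.

(** * Charts, smooth functions and partitions of unity *)

Section Charts.
Variables (R : realType) (m : nat) (M : manifold R m).
Local Notation E := 'rV[R]_m.
Implicit Types (c d : chart R M m).
Arguments chart_open_cod {R T m} c.
Arguments chart_open_dom {R T m} c.
Arguments chart_inv_cont {R T m} c.
Arguments chart_map_cont {R T m} c.

Lemma within_open_cont (T S : topologicalType) (A : set T) (f : T -> S) x : open A -> A x ->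
  {within A, continuous f} -> {for x, continuous f}.
Proof.
move=> oA Ax /subspace_continuousP/(_ x Ax).
by rewrite within_interior // /interior; exact: open_nbhs_nbhs (conj oA Ax).
Qed.

Lemma open_cont_within (T S : topologicalType) (A : set T) (f : T -> S) :
  (forall x, A x -> {for x, continuous f}) -> {within A, continuous f}.
Proof.
by move=> cf; apply/subspace_continuousP => x Ax; apply: cvg_within_filter; exact: cf.
Qed.

Lemma chart_inv_continuous c x : ccod c x -> {for x, continuous (cinv c)}.
Proof. by move=> cx; exact: within_open_cont (chart_open_cod c) cx (chart_inv_cont c). Qed.

Lemma chart_map_continuous c p : cdom c p -> {for p, continuous c}.
Proof. by move=> cp; exact: within_open_cont (chart_open_dom c) cp (chart_map_cont c). Qed.

Lemma chart_preimage_open c (A : set M) : open A -> open [set x | ccod c x /\ A (cinv c x)].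
Proof.
move=> oA; apply: open_preim => //; first exact: chart_open_cod.
exact: chart_inv_continuous.
Qed.

Lemma chart_image_open c (U : set E) : open U -> open [set p | cdom c p /\ U (c p)].
Proof.
move=> oU; rewrite openE => p [cp Up]; rewrite /interior.
have h1 := open_nbhs_nbhs (conj (chart_open_dom c) cp).
have h2 := chart_map_continuous cp (open_nbhs_nbhs (conj oU Up)).
by near=> q; split; near: q.
Unshelve. all: by end_near. Qed.

Lemma atlas_smooth_chart c : atlas c -> smooth_chart c.
Proof. by move=> ac c' ac'; exact: atlas_compatible. Qed.

Lemma local_dom_open c d : open (local_dom idfun c d).
Proof. exact: chart_preimage_open (chart_open_dom d). Qed.

(** A smooth chart is compatible with the atlas by definition; two of them are compared locally
    through an atlas chart around the point. *)
Lemma smooth_transition c d : smooth_chart c -> smooth_chart d ->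
  smooth_on (local_dom idfun c d) (local_map idfun c d).
Proof.
move=> sc sd; apply: smooth_local => x [cx dx].
have [a aa ax] := atlas_cover (cinv c x).
have [s1 _] := sc a aa; have [_ s2] := sd a aa.
pose U := [set y | ccod c y /\ (cdom a `&` cdom d) (cinv c y)].
have oU : open U by apply: chart_preimage_open; apply: openI; exact: chart_open_dom.
exists U; split=> //.
have s1U : smooth_on U (local_map idfun c a) by apply: smooth_subset s1 => y [cy [ay dy]].
apply: (smooth_ext oU (f := fun y => local_map idfun a d (local_map idfun c a y))).
  by move=> y [cy [ay dy]]; rewrite /local_map /= chart_mapK.
apply: (smooth_comp_mx oU (@local_dom_open a d)) s2 s1U => y [cy [ay dy]].
by split; rewrite /local_map /= ?chart_mapK //; exact: chart_map_cod.
Qed.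

(** New charts are always produced by a smooth coordinate change on an open part of an old one: flow
    boxes, restrictions and reflections all arise in this way. *)
Lemma rechart c (A B : set E) (u v : E -> E) : smooth_chart c -> open A -> open B ->
  A `<=` ccod c -> smooth_on A u -> smooth_on B v ->
  (forall x, A x -> B (u x) /\ v (u x) = x) -> (forall y, B y -> A (v y) /\ u (v y) = y) ->
  exists d, [/\ smooth_chart d, cdom d = [set p | cdom c p /\ A (c p)], ccod d = B,
    (forall p, d p = u (c p)) & (forall y, cinv d y = cinv c (v y))].
Proof.
move=> sc oA oB Ac su sv uK vK.
have oD := chart_image_open c oA.
have mc (p : M) : [set p | cdom c p /\ A (c p)] p -> B (u (c p)) by move=> [_ /uK[]].
have ic y : B y -> [set p | cdom c p /\ A (c p)] (cinv c (v y)).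
  by move=> /vK[Av _]; split; [exact/chart_inv_dom/Ac|rewrite /= chart_invK //; exact: Ac].
have mK (p : M) : [set p | cdom c p /\ A (c p)] p -> cinv c (v (u (c p))) = p.
  by move=> [cp /uK[_ ->]]; exact: chart_mapK.
have iK y : B y -> u (c (cinv c (v y))) = y.
  by move=> /vK[Av uvy]; rewrite chart_invK //; exact: Ac.
have cm : {within [set p | cdom c p /\ A (c p)], continuous (fun p => u (c p))}.
  apply: open_cont_within => p [cp Ap]; apply: (@continuous_comp _ _ _ c u).
    exact: chart_map_continuous.
  exact: smooth_cont su Ap.
have ci : {within B, continuous (fun y => cinv c (v y))}.
  apply: open_cont_within => y By; apply: (@continuous_comp _ _ _ v (cinv c)).
    exact: smooth_cont sv By.
  by apply: chart_inv_continuous; apply: Ac; case: (vK y By).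
exists (Chart oD oB mc ic mK iK cm ci); split=> // a aa; have [s1 s2] := sc a aa.
split; rewrite /local_map /=.
  have oL : open (local_dom idfun (Chart oD oB mc ic mK iK cm ci) a) by exact: local_dom_open.
  apply: (smooth_comp_mx oL (@local_dom_open c a)) s1 _ => [y [/= By ay]|].
    by split=> //; apply: Ac; case: (vK y By).
  by apply: smooth_subset sv => y [].
have oL : open (local_dom idfun a (Chart oD oB mc ic mK iK cm ci)) by exact: local_dom_open.
apply: (smooth_comp_mx oL oA) su _ => [y [/= ay [_ Ay]]|] //.
by apply: smooth_subset s2 => y [/= ay [cy _]].
Qed.

Lemma smooth_function_local (f : M -> R) :
  (forall p, exists c U, [/\ smooth_chart c, cdom c p, open U, U (c p) &
     smooth_on (U `&` ccod c) (fun x => f (cinv c x) : R)]) -> smooth_function f.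
Proof.
move=> loc d sd; apply: smooth_local => y dy.
have [c [U [sc cp oU Up sf]]] := loc (cinv d y).
pose V := [set z | ccod d z /\ [set p | cdom c p /\ U (c p)] (cinv d z)].
have oV : open V by apply: chart_preimage_open; exact: chart_image_open.
exists V; split=> //.
apply: (smooth_ext oV (f := fun z => f (cinv c (local_map idfun d c z)))).
  by move=> z [dz [cz Uz]]; rewrite /local_map /= chart_mapK.
apply: (smooth_comp oV (openI oU (chart_open_cod c))) sf _ => [z [dz [cz Uz]]|].
  by split=> //; exact: chart_map_cod.
by apply: smooth_subset (smooth_transition sd sc) => z [dz [cz Uz]].
Qed.

Lemma chart_continuous (T : topologicalType) (f : M -> T) :
  (forall p, exists c, [/\ cdom c p & {for c p, continuous (fun x => f (cinv c x))}]) -> continuous f.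
Proof.
move=> loc p; have [c [cp cf]] := loc p.
have h : {for p, continuous (fun q => f (cinv c (c q)))}.
  by apply: (@continuous_comp _ _ _ c (fun x => f (cinv c x))); [exact: chart_map_continuous|].
apply: continuous_ext (chart_open_dom c) cp _ h => q cq; by rewrite chart_mapK.
Qed.

Lemma smooth_function_continuous (f : M -> R) : smooth_function f -> continuous f.
Proof.
move=> sf; apply: chart_continuous => p; have [c ac cp] := atlas_cover p.
exists c; split=> //; apply: (smooth_cont (sf c (atlas_smooth_chart ac))).
exact: chart_map_cod.
Qed.

(** Extension by zero is smooth because the support lies in the image of a compact ball, which is
    closed as the manifold is Hausdorff. *)
Lemma smooth_bump_at c p : smooth_chart c -> cdom c p -> exists chi : M -> R,
  [/\ smooth_function chi, forall q, 0 <= chi q, 0 < chi p & closure [set q | chi q != 0] `<=` cdom c].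
Proof.
move=> sc cp; have [r r0 rc] := open_ball_sub (chart_open_cod c) (chart_map_cod cp).
have r20 : 0 < r / 2 by rewrite divr_gt0.
pose K := [set x : E | `|x - c p| <= r / 2].
have KB : K `<=` ccod c.
  move=> x Kx; apply: rc; rewrite -ball_normE /= distrC; apply: le_lt_trans Kx _.
  by rewrite ltr_pdivrMr // ltr_pMr // ltr1n.
have cK : compact K.
  rewrite (_ : K = (fun x => x + c p) @` [set x : E | `|x| <= r / 2]).
    apply: continuous_compact (@closed_ball_norm_compact R m (r / 2)).
    apply: continuous_subspaceT => x; apply: (smooth_cont (U := setT)) => //.
  apply/seteqP; split=> [x Kx|_ [x Kx <-]]; last by rewrite /K /= addrK.
  by exists (x - c p); rewrite ?subrK.
have cKM : closed (cinv c @` K).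
  apply: compact_closed; first exact: manifold_hausdorff.
  apply: continuous_compact cK; apply: open_cont_within => x /KB; exact: chart_inv_continuous.
pose chi q := if `[< cdom c q >] then bump (c p) (r / 2) (c q) else 0.
have chiK q : ~ (cinv c @` K) q -> chi q = 0.
  move=> nKq; rewrite /chi; case: asboolP => // cq; apply/eqP; apply: contra_notT nKq => h.
  exists (c q); last exact: chart_mapK.
  exact: bump_support r20 h.
have chiE x : ccod c x -> chi (cinv c x) = bump (c p) (r / 2) x.
  by move=> cx; rewrite /chi; case: asboolP => [_|[]]; rewrite ?chart_invK //; exact: chart_inv_dom.
exists chi; split.
- apply: smooth_function_local => q.
  have [[x Kx xq]|nKq] := pselect ((cinv c @` K) q).
    exists c, setT; split=> //; last 1 first.
    + rewrite setTI; apply: (smooth_ext (chart_open_cod c) (f := bump (c p) (r / 2))).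
        by move=> y cy; rewrite chiE.
      exact: smooth_subset (smooth_bump _ _).
    + by rewrite -xq; apply: chart_inv_dom; exact: KB.
    + exact: openT.
  have [d ad dq] := atlas_cover q.
  pose U := [set y | ccod d y /\ (~` (cinv c @` K)) (cinv d y)].
  have oU : open U by apply: chart_preimage_open; exact: closed_openC.
  exists d, U; split=> //; first exact: atlas_smooth_chart.
    by split; [exact: chart_map_cod|rewrite /= chart_mapK].
  apply: (smooth_ext (f := fun=> 0)); [apply: openI => //; exact: chart_open_cod| |exact: smooth_cst].
  by move=> y [[_ /chiK ->] _].
- by move=> q; rewrite /chi; case: asboolP => // _; exact: bump_ge0.
- by rewrite /chi; case: asboolP => // _; exact: bump_gt0.
- have sub : [set q | chi q != 0] `<=` cinv c @` K.
    by move=> q /= /eqP h; apply: contrapT => /chiK.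
  move=> q /(closureS sub); rewrite -(closure_id _).1 // => -[x /KB cx <-]; exact: chart_inv_dom.
Qed.

Theorem partition_of_unity (Q : chart R M m -> Prop) : compact [set: M] ->
  (forall p, exists c, [/\ smooth_chart c, Q c & cdom c p]) ->
  exists (r : nat) (c : 'I_r -> chart R M m) (chi : 'I_r -> M -> R),
    [/\ forall i, smooth_chart (c i) /\ Q (c i),
        forall i, [/\ smooth_function (chi i), forall p, 0 <= chi i p &
          closure [set p | chi i p != 0] `<=` cdom (c i)] &
        forall p, \sum_i chi i p = 1].
Proof.
move=> cM cov.
have [cc ccP] := choice cov.
have /choice[b bP] p : exists b : M -> R, [/\ smooth_function b, forall q, 0 <= b q,
    0 < b p & closure [set q | b q != 0] `<=` cdom (cc p)].
  by have [s1 _ s3] := ccP p; exact: smooth_bump_at.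
have bc p : continuous (b p) by apply: smooth_function_continuous; case: (bP p).
(* A finite subcover is extracted from the near-covering form of compactness, with the filter of
   finite lists ordered by inclusion. *)
pose F : set_system (seq M) := [set A : set (seq M) | exists s0 : seq M, forall s : seq M, {subset s0 <= s} -> A s].
have FF : Filter F.
  split; first by exists [::].
  - move=> A B [s1 H1] [s2 H2]; exists (s1 ++ s2) => s h; split.
      by apply: H1 => x xs; apply: h; rewrite mem_cat xs.
    by apply: H2 => x xs; apply: h; rewrite mem_cat xs orbT.
  - by move=> A B AB [s1 H1]; exists s1 => s h; apply/AB/H1.
move: cM => /compact_near_coveringP/(_ _ F (fun s q => exists2 p, p \in s & 0 < b p q) FF).
case=> [p _|s0 /(_ s0 (fun _ h => h)) Fcov].
  exists ([set q | 0 < b p q], [set s : seq M | p \in s]) => /=; last by move=> [q s] [/= h1 h2]; exists p.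
  split; last by exists [:: p] => s /(_ p); rewrite inE eqxx; apply.
  have [_ _ b0 _] := bP p.
  have := bc p p [set t | 0 < t] (open_nbhs_nbhs (conj (@open_gt _ _) b0)).
  by [].
pose s := s0; pose pt i := tnth (in_tuple s) i.
pose tot q := \sum_i b (pt i) q.
have tot0 q : 0 < tot q.
  have [p ps bpq] := Fcov q Logic.I.
  have /tnthP[i pi] : p \in in_tuple s by [].
  rewrite /tot (bigD1 i) //= ltr_wpDr //; last by rewrite /pt -pi.
  by apply: sumr_ge0 => j _; case: (bP (pt j)).
have sb i : smooth_function (b (pt i)) by case: (bP (pt i)).
exists (size s), (fun i => cc (pt i)), (fun i q => b (pt i) q / tot q); split.
- by move=> i; case: (ccP (pt i)).
- move=> i; have [s1 s2 s3 s4] := bP (pt i); split.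
  + move=> c sc; apply: smoothM; first exact: chart_open_cod.
      done.
    apply: smoothV; [exact: chart_open_cod|by move=> x _; rewrite gt_eqF|].
    by apply: smooth_sum; [exact: chart_open_cod|move=> j; exact: sb].
  + by move=> q; rewrite divr_ge0 // ltW.
  + apply: subset_trans s4; apply: closureS => q /=.
    by apply: contraNN => /eqP ->; rewrite mul0r.
- by move=> q; rewrite -mulr_suml -/(tot q) mulfV // gt_eqF.
Qed.
End Charts.

(** * Change of variables by homotopy *)

Section HomotopyIdentity.
Variables (R : realType) (m : nat).
Local Notation E := 'rV[R]_m.
Local Notation Z := 'rV[R]_(1 + m).
Variables (W : set Z) (F : Z -> E) (g : E -> R).
Hypotheses (oW : open W) (sF : smooth_on W F) (sg : smooth_on setT g).
Local Notation o := (lshift m (0 : 'I_1)).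
Local Notation c := (rshift 1).

Definition space_jac (z : Z) : 'M[R]_m := \matrix_(i, j) pd (c i) (fun z => F z 0 j : R) z.
Local Notation J := space_jac.
Hypothesis uJ : forall z, W z -> J z \in unitmx.

(** The velocity of the homotopy pulled back to the source: the vector field that transports the
    pulled-back density. *)
Definition homotopy_flux (z : Z) : E := (\row_j pd o (fun z => F z 0 j : R) z) *m invmx (J z).
Local Notation Y := homotopy_flux.

Let sFj j : smooth_on W (fun z => F z 0 j : R). Proof. done. Qed.
Let sgF : smooth_on W (fun z => g (F z)). Proof. exact: (smooth_comp oW openT _ sg sF). Qed.

Lemma smooth_space_jac : smooth_on W J.
Proof.
apply/smooth_mxP => // i j; apply: (smooth_ext oW (f := pd (c i) (fun z => F z 0 j))) => [z _|].
  by rewrite mxE.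
done.
Qed.

Lemma smooth_homotopy_flux : smooth_on W Y.
Proof.
apply: smooth_mulmx => //; last by apply: smooth_invmx => //; exact: smooth_space_jac.
apply/smooth_mxP => // i j; apply: (smooth_ext oW (f := pd o (fun z => F z 0 j))) => [z _|].
  by rewrite mxE.
done.
Qed.

(* Both sides are [det J] times the derivative of [g] along the flux plus [g]
   times the trace of [J^-1 pd o J]; the remaining terms cancel because
   [pd (c k) J l i] is symmetric in [k] and [l]. *)
Lemma homotopy_identity z : W z -> pd o (fun z => g (F z) * \det (J z)) z =
  \sum_k pd (c k) (fun z => g (F z) * \det (J z) * Y z 0 k) z.
Proof.
move=> Wz; have sJ := smooth_space_jac; have sY := smooth_homotopy_flux.
have sD : smooth_on W (fun z => \det (J z)) by [].
have sYk k : smooth_on W (fun z => Y z 0 k : R) by [].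
have dF := smooth_differentiable openT sg (Logic.I : setT (F z)).
have pg l : pd l (fun z => g (F z)) z = \sum_j pd j g (F z) * pd l (fun z => F z 0 j) z.
  by apply: pd_chain => // j.
have pJ l i j : pd l J z i j = pd l (pd (c i) (fun z => F z 0 j)) z.
  rewrite pd_mx //.
  by apply: (pd_ext _ oW Wz) => w _; rewrite mxE.
have YJ : Y z *m J z = \row_j pd o (fun z => F z 0 j : R) z by rewrite mulmxKV // uJ.
pose T l := \tr (invmx (J z) *m pd l J z).
have pY k : pd (c k) (fun z => Y z 0 k : R) z =
   \sum_j pd o J z k j * invmx (J z) j k - \sum_l Y z 0 l * (pd (c l) J z *m invmx (J z)) k k.
  pose V z : E := \row_j pd o (fun z => F z 0 j : R) z.
  have sV : smooth_on W V.
    apply/smooth_mxP => // i j; apply: (smooth_ext oW (f := pd o (fun z => F z 0 j))) => [w _|].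
      by rewrite mxE.
    done.
  have sI : smooth_on W (fun z => invmx (J z)) by [].
  rewrite -(pd_mx _ _ (smooth_derivable sY Wz)) (pd_mulmx (smooth_derivable sV Wz) (smooth_derivable sI Wz)).1.
  rewrite (jet1_invmx oW Wz _ sJ uJ) mulmxN mxE [X in _ + X]mxE !mulmxA -/(Y z) -mulmxA mxE [in X in _ - X]mxE; congr (_ - _).
    apply: eq_bigr => j _; congr (_ * _); rewrite (pd_mx _ _ (smooth_derivable sV Wz)) pJ.
    rewrite -(schwarz (c k) o oW (sFj j) Wz); by apply: (pd_ext _ oW Wz) => w _; rewrite mxE.
  apply: eq_bigr => l _; congr (_ * _); rewrite !mxE; apply: eq_bigr => i _; congr (_ * _).
  by rewrite !pJ (schwarz (c k) (c l) oW (sFj i) Wz).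
rewrite (jet1M Wz) // (pd_det oW Wz _ sJ (uJ Wz)) -/(T o).
have E1 k : pd (c k) (fun z => g (F z) * \det (J z) * Y z 0 k) z = \det (J z) * (pd (c k) (fun z => g (F z)) z * Y z 0 k)
    + g (F z) * \det (J z) * (T (c k) * Y z 0 k + pd (c k) (fun z => Y z 0 k : R) z).
  rewrite (jet1M Wz) //.
  rewrite (jet1M Wz) // (pd_det oW Wz _ sJ (uJ Wz)) -/(T (c k)).
  by move: (pd _ _ z) (pd _ _ z) (T _) (\det _) (Y z 0 k) => a b t e v; ring.
rewrite (eq_bigr _ (fun k _ => E1 k)) big_split /= -!mulr_sumr.
have -> : \sum_k pd (c k) (fun z => g (F z)) z * Y z 0 k = pd o (fun z => g (F z)) z.
  under eq_bigr do rewrite pg mulr_suml.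
  rewrite exchange_big pg; apply: eq_bigr => j _ /=; have /rowP/(_ j) := YJ; rewrite !mxE => <-.
  by rewrite mulr_sumr; apply: eq_bigr => k _; rewrite [J z k j]mxE mulrAC mulrA mulrC mulrA mulrAC.
have -> : \sum_k (T (c k) * Y z 0 k + pd (c k) (fun z => Y z 0 k : R) z) = T o.
  under eq_bigr do rewrite pY.
  rewrite big_split sumrB /=.
  have -> : \sum_k \sum_l Y z 0 l * (pd (c l) J z *m invmx (J z)) k k = \sum_k T (c k) * Y z 0 k.
    rewrite exchange_big; apply: eq_bigr => l _ /=; rewrite -mulr_sumr mulrC; congr (_ * _).
    by rewrite /T mxtrace_mulC.
  rewrite addrC subrK /T mxtrace_mulC; by apply: eq_bigr => k _; rewrite mxE.
by rewrite mulrC -mulrA.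
Qed.
End HomotopyIdentity.

Section Supported.
Variables (R : realType) (m : nat).
Local Notation E := 'rV[R]_m.
Local Notation I f := (iterated_integral f).

Lemma compact_bound (K : set E) : compact K -> exists2 A, 0 < A & forall x, K x -> `|x| < A.
Proof.
move=> /compact_bounded[B [_ HB]]; exists (Num.max 0 (B + 1) + 1).
  by rewrite ltr_wpDl // le_max lexx.
by move=> x Kx; rewrite ltr_pwDr //; apply: (HB (Num.max 0 (B + 1))) => //; rewrite lt_max ltrDl ltr01 orbT.
Qed.

Lemma supported_le A B (f : E -> R) : A <= B -> supported A f -> supported B f.
Proof. by move=> AB [cf f0]; split=> // x Bx; apply: f0; exact: le_trans Bx. Qed.

Lemma iterated_integral_scale A (f : E -> R) a : supported A f -> I (fun x => a * f x) = a * I f.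
Proof.
move=> sf; have s0 : supported A (fun _ : E => 0 : R) by split=> // x; exact: cst_continuous.
have := iterated_integral_linear a s0 sf; rewrite (@iterated_integral_eq0 _ _ (fun=> 0)) // add0r => <-.
by congr iterated_integral; apply/funext => x; rewrite add0r.
Qed.

End Supported.

Section SpaceVariable.
Variables (R : realType) (m : nat) (W : set 'rV[R]_(1 + m)) (U : set 'rV[R]_m).
Hypotheses (oW : open W) (oU : open U) (WU : forall z, W z -> U (rsubmx z)).

Lemma smooth_rsubmx : smooth_on W (fun z => rsubmx z).
Proof.
apply/smooth_mxP => // i j; apply: (smooth_ext oW (f := fun z : 'rV[R]_(1 + m) => z 0 (rshift 1 j))).
  by move=> z _; rewrite ord1 mxE.
done.
Qed.

Lemma smooth_space (g : 'rV[R]_m -> R) : smooth_on U g -> smooth_on W (fun z => g (rsubmx z)).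
Proof. by move=> sg; exact: smooth_comp oW oU WU sg smooth_rsubmx. Qed.

Lemma pd_space (g : 'rV[R]_m -> R) z : W z -> smooth_on U g ->
  (forall i, pd (rshift 1 i) (fun z => g (rsubmx z)) z = pd i g (rsubmx z)) /\
  pd (lshift m (0 : 'I_1)) (fun z => g (rsubmx z)) z = 0.
Proof.
move=> Wz sg; have dg := smooth_differentiable oU sg (WU Wz).
have dl j : differentiable (fun z : 'rV[R]_(1 + m) => rsubmx z 0 j : R) z.
  exact: smooth_differentiable oW (smooth_entry 0 j oW smooth_rsubmx) Wz.
have pl l j : pd l (fun z : 'rV[R]_(1 + m) => rsubmx z 0 j : R) z = (rshift 1 j == l)%:R.
  by rewrite -(pd_coord l (rshift 1 j) z); congr pd; apply/funext => w; rewrite mxE.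
split=> [i|]; rewrite (pd_chain _ dg dl).
  rewrite (bigD1 i) //= big1 ?addr0 => [|j ji]; first by rewrite pl eqxx mulr1.
  by rewrite pl eq_rshift (negPf ji) mulr0.
by apply: big1 => j _; rewrite pl eq_rlshift mulr0.
Qed.
End SpaceVariable.

Section Homotopy.
Variables (R : realType) (m : nat).
Local Notation E := 'rV[R]_m.
Local Notation Z := 'rV[R]_(1 + m).
Local Notation I f := (iterated_integral f).
Local Notation o := (lshift m (0 : 'I_1)).
Variables (q : R) (q0 : 0 < q).
Local Notation T s := (- q < (s : R) < 1 + q).

Let unit_interval (s : R) : 0 <= s <= 1 -> T s.
Proof. by move: q0 => q0' /andP[h1 h2]; apply/andP; lra. Qed.

Let S : set Z := [set z | T (z 0 o)].
Let ST s x : T s -> S (pt s x). Proof. by rewrite /S /= row_mxEl mxE eqxx. Qed.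
Let oT : open [set s : R | T s].
Proof.
by rewrite (_ : [set s | _] = `]- q, 1 + q[%classic) //.
Qed.
Let oS : open S.
Proof. exact: (open_parameter_strip oT). Qed.

Lemma homotopy_integral (G : Z -> R) (A : R) : 0 < A -> smooth_on S G ->
  (forall s x, T s -> A <= `|x| -> G (pt s x) = 0) ->
  (forall s, T s -> I (fun x : E => pd o G (pt s x)) = 0) ->
  I (fun x => G (pt 0 x)) = I (fun x => G (pt 1 x)).
Proof.
move=> A0 sG G0 dG0; pose phi s := I (fun x => G (pt s x)).
have dphi s : T s -> is_derive s (1 : R) phi 0.
  by move=> Ts; rewrite -(dG0 s Ts); exact: (iterated_integral_parameter oT A0 sG).
have [||w _] := @MVT R phi (fun=> 0) 0 1 ltr01.
- by move=> w /andP[w0 w1]; apply/dphi/unit_interval; rewrite !ltW.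
- apply: open_cont_within => w /=; rewrite in_itv /= => /unit_interval/dphi[dw _].
  by apply: differentiable_continuous; apply/derivable1_diffP.
by rewrite mul0r => /eqP; rewrite subr_eq0 => /eqP.
Qed.

Variables (U K : set E) (T0 T1 : E -> E) (g : E -> R).
Hypotheses (oU : open U) (cK : compact K) (KU : K `<=` U).
Hypotheses (s0 : smooth_on U T0) (s1 : smooth_on U T1) (sg : smooth_on setT g).
Hypothesis uJ : forall s x, T s -> U x -> jac T0 x + s *: (jac T1 x - jac T0 x) \in unitmx.
Hypothesis gK : forall s x, T s -> U x -> ~ K x -> g (T0 x + s *: (T1 x - T0 x)) = 0.

(** The homotopy is the segment between the two maps. The derivative of the transported density is a
    divergence by [homotopy_identity], and [gK] keeps its support in the fixed compact set, so the
    integral is constant. The parameter exceeds [0, 1] by [q] on both sides to range over an open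
    interval. *)
Theorem homotopy_change :
  I (fun x => if `[< U x >] then g (T0 x) * \det (jac T0 x) else 0) =
  I (fun x => if `[< U x >] then g (T1 x) * \det (jac T1 x) else 0).
Proof.
pose W : set Z := [set z | S z /\ U (rsubmx z)].
have sr : smooth_on S (fun z => rsubmx z) by exact: smooth_rsubmx.
have oW : open W := open_preim oS oU (fun z Sz => smooth_cont sr Sz).
have WU z : W z -> U (rsubmx z) by case.
pose F z : E := T0 (rsubmx z) + z 0 o *: (T1 (rsubmx z) - T0 (rsubmx z)).
have FE j z : F z 0 j = T0 (rsubmx z) 0 j + z 0 o * (T1 (rsubmx z) 0 j - T0 (rsubmx z) 0 j) by rewrite !mxE.
have e0 j : smooth_on U (fun x => T0 x 0 j : R) by [].
have e1 j : smooth_on U (fun x => T1 x 0 j : R) by [].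
have sE j := smooth_space oW oU WU (e0 j).
have sB j := smooth_space oW oU WU (smoothB oU (e1 j) (e0 j)).
have so : smooth_on W (fun z => z 0 o : R) by [].
have sF : smooth_on W F.
  apply/smooth_mxP => // i j; rewrite ord1.
  apply: (smooth_ext oW (f := fun z => T0 (rsubmx z) 0 j + z 0 o * (T1 (rsubmx z) 0 j - T0 (rsubmx z) 0 j))) => [z _|].
    by [].
  by [].
have JE z : W z -> space_jac F z = jac T0 (rsubmx z) + z 0 o *: (jac T1 (rsubmx z) - jac T0 (rsubmx z)).
  move=> Wz; have Uz := WU z Wz; apply/matrixP => i j; rewrite !mxE.
  rewrite !jac_entry //.
  rewrite (pd_ext (g := fun z => T0 (rsubmx z) 0 j + z 0 o * (T1 (rsubmx z) 0 j - T0 (rsubmx z) 0 j)) _ oW Wz) //.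
  rewrite (jet1D Wz) //.
  rewrite (jet1M Wz) // (pd_space oW oU WU Wz (e0 j)).1 (pd_space oW oU WU Wz (smoothB oU (e1 j) (e0 j))).1.
  by rewrite (jet1B Uz) // pd_coord eq_lrshift mul0r add0r.
have uW z : W z -> space_jac F z \in unitmx by move=> Wz; rewrite JE //; case: Wz => *; exact: uJ.
have gFK z : W z -> ~ K (rsubmx z) -> g (F z) = 0 by move=> [Sz Uz]; exact: gK.
have clK : closed K by exact: compact_closed (@norm_hausdorff _ _) cK.
have oK : open (~` K) by exact: closed_openC.
have sgF : smooth_on W (fun z => g (F z)) by exact: (smooth_comp oW openT _ sg sF).
have sGW : smooth_on W (fun z => g (F z) * \det (space_jac F z)).
  by apply: smoothM => //; apply: smooth_det => //; exact: smooth_space_jac.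
pose G z := if `[< U (rsubmx z) >] then g (F z) * \det (space_jac F z) else 0.
have GW z : W z -> G z = g (F z) * \det (space_jac F z) by move=> [_ Uz]; rewrite /G asboolT.
have G0 z : S z -> ~ K (rsubmx z) -> G z = 0.
  by move=> Sz Kz; rewrite /G; case: asboolP => // Uz; rewrite gFK ?mul0r.
pose N : set Z := [set z | S z /\ (~` K) (rsubmx z)].
have oN : open N := open_preim oS oK (fun z Sz => smooth_cont sr Sz).
have sG : smooth_on S G.
  apply: smooth_local => z Sz; have [Kz|nKz] := pselect (K (rsubmx z)).
    exists W; split=> //; first by split=> //; exact: KU.
    by apply: (smooth_ext oW _ sGW) => w Ww; rewrite GW.
  by exists N; split=> //; apply: (smooth_ext oN (f := fun=> 0)) => [w [Sw Kw]|]; [rewrite G0|exact: smooth_cst].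
have rsub s x : rsubmx (pt s x) = x by rewrite row_mxKr.
have pt0 s x : pt s x 0 o = s by rewrite row_mxEl mxE eqxx.
have GE s x : T s -> G (pt s x) = if `[< U x >] then g (T0 x + s *: (T1 x - T0 x)) * \det (jac T0 x + s *: (jac T1 x - jac T0 x)) else 0.
  move=> Ts; rewrite /G rsub; case: asboolP => // Ux; rewrite JE ?rsub ?pt0 /F ?rsub ?pt0 //.
  by split; [exact: ST|rewrite rsub].
have [A A0 KA] := compact_bound cK.
have -> : (fun x => if `[< U x >] then g (T0 x) * \det (jac T0 x) else 0) = fun x => G (pt 0 x).
  by apply/funext => x; rewrite GE ?unit_interval ?lexx ?ler01 // !scale0r !addr0.
have -> : (fun x => if `[< U x >] then g (T1 x) * \det (jac T1 x) else 0) = fun x => G (pt 1 x).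
  by apply/funext => x; rewrite GE ?unit_interval ?lexx ?ler01 // !scale1r ![_ + (_ - _)]addrC !subrK.
apply: (homotopy_integral A0 sG) => [s x Ts Ax|s Ts].
  by apply: G0 (ST x Ts) _; rewrite rsub => /KA; rewrite ltNge Ax.
pose V k z := g (F z) * \det (space_jac F z) * homotopy_flux F z 0 k.
have sV k : smooth_on W (V k).
  by apply: smoothM => //; apply: smooth_entry => //; exact: smooth_homotopy_flux.
pose v k x := if `[< U x >] then V k (pt s x) else 0.
have v0 k x : ~ K x -> v k x = 0.
  move=> Kx; rewrite /v; case: asboolP => // Ux; rewrite /V gFK ?mul0r ?rsub //.
  by split; [exact: ST|rewrite rsub].
have Wpt x : U x -> W (pt s x) by move=> Ux; split; [exact: ST|rewrite rsub].
have sv k : smooth_on setT (v k).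
  apply: (smooth_zero_extension oU clK KU) (v0 k).
  apply: (smooth_ext oU (f := fun x => V k (pt s x))) => [x Ux|]; first by rewrite /v asboolT.
  apply: (smooth_comp oU oW Wpt (sV k)); apply: smooth_pt => //.
have pv0 k x : ~ K x -> pd k (v k) x = 0.
  by move=> Kx; rewrite (pd_ext (g := fun=> 0) _ oK Kx) ?pd_cst // => y; exact: v0.
have -> : (fun x => pd o G (pt s x)) = fun x => \sum_k pd k (v k) x.
  apply/funext => x; have [Kx|nKx] := pselect (K x); last first.
    rewrite big1 => [|k _]; last exact: pv0.
    have Nx : N (pt s x) by split; [exact: ST|rewrite /= rsub].
    by rewrite (pd_ext (g := fun=> 0) _ oN Nx) ?pd_cst // => z [Sz Kz]; exact: G0.
  have Ux := KU Kx; rewrite (pd_ext _ oW (Wpt x Ux) GW) (homotopy_identity oW sF sg uW (Wpt x Ux)).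
  apply: eq_bigr => k _; rewrite (pd_ext (g := fun x => V k (pt s x)) _ oU Ux) => [|y Uy]; last by rewrite /v asboolT.
  by rewrite (pd_graph (tau := fun=> s) k oW oU (sV k) (smooth_cst _ _) Ux (Wpt x Ux)) pd_cst mulr0 add0r.
have sup k : supported A (pd k (v k)).
  split=> [x|x Ax]; first by apply: (smooth_cont (U := setT)) => //.
  by apply: pv0 => /KA; rewrite ltNge Ax.
have [-> _] := iterated_integral_sum sup; apply: big1 => k _; apply: iterated_integral_pd A0 (sv k) _ => x Ax.
by apply: v0 => /KA; rewrite ltNge Ax.
Qed.
End Homotopy.

(** * Linear and local changes of variables *)

Lemma det_rank_one (R : realType) m (u : 'cV[R]_m) (w : 'rV[R]_m) : \det (1%:M + u *m w) = 1 + (w *m u) 0 0.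
Proof.
have E1 : block_mx (1%:M : 'M[R]_1) (- w) u 1%:M
   = block_mx (1%:M : 'M[R]_1) 0 u 1%:M *m block_mx (1%:M : 'M[R]_1) (- w) 0 (1%:M + u *m w).
  by rewrite mulmx_block !mul0mx !mulmx0 !mul1mx !mulmx1 !addr0 mulmxN addrC addrK.
have E2 : block_mx (1%:M : 'M[R]_1) (- w) u 1%:M
   = block_mx (1%:M : 'M[R]_1) (- w) 0 1%:M *m block_mx (1%:M + w *m u : 'M[R]_1) 0 u 1%:M.
  by rewrite mulmx_block !mul0mx !mulmx0 !mul1mx !mulmx1 !add0r mulNmx addrK.
have := congr1 (@determinant _ _) E1; rewrite {1}E2 !det_mulmx !det_lblock !det_ublock !det1 !mul1r !mulr1.
by rewrite det_mx11 mxE mxE eqxx => <-.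
Qed.

Definition compact_smooth (R : realType) m (g : 'rV[R]_m -> R) :=
  smooth_on setT g /\ exists A, 0 < A /\ forall x, A <= `|x| -> g x = 0.

Lemma compact_smooth_mulmx (R : realType) m (g : 'rV[R]_m -> R) (M : 'M[R]_m) : M \in unitmx ->
  compact_smooth g -> compact_smooth (fun x => g (x *m M)).
Proof.
move=> uM [sg [A [A0 gA]]]; split.
  by apply: (smooth_comp openT openT _ sg) => //.
exists (m%:R * A * `|invmx M| + 1); split; first by rewrite ltr_wpDl // !mulr_ge0 // ltW.
move=> x xA; apply: gA; rewrite leNgt; apply/negP => h.
have := norm_mulmx (x *m M) (invmx M); rewrite mulmxK // => h1.
have : m%:R * `|x *m M| * `|invmx M| <= m%:R * A * `|invmx M|.
  by rewrite ler_wpM2r // ler_wpM2l // ltW.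
by move: xA h1; lra.
Qed.

Section LinearChange.
Variables (R : realType) (m : nat).
Local Notation E := 'rV[R]_m.
Local Notation I f := (iterated_integral f).
Variables (g : E -> R).
Hypothesis cg : compact_smooth g.
Local Notation phi M := (I (fun x => g (x *m M)) * \det M).

Let unit_of (M : 'M[R]_m) : 0 < \det M -> M \in unitmx.
Proof. by move=> dM; rewrite unitmxE unitfE gt_eqF. Qed.

Let det_shift (M : 'M[R]_m) (u : 'cV[R]_m) (w : E) : 0 < \det M -> \det (M + u *m w) = \det M * (1 + (w *m invmx M *m u) 0 0).
Proof.
move=> /[dup] dM /unit_of uM; by rewrite -mulmxA -det_rank_one -det_mulmx mulmxDr mulmx1 !mulmxA mulmxV // mul1mx.
Qed.

(** Along the segment from [M] to [M + u *m w] the determinant is affine in the parameter, hence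
    positive between two positive ends, and the homotopy theorem applies. *)
Lemma rank_one_change (M : 'M[R]_m) (u : 'cV[R]_m) (w : E) : 0 < \det M -> 0 < \det (M + u *m w) ->
  phi M = phi (M + u *m w).
Proof.
move=> d0 d1; have uM := unit_of d0.
set t := (w *m invmx M *m u) 0 0; have [sg [A [A0 gA]]] := cg.
have dE s : \det (M + s *: (u *m w)) = \det M * (1 + s * t).
  by rewrite scalemxAl det_shift // -scalemxAr mxE.
have t1 : 0 < 1 + t by move: d1; rewrite -[u *m w]scale1r dE mul1r pmulr_rgt0.
(* Half the smaller end value of 1 + s t. On the interval enlarged by [q] this affine function stays
   above [e]. *)
pose e := Num.min 1 (1 + t) / 2; have e0 : 0 < e by rewrite divr_gt0 // lt_min ltr01.
pose q := e / (`|t| + 1); have q0 : 0 < q by rewrite divr_gt0 // ltr_wpDl.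
have ste s : - q < s < 1 + q -> e <= 1 + s * t.
  move=> /andP[s1 s2]; have e1 : 2 * e <= 1 by rewrite /e mulrC divfK // ge_min lexx.
  have e2 : 2 * e <= 1 + t by rewrite /e mulrC divfK // ge_min lexx orbT.
  have /andP[h1 h2] : - e <= q * t <= e.
    rewrite -ler_norml normrM (gtr0_norm q0) /q mulrAC ler_pdivrMr ?ltr_wpDl //.
    by rewrite ler_wpM2l ?(ltW e0) // lerDl.
  have [t0|t0] := leP 0 t.
    by have : - q * t <= s * t by [rewrite ler_wpM2r // ltW]; lra.
  have : (1 + q) * t <= s * t by rewrite ler_wnM2r // ltW.
  by rewrite mulrDl mul1r; lra.
(* Uniform control of supports: for y = x M + s (x u) w, the product y v equals (x u) (1 + s t).
   This bounds x u, then x M = y - s (x u) w, and finally x. *)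
pose v := invmx M *m u; pose D := A + (1 + q) * (m%:R * A * `|v| / e) * `|w|.
pose B := m%:R * D * `|invmx M|.
have out s x : - q < s < 1 + q -> B < `|x| -> g (x *m M + s *: (x *m (u *m w))) = 0.
  move=> hs xB; apply: gA; rewrite leNgt; apply/negP; set y := _ + _ => yA.
  pose a := (x *m u) 0 0; have yE : y = x *m M + (s * a) *: w.
    by rewrite /y mulmxA [x *m u]mx11_scalar mul_scalar_mx scalerA.
  have se := ste s hs; have st0 : 0 < 1 + s * t by apply: lt_le_trans se.
  have av : (y *m v) 0 0 = a * (1 + s * t).
    by rewrite yE mulmxDl /v !mulmxA mulmxK // -!scalemxAl mxE [X in _ + X]mxE -/t -/a; ring.
  have ba : `|a| <= m%:R * A * `|v| / e.
    rewrite ler_pdivlMr //; apply: le_trans (_ : `|a| * (1 + s * t) <= _); first exact: ler_wpM2l.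
    rewrite -{1}(gtr0_norm st0) -normrM -av; apply: le_trans (coord_le_norm _ _ _) _.
    by apply: le_trans (norm_mulmx _ _) _; rewrite ler_wpM2r // ler_wpM2l // ltW.
  have bs : `|s| <= 1 + q by move/andP: hs => [h1 h2]; rewrite ler_norml; apply/andP; lra.
  have bD : `|x *m M| <= D.
    rewrite (_ : x *m M = y - (s * a) *: w); last by rewrite yE addrK.
    apply: le_trans (ler_normB _ _) _; apply: lerD; first exact: ltW.
    by rewrite normrZ normrM ler_wpM2r // ler_pM.
  have := norm_mulmx (x *m M) (invmx M); rewrite mulmxK // leNgt => /negP; apply.
  by apply: le_lt_trans xB; rewrite ler_wpM2r // ler_wpM2l.
have sl (N : 'M[R]_m) : smooth_on setT (fun x : E => x *m N) by [].
have conv N : (fun x : E => if `[< setT x >] then g (x *m N) * \det (jac (mulmx^~ N) x) else 0) = fun x => g (x *m N) * \det N.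
  by apply/funext => x; rewrite asboolT // jac_linear.
have pull N : 0 < \det N -> I (fun x => g (x *m N) * \det N) = phi N.
  move=> dN; have [sN [a [a0 Na]]] := compact_smooth_mulmx (unit_of dN) cg.
  rewrite mulrC -(iterated_integral_scale (A := a)) //; first by congr iterated_integral; apply/funext => x; rewrite mulrC.
  by split=> // x; exact: (smooth_cont sN).
rewrite -(pull M d0) -(pull _ d1) -!conv.
apply: (homotopy_change q0 openT (closed_ball_norm_compact (A := B))) => // s x hs _.
  by rewrite !jac_linear addrAC subrr add0r unitmxE unitfE dE gt_eqF // mulr_gt0 //; exact: lt_le_trans (ste s hs).
by move=> /negP; rewrite -ltNge => xB; rewrite mulmxDr addrAC subrr add0r; exact: out.
Qed.

(** Rows are made standard one at a time by rank one modifications that keep the determinant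
    positive; [k] counts those still to be treated. *)
Lemma linear_change_from k (M : 'M[R]_m) : (k <= m)%N -> 0 < \det M ->
  (forall i : 'I_m, (i < m - k)%N -> row i M = delta_mx 0 i) -> phi M = I g.
Proof.
elim: k M => [|k IH] M km dM Mrow.
  have -> : M = 1%:M by apply/row_matrixP => i; rewrite Mrow ?subn0 // row1.
  by rewrite det1 mulr1; congr iterated_integral; apply/funext => x; rewrite mulmx1.
have pm : (m - k.+1 < m)%N by rewrite ltn_subrL (leq_trans _ km).
pose p := Ordinal pm; have {}Mrow (i : 'I_m) : (i < p)%N -> row i M = delta_mx 0 i by exact: Mrow.
pose B (N : 'M[R]_m) := invmx N; pose fixed (N : 'M[R]_m) := forall i : 'I_m, (i < p)%N -> row i N = delta_mx 0 i :> E.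
have rowD (N : 'M[R]_m) (j i : 'I_m) (w : E) : row i (N + delta_mx j 0 *m w) = row i N + (i == j)%:R *: w.
  by rewrite linearD /= row_mul; apply/rowP => l; rewrite !mxE big_ord1 !mxE andbT.
have entry (N : 'M[R]_m) (w : E) j : (w *m B N *m delta_mx j (0 : 'I_1)) 0 0 = (w *m B N) 0 j.
  by rewrite -colE mxE.
(* Adding a multiple of row l to row j keeps the determinant and subtracts a multiple of column j of
   the inverse from its column l. *)
have shear (N : 'M[R]_m) (j l : 'I_m) t : 0 < \det N -> j != l -> exists N' : 'M[R]_m, [/\ 0 < \det N', phi N = phi N',
    forall i, i != j -> row i N' = row i N & forall i b, B N' i b = B N i b - t * B N i j * (b == l)%:R].
  move=> dN jac_linear; have uN := unit_of dN; pose w := t *: row l N; pose N' := N + delta_mx j 0 *m w; exists N'.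
  have dE : \det N' = \det N.
    rewrite det_shift // entry -scalemxAl -row_mul mulmxV // row1 !mxE eqxx /= (negPf jac_linear).
    by rewrite mulr0 addr0 mulr1.
  have dN' : 0 < \det N' by rewrite dE.
  split=> //; [exact: rank_one_change|by move=> i ij; rewrite rowD (negPf ij) scale0r addr0|].
  pose X := B N - t *: (B N *m delta_mx j l).
  have XE : X *m N' = 1%:M.
    have E1 : delta_mx j l *m N = delta_mx j 0 *m row l N.
      by rewrite rowE mulmxA mul_delta_mx.
    rewrite mulmxBl !mulmxDr mulVmx // -!scalemxAl -!mulmxA E1 -scalemxAr -!scalemxAr.
    rewrite [delta_mx j l *m (_ *m _)]mulmxA mul_delta_mx_0 1?eq_sym // mul0mx mulmx0 !scaler0 addr0.
    by rewrite addrK.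
  move=> i b; have -> : B N' = X by rewrite -[X](mulmxK (unit_of dN')) XE mul1mx.
  rewrite !mxE (bigD1 j) //= big1 ?addr0 => [|a aj]; last by rewrite mxE (negPf aj) mulr0.
  by rewrite mxE eqxx mulrA.
(* Making row p standard multiplies the determinant by the entry (p, p) of the inverse, which must
   therefore be positive. *)
have good (N : 'M[R]_m) : 0 < \det N -> fixed N -> 0 < B N p p -> phi N = I g.
  move=> dN Nrow Bpp; have uN := unit_of dN; pose w := delta_mx 0 p - row p N.
  have dN' : 0 < \det (N + delta_mx p 0 *m w).
    rewrite det_shift // mulr_gt0 // entry /w mulmxBl -rowE -row_mul mulmxV // row1 !mxE !eqxx.
    by rewrite (_ : 1 + _ = B N p p) //=; ring.
  rewrite (rank_one_change dN dN'); apply: IH => //; first exact: ltnW.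
  move=> i; rewrite -[(m - k)%N](subnSK km) ltnS leq_eqVlt rowD => /orP[/eqP ip|ip].
    by rewrite (_ : i = p) ?eqxx ?scale1r 1?addrC ?subrK //; exact: val_inj.
  by rewrite Nrow // (_ : i == p = false) ?scale0r ?addr0 //; rewrite -val_eqE ltn_eqF.
(* If row p of the inverse has a nonzero entry to the right of the diagonal, a shear makes its
   diagonal entry equal to 1. *)
have good2 (N : 'M[R]_m) (j : 'I_m) : 0 < \det N -> fixed N -> (p < j)%N -> B N p j != 0 -> phi N = I g.
  move=> dN Nrow pj Bpj; have jp : j != p by rewrite -val_eqE gtn_eqF.
  have [N' [dN' -> rN' BN']] := shear N j p ((B N p p - 1) / B N p j) dN jp.
  apply: good => // [i ip|]; last by rewrite BN' eqxx mulr1 divfK // subKr.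
  by rewrite rN' ?Nrow // -val_eqE ltn_eqF // (ltn_trans ip).
have uM := unit_of dM.
have [[j pj Bpj]|noj] := pselect (exists2 j : 'I_m, (p < j)%N & B M p j != 0); first exact: (good2 M j).
have Bp0 (j : 'I_m) : (p < j)%N -> B M p j = 0.
  by move=> pj; apply/eqP; apply: contrapT => /negP h; apply: noj; exists j.
(* In the last row no shear is available, but there the diagonal entry is the inverse of the
   determinant. *)
have [mp|pm'] := leqP m p.+1.
  apply: good => //; rewrite /B /invmx uM mxE pmulr_rgt0 ?invr_gt0 // mxE /cofactor addnn -muln2 mulnC exprM sqrrN !expr1n mul1r.
  rewrite (_ : row' p _ = 1%:M) ?det1 //; apply/matrixP => i j; rewrite !mxE.
  have ip : (lift p i < p)%N.
    have h : (lift p i <= p)%N by rewrite -ltnS (leq_trans (ltn_ord _)).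
    by rewrite ltn_neqAle h andbT eq_sym; exact: neq_lift.
  have /rowP/(_ (lift p j)) := Mrow _ ip; rewrite !mxE eqxx /= => ->.
  by rewrite (inj_eq lift_inj) eq_sym.
have Bpp : B M p p != 0.
  apply: contraTneq (oner_neq0 R) => Bpp.
  have := congr1 (fun X : 'M[R]_m => X p p) (mulVmx uM); rewrite !mxE eqxx mulr1n => <-; rewrite negbK.
  rewrite big1 // => i _; have [ip|] := ltnP i p.
    by have /rowP/(_ p) := Mrow i ip; rewrite !mxE eqxx /= => ->; rewrite -val_eqE gtn_eqF ?mulr0.
  rewrite leq_eqVlt => /orP[/eqP pi|pi]; last by rewrite -/(B M) Bp0 ?mul0r.
  by rewrite -(_ : p = i) -/(B M) ?Bpp ?mul0r //; exact: val_inj.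
(* In the remaining case, adding the next row to row p creates a nonzero entry beside the
   diagonal. *)
pose j := Ordinal pm'; have pj : p != j by rewrite -val_eqE /= ltn_eqF.
have [N' [dN' -> rN' BN']] := shear M p j 1 dM pj.
apply: (good2 N' j) => // [i ip|]; first by rewrite rN' ?Mrow // -val_eqE ltn_eqF.
by rewrite BN' eqxx mulr1 mul1r Bp0 // sub0r oppr_eq0.
Qed.

Theorem linear_change (M : 'M[R]_m) : 0 < \det M -> phi M = I g.
Proof. by move=> dM; apply: (@linear_change_from m) => // i; rewrite subnn. Qed.
End LinearChange.

Section LocalChange.
Variables (R : realType) (m : nat).
Local Notation E := 'rV[R]_m.
Local Notation I f := (iterated_integral f).

Lemma iterated_integral_translate (g : E -> R) (v : E) : compact_smooth g -> I (fun x => g (x + v)) = I g.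
Proof.
move=> [sg [A [A0 gA]]].
have E0 w : (fun x : E => if `[< setT x >] then g (x + w) * \det (jac (fun y : E => y + w) x) else 0) = fun x => g (x + w).
  by apply/funext => x; rewrite asboolT // jac_translate det1 mulr1.
have -> : I g = I (fun x => g (x + 0)) by congr iterated_integral; apply/funext => x; rewrite addr0.
rewrite -(E0 v) -(E0 0); apply/esym; have st := @smooth_translate R m.
apply: (homotopy_change ltr01 openT (closed_ball_norm_compact (A := A + 2 * `|v|))) => // s x hs _.
  by rewrite !jac_translate subrr scaler0 addr0 unitmx1.
move=> /negP; rewrite -ltNge => xA; apply: gA; rewrite addr0 addrAC subrr add0r.
have s2 : `|s| <= 2 by move/andP: hs => [h1 h2]; rewrite ler_norml; apply/andP; lra.
have h : `|s *: v| <= 2 * `|v| by rewrite normrZ ler_wpM2r.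
by have := ler_normB (x + s *: v) (s *: v); rewrite addrK; lra.
Qed.

(** Near [x0] the map is deformed to a translation. Their Jacobians differ so little that the whole
    segment, for parameters in (-1, 2), has invertible Jacobian. *)
Lemma local_change1 (U : set E) (F : E -> E) x0 : open U -> smooth_on U F -> U x0 -> jac F x0 = 1%:M ->
  exists2 r, 0 < r & ball x0 r `<=` U /\ exists2 d, 0 < d & forall g : E -> R, compact_smooth g ->
    (forall y, g y != 0 -> `|y - F x0| < d) ->
    I (fun x => if `[< ball x0 r x >] then g (F x) * \det (jac F x) else 0) = I g.
Proof.
move=> oU sF Ux0 J1; have q4 : 0 < 4^-1 :> R by rewrite invr_gt0.
have [r r0 [rU Hr]] := linear_approximation oU sF Ux0 q4; rewrite J1 in Hr; exists r => //; split=> //.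
(* The accuracy 1/4 and |s| <= 2 give |x - x0| <= |image - F x0| + |x - x0| / 2, so points with
   image within r / 4 of F x0 lie within r / 2 of x0. *)
exists (r / 4) => [|g cg gd]; first by rewrite divr_gt0.
pose v := F x0 - x0; have gv x : g (x + v) != 0 -> ball x0 r x.
  move=> /gd; rewrite /v addrA addrAC addrK -ball_normE /= distrC => h; apply: lt_trans h _.
  by rewrite ltr_pdivrMr // ltr_pMr //; lra.
rewrite -(iterated_integral_translate v cg).
have -> : (fun x => g (x + v)) = fun x => if `[< ball x0 r x >] then g (x + v) * \det (jac (fun y : E => y + v) x) else 0.
  apply/funext => x; case: asboolP => [_|]; first by rewrite jac_translate det1 mulr1.
  by move=> nb; apply/eqP; apply: contrapT => /negP /gv.
have r2 : 0 < r / 2 by exact: divr_gt0.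
have [sg _] := cg; apply/esym.
have oB : open (ball x0 r : set E) by exact: ball_open.
apply: (homotopy_change ltr01 oB (K := closed_ball x0 (r / 2))) => //.
- apply: (subclosed_compact _ (closed_ball_norm_compact (A := `|x0| + r / 2))); first exact: closed_ball_closed.
  move=> x; rewrite closed_ballE // /closed_ball_ /= => h; have := ler_normD x0 (x - x0); rewrite [`|x - x0|]distrC addrC subrK; lra.
- move=> x; rewrite closed_ballE // -ball_normE /closed_ball_ /= => h; apply: le_lt_trans h _; lra.
- exact: smooth_subset sF.
- move=> s x /andP[h1 h2] /Hr[hx _]; rewrite jac_translate; apply: unitmx_near1.
  have s2 : `|s| <= 2 by rewrite ler_norml; apply/andP; split; lra.
  by rewrite normrZ mulrCA; apply: le_lt_trans (_ : 2 * 4^-1 < 1); [apply: ler_pM => //; rewrite mulr_ge0|lra].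
move=> s x /andP[h1 h2] bx nK; apply/eqP; apply: contrapT => /negP /gd h; apply: nK.
rewrite closed_ballE // /closed_ball_ /= distrC.
have [_ /(_ x0 (ballxx _ r0))] := Hr x bx; rewrite mulmx1 => hx.
have s2 : `|s| <= 2 by rewrite ler_norml; apply/andP; split; lra.
set w := F x - F x0 - (x - x0) in hx.
have hs : `|s *: w| <= 2 * (4^-1 * `|x - x0|) by rewrite normrZ ler_pM.
have E1 : x - x0 = (x + v + s *: (F x - (x + v)) - F x0) - s *: w.
  rewrite (_ : F x - (x + v) = w); first by rewrite /v; apply/rowP => j; rewrite !mxE; ring.
  by rewrite /w /v; apply/rowP => j; rewrite !mxE; ring.
by have := ler_normB (x + v + s *: (F x - (x + v)) - F x0) (s *: w); rewrite -E1; lra.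
Qed.

(** The Jacobian at [x0] is split off as a linear factor, for which [linear_change] holds; its
    positive determinant fixes the orientation. *)
Theorem local_change (U : set E) (F : E -> E) x0 : open U -> smooth_on U F -> U x0 -> 0 < \det (jac F x0) ->
  exists2 r, 0 < r & ball x0 r `<=` U /\ exists2 d, 0 < d & forall g : E -> R, compact_smooth g ->
    (forall y, g y != 0 -> `|y - F x0| < d) ->
    I (fun x => if `[< ball x0 r x >] then g (F x) * \det (jac F x) else 0) = I g.
Proof.
move=> oU sF Ux0; set A := jac F x0 => dA; have uA : A \in unitmx by rewrite unitmxE unitfE gt_eqF.
have sFA : smooth_on U (fun x => F x *m invmx A) by [].
have JA x : U x -> jac (fun x => F x *m invmx A) x = jac F x *m invmx A.
  move=> Ux; rewrite (jac_comp (g := fun y => y *m invmx A)) ?jac_linear //.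
  exact: smooth_differentiable_row openT (smooth_linear (invmx A) openT) Logic.I.
have [|r r0 [rU [d d0 H]]] := local_change1 oU sFA Ux0; first by rewrite JA ?mulmxV.
exists r => //; split=> //; pose C := m%:R * `|invmx A|; have C0 : 0 <= C by exact: mulr_ge0.
exists (d / (C + 1)) => [|g cg gd]; first by rewrite divr_gt0 // ltr_wpDl.
have cgA := compact_smooth_mulmx uA cg.
have [sgA [B [B0 gB]]] := cgA.
have cG : compact_smooth (fun y => \det A * g (y *m A)).
  by split; [apply: smoothM openT _ _ => //; exact: smooth_cst|exists B; split=> // y /gB ->; rewrite mulr0].
rewrite -(linear_change cg dA) mulrC -(iterated_integral_scale (A := B)) => [|]; last first.
  by split=> // x; exact: (smooth_cont sgA).
rewrite -(H _ cG) => [|y]; last first.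
  rewrite mulf_eq0 negb_or => /andP[_ /gd]; rewrite ltr_pdivlMr ?ltr_wpDl // => h.
  have -> : y - F x0 *m invmx A = (y *m A - F x0) *m invmx A by rewrite mulmxBl mulmxK.
  by apply: le_lt_trans (norm_mulmx _ _) (le_lt_trans _ h); rewrite mulrAC mulrC ler_wpM2l // /C lerDl.
congr iterated_integral; apply/funext => x; case: asboolP => // /rU Ux.
by rewrite JA // mulmxKV // det_mulmx det_inv; field; rewrite gt_eqF.
Qed.
End LocalChange.

(** * Smooth actions and their fundamental fields *)

Section Curves.
Variables (R : realType) (p q : nat).

Lemma mulmx_jac (G : 'rV[R]_p -> 'rV[R]_q) y (v : 'rV[R]_p) : differentiable G y -> v *m jac G y = 'd G y v.
Proof. by move=> dG; rewrite -jacE /jacobian mul_rV_lin1. Qed.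

Lemma curve_jac (g : R -> 'rV[R]_p) (G : 'rV[R]_p -> 'rV[R]_q) (t : R) (v : 'rV[R]_p) :
  is_derive t (1 : R) g v -> differentiable G (g t) ->
  is_derive t (1 : R) (fun s => G (g s)) (v *m jac G (g t)).
Proof.
move=> [dg vE] dG; have dg' : differentiable g t by apply/derivable1_diffP.
have dGg : differentiable (G \o g) t by exact: differentiable_comp.
apply: DeriveDef; first exact: diff_derivable.
by rewrite -vE deriveE // mulmx_jac // deriveE // (diff_comp dg' dG).
Qed.

Lemma affine_derive (w v : 'rV[R]_p) (t : R) : is_derive t (1 : R) (fun s : R => s *: v + w) v.
Proof.
have E1 : (fun h : R => h^-1 *: ((h *: (1 : R) + t) *: v + w - (t *: v + w))) @ 0^' --> v.
  apply: cvg_near_cst; near=> h.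
  have h0 : h != 0 by near: h; exact: nbhs_dnbhs_neq.
  by rewrite opprD addrACA subrr addr0 -scalerBl addrK scalerA [h *: _]mulr1 mulVf ?scale1r.
have dv : derivable (fun s : R => s *: v + w) t (1 : R) by apply/cvg_ex; exists v.
by apply: DeriveDef => //; apply: cvg_lim.
Unshelve. all: by end_near. Qed.
End Curves.

Lemma curve_coord (R : realType) p (g : R -> 'rV[R]_p) (t : R) v i :
  is_derive t (1 : R) g v -> is_derive t (1 : R) (fun s => g s 0 i : R) (v 0 i).
Proof.
move=> [dg vE].
have c1 : (fun h : R => h^-1 *: (g (h *: (1 : R) + t) - g t)) @ 0^' --> v by rewrite -vE.
have c2 : (fun h : R => h^-1 *: (g (h *: (1 : R) + t) 0 i - g t 0 i)) @ 0^' --> v 0 i.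
  have ci := smooth_cont (smooth_coord setT i) (x := v) Logic.I.
  have := cvg_comp _ _ c1 ci; apply: cvg_trans; apply: near_eq_cvg; near=> h.
  by rewrite /= !mxE.
have dc : derivable (fun s => g s 0 i : R) t (1 : R) by apply/cvg_ex; exists (v 0 i).
by apply: DeriveDef => //; apply: cvg_lim.
Unshelve. all: by end_near. Qed.

Section ActionFields.
Variables (R : realType) (m : nat) (M : manifold R m) (k : nat) (rho : 'rV[R]_k -> M -> M).
Hypothesis act : smooth_action rho.
Local Notation E := 'rV[R]_m.
Local Notation chartM := (chart R M m).
Implicit Types (c d : chartM) (a b : 'rV[R]_k).

Lemma action0 p : rho 0 p = p. Proof. by case: act. Qed.
Lemma actionD a b p : rho (a + b) p = rho a (rho b p). Proof. by case: act. Qed.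

Definition action_dom c d : set 'rV[R]_(k + m) := [set z | ccod c (rsubmx z) /\
  cdom d (rho (lsubmx z) (cinv c (rsubmx z)))].
Definition action_map c d (z : 'rV[R]_(k + m)) : E := d (rho (lsubmx z) (cinv c (rsubmx z))).

Lemma action_spec c d : smooth_chart c -> smooth_chart d ->
  open (action_dom c d) /\ smooth_on (action_dom c d) (action_map c d).
Proof. by move=> sc sd; case: act => _ _ /(_ c d sc sd). Qed.

Lemma smooth_action_map a : smooth_map (rho a).
Proof.
move=> c d sc sd; have [oA sA] := action_spec sc sd.
have sr : smooth_on setT (fun x : E => row_mx a x).
  by apply: smooth_row_mx; [exact: openT|exact: smooth_cst|exact: smooth_id openT].
have E1 : local_dom (rho a) c d = [set x | setT x /\ action_dom c d (row_mx a x)].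
  by apply/seteqP; split=> x; rewrite /action_dom /local_dom /= row_mxKl row_mxKr; case.
have oL : open (local_dom (rho a) c d).
  by rewrite E1; apply: open_preim => // [|x _]; [exact: openT|exact: (smooth_cont sr)].
split=> //; apply: (smooth_ext oL (f := fun x => action_map c d (row_mx a x))).
  by move=> x _; rewrite /action_map row_mxKl row_mxKr.
apply: (smooth_comp_mx oL oA) => //; last exact: smooth_subset sr.
by move=> x [cx dx]; rewrite /action_dom /= row_mxKl row_mxKr.
Qed.

Lemma orbit_derive c d x a b (t : R) : smooth_chart c -> smooth_chart d -> ccod c x ->
  cdom d (rho (t *: a + b) (cinv c x)) ->
  is_derive t (1 : R) (fun s : R => d (rho (s *: a + b) (cinv c x)))
    (row_mx a 0 *m jac (action_map c d) (row_mx (t *: a + b) x)).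
Proof.
move=> sc sd cx dx; have [oA sA] := action_spec sc sd.
pose g s : 'rV[R]_(k + m) := row_mx (s *: a + b) x.
have gE : g = fun s : R => s *: row_mx a 0 + row_mx b x.
  by apply/funext => s; rewrite scale_row_mx add_row_mx scaler0 add0r.
have dg : is_derive t (1 : R) g (row_mx a 0) by rewrite gE; exact: affine_derive.
have := curve_jac (G := action_map c d) dg.
rewrite /action_map (_ : (fun s => _) = fun s : R => d (rho (s *: a + b) (cinv c x))); last first.
  by apply/funext => s; rewrite row_mxKl row_mxKr.
apply; apply: (smooth_differentiable_row oA sA).
by rewrite /action_dom /= row_mxKl row_mxKr.
Qed.

Local Notation X := (fundamental_field rho).

Lemma fundamental_fieldE a c x : smooth_chart c -> ccod c x ->
  X a c x = row_mx a 0 *m jac (action_map c c) (row_mx 0 x).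
Proof.
move=> sc cx; rewrite /fundamental_field derive1E.
have := @orbit_derive c c x a 0 0 sc sc cx; rewrite scale0r addr0 action0 => /(_ (chart_inv_dom cx)).
rewrite (_ : (fun s => _) = fun s : R => c (rho (s *: a) (cinv c x))); first by case.
by apply/funext => s; rewrite addr0.
Qed.

Lemma fundamental_field_smooth a c : smooth_chart c -> smooth_on (ccod c) (X a c).
Proof.
move=> sc; have [oA sA] := action_spec sc sc; have oc := @chart_open_cod _ _ _ c.
apply: (smooth_ext oc (f := fun x => row_mx a 0 *m jac (action_map c c) (row_mx 0 x))).
  by move=> x cx; rewrite fundamental_fieldE.
apply: smooth_mulmx => //.
apply: (smooth_comp_mx oc oA _ (smooth_jac oA sA)) => [x cx|].
  by rewrite /action_dom /= row_mxKl row_mxKr action0; split=> //; exact: chart_inv_dom.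
by apply: smooth_row_mx => //.
Qed.

Lemma fundamental_field_derive a c x : smooth_chart c -> ccod c x ->
  is_derive (0 : R) (1 : R) (fun s : R => c (rho (s *: a) (cinv c x))) (X a c x).
Proof.
move=> sc cx; rewrite fundamental_fieldE //.
have := @orbit_derive c c x a 0 0 sc sc cx; rewrite scale0r addr0 action0 => /(_ (chart_inv_dom cx)).
by rewrite (_ : (fun s => _) = fun s : R => c (rho (s *: a) (cinv c x))) //; apply/funext => s; rewrite addr0.
Qed.

Lemma orbit_near a c (p : M) : smooth_chart c -> cdom c p -> \forall s \near (0 : R), cdom c (rho (s *: a) p).
Proof.
move=> sc cp; have cx := chart_map_cod cp; have [oA sA] := action_spec sc sc.
pose g (s : R) : 'rV[R]_(k + m) := row_mx (s *: a) (c p).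
have cg : {for (0 : R), continuous g}.
  have -> : g = fun s : R => s *: row_mx a 0 + row_mx 0 (c p).
    by apply/funext => s; rewrite scale_row_mx add_row_mx scaler0 add0r addr0.
  apply: differentiable_continuous => //.
have A0 : action_dom c c (g 0) by rewrite /action_dom /g /= row_mxKl row_mxKr scale0r action0 chart_mapK.
have H : \forall s \near (0 : R), action_dom c c (g s) := cg _ (open_nbhs_nbhs (conj oA A0)).
near=> s; have : action_dom c c (g s) by near: s.
by rewrite /action_dom /g /= row_mxKl row_mxKr chart_mapK // => -[].
Unshelve. all: by end_near. Qed.

(** The acting group is abelian, so [rho b] permutes the orbits of the flow of [a]. With [b = 0]
    this is the transformation of a field under a change of charts. *)
Lemma fundamental_field_push a b c d x : smooth_chart c -> smooth_chart d -> local_dom (rho b) c d x ->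
  X a d (local_map (rho b) c d x) = X a c x *m jac (local_map (rho b) c d) x.
Proof.
move=> sc sd [cx dx]; have [oL sL] := smooth_action_map b sc sd.
have dc : ccod d (local_map (rho b) c d x) by exact: chart_map_cod.
have [_ <-] := fundamental_field_derive a sd dc.
have h1 := curve_jac (fundamental_field_derive a sc cx) (G := local_map (rho b) c d).
rewrite scale0r action0 chart_invK // in h1.
have [_ <-] := h1 (smooth_differentiable_row oL sL (conj cx dx)).
apply: near_eq_derive; rewrite /local_map /= chart_mapK //.
have := orbit_near a sc (chart_inv_dom cx); apply: filterS => s cs.
by rewrite chart_mapK // -!actionD addrC.
Qed.

Lemma fundamental_field_orbit a c (p : M) (t : R) : smooth_chart c -> cdom c (rho (t *: a) p) ->
  is_derive t (1 : R) (fun s : R => c (rho (s *: a) p)) (X a c (c (rho (t *: a) p))).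
Proof.
move=> sc ct; have := fundamental_field_derive a sc (chart_map_cod ct); rewrite (chart_mapK ct) => -[d0 v0].
have [E1 E2] := derive_translate (fun s : R => c (rho (s *: a) (rho (t *: a) p))) (- t) t (1 : R).
rewrite subrr in E1 E2.
have Ef : (fun y : R => c (rho ((y - t) *: a) (rho (t *: a) p))) = fun s : R => c (rho (s *: a) p).
  by apply/funext => s; rewrite -actionD -scalerDl subrK.
rewrite Ef in E1 E2; apply: DeriveDef; first exact: E2.
by rewrite E1 v0.
Qed.

Lemma rho0_local c d : local_map (rho 0) c d = local_map idfun c d /\ local_dom (rho 0) c d = local_dom idfun c d.
Proof.
have -> : rho 0 = idfun by apply/funext => p; exact: action0.
by [].
Qed.
Section Flow.
Variables (a : 'rV[R]_k) (c : chartM).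
Hypothesis sc : smooth_chart c.

Let tm (z : 'rV[R]_(1 + m)) : 'rV[R]_(k + m) := row_mx (lsubmx z 0 0 *: a) (rsubmx z).

Let tmE s x : tm (pt s x) = row_mx (s *: a) x.
Proof. by rewrite /tm row_mxKl row_mxKr mxE eqxx mulr1n. Qed.

Let smooth_tm : smooth_on setT tm.
Proof.
have oT : open [set: 'rV[R]_(1 + m)] by exact: openT.
apply: smooth_row_mx => //.
  apply: smoothZmx => //.
  apply: (smooth_ext oT (f := fun z : 'rV[R]_(1 + m) => z 0 (lshift _ 0))) => //.
  by move=> z _; rewrite mxE.
apply/smooth_mxP => // i j; rewrite ord1.
apply: (smooth_ext oT (f := fun z : 'rV[R]_(1 + m) => z 0 (rshift 1 j))) => //.
by move=> z _; rewrite mxE.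
Qed.

Definition flow_dom : set 'rV[R]_(1 + m) := [set z | setT z /\ action_dom c c
  (row_mx (lsubmx z 0 0 *: a) (rsubmx z))].
Definition flow_map (z : 'rV[R]_(1 + m)) : E := action_map c c (row_mx (lsubmx z 0 0 *: a) (rsubmx z)).

Lemma flow_domE s x : flow_dom (pt s x) <-> ccod c x /\ cdom c (rho (s *: a) (cinv c x)).
Proof. by rewrite /flow_dom /action_dom /= -/(tm _) tmE row_mxKl row_mxKr; split=> [[]|]. Qed.

Lemma flow_mapE s x : flow_map (pt s x) = c (rho (s *: a) (cinv c x)).
Proof. by rewrite /flow_map /action_map -/(tm _) tmE row_mxKl row_mxKr. Qed.

Lemma flow_dom_open : open flow_dom.
Proof.
have [oA _] := action_spec sc sc.
apply: open_preim => // [|z _]; [exact: openT|exact: (smooth_cont smooth_tm)].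
Qed.

Lemma flow_map_smooth : smooth_on flow_dom flow_map.
Proof.
have [oA sA] := action_spec sc sc.
apply: (smooth_comp_mx flow_dom_open oA) sA _ => [z []//|]; exact: smooth_subset smooth_tm.
Qed.

Lemma flow_map_time x i : ccod c x -> pd (lshift m 0) (fun z => flow_map z 0 i) (pt 0 x) = X a c x 0 i.
Proof.
move=> cx; rewrite -pdE /partial.
have [E1 _] := line_derive (fun z => flow_map z 0 i) (pt 0 x) (delta_mx 0 (lshift m 0)) 0.
rewrite scale0r addr0 in E1; rewrite -E1.
have -> : (fun t : R => flow_map (pt 0 x + t *: delta_mx 0 (lshift m 0)) 0 i)
    = fun t : R => c (rho (t *: a) (cinv c x)) 0 i.
  by apply/funext => t; rewrite pt_shift_time add0r flow_mapE.
by have [_ ->] := curve_coord i (fundamental_field_derive a sc cx).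
Qed.

Local Notation pd0 := (pd (lshift m (0 : 'I_1))).
Local Notation W := flow_dom.
Local Notation H := flow_map.

Lemma flow_dom0 x : ccod c x -> W (pt 0 x) /\ H (pt 0 x) = x.
Proof.
move=> cx; split; last by rewrite flow_mapE scale0r action0 chart_invK.
by apply/flow_domE; rewrite scale0r action0; split=> //; exact: chart_inv_dom.
Qed.

Lemma flow_map_cod z : W z -> ccod c (H z).
Proof.
by have [s [y ->]] := pt_surj z; move=> /flow_domE[_ dy]; rewrite flow_mapE; exact: chart_map_cod.
Qed.

Lemma flow_pull p q (F : E -> 'M[R]_(p, q)) x : smooth_on (ccod c) F -> ccod c x ->
  smooth_on W (fun z => F (H z)) /\ pd0 (fun z => F (H z)) (pt 0 x) = \sum_l X a c x 0 l *: pd l F x.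
Proof.
move=> sF cx; have oc := @chart_open_cod _ _ _ c; have [W0 H0] := flow_dom0 cx.
have sFH := smooth_comp_mx flow_dom_open oc flow_map_cod sF flow_map_smooth; split=> //.
apply/matrixP => i j; rewrite pd_mx //.
rewrite (pd_chain (f := fun y => F y i j)).
- rewrite summxE; apply: eq_bigr => l _; rewrite H0 flow_map_time // mxE pd_mx 1?mulrC //.
- rewrite H0 //.
by move=> l; exact: (smooth_differentiable flow_dom_open (smooth_entry _ _ flow_dom_open flow_map_smooth)).
Qed.

Definition flow_jac (z : 'rV[R]_(1 + m)) : 'M[R]_m :=
  \matrix_(j, i) pd (rshift 1 j) (fun z => H z 0 i : R) z.

Let sH i : smooth_on W (fun z => H z 0 i : R).
Proof. exact: smooth_entry flow_dom_open flow_map_smooth. Qed.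

Lemma flow_jac_smooth : smooth_on W flow_jac.
Proof.
apply/(smooth_mxP _ flow_dom_open) => j i.
apply: (smooth_ext flow_dom_open (f := pd (rshift 1 j) (fun z => H z 0 i : R))) => //.
by move=> z _; rewrite mxE.
Qed.

Lemma jac_flow s y : W (pt s y) -> jac (local_map (rho (s *: a)) c c) y = flow_jac (pt s y).
Proof.
move=> Wz; have Ly := (flow_domE s y).1 Wz; have [oL sL] := smooth_action_map (s *: a) sc sc.
apply/matrixP => j i; rewrite jac_entry ?mxE; last exact: (smooth_differentiable_row oL sL).
rewrite (pd_ext (g := fun y => H (pt s y) 0 i) _ oL) //; last by move=> y' _; rewrite flow_mapE.
by rewrite (pd_graph j flow_dom_open oL (sH i) (smooth_cst _ s) Ly Wz) pd_cst mulr0 add0r.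
Qed.

Lemma flow_jac0 x : ccod c x -> flow_jac (pt 0 x) = 1%:M /\ pd0 flow_jac (pt 0 x) = jac (X a c) x.
Proof.
move=> cx; have oc := @chart_open_cod _ _ _ c; have [W0 H0] := flow_dom0 cx.
split; apply/matrixP => j i; rewrite ?pd_mx ?mxE; last exact: smooth_derivable flow_jac_smooth W0.
  have := pd_graph j flow_dom_open oc (sH i) (smooth_cst _ 0) cx W0.
  rewrite pd_cst mulr0 add0r => <-; rewrite (pd_ext (g := fun y : E => y 0 i) _ oc) ?pd_coord 1?eq_sym //.
  by move=> y /flow_dom0[_ ->].
rewrite jac_entry; last exact: (smooth_differentiable_row oc (fundamental_field_smooth a sc)).
rewrite (pd_ext (g := pd (rshift 1 j) (fun z => H z 0 i : R)) _ flow_dom_open) //; last by move=> z _; rewrite mxE.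
rewrite (schwarz _ _ flow_dom_open (sH i) W0).
have := pd_graph j flow_dom_open oc (smooth_on_pd (lshift _ 0) (sH i)) (smooth_cst _ 0) cx W0.
rewrite pd_cst mulr0 add0r => <-; apply: (pd_ext _ oc) => // y cy; exact: flow_map_time.
Qed.

Let pd0_const p q (F : E -> 'M[R]_(p, q)) (T : 'rV[R]_(1 + m) -> 'M[R]_(p, q)) x :
  (forall z, W z -> T z = F (rsubmx z)) -> ccod c x -> pd0 T (pt 0 x) = 0.
Proof.
move=> TF cx; have [W0 _] := flow_dom0 cx; rewrite (pd_ext (g := fun z => F (rsubmx z)) _ flow_dom_open W0 TF).
rewrite -pdE /partial; have [E1 _] := line_derive (fun z : 'rV[R]_(1 + m) => F (rsubmx z)) (pt 0 x) (delta_mx 0 (lshift _ 0)) 0.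
rewrite scale0r addr0 in E1; rewrite -E1 (_ : (fun t : R => _) = fun=> F x); first exact: derive_cst.
by apply/funext => t; rewrite pt_shift_time row_mxKr.
Qed.

(** The invariance is written with the Jacobian [flow_jac] as a function of time and differentiated
    at time 0, where that Jacobian is the identity: the Lie derivative along the field vanishes. *)
Lemma lie_form (F : E -> 'cV[R]_m) x : smooth_on (ccod c) F -> ccod c x ->
  (forall s y, local_dom (rho (s *: a)) c c y -> F y = jac (local_map (rho (s *: a)) c c) y *m F (local_map (rho (s *: a)) c c y)) ->
  jac (X a c) x *m F x + \sum_l X a c x 0 l *: pd l F x = 0.
Proof.
move=> sF cx inv; have [W0 H0] := flow_dom0 cx; have [sFH <-] := flow_pull sF cx; have [J0 <-] := flow_jac0 cx.
rewrite -(@pd0_const _ _ F (fun z => flow_jac z *m F (H z)) x _ cx).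
  rewrite (pd_mulmx (smooth_derivable flow_jac_smooth W0) (smooth_derivable sFH W0)).1.
  by rewrite J0 mul1mx H0.
move=> z; have [s [y ->]] := pt_surj z => Wz; rewrite row_mxKr (inv s y) ?jac_flow ?flow_mapE //.
exact/flow_domE.
Qed.

Lemma lie_metric (F : E -> 'M[R]_m) x : smooth_on (ccod c) F -> ccod c x ->
  (forall s y, local_dom (rho (s *: a)) c c y -> F y = jac (local_map (rho (s *: a)) c c) y
     *m F (local_map (rho (s *: a)) c c y) *m (jac (local_map (rho (s *: a)) c c) y)^T) ->
  jac (X a c) x *m F x + F x *m (jac (X a c) x)^T + \sum_l X a c x 0 l *: pd l F x = 0.
Proof.
move=> sF cx inv; have [W0 H0] := flow_dom0 cx; have [sFH <-] := flow_pull sF cx; have [J0 <-] := flow_jac0 cx.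
have oW := flow_dom_open; have sJ := flow_jac_smooth; have sJF := smooth_mulmx oW sJ sFH.
have sJT := smooth_trmx oW sJ.
rewrite -(@pd0_const _ _ F (fun z => flow_jac z *m F (H z) *m (flow_jac z)^T) x _ cx).
  rewrite (pd_mulmx (smooth_derivable sJF W0) (smooth_derivable sJT W0)).1.
  rewrite (pd_mulmx (smooth_derivable sJ W0) (smooth_derivable sFH W0)).1.
  rewrite J0 !mul1mx trmx1 mulmx1 H0 addrAC; congr (_ + _); congr (_ *m _).
  apply/matrixP => i j; rewrite mxE !pd_mx //.
  by congr (pd _ _ _); apply/funext => z; rewrite [RHS]mxE.
move=> z; have [s [y ->]] := pt_surj z => Wz; rewrite row_mxKr (inv s y) ?jac_flow ?flow_mapE //.
exact/flow_domE.
Qed.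
End Flow.
End ActionFields.

(** * Charts adapted to a flow *)

Section AdaptedCharts.
Variables (R : realType) (q : nat) (M : manifold R (1 + q)) (k : nat) (rho : 'rV[R]_k -> M -> M).
Hypothesis act : smooth_action rho.
Local Notation E := 'rV[R]_(1 + q).
Local Notation chartM := (chart R M (1 + q)).
Local Notation X := (fundamental_field rho).
Implicit Types (c d : chartM).

(* Flow boxes: the first coordinate is the time of the flow of b. *)
Definition adapted (b : 'rV[R]_k) d (r : R) := [/\ smooth_chart d, 0 < r, ccod d = ball (0 : E) r &
  forall t s (y : 'rV[R]_q), ccod d (pt t y) -> ccod d (pt s y) ->
    cinv d (pt s y) = rho ((s - t) *: b) (cinv d (pt t y))].

Lemma adapted_exists b c p : smooth_chart c -> cdom c p -> X b c (c p) != 0 ->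
  exists d r, [/\ adapted b d r, cdom d p & d p = 0].
Proof.
move=> sc cp X0; set x0 := c p in X0; pose W := flow_dom rho b c; pose H := flow_map rho b c.
have oW : open W by exact: flow_dom_open.
have sH : smooth_on W H by exact: flow_map_smooth.
have cx0 : ccod c x0 by exact: chart_map_cod.
have [W0 H0] := flow_dom0 act b cx0; rewrite -/W -/H in W0 H0.
(* [row_ebase] completes the direction of the field to a basis: the rows of [P] span the transversal
   from which the flow starts. *)
pose B := row_ebase (X b c x0); have uB : B \in unitmx := row_ebase_unit _.
pose P : 'M[R]_(q, 1 + q) := dsubmx (B : 'M[R]_(1 + q)).
pose La := block_mx (1%:M : 'M[R]_1) (0 : 'M[R]_(1, 1 + q)) 0 P.
pose L z := z *m La + pt 0 x0.
have LE t y : L (pt t y) = pt t (y *m P + x0).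
  by rewrite /L mul_row_block mulmx1 !mulmx0 addr0 add0r ptD addr0.
have sL : smooth_on setT L.
  by apply: smoothDmx; [exact: openT|exact: smooth_linear openT|exact: smooth_cst].
pose V := [set z | setT z /\ W (L z)].
have oV : open V := open_preim openT oW (fun z _ => smooth_cont sL (Logic.I : setT z)).
have L0 : L 0 = pt 0 x0 by rewrite /L mul0mx add0r.
have V0 : V 0 by split=> //=; rewrite L0.
pose v z := H (L z).
have sv : smooth_on V v.
  by apply: (smooth_comp_mx oV oW _ sH) => [z []|] //; exact: smooth_subset sL.
have uJ : jac v 0 \in unitmx.
  have dL : differentiable L 0 by exact: (smooth_differentiable_row openT sL).
  have JL : jac L 0 = La.
    rewrite /L (jac_comp (f := fun z : E => z *m La) (g := fun z => z + pt 0 x0)); last 2 first.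
    - exact: (smooth_differentiable_row openT (smooth_linear La openT)).
    - done.
    by rewrite jac_linear jac_translate mulmx1.
  have dH : differentiable H (L 0) by rewrite L0.
  rewrite /v (jac_comp dL dH) JL L0.
  have -> : jac H (pt 0 x0) = col_mx (X b c x0) 1%:M.
    apply/matrixP => i j; rewrite jac_entry //.
    case: (split_ordP i) => l ->; rewrite ?col_mxEu ?col_mxEd ?(ord1 l) ?(flow_map_time act b sc j cx0) //.
    by have [<- _] := flow_jac0 act b sc cx0; rewrite mxE.
  rewrite /La mul_block_col !mul1mx !mul0mx addr0 add0r mulmx1.
  have [a a0 ->] : exists2 a : R, a != 0 & X b c x0 = a%:M *m usubmx (B : 'M[R]_(1 + q)).
    exists (col_ebase (X b c x0) 0 0).
      by have := col_ebase_unit (X b c x0); rewrite unitmxE det_mx11 unitfE.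
    rewrite -[LHS]mulmx_ebase rank_rV X0 -[_%:M]mx11_scalar -mulmxA; congr (_ *m _).
    by rewrite -/B -[B in LHS]vsubmxK pid_mx_row mul_row_col mul1mx mul0mx addr0.
  rewrite -[col_mx _ _](_ : block_mx a%:M 0 0 1%:M *m B = _).
    by rewrite unitmx_mul uB andbT unitmxE det_lblock det1 mulr1 det_mx11 mxE unitfE a0.
  by rewrite -[B in LHS]vsubmxK mul_block_col !mul0mx mul1mx addr0 add0r.
have [r [u [r0 rV oA su uv]]] := inverse_function oV sv V0 uJ.
have vE t y : v (pt t y) = c (rho (t *: b) (cinv c (y *m P + x0))) by rewrite /v LE /H flow_mapE.
have Vc t y : V (pt t y) -> ccod c (y *m P + x0) /\ cdom c (rho (t *: b) (cinv c (y *m P + x0))).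
  by move=> [_ +]; rewrite LE => /flow_domE.
have oB : open (ball (0 : E) r) by exact: ball_open.
have [|||d [sd dd cd md id]] := rechart sc oA oB _ su (smooth_subset rV sv).
- by move=> _ [z /rV[_ Wz] <-]; exact: flow_map_cod Wz.
- by move=> _ [z Bz <-]; rewrite uv.
- by move=> z Bz; rewrite uv //.
have v0 : v 0 = c p by rewrite /v L0.
have B0 : ball (0 : E) r 0 by exact: ballxx.
exists d, r; split; last 2 first.
- by rewrite dd; split=> //; exists 0.
- by rewrite md -v0 uv.
split=> // t s y; rewrite cd => Bt Bs; rewrite !id !vE.
have [_ ct] := Vc _ _ (rV _ Bt); have [_ cs] := Vc _ _ (rV _ Bs).
by rewrite (chart_mapK cs) (chart_mapK ct) -(actionD act) -scalerDl subrK.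
Qed.

Section Properties.
Variables (b : 'rV[R]_k) (d : chartM) (r : R).
Hypothesis ad : adapted b d r.

Lemma adapted_smooth : smooth_chart d. Proof. by case: ad. Qed.

Lemma adapted_ccod t y : ccod d (pt t y) <-> `|t| < r /\ `|y| < r.
Proof.
case: ad => _ r0 -> _; rewrite -ball_normE /= sub0r normrN; split=> [h|[h1 h2]]; last exact: norm_pt_lt.
by split; apply: le_lt_trans h; [exact: norm_pt_geR|exact: norm_pt_ge].
Qed.

Lemma adapted_flow t s y : ccod d (pt t y) -> ccod d (pt s y) ->
  rho ((s - t) *: b) (cinv d (pt t y)) = cinv d (pt s y).
Proof. by case: ad => _ _ _ h h1 h2; rewrite (h t s). Qed.

Lemma adapted_field z : ccod d z -> X b d z = pt 1 0.
Proof.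
move=> dz; have sd := adapted_smooth; have [_ <-] := fundamental_field_derive act b sd dz.
have [t [y zE]] := pt_surj z; subst z.
have [_ <-] := affine_derive (pt t y) (pt 1 0) 0.
apply: near_eq_derive; have [ht hy] := (adapted_ccod t y).1 dz.
have [e e0 He] : exists2 e : R, 0 < e & forall s, `|s| < e -> `|t + s| < r.
  exists (r - `|t|); first by rewrite subr_gt0.
  by move=> s hs; apply: le_lt_trans (ler_normD _ _) _; rewrite -ltrBrDl.
exists e => //= s /=; rewrite sub0r normrN => hs.
have ds : ccod d (pt (t + s) y) by apply/adapted_ccod; split=> //; exact: He.
have := adapted_flow dz ds; rewrite [t + s]addrC addrK => ->.
by rewrite chart_invK [s + t]addrC // ptZ ptD mulr1 scaler0 add0r addrC.
Qed.

(** In a flow box the flow is the translation of time, whose Jacobian is the identity; hence every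
    invariant tensor has coefficients independent of time. *)
Lemma adapted_shift t s y : ccod d (pt t y) -> ccod d (pt s y) ->
  local_dom (rho ((s - t) *: b)) d d (pt t y) /\ local_map (rho ((s - t) *: b)) d d (pt t y) = pt s y.
Proof.
move=> dt ds; rewrite /local_dom /local_map /= adapted_flow //; split; last exact: chart_invK.
by split=> //; exact: chart_inv_dom.
Qed.

Lemma adapted_shift_jac t s y : ccod d (pt t y) -> ccod d (pt s y) ->
  jac (local_map (rho ((s - t) *: b)) d d) (pt t y) = 1%:M.
Proof.
move=> dt ds; have sd := adapted_smooth; have [oL sL] := smooth_action_map act ((s - t) *: b) sd sd.
have [Lt _] := adapted_shift dt ds.
pose U := [set z : E | ccod d z /\ ccod d (z + pt (s - t) 0)].
have sT := smooth_translate (pt (s - t) 0 : E).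
have oU : open U.
  apply: open_preim; [exact: chart_open_cod|exact: chart_open_cod|].
  by move=> z _; exact: (smooth_cont sT).
have Ut : U (pt t y) by split=> //=; rewrite ptD addr0 [t + _]addrC subrK.
have UL z : U z -> local_dom (rho ((s - t) *: b)) d d z /\ local_map (rho ((s - t) *: b)) d d z = z + pt (s - t) 0.
  move=> [dz dz']; have [t' [y' zE]] := pt_surj z; subst z; rewrite ptD addr0 in dz' *.
  by have := adapted_shift dz dz'; rewrite [t' + _]addrC addrK.
rewrite (jac_ext (g := fun z : E => z + pt (s - t) 0) oU Ut) //; last by move=> z /UL[].
exact: jac_translate.
Qed.
End Properties.
End AdaptedCharts.

(** * One-forms, exterior derivatives, block matrices *)

Section Pairing.
Variables (R : realType) (m : nat).
Implicit Types (v w : 'rV[R]_m) (a : 'cV[R]_m).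

Lemma pairingE v a : pairing v a = \sum_i v 0 i * a i 0.
Proof. by rewrite /pairing mxE. Qed.

Lemma pairingDl v w a : pairing (v + w) a = pairing v a + pairing w a.
Proof. by rewrite /pairing mulmxDl mxE. Qed.

Lemma pairingZl (s : R) v a : pairing (s *: v) a = s * pairing v a.
Proof. by rewrite /pairing -scalemxAl mxE. Qed.

Lemma pairingBl v w a : pairing (v - w) a = pairing v a - pairing w a.
Proof. by rewrite -scaleN1r pairingDl pairingZl mulN1r. Qed.

Lemma pairingZr (s : R) v a : pairing v (s *: a) = s * pairing v a.
Proof. by rewrite /pairing -scalemxAr mxE. Qed.

Lemma pairing_mul v (A : 'M[R]_m) a : pairing v (A *m a) = pairing (v *m A) a.
Proof. by rewrite /pairing mulmxA. Qed.

Lemma mul_outer v a w : v *m (a *m w) = pairing v a *: w.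
Proof. by rewrite mulmxA [v *m a]mx11_scalar mul_scalar_mx. Qed.

Lemma colv_ext a a' : (forall v, pairing v a = pairing v a') -> a = a'.
Proof.
move=> h; apply/colP => i; have := h (delta_mx 0 i).
by rewrite /pairing -!rowE !mxE.
Qed.

Lemma row_ext p (A B : 'M[R]_(m, p)) : (forall v, v *m A = v *m B) -> A = B.
Proof.
move=> h; apply/matrixP => i j; have /rowP/(_ j) := h (delta_mx 0 i).
by rewrite -!rowE !mxE.
Qed.

Lemma smooth_pairing p (U : set 'rV[R]_p) (f : 'rV[R]_p -> 'rV[R]_m) (g : 'rV[R]_p -> 'cV[R]_m) :
  open U -> smooth_on U f -> smooth_on U g -> smooth_on U (fun x => pairing (f x) (g x)).
Proof. by move=> oU sf sg; apply: smooth_entry => //. Qed.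

Lemma exterior_scale (U : set 'rV[R]_m) (g : 'rV[R]_m -> R) (e : 'rV[R]_m -> 'cV[R]_m) x :
  open U -> U x -> smooth_on U g -> smooth_on U e ->
  exterior (fun x => g x *: e x) x
    = g x *: exterior e x + (gradient g x *m (e x)^T - e x *m (gradient g x)^T).
Proof.
move=> oU Ux sg se; have sj j : smooth_on U (fun w => e w j 0 : R) by exact: smooth_entry.
have E1 i j : pd i (fun w => (g w *: e w) j 0 : R) x = pd i g x * e x j 0 + g x * pd i (fun w => e w j 0 : R) x.
  rewrite (pd_ext (g := fun w => g w * e w j 0) _ oU) //; first by rewrite (jet1M Ux).
  by move=> w _; rewrite mxE.
apply/matrixP => i j; rewrite mxE !E1 !mxE !big_ord1 !mxE; ring.
Qed.

Lemma exterior_ext (U : set 'rV[R]_m) (e e' : 'rV[R]_m -> 'cV[R]_m) x :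
  open U -> U x -> (forall y, U y -> e y = e' y) -> exterior e x = exterior e' x.
Proof.
move=> oU Ux ee'; apply/matrixP => i j; rewrite !mxE.
by congr (_ - _); apply: (pd_ext _ oU) => // y Uy; rewrite ee'.
Qed.

Lemma exterior_pull (U V : set 'rV[R]_m) (al : 'rV[R]_m -> 'cV[R]_m) (phi : 'rV[R]_m -> 'rV[R]_m) z :
  open U -> open V -> smooth_on U al -> smooth_on V phi -> (forall z, V z -> U (phi z)) -> V z ->
  exterior (fun z => jac phi z *m al (phi z)) z
    = jac phi z *m exterior al (phi z) *m (jac phi z)^T.
Proof.
move=> oU oV sal sphi VU Vz.
rewrite -(exterior_gauge_pullback oU oV sal sphi (@smooth_cst R m R V 0) VU Vz).
apply: (exterior_ext oV) => // y _; rewrite [X in _ + X](_ : _ = 0) ?addr0 //.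
by apply/colP => i; rewrite !mxE pd_cst.
Qed.

Lemma bracketE (U : set 'rV[R]_m) (X Y : 'rV[R]_m -> 'rV[R]_m) x : open U -> U x ->
  smooth_on U X -> smooth_on U Y -> bracket X Y x = X x *m jac Y x - Y x *m jac X x.
Proof.
move=> oU Ux sX sY; have dX := smooth_differentiable_row oU sX Ux.
have dY := smooth_differentiable_row oU sY Ux.
by rewrite /bracket !deriveE // !mulmx_jac.
Qed.

(* Cartan's formula on sections of the kernel. *)
Lemma exterior_bracket (U : set 'rV[R]_m) (e : 'rV[R]_m -> 'cV[R]_m) (X Y : 'rV[R]_m -> 'rV[R]_m) x :
  open U -> U x -> smooth_on U e -> smooth_on U X -> smooth_on U Y ->
  (forall y, U y -> pairing (X y) (e y) = 0 /\ pairing (Y y) (e y) = 0) ->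
  bil (exterior e x) (X x) (Y x) = - pairing (bracket X Y x) (e x).
Proof.
move=> oU Ux se sX sY XY0.
have key (Z : 'rV[R]_m -> 'rV[R]_m) : smooth_on U Z -> (forall y, U y -> pairing (Z y) (e y) = 0) ->
    forall v, pairing (v *m jac Z x) (e x) = - \sum_i \sum_j v 0 i * (Z x 0 j * pd i (fun w => e w j 0 : R) x).
  move=> sZ Z0 v; have dZ := smooth_differentiable_row oU sZ Ux.
  have E0 i : \sum_j (jac Z x i j * e x j 0 + Z x 0 j * pd i (fun w => e w j 0 : R) x) = 0.
    have pd0 : pd i (fun y => \sum_j Z y 0 j * e y j 0) x = 0.
      rewrite (pd_ext (g := fun=> 0) _ oU) ?pd_cst // => y Uy; by rewrite -pairingE Z0.
    rewrite -[RHS]pd0 (jet1_sum Ux) //.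
    apply: eq_bigr => j _; rewrite (jet1M Ux); [by rewrite jac_entry|exact: smooth_entry|exact: smooth_entry].
  rewrite pairingE.
  under eq_bigr do rewrite mxE mulr_suml.
  rewrite exchange_big -sumrN; apply: eq_bigr => i _ /=.
  have := E0 i; rewrite big_split /= => /eqP; rewrite addr_eq0 => /eqP E1.
  under eq_bigr do rewrite -mulrA.
  by rewrite -mulr_sumr E1 mulrN mulr_sumr.
have X0 y : U y -> pairing (X y) (e y) = 0 by move=> /XY0[].
have Y0 y : U y -> pairing (Y y) (e y) = 0 by move=> /XY0[].
rewrite (bracketE oU Ux sX sY) pairingBl (key Y) // (key X) // opprB opprK addrC.
rewrite /bil mxE; under eq_bigr do rewrite !mxE mulr_suml.
rewrite exchange_big /=.
have -> : \sum_i \sum_j Y x 0 i * (X x 0 j * pd i (fun w => e w j 0 : R) x)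
   = \sum_i \sum_j X x 0 i * Y x 0 j * pd j (fun w => e w i 0 : R) x.
  by rewrite exchange_big; apply: eq_bigr => i _; apply: eq_bigr => j _; rewrite /= mulrCA mulrA.
rewrite -sumrB; apply: eq_bigr => i _; rewrite -sumrB; apply: eq_bigr => j _; rewrite !mxE; ring.
Qed.
End Pairing.

Section BlockKernel.
Variables (R : realType) (q : nat).
Local Notation e0 := (pt 1 0 : 'rV[R]_(1 + q)).

Lemma e0_mul p (A : 'M[R]_(1 + q, p)) : e0 *m A = usubmx A.
Proof. by rewrite -{1}(vsubmxK A) mul_row_col mul1mx mul0mx addr0. Qed.

Lemma block_of_kernel (A : 'M[R]_(1 + q)) : e0 *m A = 0 -> A *m e0^T = 0 ->
  A = block_mx 0 0 0 (drsubmx A).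
Proof.
move=> h1 h2; rewrite e0_mul in h1.
have h3 : lsubmx A = 0.
  by rewrite -{1}(hsubmxK A) tr_row_mx mul_row_col trmx0 mulmx0 addr0 tr_scalar_mx mulmx1 in h2.
rewrite -[LHS]submxK; congr block_mx.
- by rewrite /ulsubmx h1 linear0.
- by rewrite /ursubmx h1 linear0.
- by apply/matrixP => i j; have /matrixP/(_ (rshift 1 i) j) := h3; rewrite !mxE.
Qed.

Lemma bil_block (A : 'M[R]_q) u v :
  bil (block_mx (0 : 'M[R]_1) 0 0 A) u v = bil A (rsubmx u) (rsubmx v).
Proof.
rewrite /bil -{1}(hsubmxK u) mul_row_block !mulmx0 add0r add0r -{1}(hsubmxK v).
by rewrite tr_row_mx mul_row_col mul0mx add0r.
Qed.

Lemma row_mul_block (A : 'M[R]_q) (u : 'rV[R]_(1 + q)) :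
  u *m block_mx (0 : 'M[R]_1) 0 0 A = row_mx 0 (rsubmx u *m A).
Proof. by rewrite -{1}(hsubmxK u) mul_row_block !mulmx0 add0r add0r. Qed.

Lemma pairing_pt (s : R) (v : 'rV[R]_q) (w : 'cV[R]_q) :
  pairing (pt s v) (col_mx (1%:M : 'M[R]_1) w) = s + (v *m w) 0 0.
Proof. by rewrite /pairing mul_row_col mulmx1 mxE [X in X + _]mxE eqxx mulr1n. Qed.

Lemma drsubmx_block_mul (c : R) (A B : 'M[R]_q) (C : 'M[R]_(q, 1)) :
  drsubmx (c *: (block_mx (0 : 'M[R]_1) 0 0 A *m (block_mx (0 : 'M[R]_1) 0 C B)^T)) = c *: (A *m B^T).
Proof.
rewrite tr_block_mx !trmx0 mulmx_block !mul0mx !mulmx0 !add0r.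
by rewrite scale_block_mx block_mxKdr.
Qed.

Lemma bil_tr (A : 'M[R]_q) u v : bil A^T u v = bil A v u.
Proof.
have E1 (M : 'M[R]_1) : M^T 0 0 = M 0 0 by rewrite mxE.
by rewrite /bil -[LHS]E1 !trmx_mul !trmxK mulmxA.
Qed.

Lemma matrix_bil_ext (A B : 'M[R]_q) : (forall u v, bil A u v = bil B u v) -> A = B.
Proof.
move=> h; apply/matrixP => i j; have := h (delta_mx 0 i) (delta_mx 0 j).
by rewrite /bil -!rowE trmx_delta -!colE !mxE.
Qed.
End BlockKernel.

(** * Integration on a compact manifold *)

Section ChartIntegral.
Variables (R : realType) (m : nat) (M : manifold R m).
Variable vol : chart R M m -> 'rV[R]_m -> R.
Local Notation E := 'rV[R]_m.
Local Notation chartM := (chart R M m).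
Local Notation I f := (iterated_integral f).
Hypothesis M_compact : compact [set: M].
Hypothesis vol_smooth : forall c, smooth_chart c -> smooth_on (ccod c) (vol c).
Hypothesis vol_change : forall c d x, smooth_chart c -> smooth_chart d -> local_dom idfun c d x ->
  vol c x = \det (jac (local_map idfun c d) x) * vol d (local_map idfun c d x).
Implicit Types (c d : chartM) (g : M -> R).
Local Notation tr c d := (local_map idfun c d).

Definition positive_chart c := smooth_chart c /\ forall x, ccod c x -> 0 < vol c x.

Definition supported_in c g := closure [set p | g p != 0] `<=` cdom c.

(** The value of [cinv] outside the codomain of the chart is arbitrary, so the integrand is cut
    there by hand; it is smooth when the support of [g] lies in the chart. *)
Definition zero_extension c g (u : E -> R) (x : E) : R :=
  if `[< ccod c x >] then g (cinv c x) * u x else 0.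

Lemma supported_in_sub c g g' : (forall p, g p = 0 -> g' p = 0) -> supported_in c g -> supported_in c g'.
Proof.
move=> gg'; apply: subset_trans; apply: closureS => p /=; by apply: contra_neq => /gg'.
Qed.

Lemma chart_support_compact c g : supported_in c g -> exists K : set E,
  [/\ compact K, forall x, K x -> ccod c x /\ closure [set p | g p != 0] (cinv c x) &
      forall x, ccod c x -> g (cinv c x) != 0 -> K x].
Proof.
move=> sg; exists (c @` closure [set p | g p != 0]); split.
- apply: continuous_compact; last by apply: (subclosed_compact _ M_compact) => //; exact: closed_closure.
  by apply: open_cont_within => p /sg; exact: chart_map_continuous.
- by move=> _ [p gp <-]; have cp := sg p gp; rewrite chart_mapK //; split=> //; exact: chart_map_cod.
- by move=> x cx gx; exists (cinv c x); [exact: subset_closure|exact: chart_invK].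
Qed.

Lemma zero_extension_out (K : set E) c g u x : (forall x, ccod c x -> g (cinv c x) != 0 -> K x) ->
  ~ K x -> zero_extension c g u x = 0.
Proof.
move=> HK nKx; rewrite /zero_extension; case: asboolP => // cx.
have [->|g0] := eqVneq (g (cinv c x)) 0; first by rewrite mul0r.
by case: nKx; exact: HK.
Qed.

Lemma zero_extension_smooth c g u : smooth_chart c -> smooth_function g -> supported_in c g ->
  smooth_on (ccod c) u -> compact_smooth (zero_extension c g u).
Proof.
move=> sc smg sg su; have [K [cK Kc HK]] := chart_support_compact sg; have [A A0 KA] := compact_bound cK.
have oc := @chart_open_cod _ _ _ c.
split; last by exists A; split=> // x Ax; apply: zero_extension_out HK _ => /KA; rewrite ltNge Ax.
apply: (smooth_zero_extension oc (compact_closed (@norm_hausdorff _ _) cK) (fun x Kx => (Kc x Kx).1)).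
  apply: (smooth_ext oc (f := fun x => g (cinv c x) * u x)); last by apply: smoothM => //.
  by move=> y cy; rewrite /zero_extension; case: asboolP.
by move=> x; exact: zero_extension_out.
Qed.

Definition chart_integral c g : R := I (zero_extension c g (vol c)).

Lemma zero_extension_ge0 c g u : (forall p, 0 <= g p) -> (forall x, ccod c x -> 0 <= u x) ->
  forall x, 0 <= zero_extension c g u x.
Proof. by move=> g0 u0 x; rewrite /zero_extension; case: asboolP => // cx; rewrite mulr_ge0 ?u0. Qed.

(** Both densities are positive, so the transition map has positive Jacobian determinant and
    [local_change] applies at the image of [p]. The set [U] confines supports to the two balls of
    that statement. *)
Lemma chart_integral_local c d p : positive_chart c -> positive_chart d -> cdom c p -> cdom d p ->
  exists U : set M, [/\ open U, U p & forall g, smooth_function g -> supported_in d g ->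
    (forall q, g q != 0 -> U q) -> chart_integral c g = chart_integral d g].
Proof.
move=> [sc pc] [sd pd_] cp dp; pose T := tr c d; have sT : smooth_on _ T := smooth_transition sc sd.
have oL := @local_dom_open R m M c d.
have cx : ccod c (c p) by exact: chart_map_cod.
have Lx : local_dom idfun c d (c p) by split=> //; rewrite chart_mapK.
have dA : 0 < \det (jac T (c p)).
  have := pc _ cx; rewrite (vol_change sc sd Lx) pmulr_lgt0 //; apply: pd_.
  by case: Lx => _ dx; exact: chart_map_cod.
have [r r0 [rL [e e0 H]]] := local_change oL sT Lx dA.
have Tp : T (c p) = d p by rewrite /T /local_map chart_mapK.
exists ([set q | cdom c q /\ ball (c p) r (c q)] `&` [set q | cdom d q /\ ball (d p) e (d q)]).
split=> [||g sg gd gU]; first by apply: openI; apply: chart_image_open; exact: ball_open.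
  by split; split=> //; exact: ballxx.
rewrite {2}/chart_integral -H; last 2 first.
- exact: zero_extension_smooth (vol_smooth sd).
- move=> y; rewrite /zero_extension; case: asboolP => [dy|]; last by rewrite eqxx.
  rewrite mulf_eq0 negb_or => /andP[/gU[_ []]]; rewrite chart_invK // -ball_normE /= Tp distrC => _ + _.
  by [].
congr iterated_integral; apply/funext => x; case: asboolP => [bx|nb].
  have Lx' := rL _ bx; have [cx' dx'] := Lx'.
  rewrite /zero_extension !asboolT //; last exact: chart_map_cod.
  by rewrite (vol_change sc sd Lx') /T /local_map /= chart_mapK // mulrCA mulrC.
rewrite /zero_extension; case: asboolP => // cx'; have [->|/gU[[_ h]]] := eqVneq (g (cinv c x)) 0; first by rewrite mul0r.
by move: h; rewrite chart_invK.
Qed.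

Lemma smooth_functionM (f g : M -> R) : smooth_function f -> smooth_function g -> smooth_function (fun p => f p * g p).
Proof. by move=> sf sg c sc. Qed.

Lemma smooth_function_linear (f g : M -> R) a : smooth_function f -> smooth_function g ->
  smooth_function (fun p => f p + a * g p).
Proof. by move=> sf sg c sc. Qed.

Lemma smooth_functionX (g : M -> R) n : smooth_function g -> smooth_function (fun p => g p ^+ n).
Proof. by move=> sg c sc. Qed.

Lemma smooth_functionV (g : M -> R) : (forall p, g p != 0) -> smooth_function g -> smooth_function (fun p => (g p)^-1).
Proof. by move=> g0 sg c sc; apply: smoothV => //; exact: chart_open_cod. Qed.

Lemma chart_restrict c p (U : set M) : smooth_chart c -> cdom c p -> open U -> U p ->
  exists a, [/\ smooth_chart a, cdom a p & cdom a `<=` U].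
Proof.
move=> sc cp oU Up; pose A := [set x | ccod c x /\ U (cinv c x)].
have oA : open A by exact: chart_preimage_open.
have sA : smooth_on A id by [].
have [|||a [sa da _ _ _]] := rechart sc oA oA _ sA sA; first by move=> x [].
- by [].
- by [].
exists a; split=> //; rewrite da; last by move=> q [cq [_]]; rewrite chart_mapK.
by split=> //; split; [exact: chart_map_cod|rewrite /= chart_mapK].
Qed.

Lemma chart_integral_linear c g g' a : smooth_chart c -> smooth_function g -> smooth_function g' ->
  supported_in c g -> supported_in c g' ->
  chart_integral c (fun p => g p + a * g' p) = chart_integral c g + a * chart_integral c g'.
Proof.
move=> sc sg sg' cg cg'; have [s1 [A [A0 gA]]] := zero_extension_smooth sc sg cg (vol_smooth sc).
have [s2 [B [B0 gB]]] := zero_extension_smooth sc sg' cg' (vol_smooth sc).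
rewrite /chart_integral -(iterated_integral_linear (A := Num.max A B)).
- by congr iterated_integral; apply/funext => x; rewrite /zero_extension; case: asboolP => _; ring.
- by split=> x; [exact: (smooth_cont s1)|rewrite ge_max => /andP[/gA]].
- by split=> x; [exact: (smooth_cont s2)|rewrite ge_max => /andP[_ /gB]].
Qed.

Lemma chart_integral0 c : chart_integral c (fun=> 0) = 0.
Proof. by apply: iterated_integral_eq0 => x; rewrite /zero_extension mul0r if_same. Qed.

Lemma chart_integral_ge0 c g : positive_chart c -> (forall p, 0 <= g p) -> 0 <= chart_integral c g.
Proof.
move=> [sc vc] g0; apply: iterated_integral_ge0; apply: zero_extension_ge0 => // x cx; exact/ltW/vc.
Qed.

Lemma smooth_function_sum (J : Type) (r : seq J) (g : J -> M -> R) : (forall j, smooth_function (g j)) ->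
  smooth_function (fun p => \sum_(j <- r) g j p).
Proof. by move=> sg c sc. Qed.

Lemma supported_in0 c : supported_in c (fun=> 0).
Proof.
by move=> p; rewrite (_ : [set _ | _] = set0) ?closure0 //; apply/seteqP; split=> q //=; rewrite eqxx.
Qed.

Lemma supported_inD c g g' a : supported_in c g -> supported_in c g' -> supported_in c (fun p => g p + a * g' p).
Proof.
move=> cg cg' p; have : [set p | g p + a * g' p != 0] `<=` [set p | g p != 0] `|` [set p | g' p != 0].
  move=> q /= h; apply: contrapT => /not_orP[/negP/negbNE/eqP g0 /negP/negbNE/eqP g'0].
  by move: h; rewrite g0 g'0 mulr0 addr0 eqxx.
by move=> /closureS/[apply]; rewrite closureU => -[/cg|/cg'].
Qed.

Lemma chart_integral_sum c (J : Type) (r : seq J) (g : J -> M -> R) : smooth_chart c ->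
  (forall j, smooth_function (g j) /\ supported_in c (g j)) ->
  chart_integral c (fun p => \sum_(j <- r) g j p) = \sum_(j <- r) chart_integral c (g j).
Proof.
move=> sc sg; suff [] : supported_in c (fun p => \sum_(j <- r) g j p) /\
   chart_integral c (fun p => \sum_(j <- r) g j p) = \sum_(j <- r) chart_integral c (g j) by [].
elim: r => [|j r [IH1 IH2]].
  rewrite big_nil (_ : (fun p => _) = fun=> 0); last by apply/funext => p; rewrite big_nil.
  by rewrite chart_integral0; split=> //; exact: supported_in0.
have [s1 c1] := sg j; rewrite (_ : (fun p => _) = fun p => \sum_(j <- r) g j p + 1 * g j p); last first.
  by apply/funext => p; rewrite big_cons mul1r addrC.
split; first exact: supported_inD.
rewrite chart_integral_linear // ?big_cons ?mul1r ?IH2 1?addrC //.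
by apply: smooth_function_sum => i; case: (sg i).
Qed.

(** A partition of unity cuts the function into pieces of small support, to each of which
    [chart_integral_local] applies. *)
Theorem chart_integral_eq c d g : positive_chart c -> positive_chart d -> smooth_function g ->
  supported_in c g -> supported_in d g -> chart_integral c g = chart_integral d g.
Proof.
move=> pc pd_ sg gc gd; pose good (U : set M) := forall g, smooth_function g -> supported_in d g ->
    (forall q, g q != 0 -> U q) -> chart_integral c g = chart_integral d g.
(* The second alternative covers the complement of the support, which need not meet either chart. *)
pose Q (a : chartM) := (exists2 U, good U & cdom a `<=` U) \/ (forall q, cdom a q -> g q = 0).
have [p|r [a [chi [aQ chiP chi1]]]] := @partition_of_unity R m M Q M_compact.
  have [gp|ngp] := pselect (closure [set p | g p != 0] p).
    have [U [oU Up gU]] := chart_integral_local pc pd_ (gc p gp) (gd p gp).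
    have [a [sa ap aU]] := chart_restrict pc.1 (gc p gp) oU Up.
    by exists a; split=> //; left; exists U.
  have [b ab bp] := atlas_cover p; have oC := closed_openC (@closed_closure _ [set p | g p != 0]).
  have [a [sa ap aU]] := chart_restrict (atlas_smooth_chart ab) bp oC ngp.
  exists a; split=> //; right=> q /aU nq; apply/eqP; apply: contrapT => /negP gq; apply: nq.
  exact: subset_closure.
have sgi i : smooth_function (fun p => chi i p * g p) by apply: smooth_functionM => //; case: (chiP i).
have supp_i b i : supported_in b g -> supported_in b (fun p => chi i p * g p).
  by apply: supported_in_sub => p ->; rewrite mulr0.
have gE : g = fun p => \sum_i chi i p * g p by apply/funext => p; rewrite -mulr_suml chi1 mul1r.
have [sc _] := pc; have [sd _] := pd_.
rewrite gE !chart_integral_sum //; last 2 first.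
- by move=> i; split=> //; exact: supp_i.
- by move=> i; split=> //; exact: supp_i.
apply: eq_bigr => i _; have [_ chi0 chis] := chiP i.
have chia q : chi i q * g q != 0 -> cdom (a i) q.
  by rewrite mulf_eq0 negb_or => /andP[h _]; apply: chis; exact: subset_closure.
have [_ [[U gU aU]|a0]] := aQ i.
  by apply: gU => //; [exact: supp_i|move=> q /chia/aU].
rewrite (_ : (fun p => _) = fun=> 0) ?chart_integral0 //; apply/funext => q; apply/eqP.
by apply: contrapT => /negP h; move: (h); rewrite (a0 q (chia q h)) mulr0 eqxx.
Qed.

Lemma smooth_function_bounded (F : M -> R) : smooth_function F -> exists2 C, 0 < C & forall p, `|F p| <= C.
Proof.
move=> /smooth_function_continuous cF.
have /compact_bounded[B [_ HB]] : compact (F @` setT).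
  by apply: continuous_compact M_compact; exact: continuous_subspaceT.
exists (Num.max 0 (B + 1) + 1); first by rewrite ltr_wpDl // le_max lexx.
move=> p; apply: (HB (Num.max 0 (B + 1) + 1)); last by exists p.
by rewrite (lt_le_trans (_ : _ < B + 1)) ?ltrDl // ler_wpDr // le_max lexx orbT.
Qed.

Definition positive_partition r (c : 'I_r -> chartM) (chi : 'I_r -> M -> R) :=
  [/\ forall i, positive_chart (c i),
      forall i, [/\ smooth_function (chi i), forall p, 0 <= chi i p & supported_in (c i) (chi i)] &
      forall p, \sum_i chi i p = 1].

Lemma chart_integral_partition r (c : 'I_r -> chartM) chi d F : positive_partition c chi ->
  positive_chart d -> smooth_function F -> supported_in d F ->
  chart_integral d F = \sum_i chart_integral (c i) (fun p => chi i p * F p).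
Proof.
move=> [pc chiP chi1] pd_ sF Fd.
have sd i : supported_in d (fun p => chi i p * F p) by apply: supported_in_sub Fd => p ->; rewrite mulr0.
have sm i : smooth_function (fun p => chi i p * F p) by apply: smooth_functionM => //; case: (chiP i).
rewrite {1}(_ : F = fun p => \sum_i chi i p * F p); last by apply/funext => p; rewrite -mulr_suml chi1 mul1r.
rewrite (chart_integral_sum _ pd_.1) //; apply: eq_bigr => i _; apply: chart_integral_eq => //.
by have [_ _ c1] := chiP i; apply: supported_in_sub c1 => p ->; rewrite mul0r.
Qed.

(** Each partition is inserted into the other; the resulting double sums agree by independence of
    the chart. *)
Lemma integral_partition_unique r (c : 'I_r -> chartM) chi r' (c' : 'I_r' -> chartM) chi' F :
  positive_partition c chi -> positive_partition c' chi' -> smooth_function F ->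
  \sum_i chart_integral (c i) (fun p => chi i p * F p) = \sum_j chart_integral (c' j) (fun p => chi' j p * F p).
Proof.
move=> P P' sF; have [pc chiP chi1] := P; have [pc' chiP' _] := P'.
have sm i : smooth_function (fun p => chi i p * F p) by apply: smooth_functionM => //; case: (chiP i).
rewrite [LHS](eq_bigr (fun i => \sum_j chart_integral (c' j) (fun p => chi' j p * (chi i p * F p)))) => [|i _]; last first.
  have [_ _ c1] := chiP i; apply: chart_integral_partition P' (pc i) (sm i) _.
  by apply: supported_in_sub c1 => p ->; rewrite mul0r.
rewrite exchange_big; apply: eq_bigr => j _ /=; have [s1 _ c1] := chiP' j.
rewrite -(chart_integral_sum _ (pc' j).1) => [|i]; last first.
  split; first by apply: smooth_functionM => //.
  by apply: supported_in_sub c1 => p ->; rewrite mul0r.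
by congr chart_integral; apply/funext => p; rewrite -mulr_sumr -mulr_suml chi1 mul1r.
Qed.
End ChartIntegral.

(** * The top-degree form built from a contact form *)

Section VolumeForm.
Variables (R : realType) (n : nat).
Local Notation J := 'I_(n.*2.+1).
Let i1 (k : 'I_n) : J := inord k.*2.+1.
Let i2 (k : 'I_n) : J := inord k.*2.+2.

Definition volume_form (a : 'cV[R]_(n.*2.+1)) (O : 'M[R]_(n.*2.+1)) : R :=
  \sum_(s : 'S_(n.*2.+1)) (-1) ^+ s * a (s ord0) 0 * \prod_(k < n) O (s (i1 k)) (s (i2 k)).

Lemma prod_pairs (F : J -> R) : \prod_i F i = F ord0 * \prod_(k < n) (F (i1 k) * F (i2 k)).
Proof.
have H m (G : nat -> R) : \prod_(i < m.*2.+1) G i = G 0 * \prod_(k < m) (G k.*2.+1 * G k.*2.+2).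
  elim: m => [|m IH]; first by rewrite big_ord1 big_ord0 mulr1.
  by rewrite doubleS !(big_ord_recr m.*2.+2) (big_ord_recr m.*2.+1) /= IH big_ord_recr /= !mulrA.
transitivity (\prod_(i < n.*2.+1) F (inord i)); first by apply: eq_bigr => i _; rewrite inord_val.
by rewrite (H n (fun i => F (inord i))); congr (F _ * _); apply: val_inj; rewrite /= inordK.
Qed.

Let split_pairs (f : {ffun J -> J}) : J * {ffun 'I_n -> J * J} :=
  (f ord0, [ffun k => (f (i1 k), f (i2 k))]).

Let split_pairs_bij : bijective split_pairs.
Proof.
apply: inj_card_bij; last first.
  by rewrite card_prod !card_ffun card_prod !card_ord expnMn -expnD addnn expnS.
move=> f g [E0 /ffunP E1]; apply/ffunP => -[[|j] hj].
  by rewrite (_ : Ordinal hj = ord0) //; exact: val_inj.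
have hk : (j./2 < n)%N by rewrite ltnS in hj; rewrite -(ltn_double) (leq_ltn_trans _ hj) // -[X in (_ <= X)%N]odd_double_half leq_addl.
have := E1 (Ordinal hk); rewrite !ffunE => -[e1 e2]; have := odd_double_half j.
case: (odd j) => /= jE.
- have jE2 : j.+1 = j./2.*2.+2 by rewrite -[in LHS]jE.
  rewrite (_ : Ordinal hj = i2 (Ordinal hk)) //; apply: val_inj; rewrite /= inordK /= -?jE2 //.
- have jE2 : j.+1 = j./2.*2.+1 by rewrite -[in LHS]jE.
  rewrite (_ : Ordinal hj = i1 (Ordinal hk)) //; apply: val_inj; rewrite /= inordK /= -?jE2 //.
Qed.

Lemma det_columns (A : 'M[R]_(n.*2.+1)) (s : 'S_(n.*2.+1)) :
  \det (\matrix_(i, j) A i (s j)) = (-1) ^+ s * \det A.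
Proof.
have -> : \matrix_(i, j) A i (s j) = col_perm s A by apply/matrixP => i j; rewrite !mxE.
by rewrite col_permE det_mulmx det_perm odd_permV mulrC.
Qed.

(** The expansion over all maps f of the index set gives determinants of matrices with columns
    chosen by f: repeated columns vanish and permutations contribute signs, as for the product of
    determinants. The bijection [split_pairs] regroups the indices into 0 and the pairs (2k + 1, 2k
    + 2). *)
Lemma volume_form_change (A : 'M[R]_(n.*2.+1)) a O :
  volume_form (A *m a) (A *m O *m A^T) = \det A * volume_form a O.
Proof.
pose T (f : {ffun J -> J}) := a (f ord0) 0 * \prod_(k < n) O (f (i1 k)) (f (i2 k)).
transitivity (\sum_(f : {ffun J -> J}) T f * \det (\matrix_(i, j) A i (f j))).
  transitivity (\sum_(f : {ffun J -> J}) \sum_(s : 'S_(n.*2.+1)) (-1) ^+ s * (T f * \prod_i A (s i) (f i))).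
    rewrite exchange_big; apply: eq_bigr => s _ /=; rewrite -mulr_sumr -mulrA; congr (_ * _).
    rewrite mxE (eq_bigr (fun k => \sum_(q : J * J) A (s (i1 k)) q.1 * O q.1 q.2 * A (s (i2 k)) q.2)); last first.
      move=> k _; rewrite -(pair_bigA _ (fun p q => A (s (i1 k)) p * O p q * A (s (i2 k)) q)) /= mxE exchange_big.
      by apply: eq_bigr => q _ /=; rewrite !mxE mulr_suml.
    rewrite bigA_distr_bigA mulr_suml.
    under eq_bigr do rewrite mulr_sumr.
    rewrite pair_bigA (reindex split_pairs) /=; last exact: onW_bij split_pairs_bij.
    apply: eq_bigr => f _; rewrite prod_pairs /T.
    under eq_bigr do rewrite !ffunE /=.
    rewrite (eq_bigr (fun k => O (f (i1 k)) (f (i2 k)) * (A (s (i1 k)) (f (i1 k)) * A (s (i2 k)) (f (i2 k))))); last first.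
      by move=> k _; rewrite mulrCA mulrA.
    rewrite big_split /=; ring.
  apply: eq_bigr => f _; rewrite -det_tr mulr_sumr; apply: eq_bigr => s _; rewrite mulrCA; congr (_ * (_ * _)).
  by apply: eq_bigr => i _; rewrite !mxE.
rewrite (bigID (fun f : {ffun J -> J} => injectiveb f)) /= addrC big1 ?add0r => [|f Uf]; last first.
  case/injectivePn: Uf => j1 [j2 Dj Ef]; rewrite -det_tr (determinant_alternate Dj) ?mulr0 // => i.
  by rewrite !mxE Ef.
rewrite (reindex (@pval _)) /=; last first.
  pose in_Sn := insubd (1%g : 'S_(n.*2.+1)).
  by exists in_Sn => /= f Uf; first apply: val_inj; apply: insubdK.
rewrite /volume_form mulr_sumr; apply: eq_big => /= [s|s _]; first by rewrite (valP s).
rewrite /T !pvalE det_columns; move: (\prod_(k < n) _) ((-1) ^+ s) (\det A) => u v w; ring.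
Qed.

Lemma volume_form_scale (t : R) a O : volume_form (t *: a) (t *: O) = t ^+ n.+1 * volume_form a O.
Proof.
rewrite /volume_form mulr_sumr; apply: eq_bigr => s _; rewrite mxE.
under eq_bigr do rewrite mxE.
rewrite big_split prodr_const card_ord /= exprS; move: (\prod_(i < n) _) ((-1) ^+ s) (t ^+ n) => u v w; ring.
Qed.

(* The matrix [1 + e w] with [w] in the kernel of [e] fixes [e] and turns [O]
   into [O + e (w O) - (w O)^T e^T]. *)
Lemma volume_form_twist (e r : 'cV[R]_(n.*2.+1)) (O : 'M[R]_(n.*2.+1)) (X : 'rV[R]_(n.*2.+1)) :
  O^T = - O -> X *m O = 0 -> pairing X e = 1 ->
  (forall v, pairing v e = 0 -> v *m O = 0 -> v = 0) ->
  volume_form e (O + (r *m e^T - e *m r^T)) = volume_form e O.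
Proof.
move=> Oa XO Xe nd; pose B := O + e *m e^T.
have OX : O *m X^T = 0 by apply: trmx_inj; rewrite trmx_mul trmxK Oa mulmxN XO trmx0 oppr0.
have eX : e^T *m X^T = 1%:M.
  by rewrite -trmx_mul; apply/matrixP => i j; rewrite !ord1 mxE [LHS]Xe mxE eqxx.
have vB v : v *m B = v *m O + pairing v e *: e^T by rewrite /B mulmxDr mul_outer.
have uB : B \in unitmx.
  rewrite -row_free_unit -kermx_eq0; apply/eqP/row_matrixP => i; rewrite row0.
  have := mulmx_ker B; move=> /(congr1 (row i)); rewrite row_mul row0 vB => h; apply: nd.
    have := congr1 (fun u => u *m X^T) h.
    rewrite mulmxDl -mulmxA OX mulmx0 add0r -scalemxAl eX mul0mx => /matrixP/(_ 0 0).
    by rewrite !mxE eqxx mulr1.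
  have h0 : pairing (row i (kermx B)) e = 0.
    have := congr1 (fun u => u *m X^T) h.
    rewrite mulmxDl -mulmxA OX mulmx0 add0r -scalemxAl eX mul0mx => /matrixP/(_ 0 0).
    by rewrite !mxE eqxx mulr1.
  by rewrite h0 scale0r addr0 in h.
pose u := - r^T *m invmx B; pose w := u - pairing u e *: X.
have we : w *m e = 0.
  by apply/matrixP => i j; rewrite !ord1 [RHS]mxE [LHS](pairingBl u) pairingZl Xe mulr1 subrr.
have wO : w *m O = - r^T - pairing u e *: e^T.
  by rewrite mulmxBl -scalemxAl XO scaler0 subr0 -[- r^T](mulmxKV uB) -/u vB addrK.
have Ow : O *m w^T = r + pairing u e *: e.
  have := congr1 trmx wO; rewrite trmx_mul Oa mulNmx => /(congr1 -%R); rewrite opprK => ->.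
  by move: (pairing u e) => t; apply/colP => i; rewrite !mxE; ring.
have wOw : w *m (O *m w^T) = 0.
  apply/matrixP => i j; rewrite !ord1; have h : (w *m (O *m w^T))^T = - (w *m (O *m w^T)).
    by rewrite !trmx_mul trmxK Oa mulmxN mulNmx mulmxA.
  by have /matrixP/(_ 0 0) := h; rewrite !mxE; lra.
pose A := 1%:M + e *m w.
have dA : \det A = 1 by rewrite det_rank_one we mxE addr0.
have Ae : A *m e = e by rewrite mulmxDl mul1mx -mulmxA we mulmx0 addr0.
have AO : A *m O *m A^T = O + (r *m e^T - e *m r^T).
  rewrite linearD /= trmx1 trmx_mul mulmxDl mul1mx mulmxDr mulmx1 mulmxDl -!mulmxA [w *m (O *m _)]mulmxA.
  rewrite -(mulmxA w O) (mulmxA O w^T) [w *m (_ *m _ *m _)]mulmxA wOw mul0mx mulmx0 addr0 wO Ow.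
  by move: (pairing u e) => t; apply/matrixP => i j; rewrite !mxE !big_ord1 !mxE; ring.
by rewrite -AO -{1}Ae volume_form_change dA mul1r.
Qed.
End VolumeForm.

(** * Unique continuation for Killing fields *)

Section Killing.
Variables (R : realType) (m : nat).
Local Notation E := 'rV[R]_m.

Lemma near_bounded (T : topologicalType) (J : finType) (f : J -> T -> R) p :
  (forall j, {for p, continuous (f j)}) -> exists2 C, 0 < C & \forall z \near p, forall j, `|f j z| <= C.
Proof.
move=> cf; pose C := \sum_j `|f j p| + 1.
have s0 : 0 <= \sum_j `|f j p| by apply: sumr_ge0.
exists C; first by rewrite ltr_wpDl.
apply: (filter_forall (F := nbhs p) (nbhs_filter p)) => j.
apply: (@filterS _ (nbhs p) (nbhs_filter p) _ _ _ ((cvgrPdist_le _ _).1 (cf j) 1 ltr01)) => z h.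
rewrite -[f j z](subrK (f j p)) /C addrC; apply: le_trans (ler_normD _ _) _; rewrite lerD ?(distrC (f j z)) //.
by rewrite (bigD1 j) //= lerDl sumr_ge0.
Qed.

Lemma le0_of_halving (x B : R) : (forall n, x <= B * 2^-1 ^+ n) -> x <= 0.
Proof.
move=> h; rewrite leNgt; apply/negP => x0; have := h (Num.bound `|B / x|); rewrite exprVn.
rewrite ler_pdivlMr ?exprn_gt0 // leNgt mulrC -ltr_pdivrMr //; apply/negP/negPn.
apply: le_lt_trans (ler_norm _) _; apply: lt_le_trans (archi_boundP (normr_ge0 _)) _.
by rewrite -natrX ler_nat; apply: ltnW; apply: leq_trans (ltn_expl _ (ltnSn 1)) _.
Qed.

(* The Koszul trick: differentiating the Killing equation once expresses all
   second derivatives of X by its first jet. *)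
Lemma killing_vanish (U : set E) (X : E -> E) (g : E -> 'M[R]_m) p : open U -> U p ->
  smooth_on U X -> smooth_on U g -> (forall x, U x -> (g x)^T = g x /\ g x \in unitmx) ->
  (forall x, U x -> jac X x *m g x + g x *m (jac X x)^T + \sum_l X x 0 l *: pd l g x = 0) ->
  X p = 0 -> jac X p = 0 -> exists2 r, 0 < r & forall z, ball p r z -> X z = 0.
Proof.
move=> oU Up sX sg gsu kil Xp Jp.
have sXl l : smooth_on U (fun x => X x 0 l : R) by [].
have sgl i j : smooth_on U (fun x => g x i j : R) by [].
have sJ i l : smooth_on U (pd i (fun x => X x 0 l : R)) by [].
have sdg k i j : smooth_on U (pd k (fun x => g x i j : R)) by [].
have sgi i j : smooth_on U (fun x => invmx (g x) i j : R).
  by apply: smooth_entry => //; apply: smooth_invmx => // x /gsu[].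
have JE x i l : U x -> jac X x i l = pd i (fun x => X x 0 l : R) x.
  by move=> Ux; rewrite jac_entry //.
have kilE x i j : U x -> \sum_l (pd i (fun x => X x 0 l : R) x * g x l j + g x i l * pd j (fun x => X x 0 l : R) x
    + X x 0 l * pd l (fun x => g x i j : R) x) = 0.
  move=> Ux; have /matrixP/(_ i j) := kil x Ux; rewrite !mxE summxE -!big_split /= => E0; rewrite -[RHS]E0.
  by apply: eq_bigr => l _; rewrite !mxE !JE // pd_mx //.
have [C1 C10 n1] := near_bounded (fun ij : 'I_m * 'I_m => smooth_cont (sgl ij.1 ij.2) Up).
have [C2 C20 n2] := near_bounded (fun t : 'I_m * ('I_m * 'I_m) => smooth_cont (sdg t.1 t.2.1 t.2.2) Up).
have [C3 C30 n3] := near_bounded (fun t : ('I_m * 'I_m) * ('I_m * 'I_m) => smooth_cont (smooth_on_pd t.1.1 (sdg t.1.2 t.2.1 t.2.2)) Up).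
have [C4 C40 n4] := near_bounded (fun ij : 'I_m * 'I_m => smooth_cont (sgi ij.1 ij.2) Up).
have [C5 C50 n5] := near_bounded (fun l : 'I_m => smooth_cont (sXl l) Up).
have [C6 C60 n6] := near_bounded (fun ij : 'I_m * 'I_m => smooth_cont (sJ ij.1 ij.2) Up).
pose C0 := C2 + C3; pose C := m%:R * (m%:R * (5 * C0) * 2 * C4).
have C00 : 0 < C0 by rewrite addr_gt0.
have C0' : 0 <= C by rewrite !mulr_ge0 // ltW.
have [r /= r0 Hr] := (nbhs_ballP _ _).1 (filterI (open_nbhs_nbhs (conj oU Up)) (filterI n2 (filterI n3 (filterI n4 (filterI n5 n6))))).
(* The radius satisfies m (1 + C) s <= 1/2, so by the mean value bound any bound B for the 1-jet on
   the ball improves to B / 2. *)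
pose s := Num.min r (2^-1 / (m%:R * (1 + C) + 1)).
have D0 : 0 < m%:R * (1 + C) + 1 by rewrite ltr_wpDl // mulr_ge0 // addr_ge0.
have s0 : 0 < s by rewrite lt_min r0 divr_gt0.
have sr z : ball p s z -> ball p r z by apply: le_ball; rewrite ge_min lexx.
have jets B z : ball p s z -> (forall l, `|X z 0 l| <= B) -> (forall i l, `|pd i (fun x => X x 0 l : R) z| <= B) ->
    forall k i l, `|pd k (pd i (fun x => X x 0 l : R)) z| <= C * B.
  move=> /sr/Hr[Uz [h2 [h3 [h4 _]]]] XB JB.
  have h2' k i j : `|pd k (fun x => g x i j : R) z| <= C0 by apply: le_trans (h2 (k, (i, j))) _; rewrite lerDl ltW.
  have h3' k k' i j : `|pd k (pd k' (fun x => g x i j : R)) z| <= C0 by apply: le_trans (h3 ((k, k'), (i, j))) _; rewrite lerDr ltW.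
  pose A k i j := \sum_l pd k (pd i (fun x => X x 0 l : R)) z * g z l j.
  pose Q k i j := \sum_l (pd i (fun x => X x 0 l : R) z * pd k (fun x => g x l j : R) z
     + pd k (fun x => g x i l : R) z * pd j (fun x => X x 0 l : R) z
     + pd k (fun x => X x 0 l : R) z * pd l (fun x => g x i j : R) z
     + X z 0 l * pd k (pd l (fun x => g x i j : R)) z).
  have AQ k i j : A k i j + A k j i + Q k i j = 0.
    have E0 : pd k (fun x => \sum_l (pd i (fun x => X x 0 l : R) x * g x l j + g x i l * pd j (fun x => X x 0 l : R) x
        + X x 0 l * pd l (fun x => g x i j : R) x)) z = 0.
      by rewrite (pd_ext (g := fun=> 0) _ oU Uz) ?pd_cst // => x Ux; exact: kilE.
    rewrite -[RHS]E0 (jet1_sum Uz) => [|l] //.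
    rewrite -!big_split; apply: eq_bigr => l _ /=.
    rewrite (jet1D Uz) ?(jet1M Uz) //.
    rewrite (jet1D Uz) ?(jet1M Uz) //.
    by rewrite -[in g z l i](gsu z Uz).1 [_^T l i]mxE; ring.
  have Asym k i j : A k i j = A i k j by apply: eq_bigr => l _; rewrite (schwarz _ _ oU (sXl l) Uz).
  have QB k i j : `|Q k i j| <= m%:R * (4 * C0 * B).
    apply: le_trans (ler_norm_sum _ _ _) _; rewrite -[X in X%:R]card_ord mulr_natl -sumr_const.
    have t (u v : R) : `|u| <= B -> `|v| <= C0 -> `|u * v| <= C0 * B by move=> hu hv; rewrite normrM mulrC ler_pM.
    apply: ler_sum => l _; rewrite (_ : 4 * C0 * B = C0 * B + C0 * B + C0 * B + C0 * B); last by ring.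
    apply: le_trans (ler_normD _ _) _; apply: lerD; last exact: t.
    apply: le_trans (ler_normD _ _) _; apply: lerD; last exact: t.
    by apply: le_trans (ler_normD _ _) _; apply: lerD; [|rewrite mulrC]; exact: t.
  have AB k i j : `|A k i j| <= m%:R * (4 * C0 * B) * 2.
    (* [A] is symmetric in its first two indices; three cyclic instances of [AQ] then determine
       it. *)
    have -> : A k i j = - (Q k i j + Q i j k - Q j k i) / 2.
      have := AQ k i j; have := AQ i j k; have := AQ j k i.
      rewrite [A j k i]Asym [A j i k]Asym [A i k j]Asym.
      by move: (A k i j) (A k j i) (A i j k) (Q k i j) (Q i j k) (Q j k i) => a1 a2 a3 q1 q2 q3; lra.
    have := QB k i j; have := QB i j k; have := QB j k i; rewrite !ler_norml.
    move: (m%:R * _) (Q k i j) (Q i j k) (Q j k i) => t q1 q2 q3 /andP[? ?] /andP[? ?] /andP[? ?].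
    by apply/andP; lra.
  move=> k i l; have -> : pd k (pd i (fun x => X x 0 l : R)) z = \sum_j A k i j * invmx (g z) j l.
    transitivity (((\row_l pd k (pd i (fun x => X x 0 l : R)) z) *m g z *m invmx (g z)) 0 l).
      by rewrite mulmxK ?(gsu z Uz).2 // mxE.
    by rewrite mxE; apply: eq_bigr => j _; rewrite mxE; congr (_ * _); apply: eq_bigr => l' _; rewrite mxE.
  apply: le_trans (ler_norm_sum _ _ _) _.
  have B0 : 0 <= B by apply: le_trans (XB k).
  rewrite /C -mulrA -[X in X%:R * _](card_ord m) [_%:R * _]mulr_natl -sumr_const; apply: ler_sum => j _.
  rewrite normrM (_ : _ * B = m%:R * (5 * C0 * B) * 2 * C4); last by ring.
  apply: ler_pM => //; last exact: (h4 (j, l)).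
  apply: le_trans (AB k i j) _; rewrite ler_wpM2r // ler_wpM2l // ler_wpM2r // ler_wpM2r ?(ltW C00) //; lra.
have halve B : 0 <= B -> (forall z, ball p s z -> (forall l, `|X z 0 l| <= B) /\ forall i l, `|pd i (fun x => X x 0 l : R) z| <= B) ->
   forall z, ball p s z -> (forall l, `|X z 0 l| <= B * 2^-1) /\ forall i l, `|pd i (fun x => X x 0 l : R) z| <= B * 2^-1.
  move=> B0 HB z bz; have pp : ball p s p by exact: ballxx.
  have Bs t (f : E -> R) : 0 <= t -> t <= 1 + C -> smooth_on U f -> f p = 0 -> (forall y, ball p s y -> forall i, `|pd i f y| <= t * B) -> `|f z| <= B * 2^-1.
    move=> t0 tC sf fp Hf; have := @mean_value_bound R m f p s (t * B) z p.
    rewrite fp subr0 => h; apply: le_trans (h _ bz pp) _.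
      by move=> y by_; split; [have [Uy _] := Hr y (sr y by_); exact: (smooth_differentiable oU)|exact: Hf].
    have zp : `|z - p| <= s by move: bz; rewrite -ball_normE /= distrC => /ltW.
    have h2 : m%:R * t * s <= 2^-1.
      apply: (@le_trans _ _ ((m%:R * (1 + C) + 1) * s)).
        by rewrite ler_wpM2r ?(ltW s0) // ler_wpDr // ler_wpM2l.
      by rewrite mulrC -ler_pdivlMr // ge_min lexx orbT.
    apply: (@le_trans _ _ (m%:R * (t * B) * s)); first by rewrite ler_wpM2l // !mulr_ge0.
    by rewrite mulrA mulrAC mulrC ler_wpM2l.
  split=> [l|i l].
    apply: (Bs 1 (fun x => X x 0 l : R)) => //; [by rewrite lerDl|by rewrite Xp mxE|].
    by move=> y by_ i; rewrite mul1r; have [_ ->] := HB y by_.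
  apply: (Bs C (pd i (fun x => X x 0 l : R))) => //; [by rewrite lerDr|by rewrite -JE // Jp mxE|].
  by move=> y by_ k; have [h1 h2] := HB y by_; exact: jets.
have iter n z : ball p s z -> (forall l, `|X z 0 l| <= (C5 + C6) * 2^-1 ^+ n) /\ forall i l, `|pd i (fun x => X x 0 l : R) z| <= (C5 + C6) * 2^-1 ^+ n.
  elim: n z => [|n IH] z bz.
    have [_ [_ [_ [_ [h5 h6]]]]] := Hr z (sr z bz); rewrite expr0 mulr1; split=> [l|i l].
      by apply: le_trans (h5 l) _; rewrite lerDl ltW.
    by apply: le_trans (h6 (i, l)) _; rewrite lerDr ltW.
  rewrite exprSr mulrA; apply: halve => //.
  by rewrite mulr_ge0 ?exprn_ge0 // ltW // addr_gt0.
exists s => // z bz; apply/rowP => l; rewrite mxE; apply/eqP; rewrite -normr_le0.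
by apply: (@le0_of_halving _ (C5 + C6)) => n; have [h _] := iter n z bz.
Qed.
End Killing.

(** A lattice contains no line: rescale [a] so that one of its nonzero coordinates becomes 1/2. *)
Lemma torus_field_neq0 (R : realType) (n : nat) (N : manifold R n.*2.+1) (S : CR_structure N) k
    (rho : 'rV[R]_k -> N -> N) (a : 'rV[R]_k) : CR_torus S rho -> a != 0 ->
  ~ (forall (t : R) p, rho (t *: a) p = p).
Proof.
move=> [_ _ ker] /eqP a0 triv; apply: a0; apply/rowP => i; rewrite mxE; apply/eqP; apply: contrapT => /negP ai.
have := (ker ((2^-1 / a 0 i) *: a)).1 (triv _) i; rewrite mxE mulfVK // => /natr_norm_int/natrP[m].
rewrite ger0_norm ?invr_ge0 // => /(congr1 ( *%R^~ 2)); rewrite mulVf ?pnatr_eq0 // -natrM => /eqP.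
by rewrite -[1]/(1%:R) eqr_nat => /eqP /(congr1 odd); rewrite oddM andbF.
Qed.

(** * Nonnegative functions at their zeros *)

Section Minimum.
Variables (R : realType) (d : nat) (U : set 'rV[R]_d) (f : 'rV[R]_d -> R) (y : 'rV[R]_d).
Hypotheses (oU : open U) (Uy : U y) (sf : smooth_on U f).
Hypotheses (f0 : forall z, U z -> 0 <= f z) (fy : f y = 0).

Let D (v : 'rV[R]_d) (g : 'rV[R]_d -> R) z := \sum_i v 0 i * pd i g z.

Let sD v (g : 'rV[R]_d -> R) : smooth_on U g -> smooth_on U (D v g).
Proof.
by move=> sg; apply: smooth_sum => // i.
Qed.

Let decrease v (g : 'rV[R]_d -> R) : smooth_on U g -> g y = 0 -> D v g y < 0 ->
  exists2 r, 0 < r & forall t, 0 < t -> t < r -> U (y + t *: v) /\ g (y + t *: v) < 0.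
Proof.
move=> sg gy Dg; have cl : {for (0 : R), continuous (fun t : R => y + t *: v)}.
  apply: differentiable_continuous => //.
have oW : open [set z | U z /\ [set t : R | t < 0] (D v g z)].
  by apply: open_preim => [//||z]; [exact: open_lt|exact: smooth_cont (sD v sg)].
have [|r /= r0 Hr] := (nbhs_ballP _ _).1 (cl _ (open_nbhs_nbhs (conj oW _))); first by rewrite scale0r addr0.
have in_ t : `|t| < r -> U (y + t *: v) /\ D v g (y + t *: v) < 0.
  by move=> h; apply: Hr; rewrite -ball_normE /= sub0r normrN.
exists r => // t t0 tr; have tn : `|t| < r by rewrite gtr0_norm.
split; first by case: (in_ t tn).
have [s s_ E1] := @line_MVT R _ g y v t (fun s hs => diff_derivable (smooth_differentiable oU sg (in_ s (le_lt_trans hs tn)).1)).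
have [Us Ds] := in_ s (le_lt_trans s_ tn).
rewrite -[g _](subrK (g y)) E1 gy addr0 (derive_sum_pd _ (smooth_differentiable oU sg Us)).
by rewrite pmulr_rlt0.
Qed.

Lemma minimum_gradient i : pd i f y = 0.
Proof.
have DE (s : R) : D (s *: delta_mx 0 i) f y = s * pd i f y.
  rewrite /D (bigD1 i) //= big1 ?addr0; first by rewrite !mxE !eqxx mulr1.
  by move=> j ji; rewrite !mxE (negPf ji) mulr0 mul0r.
have H (s : R) : 0 <= s * pd i f y.
  rewrite -DE leNgt; apply/negP => /(decrease sf fy)[r r0 Hr].
  have [|Ut] := Hr (r / 2) (divr_gt0 r0 (ltr0Sn R 1)); first by rewrite ltr_pdivrMr // mulr_natr mulr2n ltrDl.
  by rewrite ltNge f0.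
by have := H 1; have := H (-1); rewrite mulN1r mul1r oppr_ge0 => h1 h2; apply/le_anti/andP.
Qed.

Lemma minimum_hessian (v : 'rV[R]_d) : 0 <= \sum_i v 0 i * \sum_j v 0 j * pd i (pd j f) y.
Proof.
have DE : D v (D v f) y = \sum_i v 0 i * \sum_j v 0 j * pd i (pd j f) y.
  apply: eq_bigr => i _; congr (_ * _); rewrite (jet1_sum Uy) => [|j] //.
  by apply: eq_bigr => j _; rewrite (jet1M Uy) ?pd_cst ?mul0r ?add0r //.
rewrite -DE leNgt; apply/negP => /(decrease (sD v sf)) H.
have [|r r0 Hr] := H _; first by apply: big1 => i _; rewrite minimum_gradient mulr0.
have dl t : 0 <= t -> t < r -> U (y + t *: v).
  by rewrite le_eqVlt => /predU1P[<- _|t0 tr]; [rewrite scale0r addr0|case: (Hr t t0 tr)].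
pose t := r / 2; have t0 : 0 < t by rewrite divr_gt0.
have tr : t < r by rewrite ltr_pdivrMr // mulr_natr mulr2n ltrDl.
have der s : 0 <= s -> s < r -> is_derive s (1 : R) (fun s : R => f (y + s *: v)) (D v f (y + s *: v)).
  move=> s0 sr; have df := smooth_differentiable oU sf (dl s s0 sr).
  have [E1 dg] := line_derive f y v s; rewrite /D -(derive_sum_pd v df) -E1.
  exact/derivableP/dg/diff_derivable.
have [s||s] := @MVT R (fun s : R => f (y + s *: v)) (fun s => D v f (y + s *: v)) 0 t t0.
- by rewrite in_itv /= => /andP[s0 st]; apply: der; [exact: ltW|exact: lt_trans tr].
- apply: derivable_within_continuous => s; rewrite in_itv /= => /andP[s0 st].
  by case: (der s s0 (le_lt_trans st tr)).
rewrite in_itv /= => /andP[s0 st] E1; have [_ Ds] := Hr s s0 (lt_trans st tr).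
have := f0 (dl t (ltW t0) tr); move: E1; rewrite scale0r addr0 fy !subr0 => ->.
by rewrite pmulr_lge0 // leNgt Ds.
Qed.
End Minimum.

Section PositiveLaplacian.
Variables (R : realType) (d : nat) (U : set 'rV[R]_d) (f : 'rV[R]_d -> R) (h : 'rV[R]_d -> 'M[R]_d) (y : 'rV[R]_d).
Hypotheses (oU : open U) (Uy : U y) (sf : smooth_on U f).
Hypotheses (f0 : forall z, U z -> 0 <= f z) (fy : f y = 0).
Hypotheses (hsym : (h y)^T = h y) (hpos : positive_form (h y)).

(** At a minimum the gradient vanishes, so the covariant Hessian is the matrix of second derivatives
    and is positive semidefinite. If its trace in an orthonormal basis is not positive, every basis
    vector is null. *)
Lemma laplacian_minimum_eq0 : laplacian h f y <= 0 -> forall i j, pd i (pd j f) y = 0.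
Proof.
pose H : 'M[R]_d := \matrix_(i, j) pd i (pd j f) y => L0.
have Hsym : H^T = H by apply/matrixP => i j; rewrite !mxE (schwarz _ _ oU sf Uy).
have HE v : bil H v v = \sum_i v 0 i * \sum_j v 0 j * pd i (pd j f) y.
  rewrite /bil -mulmxA mxE; apply: eq_bigr => i _; congr (_ * _); rewrite mxE; apply: eq_bigr => j _.
  by rewrite !mxE mulrC.
have Hpos v : 0 <= bil H v v by rewrite HE; exact: (minimum_hessian oU Uy sf f0 fy).
(* A null vector of a semidefinite form lies in its kernel: otherwise the form takes the value -1 at
   the combination below. *)
have Hnull u : bil H u u = 0 -> forall v, bil H v u = 0.
  move=> u0 v; apply/eqP; apply: contrapT => /negP q0.
  have sb x z : bil H x z = bil H z x by rewrite -bil_tr Hsym.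
  have lin (s : R) z : bil H (v + s *: u) z = bil H v z + s * bil H u z.
    by rewrite /bil -!mulmxA -/(pairing _ _) pairingDl pairingZl.
  have := Hpos (v + (- (bil H v v + 1) / (2 * bil H v u)) *: u).
  rewrite lin [bil H v (_ + _)]sb [bil H u (_ + _)]sb !lin u0 [bil H u v]sb (_ : _ + _ = -1) ?ler0N1 //.
  by field.
have [B HB] := orthonormal_basis hsym hpos.
have uB : B \in unitmx by have [] := mulmx1_unit HB; rewrite unitmx_mul => /andP[].
have hV : invmx (h y) = B^T *m B.
  have E1 := mulmx1C HB; rewrite -[RHS](mulmxK (positive_form_unit hsym hpos)) -[B^T *m B *m h y]mulmxA E1.
  by rewrite mul1mx.
have LE : laplacian h f y = \sum_i bil H (row i B) (row i B).
  rewrite /laplacian (_ : hessian h f y = H); last first.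
    apply/matrixP => i j; rewrite mxE big1 ?subr0 => [|l _]; last by rewrite (minimum_gradient oU Uy sf f0 fy) mulr0.
    by rewrite -Hsym !mxE.
  rewrite hV -mulmxA mxtrace_mulC; apply: eq_bigr => i _.
  by rewrite /bil -row_mul mxE [RHS]mxE; apply: eq_bigr => j _; rewrite !mxE.
have bnull i : bil H (row i B) (row i B) = 0.
  have : \sum_i bil H (row i B) (row i B) == 0 by rewrite -LE eq_le L0 LE sumr_ge0.
  by rewrite psumr_eq0 // => /allP/(_ i (mem_index_enum i))/eqP.
have H0 : H = 0.
  suff HB0 : H *m B^T = 0 by rewrite -[H](mulmxK (_ : B^T \in unitmx)) ?unitmx_tr // HB0 mul0mx.
  apply/matrixP => i j; rewrite mxE; have := Hnull _ (bnull j) (delta_mx 0 i).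
  by rewrite /bil -rowE tr_row -row_mul !mxE => E1; rewrite -[RHS]E1; apply: eq_bigr => l _; rewrite !mxE.
by move=> i j; have /matrixP/(_ i j) := H0; rewrite !mxE.
Qed.
End PositiveLaplacian.

Section SmoothTensors.
Variables (R : realType) (d : nat) (U : set 'rV[R]_d) (h : 'rV[R]_d -> 'M[R]_d).
Hypotheses (oU : open U) (sh : smooth_on U h).
Hypotheses (hsym : forall y, U y -> (h y)^T = h y) (hu : forall y, U y -> h y \in unitmx).

Let sG i j : smooth_on U (fun y => invmx (h y) i j : R).
Proof. by []. Qed.

Let sC k i j : smooth_on U (christoffel h k i j).
Proof.
have := smooth_entry i k oU (smooth_connection j oU sh hsym hu).
by apply: smooth_ext => // y _; rewrite mxE.
Qed.

Lemma smooth_laplacian f : smooth_on U f -> smooth_on U (laplacian h f).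
Proof.
move=> sf; apply: smooth_sum => // i; apply: smooth_entry => //.
apply: smooth_mulmx => //.
apply/smooth_mxP => // i' j.
apply: (smooth_ext oU (f := fun y => pd j (pd i' f) y - \sum_l connection h j y i' l * pd l f y)).
  by move=> y _; rewrite mxE.
apply: smoothB => //.
apply: smooth_sum => // l; apply: smoothM => //.
by apply: smooth_entry => //; exact: smooth_connection.
Qed.

Lemma smooth_gradient_sqr f : smooth_on U f -> smooth_on U (gradient_sqr h f).
Proof.
move=> sf; apply: (smooth_ext oU (f := fun y => \sum_j (\sum_i pd i f y * invmx (h y) i j) * pd j f y)) => [y _|].
  by rewrite /gradient_sqr mxE; apply: eq_bigr => j _; rewrite !mxE; congr (_ * _); apply: eq_bigr => i _; rewrite !mxE.
done.
Qed.

Lemma smooth_scalar_curvature : smooth_on U (scalar_curvature h).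
Proof.
rewrite /scalar_curvature /ricci pdE //.
Qed.

(** Cauchy-Schwarz: the partial derivative is the inner product of the gradient [w] with a
    coordinate vector, and the form is evaluated at the component of [w] orthogonal to that
    vector. *)
Lemma gradient_sqr_bound (f : 'rV[R]_d -> R) y : U y -> positive_form (h y) ->
  0 <= gradient_sqr h f y /\ forall l, (pd l f y) ^+ 2 <= h y l l * gradient_sqr h f y.
Proof.
move=> Uy hpos; have [hT uh] := (hsym Uy, hu Uy); pose q := (gradient f y)^T; pose w := q *m invmx (h y).
have wh : w *m h y = q by rewrite mulmxKV.
have gE : bil (h y) w w = gradient_sqr h f y.
  by rewrite /bil wh /w trmx_mul trmx_inv hT trmxK mulmxA.
have pos v : 0 <= bil (h y) v v.
  by have [->|v0] := eqVneq v 0; [rewrite /bil mul0mx mul0mx mxE|exact/ltW/hpos].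
split=> [|l]; first by rewrite -gE.
have dE : bil (h y) (delta_mx 0 l) (delta_mx 0 l) = h y l l by rewrite /bil -rowE trmx_delta -colE !mxE.
have wE : bil (h y) w (delta_mx 0 l) = pd l f y by rewrite /bil wh trmx_delta -colE !mxE.
have dw : bil (h y) (delta_mx 0 l) w = pd l f y by rewrite -bil_tr hT.
have hl : 0 < h y l l.
  rewrite -dE; apply: hpos; apply/eqP => /rowP/(_ l); rewrite !mxE !eqxx => /eqP; by rewrite oner_eq0.
have lin (s : R) u v z : bil (h y) (u + s *: v) z = bil (h y) u z + s * bil (h y) v z.
  by rewrite /bil -!mulmxA -/(pairing _ _) pairingDl pairingZl.
have sb u v : bil (h y) u v = bil (h y) v u by rewrite -bil_tr hT.
have := pos (w + (- (pd l f y / h y l l)) *: delta_mx 0 l).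
rewrite lin [bil _ w (_ + _)]sb [bil _ (delta_mx 0 l) (_ + _)]sb !lin wE dE gE dw.
rewrite (_ : _ + _ = gradient_sqr h f y - (pd l f y) ^+ 2 / h y l l); last by field; rewrite gt_eqF.
by rewrite subr_ge0 ler_pdivrMr // mulrC.
Qed.
End SmoothTensors.

(** * Pointwise lower bound for the integrand *)

Section PointwiseEstimate.
Variable R : realType.

(* The coefficient nu + 5/2 of the divergence exceeds the critical value
   nu + 2, which leaves a positive multiple of |df|^2/f to absorb all terms
   linear in df. *)
Lemma pointwise_estimate (m : nat) (nu C : R) : 1 <= nu -> 1 <= C ->
  exists c D : R, [/\ 0 < c, 0 <= D & forall (q a be : 'I_m -> R) (psi tau f g L s : R),
    0 <= psi <= 1 -> tau <= C -> 1 <= C * tau -> 0 < f -> 0 <= g -> `|s| <= C ->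
    (forall l, q l ^+ 2 <= C * g) -> (forall l, `|a l| <= C) -> (forall l, `|be l| <= C) ->
    1 <= C * (L + C * f) ->
    c * (psi ^+ 4 * tau) - D * (psi ^+ 2 * f) <=
      psi ^+ 4 * tau * (f * s + (2 * nu + 2) * L - (2 * nu + 2) * (2 * nu + 4) / 4 * g / f)
      - (nu + 5 / 2) * (psi ^+ 3 * (\sum_l a l * q l) - (nu + 1) * (psi ^+ 4 * tau) * (g / f)
          + psi ^+ 4 * tau * (L + \sum_l be l * q l))].
Proof.
move=> nu1 C1; have C0 : 0 < C by apply: lt_le_trans C1.
pose D0 := (nu + 5 / 2) * (C + C * C); pose ka := (C * C * m.+1%:R)^-1.
pose D1 := m%:R * (D0 * D0 / (4 * ka)).
have D00 : 0 <= D0 by rewrite mulr_ge0 ?addr_ge0 ?mulr_ge0 //; lra.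
have ka0 : 0 < ka by rewrite invr_gt0 !mulr_gt0.
have D10 : 0 <= D1 by do 2 rewrite mulr_ge0 //; [exact: mulr_ge0|rewrite invr_ge0 mulr_ge0 // ltW].
exists ((nu - 2^-1) / C), (C * C + nu * C * C + D1); split.
- by rewrite divr_gt0 //; lra.
- have n0 : 0 <= nu by lra.
  by rewrite addr_ge0 // addr_ge0 // !mulr_ge0 // ltW.
move=> q a be psi tau f g L s /andP[p0 p1] tC Ct f0 g0 sC qg aC bC LC.
have t0 : 0 < tau by have : 0 < C * tau by [apply: lt_le_trans Ct]; rewrite pmulr_rgt0.
pose T := \sum_l `|q l|.
have sumT (z : 'I_m -> R) : (forall l, `|z l| <= C) -> `|\sum_l z l * q l| <= C * T.
  move=> zC; apply: le_trans (ler_norm_sum _ _ _) _; rewrite mulr_sumr; apply: ler_sum => l _.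
  by rewrite normrM ler_wpM2r.
have := sumT a aC; have := sumT be bC.
move: (\sum_l a l * q l) (\sum_l be l * q l) => S1 S2 hS2 hS1.
have T0 : 0 <= T by apply: sumr_ge0.
have key : D0 * (psi ^+ 3 * T) <= psi ^+ 4 * (g / f) / C + D1 * (psi ^+ 2 * f).
  have each l : D0 * (psi ^+ 3 * `|q l|) <= ka * C * (psi ^+ 4 * (g / f)) + D0 * D0 / (4 * ka) * (psi ^+ 2 * f).
    have h : 0 <= ka * (psi ^+ 2 * `|q l| - D0 / (2 * ka) * (psi * f)) ^+ 2 / f.
      exact: divr_ge0 (mulr_ge0 (ltW ka0) (sqr_ge0 _)) (ltW f0).
    have E1 : ka * (psi ^+ 2 * `|q l| - D0 / (2 * ka) * (psi * f)) ^+ 2 / f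
        = ka * psi ^+ 4 * (`|q l| ^+ 2 / f) - D0 * (psi ^+ 3 * `|q l|) + D0 * D0 / (4 * ka) * (psi ^+ 2 * f).
      by field; rewrite !gt_eqF.
    have h2 : ka * psi ^+ 4 * (`|q l| ^+ 2 / f) <= ka * psi ^+ 4 * (C * g / f).
      rewrite ler_wpM2l ?mulr_ge0 ?exprn_ge0 ?(ltW ka0) // ler_wpM2r ?invr_ge0 ?(ltW f0) //.
      by rewrite real_normK ?num_real.
    rewrite (_ : ka * C * _ = ka * psi ^+ 4 * (C * g / f)); last by ring.
    by rewrite E1 in h; lra.
  have m0 : (m%:R : R) <= m.+1%:R by rewrite ler_nat.
  apply: (@le_trans _ _ (m%:R * (ka * C * (psi ^+ 4 * (g / f)) + D0 * D0 / (4 * ka) * (psi ^+ 2 * f)))).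
    rewrite /T !mulr_sumr -[X in X%:R](card_ord m) mulr_natl -sumr_const; apply: ler_sum => l _ //.
  rewrite mulrDr /D1 [m%:R * (_ * (_ * f))]mulrA lerD2r mulrA mulrC ler_wpM2l ?mulr_ge0 ?exprn_ge0 ?invr_ge0 ?(ltW f0) //.
  rewrite /ka (_ : m%:R * _ = m%:R / m.+1%:R / C); last by field; rewrite gt_eqF //= pnatr_eq0.
  by rewrite ler_piMl ?invr_ge0 ?(ltW C0) // ler_pdivrMr ?mul1r.
have p3 : 0 <= psi ^+ 3 by rewrite exprn_ge0.
have p43 : psi ^+ 4 <= psi ^+ 3 by rewrite [psi ^+ 4]exprS ler_piMl.
have p42 : psi ^+ 4 <= psi ^+ 2 by rewrite (exprD psi 2 2) ler_piMr ?exprn_ge0 // expr_le1.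
have p4 : 0 <= psi ^+ 4 by rewrite exprn_ge0.
have hX : psi ^+ 4 * tau <= C * psi ^+ 2 by rewrite mulrC ler_pM // ltW.
pose X := psi ^+ 4 * tau; have X0 : 0 <= X by rewrite mulr_ge0 // ltW.
have e1 : (nu + 5 / 2) * (psi ^+ 3 * S1 + X * S2) <= D0 * (psi ^+ 3 * T).
  have h1 : psi ^+ 3 * S1 <= psi ^+ 3 * (C * T) by rewrite ler_wpM2l // (le_trans (ler_norm _)).
  have h2 : X * S2 <= psi ^+ 3 * C * (C * T).
    apply: (@le_trans _ _ (X * (C * T))); first by rewrite ler_wpM2l // (le_trans (ler_norm _)).
    by rewrite ler_wpM2r ?mulr_ge0 ?(ltW C0) // ler_pM // ltW.
  rewrite /D0 -[leRHS]mulrA; apply: ler_wpM2l; lra.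
(* This is where the excess 1/2 of nu + 5/2 over nu + 2 is spent. *)
have e2 : psi ^+ 4 * (g / f) / C <= (nu + 1) / 2 * X * (g / f).
  have gf : 0 <= psi ^+ 4 * (g / f) by rewrite mulr_ge0 // divr_ge0 // ltW.
  rewrite (_ : (nu + 1) / 2 * X * (g / f) = psi ^+ 4 * (g / f) * ((nu + 1) / 2 * tau)); last by rewrite /X; ring.
  rewrite ler_wpM2l // -[leLHS]mul1r ler_pdivrMr //.
  apply: le_trans Ct _; rewrite mulrC ler_wpM2r ?(ltW C0) // ler_peMl ?(ltW t0) //; lra.
have e3 : - (C * C * (psi ^+ 2 * f)) <= X * (f * s).
  have h : - (f * C) <= f * s by rewrite -mulrN ler_wpM2l ?(ltW f0) //; move: sC; rewrite ler_norml => /andP[].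
  have h2 : X * (f * C) <= C * psi ^+ 2 * (f * C) by rewrite ler_wpM2r // mulr_ge0 // ltW.
  apply: (@le_trans _ _ (X * - (f * C))); last by rewrite ler_wpM2l.
  by rewrite mulrN lerN2 (le_trans h2) // le_eqVlt; apply/orP; left; apply/eqP; ring.
(* The coefficient nu - 1/2 is 2 nu + 2 minus nu + 5/2, what is left of the Laplacian; it is
   positive as nu >= 1. *)
have e4 : (nu - 2^-1) / C * X - nu * C * C * (psi ^+ 2 * f) <= (nu - 2^-1) * X * L.
  have h : C^-1 - C * f <= L by rewrite lerBlDr -[leLHS]mul1r ler_pdivrMr // mulrC.
  have h2 : (nu - 2^-1) * X * (C^-1 - C * f) <= (nu - 2^-1) * X * L by rewrite ler_wpM2l // mulr_ge0 //; lra.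
  apply: le_trans h2; rewrite mulrBr mulrAC lerD2l lerN2.
  have h3 : (nu - 2^-1) * X <= nu * (C * psi ^+ 2) by rewrite ler_pM //; lra.
  rewrite (_ : nu * C * C * _ = nu * (C * psi ^+ 2) * (C * f)); last by ring.
  by rewrite ler_wpM2r // mulr_ge0 // ltW.
rewrite -/X; have -> : X * (f * s + (2 * nu + 2) * L - (2 * nu + 2) * (2 * nu + 4) / 4 * g / f)
   - (nu + 5 / 2) * (psi ^+ 3 * S1 - (nu + 1) * X * (g / f) + X * (L + S2))
  = X * (f * s) + (nu - 2^-1) * X * L + (nu + 1) / 2 * X * (g / f) - (nu + 5 / 2) * (psi ^+ 3 * S1 + X * S2).
  by field; rewrite gt_eqF.
rewrite !mulrDl; lra.
Qed.
End PointwiseEstimate.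

(** The gradient vanishes at the zero, so the mean value bound makes it O(s) on the ball of radius s
    and, applied again, makes the function O(s^2), with one constant for all small radii. *)
Lemma quadratic_at_minimum (R : realType) m (U : set 'rV[R]_m) (g : 'rV[R]_m -> R) x0 : open U -> U x0 ->
  smooth_on U g -> (forall x, U x -> 0 <= g x) -> g x0 = 0 ->
  exists L r, [/\ 0 < L, 0 < r & forall s x, 0 < s -> s <= r -> ball x0 s x -> g x <= L * s ^+ 2].
Proof.
move=> oU Ux sg g0 gx; have grad i : pd i g x0 = 0 := minimum_gradient oU Ux sg g0 gx i.
have [C C0 nC] := near_bounded (fun ij : 'I_m * 'I_m => smooth_cont (smooth_on_pd ij.1 (smooth_on_pd ij.2 sg)) Ux).
have [r /= r0 Hr] := (nbhs_ballP _ _).1 (filterI (open_nbhs_nbhs (conj oU Ux)) nC).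
exists (m%:R * (m%:R * C) + 1), r; split=> // [|s x s0 sr bx].
  by rewrite ltr_wpDl // !mulr_ge0 // ltW.
have small z : ball x0 s z -> `|z - x0| <= s by rewrite -ball_normE /= distrC => /ltW.
have sub z : ball x0 s z -> ball x0 r z by exact: le_ball.
have c0 := ballxx x0 s0.
have b1 i z : ball x0 s z -> `|pd i g z| <= m%:R * C * s.
  move=> bz; rewrite -[pd i g z]subr0 -(grad i).
  apply: le_trans (_ : m%:R * C * `|z - x0| <= _); last by rewrite ler_wpM2l ?small // mulr_ge0 // ltW.
  apply: (@mean_value_bound R m (pd i g) x0 r C z x0) => [w bw||]; [|exact: sub|exact: sub].
  have [Uw Cw] := Hr w bw; split=> [|j]; last exact: (Cw (j, i)).
  done.
have := @mean_value_bound R m g x0 s (m%:R * C * s) x x0 _ bx c0.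
rewrite gx subr0 => h; apply: le_trans (ler_norm _) _; apply: le_trans (h _) _.
  move=> w bw; have [Uw _] := Hr w (sub w bw); split=> [|i]; last exact: b1.
  done.
apply: (@le_trans _ _ (m%:R * (m%:R * C * s) * s)).
  by rewrite ler_wpM2l ?small // !mulr_ge0 // ltW.
by rewrite mulrDl mul1r expr2 !mulrA lerDl mulr_ge0 // ltW.
Qed.

(** All admissible values of the integral agree, which determines [xget]. The positive factor [P]
    does not change which charts are positive, so one partition serves both densities. *)
Lemma integral_overE (R : realType) m (M : manifold R m) (vol vol' : chart R M m -> 'rV[R]_m -> R) (P F : M -> R)
    r (c : 'I_r -> chart R M m) chi : compact [set: M] ->
  (forall c, smooth_chart c -> smooth_on (ccod c) (vol c)) ->
  (forall c d x, smooth_chart c -> smooth_chart d -> local_dom idfun c d x ->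
    vol c x = \det (jac (local_map idfun c d) x) * vol d (local_map idfun c d x)) ->
  (forall c x, smooth_chart c -> ccod c x -> vol' c x = P (cinv c x) * vol c x) -> (forall p, 0 < P p) ->
  smooth_function P -> smooth_function F -> positive_partition vol c chi ->
  integral_over vol' F = \sum_i chart_integral vol (c i) (fun p => chi i p * (F p * P p)).
Proof.
move=> cM svol vol_change volE P0 sP sF pp; have [posc hchi chi1] := pp.
have val r' (c' : 'I_r' -> chart R M m) chi' : (forall i, smooth_chart (c' i)) ->
    \sum_i iterated_integral (fun x => if `[< ccod (c' i) x >]
      then chi' i (cinv (c' i) x) * F (cinv (c' i) x) * vol' (c' i) x else 0)
    = \sum_i chart_integral vol (c' i) (fun p => chi' i p * (F p * P p)).
  move=> sc'; apply: eq_bigr => i _; congr iterated_integral; apply/funext => x; rewrite /zero_extension.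
  by case: asboolP => // cx; rewrite volE // !mulrA.
have posE d : smooth_chart d -> (forall x, ccod d x -> 0 < vol' d x) <-> positive_chart vol d.
  move=> sd; split=> [h|[_ h] x dx]; [split=> // x dx; have := h x dx|have := h x dx]; by rewrite volE // pmulr_rgt0.
apply: xget_unique.
- exists r, c, chi; split=> //; last by rewrite val // => i; case: (posc i).
  by move=> i; have [sc _] := posc i; split=> //; apply/(posE _ sc).
move=> _ [r' [c' [chi' [hc' hchi' chi1' ->]]]]; rewrite val => [|i]; last by case: (hc' i).
apply: (integral_partition_unique cM svol vol_change) => //.
by split=> // i; have [sc /(posE _ sc)] := hc' i.
Qed.

(** * Invariant tensors of a Reeb field in the cone *)

Section SasakiCone.
Variables (R : realType) (n : nat) (N : manifold R n.*2.+1) (S : CR_structure N).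
Variables (k : nat) (rho : 'rV[R]_k -> N -> N) (eta : one_form N).
Hypotheses (torus : CR_torus S rho) (eta_contact : CR_contact_form S eta) (sasaki : Sasaki_type S).
Hypotheses (N_compact : compact [set: N]) (N_connected : connected [set: N]).
Local Notation E := 'rV[R]_(n.*2.+1).
Local Notation F := 'rV[R]_(n.*2).
Local Notation chartN := (chart R N n.*2.+1).
Local Notation X := (fundamental_field rho).
Let act : smooth_action rho. Proof. by case: torus. Qed.
Let crd : forall a, CR_diffeomorphism S (rho a). Proof. by case: torus. Qed.

Section SasakiTensors.
Implicit Types (c d : chartN).

Section OneField.
Variable b : 'rV[R]_k.
Hypothesis cone_b : Sasaki_cone rho eta b.
Local Notation e := (eta_xi rho eta b).

Lemma eta_xi_kernel c x v : smooth_chart c -> ccod c x -> cr_dist S c x v <-> pairing v (e c x) = 0.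
Proof.
move=> sc cx; have [h _ _] := eta_contact sc cx; rewrite h /eta_xi pairingZr.
have := cone_b sc cx; rewrite lt_neqAle eq_sym => /andP[h0 _].
split=> [->|/eqP]; first by rewrite mulr0.
by rewrite mulf_eq0 invr_eq0 (negPf h0) => /eqP.
Qed.

Lemma eta_xi_field c x : smooth_chart c -> ccod c x -> pairing (X b c x) (e c x) = 1.
Proof.
by move=> sc cx; rewrite /eta_xi pairingZr mulVf // gt_eqF // cone_b.
Qed.

Lemma eta_xi_smooth c : smooth_chart c -> smooth_on (ccod c) (e c).
Proof.
move=> sc; have oc := @chart_open_cod _ _ _ c.
have se := form_smooth eta sc.
apply: smoothZmx => //; apply: smoothV => //.
  by move=> x cx; rewrite gt_eqF // cone_b.
by apply: smooth_pairing => //; exact: fundamental_field_smooth.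
Qed.

(** A vector is the sum of a multiple of the Reeb vector and a vector of the distribution. This
    characterisation gives both the invariance of the form and its change with [b]. *)
Lemma eta_xi_unique c x (a : 'cV[R]_(n.*2.+1)) : smooth_chart c -> ccod c x ->
  (forall v, cr_dist S c x v -> pairing v a = 0) -> pairing (X b c x) a = 1 -> a = e c x.
Proof.
move=> sc cx a0 a1; apply: colv_ext => v; pose w := v - pairing v (e c x) *: X b c x.
have Dw : cr_dist S c x w by apply/eta_xi_kernel => //; rewrite pairingBl pairingZl eta_xi_field // mulr1 subrr.
have := a0 w Dw; rewrite pairingBl pairingZl a1 mulr1 => /eqP.
by rewrite subr_eq0 => /eqP.
Qed.

Lemma eta_xi_push a c d x : smooth_chart c -> smooth_chart d -> local_dom (rho a) c d x ->
  e c x = jac (local_map (rho a) c d) x *m e d (local_map (rho a) c d x).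
Proof.
move=> sc sd Lx; have [_ /(_ c d x sc sd Lx)] := crd a; rewrite jacE /= => -[h1 h2 h3].
have [cx dx] := Lx; have dc : ccod d (local_map (rho a) c d x) by exact: chart_map_cod.
symmetry; apply: eta_xi_unique => // [v /h1 Dv|]; rewrite pairing_mul.
  exact/eta_xi_kernel.
by rewrite -(fundamental_field_push act b sc sd Lx) eta_xi_field.
Qed.

Lemma eta_xi_exterior_push a c d x : smooth_chart c -> smooth_chart d -> local_dom (rho a) c d x ->
  exterior (e c) x = jac (local_map (rho a) c d) x *m exterior (e d) (local_map (rho a) c d x)
     *m (jac (local_map (rho a) c d) x)^T.
Proof.
move=> sc sd Lx; have [oL sL] := smooth_action_map act a sc sd.
have LD y : local_dom (rho a) c d y -> ccod d (local_map (rho a) c d y).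
  by move=> [_ dy]; exact: chart_map_cod.
rewrite -(exterior_pull (@chart_open_cod _ _ _ d) oL (eta_xi_smooth sd) sL LD Lx).
by apply: (exterior_ext oL) => // y Ly; exact: eta_xi_push.
Qed.

Lemma horizontal_dist c x v : smooth_chart c -> ccod c x ->
  cr_dist S c x (v *m (1%:M - e c x *m X b c x)).
Proof.
move=> sc cx; apply/eta_xi_kernel => //.
by rewrite mulmxBr mulmx1 mul_outer pairingBl pairingZl eta_xi_field // mulr1 subrr.
Qed.

Lemma horizontal_id c x v : smooth_chart c -> ccod c x -> cr_dist S c x v ->
  v *m (1%:M - e c x *m X b c x) = v.
Proof.
by move=> sc cx /(eta_xi_kernel _ sc cx) h; rewrite mulmxBr mulmx1 mul_outer h scale0r subr0.
Qed.

Lemma Phi_xi_push a c d x : smooth_chart c -> smooth_chart d -> local_dom (rho a) c d x ->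
  Phi_xi S rho eta b c x *m jac (local_map (rho a) c d) x
    = jac (local_map (rho a) c d) x *m Phi_xi S rho eta b d (local_map (rho a) c d x).
Proof.
move=> sc sd Lx; have [_ /(_ c d x sc sd Lx)] := crd a; rewrite jacE /= => -[h1 h2 h3].
have [cx dx] := Lx; have dc : ccod d (local_map (rho a) c d x) by exact: chart_map_cod.
apply: row_ext => v; rewrite /Phi_xi mulmxA.
rewrite [v *m (_ *m cr_J S c x)]mulmxA (h3 _ (horizontal_dist v sc cx)) !mulmxA; congr (_ *m _).
rewrite mulmxBr mulmx1 mul_outer mulmxBl -scalemxAl -(fundamental_field_push act b sc sd Lx).
by rewrite [in RHS]mulmxBr mulmx1 mul_outer -pairing_mul -eta_xi_push.
Qed.

Definition transverse_metric c x := 2^-1 *: (exterior (e c) x *m (Phi_xi S rho eta b c x)^T).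
Local Notation G := transverse_metric.

Lemma ext_derivE c x : ext_deriv e c x = exterior (e c) x.
Proof. by rewrite /ext_deriv pdE. Qed.

Lemma Sasaki_metricE c x : Sasaki_metric S rho eta b c x = G c x + e c x *m (e c x)^T.
Proof. by rewrite /Sasaki_metric ext_derivE. Qed.

Lemma transverse_metric_push a c d x : smooth_chart c -> smooth_chart d -> local_dom (rho a) c d x ->
  G c x = jac (local_map (rho a) c d) x *m G d (local_map (rho a) c d x) *m (jac (local_map (rho a) c d) x)^T.
Proof.
move=> sc sd Lx; rewrite /G (eta_xi_exterior_push sc sd Lx) -scalemxAr -scalemxAl; congr (_ *: _).
by rewrite -!mulmxA -!trmx_mul Phi_xi_push.
Qed.

Lemma Sasaki_metric_push a c d x : smooth_chart c -> smooth_chart d -> local_dom (rho a) c d x ->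
  Sasaki_metric S rho eta b c x = jac (local_map (rho a) c d) x
    *m Sasaki_metric S rho eta b d (local_map (rho a) c d x) *m (jac (local_map (rho a) c d) x)^T.
Proof.
move=> sc sd Lx; rewrite !Sasaki_metricE (transverse_metric_push sc sd Lx) mulmxDr mulmxDl.
by rewrite {1 2}(eta_xi_push sc sd Lx) trmx_mul !mulmxA.
Qed.

Lemma Phi_xi_smooth c : smooth_chart c -> smooth_on (ccod c) (Phi_xi S rho eta b c).
Proof.
move=> sc; have oc := @chart_open_cod _ _ _ c; apply: smooth_mulmx => //; last exact: endo_smooth.
apply: smoothDmx => //.
apply: smoothNmx => //; apply: smooth_mulmx => //; first exact: eta_xi_smooth.
exact: fundamental_field_smooth.
Qed.

Lemma smooth_exterior m (U : set 'rV[R]_m) (al : 'rV[R]_m -> 'cV[R]_m) : open U -> smooth_on U al ->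
  smooth_on U (exterior al).
Proof.
move=> oU sal; apply/smooth_mxP => // i j.
apply: (smooth_ext oU (f := fun x => pd i (fun w => al w j 0 : R) x - pd j (fun w => al w i 0 : R) x)).
  by move=> x _; rewrite mxE.
by [].
Qed.

Lemma transverse_metric_smooth c : smooth_chart c -> smooth_on (ccod c) (G c).
Proof.
move=> sc; have oc := @chart_open_cod _ _ _ c; apply: smoothZmx => //.
apply: smooth_mulmx => //; first by apply: smooth_exterior => //; exact: eta_xi_smooth.
by apply: smooth_trmx => //; exact: Phi_xi_smooth.
Qed.

Lemma Sasaki_metric_smooth c : smooth_chart c -> smooth_on (ccod c) (Sasaki_metric S rho eta b c).
Proof.
move=> sc; have oc := @chart_open_cod _ _ _ c; have se := eta_xi_smooth sc.
apply: (smooth_ext oc (f := fun x => G c x + e c x *m (e c x)^T)).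
  by move=> x _; rewrite Sasaki_metricE.
apply: smoothDmx => //; exact: transverse_metric_smooth.
Qed.

(** Integrability puts [JX, Y] + [X, JY] in the distribution, and [exterior_bracket] reads this as
    invariance of the form under J. The sections [sec] are constant vectors projected to the
    distribution. *)
Lemma exterior_eta_xi_J c x u v : smooth_chart c -> ccod c x -> cr_dist S c x u -> cr_dist S c x v ->
  bil (exterior (e c) x) (u *m cr_J S c x) v + bil (exterior (e c) x) u (v *m cr_J S c x) = 0.
Proof.
move=> sc cx Du Dv; have oc := @chart_open_cod _ _ _ c; have se := eta_xi_smooth sc.
pose sec (w : E) y : E := w *m (1%:M - e c y *m X b c y).
have ssec w : smooth_on (ccod c) (sec w).
  apply: smooth_mulmx => //.
  apply: smoothDmx => //.
  apply: smoothNmx => //; apply: smooth_mulmx => //; exact: fundamental_field_smooth.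
have Dsec w y : ccod c y -> cr_dist S c y (sec w y) by exact: horizontal_dist.
have sJ w : smooth_on (ccod c) (fun y => sec w y *m cr_J S c y).
  by apply: smooth_mulmx => //; exact: endo_smooth.
have DJ w y : ccod c y -> cr_dist S c y (sec w y *m cr_J S c y).
  by move=> cy; apply: cr_J_stable => //; exact: Dsec.
have [h _] := cr_J_integrable sc (ssec u) (ssec v) (fun y cy => conj (Dsec u y cy) (Dsec v y cy)) cx.
move: h => /(eta_xi_kernel _ sc cx).
have K w y : ccod c y -> pairing (sec w y) (e c y) = 0 by move=> cy; apply/eta_xi_kernel => //; exact: Dsec.
have KJ w y : ccod c y -> pairing (sec w y *m cr_J S c y) (e c y) = 0.
  by move=> cy; apply/eta_xi_kernel => //; exact: DJ.
have := exterior_bracket oc cx se (sJ u) (ssec v) (fun y cy => conj (KJ u y cy) (K v y cy)).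
have := exterior_bracket oc cx se (ssec u) (sJ v) (fun y cy => conj (K u y cy) (KJ v y cy)).
have secu : sec u x = u by exact: horizontal_id.
have secv : sec v x = v by exact: horizontal_id.
rewrite secu secv => -> ->; rewrite pairingDl => h.
by rewrite -opprD h oppr0.
Qed.

(* The Lie derivative of e along X a vanishes, so Cartan's formula gives the
   Hamiltonian equation for X a. *)
Lemma hamiltonian a c x : smooth_chart c -> ccod c x ->
  X a c x *m exterior (e c) x = - (gradient (fun y => pairing (X a c y) (e c y)) x)^T.
Proof.
move=> sc cx; have oc := @chart_open_cod _ _ _ c; have se := eta_xi_smooth sc.
have lie := lie_form (a := a) act sc se cx (fun s y Ly => eta_xi_push sc sc Ly).
have sej j : smooth_on (ccod c) (fun y => e c y j 0 : R) by [].
have sX := fundamental_field_smooth act a sc.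
have sXi i : smooth_on (ccod c) (fun y => X a c y 0 i : R) by [].
apply/rowP => j; rewrite !mxE.
rewrite (pd_ext (g := fun y => \sum_i X a c y 0 i * e c y i 0) _ oc) //; last by move=> y _; rewrite pairingE.
rewrite (jet1_sum cx) //.
under eq_bigr do rewrite mxE mulrBr.
under [in RHS]eq_bigr do rewrite (jet1M cx) //.
rewrite sumrB big_split /=; have /matrixP/(_ j 0) := lie; rewrite !mxE summxE => /eqP.
rewrite addr_eq0 => /eqP E1; rewrite opprD; congr (_ - _).
have -> : \sum_i pd j (fun z => X a c z 0 i : R) x * e c x i 0 = \sum_i jac (X a c) x j i * e c x i 0.
  by apply: eq_bigr => i _; rewrite jac_entry //.
by rewrite E1 opprK; apply: eq_bigr => i _; rewrite !mxE pd_mx //.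
Qed.

Lemma Reeb_exterior c x : smooth_chart c -> ccod c x -> X b c x *m exterior (e c) x = 0.
Proof.
move=> sc cx; rewrite hamiltonian //; apply/matrixP => i j; rewrite !mxE.
by rewrite (pd_ext (g := fun=> (1 : R)) _ (@chart_open_cod _ _ _ c)) ?pd_cst ?oppr0 // => y cy; exact: eta_xi_field.
Qed.
End OneField.

(** [Sasaki_type] gives positivity for one contact form. It has the same kernel and co-orientation,
    so the form of [b] is a positive multiple of it, and on the distribution the exterior derivative
    scales by that factor. *)
Lemma transverse_positive b c x v : Sasaki_cone rho eta b -> smooth_chart c -> ccod c x ->
  cr_dist S c x v -> v != 0 -> 0 < bil (exterior (eta_xi rho eta b c) x) v (v *m cr_J S c x).
Proof.
move=> cb sc cx Dv v0; have oc := @chart_open_cod _ _ _ c.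
have [et [Y [et_contact et_pos _ _]]] := sasaki.
have pos y : ccod c y -> 0 < pairing (X b c y) (et c y).
  by move=> cy; have [_ <- _] := et_contact c y sc cy; have [_ -> _] := eta_contact sc cy; exact: cb.
pose g y := (pairing (X b c y) (et c y))^-1.
have E1 y : ccod c y -> eta_xi rho eta b c y = g y *: et c y.
  move=> cy; symmetry; apply: eta_xi_unique => // [w Dw|]; rewrite pairingZr.
    by have [h _ _] := et_contact c y sc cy; rewrite (h w).1 ?mulr0.
  by rewrite mulVf // gt_eqF // pos.
have sX := fundamental_field_smooth act b sc; have set := form_smooth et sc.
have sg : smooth_on (ccod c) g.
  apply: smoothV => //; first by move=> y cy; rewrite gt_eqF // pos.
  exact: smooth_pairing.
rewrite (exterior_ext oc cx E1) (exterior_scale oc cx sg set).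
have [hk _ _] := et_contact c x sc cx.
have v0' : v *m et c x = 0 by apply/matrixP => i j; rewrite !ord1 [LHS]((hk v).1 Dv) mxE.
have w0 : (et c x)^T *m (v *m cr_J S c x)^T = 0.
  rewrite -trmx_mul; apply/matrixP => i j; rewrite !ord1 mxE.
  by rewrite [LHS]((hk _).1 (cr_J_stable sc cx Dv)) mxE.
have -> : bil (g x *: exterior (et c) x + (gradient g x *m (et c x)^T - et c x *m (gradient g x)^T)) v (v *m cr_J S c x)
   = g x * bil (exterior (et c) x) v (v *m cr_J S c x).
  rewrite /bil mulmxDr mulmxBr !mulmxA v0' mul0mx subr0 mulmxDl -!mulmxA w0 !mulmx0 addr0.
  by rewrite -scalemxAl -scalemxAr mxE.
rewrite mulr_gt0 ?invr_gt0 ?pos //.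
by have := et_pos c x v sc cx Dv v0; rewrite /ext_deriv pdE.
Qed.
End SasakiTensors.

(** * Restriction to the transverse slice *)

Section AdaptedStructure.
Variables (b : 'rV[R]_k) (d : chartN) (r : R).
Hypotheses (cone_b : Sasaki_cone rho eta b).
Hypothesis ad : @adapted R n.*2 N k rho b d r.
Local Notation e := (eta_xi rho eta b).
Local Notation G := (transverse_metric b).
Local Notation Phi := (Phi_xi S rho eta b).
Local Notation e0 := (pt 1 (0 : F) : 'rV[R]_(1 + n.*2)).

Definition slice_dom : set F := ball 0 r.
Definition slice_form (y : F) : 'cV[R]_(n.*2) := dsubmx (e d (pt 0 y) : 'cV[R]_(1 + n.*2)).
Definition slice_field a (y : F) : F := rsubmx (X a d (pt 0 y) : 'rV[R]_(1 + n.*2)).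
Definition slice_metric (y : F) : 'M[R]_(n.*2) := drsubmx (G d (pt 0 y) : 'M[R]_(1 + n.*2)).
Definition slice_potential a (y : F) : R := pairing (X a d (pt 0 y)) (e d (pt 0 y)).
Local Notation al := slice_form.
Local Notation K := slice_field.
Local Notation h := slice_metric.
Local Notation f := slice_potential.

Let sd : smooth_chart d. Proof. by case: ad. Qed.
Let r0 : 0 < r. Proof. by case: ad. Qed.
Let od : open (ccod d) := @chart_open_cod _ _ _ d.

Lemma slice_domE y : slice_dom y <-> `|y| < r.
Proof. by rewrite /slice_dom -ball_normE /= sub0r normrN. Qed.

Lemma slice_dom_open : open slice_dom. Proof. exact: ball_open. Qed.
Local Notation oU := slice_dom_open.

Lemma adapted_slice t y : ccod d (pt t y) -> slice_dom y.
Proof. by move/(adapted_ccod ad) => -[_ /slice_domE]. Qed.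

Lemma slice_ccod y : slice_dom y -> ccod d (pt 0 y).
Proof. by move/slice_domE => yr; apply/(adapted_ccod ad); rewrite normr0. Qed.

Let shift t y : ccod d (pt t y) -> [/\ ccod d (pt 0 y), local_dom (rho ((0 - t) *: b)) d d (pt t y),
  local_map (rho ((0 - t) *: b)) d d (pt t y) = pt 0 y & jac (local_map (rho ((0 - t) *: b)) d d) (pt t y) = 1%:M].
Proof.
move=> dt; have d0 := slice_ccod (adapted_slice dt); have [h1 h2] := adapted_shift ad dt d0.
by split=> //; exact: (adapted_shift_jac act ad dt d0).
Qed.

Lemma adapted_form t y : ccod d (pt t y) -> e d (pt t y) = col_mx (1%:M : 'M[R]_1) (al y).
Proof.
move=> dt; have [d0 Lt mE jE] := shift dt.
have -> : e d (pt t y) = e d (pt 0 y).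
  by rewrite (eta_xi_push cone_b sd sd Lt) jE mul1mx mE.
have := eta_xi_field cone_b sd d0; rewrite (adapted_field act ad d0) => h1.
have E1 : usubmx (e d (pt 0 y) : 'cV[R]_(1 + n.*2)) = 1%:M.
  by rewrite -e0_mul; apply/matrixP => i j; rewrite !ord1 [RHS]mxE eqxx.
by rewrite /al -E1 vsubmxK.
Qed.

Lemma adapted_fields a t y : ccod d (pt t y) -> X a d (pt t y) = X a d (pt 0 y).
Proof.
move=> dt; have [d0 Lt mE jE] := shift dt.
have E1 := fundamental_field_push act a sd sd Lt; rewrite mE in E1.
by rewrite E1 jE mulmx1.
Qed.

Lemma adapted_potential a t y : ccod d (pt t y) -> pairing (X a d (pt t y)) (e d (pt t y)) = f a y.
Proof.
move=> dt; have [d0 _ _ _] := shift dt.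
by rewrite /f (adapted_fields a dt) (adapted_form dt) (adapted_form d0).
Qed.

Lemma field_exterior z : ccod d z -> e0 *m exterior (e d) z = 0.
Proof. by move=> dz; rewrite -(adapted_field act ad dz); exact: Reeb_exterior. Qed.

Lemma exterior_antisym m (u : 'rV[R]_m -> 'cV[R]_m) z : (exterior u z)^T = - exterior u z.
Proof. by apply/matrixP => i j; rewrite !mxE opprB. Qed.

Lemma field_Phi z : ccod d z -> e0 *m Phi d z = 0.
Proof.
move=> dz; rewrite -(adapted_field act ad dz) /Phi_xi mulmxA mulmxBr mulmx1 mul_outer.
by rewrite eta_xi_field // scale1r subrr mul0mx.
Qed.

Let pd_slice (g : E -> R) i t y : smooth_on (ccod d) g -> ccod d (pt t y) ->
  pd i (fun y => g (pt t y)) y = pd (rshift 1 i) g (pt t y).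
Proof.
move=> sg dt; pose U := [set y | slice_dom y /\ slice_dom y].
have h1 y' : slice_dom y' -> ccod d (pt t y').
  by move=> /slice_domE h1; apply/(adapted_ccod ad); case/(adapted_ccod ad): dt.
have := pd_graph i od oU sg (smooth_cst slice_dom t) (adapted_slice dt) dt.
by rewrite pd_cst mulr0 add0r.
Qed.

Lemma adapted_exterior t y : ccod d (pt t y) ->
  exterior (e d) (pt t y) = block_mx (0 : 'M[R]_1) 0 0 (exterior al y).
Proof.
move=> dt; have se := eta_xi_smooth cone_b sd.
have k1 := field_exterior dt.
have k2 : exterior (e d) (pt t y) *m e0^T = 0.
  by apply: trmx_inj; rewrite trmx_mul trmxK exterior_antisym mulmxN k1 trmx0 oppr0.
suff E2 : drsubmx (exterior (e d) (pt t y) : 'M[R]_(1 + n.*2)) = exterior al y by rewrite (block_of_kernel k1 k2) E2.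
apply/matrixP => i j.
have se' j' : smooth_on (ccod d) (fun z => e d z (rshift 1 j') 0 : R) by [].
have E1 i' j' : pd (rshift 1 i') (fun z => e d z (rshift 1 j') 0 : R) (pt t y) = pd i' (fun y => al y j' 0 : R) y.
  rewrite -(pd_slice i' (se' j') dt); apply: (pd_ext _ oU (adapted_slice dt)) => y' y'r.
  have dt' : ccod d (pt t y').
    by apply/(adapted_ccod ad); split; [case/(adapted_ccod ad): dt|exact/slice_domE].
  by rewrite (adapted_form dt') (@col_mxEd R 1 n.*2 1).
by rewrite !mxE !E1.
Qed.

Lemma adapted_metric t y : ccod d (pt t y) -> G d (pt t y) = block_mx (0 : 'M[R]_1) 0 0 (h y).
Proof.
move=> dt; have [d0 Lt mE jE] := shift dt.
have -> : G d (pt t y) = G d (pt 0 y).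
  by rewrite (transverse_metric_push cone_b sd sd Lt) jE mul1mx trmx1 mulmx1 mE.
apply: block_of_kernel; rewrite /transverse_metric -?scalemxAl -?scalemxAr.
  by rewrite mulmxA field_exterior // mul0mx scaler0.
by rewrite -mulmxA -trmx_mul field_Phi // trmx0 mulmx0 scaler0.
Qed.

(** The lift of a slice vector to the contact distribution, where J acts and positivity is known. *)
Definition lift_vector (y v : F) : 'rV[R]_(1 + n.*2) := pt (- (v *m al y) 0 0) v.

Lemma lift_dist t y v : ccod d (pt t y) -> cr_dist S d (pt t y) (lift_vector y v).
Proof.
move=> dt; apply/(eta_xi_kernel cone_b _ sd dt).
by rewrite (adapted_form dt) (@pairing_pt R n.*2) addNr.
Qed.

Lemma dist_Phi c x u : smooth_chart c -> ccod c x -> cr_dist S c x u -> u *m Phi c x = u *m cr_J S c x.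
Proof. by move=> sc cx Du; rewrite /Phi_xi mulmxA (horizontal_id cone_b). Qed.

Lemma slice_metricE y u v : slice_dom y ->
  bil (h y) u v = 2^-1 * bil (exterior (e d) (pt 0 y)) (lift_vector y u) (lift_vector y v *m cr_J S d (pt 0 y)).
Proof.
move=> /slice_ccod d0; have := bil_block (h y) (lift_vector y u) (lift_vector y v).
rewrite !row_mxKr => <-; rewrite -(adapted_metric d0) /transverse_metric /bil.
rewrite -scalemxAr -scalemxAl mxE; congr (_ * _).
by rewrite !mulmxA -[_ *m _^T *m _]mulmxA -trmx_mul (dist_Phi sd d0 (lift_dist v d0)).
Qed.

Lemma slice_metric_sym y : slice_dom y -> (h y)^T = h y.
Proof.
move=> Uy; have d0 := slice_ccod Uy; apply: matrix_bil_ext => u v.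
rewrite bil_tr !slice_metricE //; congr (_ * _).
have := exterior_eta_xi_J cone_b sd d0 (lift_dist u d0) (lift_dist v d0).
move=> /eqP; rewrite addr_eq0 => /eqP E1; rewrite -[RHS]opprK -E1 -bil_tr exterior_antisym.
by rewrite /bil mulmxN mulNmx mxE.
Qed.

Lemma slice_metric_positive y : slice_dom y -> positive_form (h y).
Proof.
move=> Uy v v0; have d0 := slice_ccod Uy; rewrite -/(bil _ _ _) slice_metricE //.
rewrite mulr_gt0 ?invr_gt0 //; apply: (transverse_positive cone_b sd d0 (lift_dist v d0)).
by apply: contraNneq v0 => h0; rewrite -[v](row_mxKr ((- (v *m al y) 0 0)%:M : 'M[R]_1)) -/(lift_vector y v) h0 linear0.
Qed.

Lemma slice_metric_unit y : slice_dom y -> h y \in unitmx.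
Proof.
by move=> Uy; apply: positive_form_unit; [exact: slice_metric_sym|exact: slice_metric_positive].
Qed.

(** The transverse part [J] of Phi squares to minus the identity. As the metric is half of d(al)
    composed with J, inverting gives d(al) = -2 h J^T, whence the factor 4. *)
Lemma slice_almost_kahler y : slice_dom y ->
  exterior al y *m invmx (h y) *m (exterior al y)^T = 4 *: h y.
Proof.
move=> Uy; have d0 := slice_ccod Uy; pose P : 'M[R]_(1 + n.*2) := Phi d (pt 0 y).
have P0 : usubmx P = 0 by rewrite -e0_mul field_Phi.
pose J := drsubmx P.
have PE : P = block_mx 0 0 (dlsubmx P) J.
  rewrite -{1}[P]submxK; congr block_mx.
    by rewrite /ulsubmx P0 linear0.
  by rewrite /ursubmx P0 linear0.
have rP (u : 'rV[R]_(1 + n.*2)) : rsubmx (u *m P) = rsubmx u *m J.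
  by rewrite PE -{1}(hsubmxK u) mul_row_block mulmx0 add0r mulmx0 add0r row_mxKr.
have JJ : J *m J = - 1%:M.
  apply: row_ext => v; rewrite mulmxN mulmx1.
  have Dv := lift_dist v d0; have DJ := cr_J_stable sd d0 Dv.
  have <- : rsubmx (lift_vector y v *m P *m P) = v *m (J *m J) by rewrite !rP row_mxKr mulmxA.
  by rewrite /P (dist_Phi sd d0 Dv) (dist_Phi sd d0 DJ) (cr_J_sqr sd d0 Dv) linearN /= row_mxKr.
have JJT : J^T *m J^T = - 1%:M by rewrite -trmx_mul JJ linearN /= trmx1.
have hE : h y = 2^-1 *: (exterior al y *m J^T).
  rewrite -(@drsubmx_block_mul R n.*2 2^-1 (exterior al y) J (dlsubmx P)) -PE.
  by rewrite /h /transverse_metric (adapted_exterior d0).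
have OE : exterior al y = - 2 *: (h y *m J^T).
  rewrite hE -scalemxAl scalerA mulNr mulfV ?pnatr_eq0 // -mulmxA JJT mulmxN mulmx1.
  by rewrite scaleN1r opprK.
rewrite exterior_antisym mulmxN {2}OE -scalemxAr -scaleNr opprK {1}OE -!scalemxAl scalerA.
rewrite -!mulmxA [invmx _ *m _]mulmxA mulVmx ?slice_metric_unit // mul1mx JJT mulmxN mulmx1.
by rewrite scalerN -scaleNr; congr (_ *: _); ring.
Qed.

Let smooth_slice p (g : E -> 'M[R]_(p.1, p.2)) : smooth_on (ccod d) g -> smooth_on slice_dom (fun y => g (pt 0 y)).
Proof.
move=> sg; apply: (smooth_comp_mx oU od slice_ccod sg).
by apply: (smooth_pt oU) => //; exact: smooth_id oU.
Qed.

Lemma slice_smooth : [/\ smooth_on slice_dom h, smooth_on slice_dom al, forall a, smooth_on slice_dom (K a) &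
  forall a, smooth_on slice_dom (f a)].
Proof.
have se := eta_xi_smooth cone_b sd; have sX a := fundamental_field_smooth act a sd.
have sG := transverse_metric_smooth cone_b sd.
have s1 := @smooth_slice (n.*2.+1, n.*2.+1) _ sG; have s2 := @smooth_slice (n.*2.+1, 1) _ se.
have s3 a := @smooth_slice (1, n.*2.+1) _ (sX a).
split.
- apply/smooth_mxP => [|i j]; first exact: oU.
  apply: (smooth_ext oU (f := fun y => G d (pt 0 y) (rshift 1 i) (rshift 1 j) : R)).
    by move=> y _; rewrite [RHS]mxE [RHS]mxE.
  exact: smooth_entry oU s1.
- apply/smooth_mxP => [|i j]; first exact: oU.
  apply: (smooth_ext oU (f := fun y => e d (pt 0 y) (rshift 1 i) j : R)); last exact: smooth_entry oU s2.
  by move=> y _; rewrite [RHS]mxE.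
- move=> a; apply/smooth_mxP => [|i j]; first exact: oU.
  apply: (smooth_ext oU (f := fun y => X a d (pt 0 y) i (rshift 1 j) : R)); last exact: smooth_entry oU (s3 a).
  by move=> y _; rewrite [RHS]mxE.
- by move=> a; apply: smooth_pairing (s3 a) s2; exact: oU.
Qed.

Lemma slice_hamiltonian a y : slice_dom y -> K a y *m exterior al y = - (gradient (f a) y)^T.
Proof.
move=> Uy; have d0 := slice_ccod Uy; have se := eta_xi_smooth cone_b sd; have sX := fundamental_field_smooth act a sd.
have := hamiltonian cone_b a sd d0.
rewrite (adapted_exterior d0) (@row_mul_block R n.*2) => E1.
apply/rowP => j; have /rowP/(_ (rshift 1 j)) := E1; rewrite (@row_mxEr R 1 1 n.*2) /K => ->.
rewrite !mxE; congr (- _).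
rewrite -(pd_slice j (g := fun z => pairing (X a d z) (e d z))) //.
by apply: smooth_pairing.
Qed.
End AdaptedStructure.

(** * Transverse scalar curvature through any local quotient *)

Section TransverseScalarCurvature.
Local Notation e b := (eta_xi rho eta b).
Local Notation pot b1 b c x := (pairing (X b c x) (eta_xi rho eta b1 c x)).
Implicit Types (c d : chartN) (b : 'rV[R]_k).

Lemma mulCA_eq (a b f g : R) : a = f * b -> g * a = f * (g * b).
Proof. by move=> ->; rewrite mulrCA. Qed.

Lemma bil_mod m (A B : 'M[R]_m) (g a : 'cV[R]_m) (u v : 'rV[R]_m) (f : R) :
  u *m a = 0 -> a^T *m v^T = 0 -> A = f *: B + (g *m a^T - a *m g^T) -> bil A u v = f * bil B u v.
Proof.
move=> ua av ->; rewrite /bil mulmxDr mulmxBr !mulmxA ua mul0mx subr0 mulmxDl -!mulmxA av !mulmx0 addr0.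
by rewrite -scalemxAl -scalemxAr mxE.
Qed.

Section Change.
Variables b1 b : 'rV[R]_k.
Hypotheses (cone1 : Sasaki_cone rho eta b1) (cone_b : Sasaki_cone rho eta b).

Lemma potential_gt0 c x : smooth_chart c -> ccod c x -> 0 < pot b1 b c x.
Proof.
move=> sc cx; have h1 := cone1 sc cx; have h2 := cone_b sc cx.
have -> : pot b1 b c x = (pairing (X b1 c x) (eta c x))^-1 * pairing (X b c x) (eta c x) by exact: pairingZr.
have h3 : 0 < (pairing (X b1 c x) (eta c x))^-1.
  rewrite invr_gt0; exact: h1.
exact: mulr_gt0 h3 h2.
Qed.

Lemma eta_xi_change c x : smooth_chart c -> ccod c x -> e b c x = (pot b1 b c x)^-1 *: e b1 c x.
Proof.
move=> sc cx; symmetry; apply: (eta_xi_unique cone_b sc cx) => [v Dv|]; rewrite pairingZr.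
  by rewrite ((eta_xi_kernel cone1 v sc cx).1 Dv) mulr0.
by rewrite mulVf // gt_eqF // potential_gt0.
Qed.

Lemma potential_smooth c : smooth_chart c -> smooth_on (ccod c) (fun x => pot b1 b c x).
Proof.
move=> sc; apply: smooth_pairing; [exact: chart_open_cod|exact: fundamental_field_smooth|exact: eta_xi_smooth].
Qed.

(** The forms of b and b1 differ by the factor f^(-1). The derivative of this factor contributes a
    product with the contact form, which vanishes on the distribution by [bil_mod]. *)
Lemma Sasaki_metric_dist c x u v : smooth_chart c -> ccod c x -> cr_dist S c x u -> cr_dist S c x v ->
  bil (Sasaki_metric S rho eta b c x) u v = (pot b1 b c x)^-1 * bil (transverse_metric b1 c x) u v.
Proof.
move=> sc cx Du Dv; have oc := @chart_open_cod _ _ _ c.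
have u0 b' : Sasaki_cone rho eta b' -> u *m e b' c x = 0.
  move=> cb; apply/matrixP => i j; rewrite !ord1 [RHS]mxE.
  exact: (eta_xi_kernel cb u sc cx).1.
have vJ0 : (e b1 c x)^T *m (v *m cr_J S c x)^T = 0.
  rewrite -trmx_mul; apply/matrixP => i j; rewrite !ord1 [RHS]mxE mxE.
  exact: (eta_xi_kernel cone1 _ sc cx).1 (cr_J_stable sc cx Dv).
have GE b' : Sasaki_cone rho eta b' -> bil (transverse_metric b' c x) u v
    = 2^-1 * bil (exterior (e b' c) x) u (v *m cr_J S c x).
  move=> cb; rewrite /transverse_metric /bil -scalemxAr -scalemxAl mxE; congr (_ * _).
  rewrite !mulmxA -[_ *m _^T *m _]mulmxA -trmx_mul /Phi_xi mulmxA (horizontal_id cb) //.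
have -> : bil (Sasaki_metric S rho eta b c x) u v = bil (transverse_metric b c x) u v.
  by rewrite Sasaki_metricE /bil mulmxDr mulmxDl !mulmxA u0 // !mul0mx addr0.
transitivity ((pot b1 b c x)^-1 * (2^-1 * bil (exterior (e b1 c) x) u (v *m cr_J S c x))); last first.
  by congr (_ * _); exact: esym (GE b1 cone1).
rewrite (GE b cone_b).
apply: mulCA_eq; have s1 := eta_xi_smooth cone1 sc; have sp := potential_smooth sc.
have sf : smooth_on (ccod c) (fun x => (pot b1 b c x)^-1).
  by apply: smoothV => // y cy; apply: lt0r_neq0; exact: potential_gt0.
apply: (bil_mod (u0 _ cone1) vJ0).
exact: etrans (exterior_ext oc cx (fun y cy => eta_xi_change sc cy)) (exterior_scale oc cx sf s1).
Qed.
End Change.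

Section Quotient.
Variables (b : 'rV[R]_k) (c : chartN) (q : E -> F) (hq : F -> 'M[R]_(n.*2)).
Hypotheses (cone_b : Sasaki_cone rho eta b) (lq : local_quotient S rho eta b c q hq).

Let sc : smooth_chart c. Proof. by case: lq. Qed.
Let oc : open (ccod c) := @chart_open_cod _ _ _ c.
Let sq : smooth_on (ccod c) q. Proof. by case: lq => _ []. Qed.

(** The map [q] is constant along short pieces of an orbit, for which the whole path stays in the
    chart as the clause on fibres demands. *)
Lemma quotient_field x : ccod c x -> X b c x *m jac q x = 0.
Proof.
move=> cx; have dq := smooth_differentiable_row oc sq cx.
have h1 := curve_jac (fundamental_field_derive act b sc cx) (G := q).
rewrite scale0r (action0 act) chart_invK // in h1; have [_ <-] := h1 dq.
rewrite -(derive_cst (q x) (0 : R) (1 : R)); apply: near_eq_derive.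
have [e0 /= e00 He] := orbit_near act b sc (chart_inv_dom cx).
exists e0 => //= s; rewrite /= sub0r normrN => se.
have cs : cdom c (rho (s *: b) (cinv c x)) by apply: He; rewrite /= sub0r normrN.
have [_ _ h _] := lq; symmetry; apply/(h _ _ cx (chart_map_cod cs)).
exists s; split; last by rewrite chart_mapK.
move=> t /andP[t0 t1]; apply: He; rewrite /= sub0r normrN normrM (ger0_norm t0).
by apply: le_lt_trans se; rewrite ler_piMl.
Qed.

Variables (b1 : 'rV[R]_k) (d : chartN) (r : R) (p : N) (t0 : R) (y0 : F).
Hypotheses (cone1 : Sasaki_cone rho eta b1) (ad : @adapted R n.*2 N k rho b1 d r).
Hypotheses (cp : cdom c p) (dp : cdom d p) (pE : d p = pt t0 y0).
Local Notation al := (slice_form b1 d).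
Local Notation K := (slice_field d b).
Local Notation h := (slice_metric b1 d).
Local Notation f := (slice_potential b1 d b).

Let sd : smooth_chart d. Proof. by case: ad. Qed.
Let T := local_map idfun d c.
Let L := local_dom idfun d c.
Let oL : open L. Proof. exact: local_dom_open. Qed.
Let sT : smooth_on L T. Proof. exact: smooth_transition. Qed.
Let TL z : L z -> ccod c (T z). Proof. by move=> [_ cz]; exact: chart_map_cod. Qed.

Let rho0E : rho 0 = idfun. Proof. by apply/funext => x; exact: (action0 act). Qed.

Let fpos y : slice_dom r y -> 0 < f y.
Proof. by move=> Uy; apply: potential_gt0 => //; exact: slice_ccod ad _ Uy. Qed.

(** As dq kills X_b, tangent vectors may first be projected to the distribution along X_b, where the
    two metrics are proportional. The block column is this projection followed by passage to slice
    coordinates; its top row is the image of the time direction. *)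
Lemma quotient_metric_pull t y : L (pt t y) ->
  jac (fun z => q (T z)) (pt t y) *m hq (q (T (pt t y))) *m (jac (fun z => q (T z)) (pt t y))^T
  = (f y)^-1 *: (col_mx (- (f y)^-1 *: K y) (twist_map al K f y) *m h y
                 *m (col_mx (- (f y)^-1 *: K y) (twist_map al K f y))^T).
Proof.
move=> Lz; have dz : ccod d (pt t y) := Lz.1; have cx := TL Lz; set z := pt t y in Lz dz cx *.
have dT := smooth_differentiable_row oL sT Lz; have dq := smooth_differentiable_row oc sq cx.
rewrite (jac_comp dT dq); set JT := jac T z; set Jq := jac q (T z).
have Lz' : local_dom (rho 0) d c z by rewrite rho0E.
have JT0 : JT = jac (local_map (rho 0) d c) z by rewrite rho0E.
have fz : pot b1 b d z = f y by exact: (adapted_potential cone1 ad).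
have f0 : f y != 0 by apply: lt0r_neq0; exact: fpos (adapted_slice ad dz).
pose Pi : 'M[R]_(n.*2.+1) := 1%:M - e b d z *m X b d z.
have DPi u : cr_dist S d z (u *m Pi) by exact: horizontal_dist.
have push u : cr_dist S d z u -> cr_dist S c (T z) (u *m JT).
  by have [_ /(_ d c z sd sc Lz')] := crd 0; rewrite jacE rho0E /= => -[h1 _ _] /h1.
have XJ : X b d z *m JT *m Jq = 0.
  by rewrite JT0 -(fundamental_field_push act b sd sc Lz') rho0E; exact: quotient_field.
have PiJ (u : E) : u *m Pi *m JT *m Jq = u *m JT *m Jq.
  by rewrite mulmxBr mulmx1 mul_outer !mulmxBl -!scalemxAl XJ scaler0 subr0.
apply: (@matrix_bil_ext R n.*2.+1) => u v.
have -> : bil (JT *m Jq *m hq (q (T z)) *m (JT *m Jq)^T) u v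
    = bil (hq (q (T z))) (u *m Pi *m JT *m Jq) (v *m Pi *m JT *m Jq).
  by rewrite !PiJ /bil !trmx_mul !mulmxA.
have [_ _ _ hm] := lq; rewrite jacE in hm.
have := hm _ _ _ cx (push _ (DPi u)) (push _ (DPi v)); rewrite -/Jq => <-.
have -> : bil (Sasaki_metric S rho eta b c (T z)) (u *m Pi *m JT) (v *m Pi *m JT)
    = bil (Sasaki_metric S rho eta b d z) (u *m Pi) (v *m Pi).
  rewrite (Sasaki_metric_push cone_b sd sc Lz') -JT0 /bil !trmx_mul !mulmxA.
  by rewrite /T rho0E.
rewrite (Sasaki_metric_dist cone1 cone_b sd dz (DPi u) (DPi v)) fz.
rewrite (adapted_metric cone1 ad dz) (@bil_block R n.*2).
pose P := col_mx (- (f y)^-1 *: K y) (twist_map al K f y).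
have PE w : rsubmx (w *m Pi : 'rV[R]_(1 + n.*2)) = (w : 'rV[R]_(1 + n.*2)) *m P.
  have [s [w' ->]] := pt_surj (w : 'rV[R]_(1 + n.*2)).
  rewrite mulmxBr mulmx1 mul_outer (eta_xi_change cone1 cone_b sd dz) pairingZr fz.
  rewrite (adapted_form cone1 ad dz) (@pairing_pt R n.*2).
  rewrite linearB linearZ /= row_mxKr (adapted_fields ad b dz) -/(K y) mul_row_col.
  rewrite mul_scalar_mx scalerA /twist_map mulmxBr mulmx1 -scalemxAr mulmxA [w' *m al y]mx11_scalar mul_scalar_mx scalerA.
  by rewrite [(_ %:M) 0 0]mxE eqxx mulr1n mulrDr scalerDl opprD addrCA mulrN scaleNr [s * _]mulrC.
have PE2 : bil ((f y)^-1 *: (P *m h y *m P^T)) u v = (f y)^-1 * bil (h y) (u *m P) (v *m P).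
  rewrite /bil -scalemxAr -scalemxAl mxE; congr (_ * _).
  by rewrite trmx_mul !mulmxA.
by rewrite PE2 !PE.
Qed.

Theorem quotient_scalar_curvature : scalar_curvature hq (q (c p))
  = f y0 * scalar_curvature h y0 + (n.*2%:R + 2) * laplacian h f y0
    - (n.*2%:R + 2) * (n.*2%:R + 4) / 4 * gradient_sqr h f y0 / f y0.
Proof.
have oU := @slice_dom_open r.
have [sh sal sK sf] := slice_smooth cone1 ad.
have Lp : L (pt t0 y0).
  by rewrite -pE; split; [exact: chart_map_cod|rewrite /= chart_mapK].
have -> : c p = T (pt t0 y0) by rewrite -pE /T /local_map /= chart_mapK.
have sQ : smooth_on L (fun z => q (T z)) by apply: (smooth_comp_mx oL oc TL sq).
apply: (scalar_curvature_quotient oU sh sal (sK b) (sf b) _ _ _ _ _ oL Lp sQ).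
- exact: slice_metric_sym.
- exact: slice_metric_positive.
- by move=> y Uy; rewrite gt_eqF // fpos.
- by move=> y Uy; exact: (slice_hamiltonian cone1 ad b Uy).
- exact: slice_almost_kahler.
- by move=> t y Lz; exact: adapted_slice ad t y (Lz.1).
- exact: quotient_metric_pull.
Qed.
End Quotient.

Lemma field_neq0 b c x : Sasaki_cone rho eta b -> smooth_chart c -> ccod c x -> X b c x != 0.
Proof.
move=> cb sc cx; apply: contraTneq (cb c x sc cx) => ->.
by rewrite /pairing mul0mx mxE ltxx.
Qed.

Lemma adapted_at b p : Sasaki_cone rho eta b ->
  exists d r, [/\ @adapted R n.*2 N k rho b d r, cdom d p & d p = 0].
Proof.
move=> cb; have [c ac cp] := atlas_cover p; have sc := atlas_smooth_chart ac.
apply: (@adapted_exists R n.*2 N k rho act b c p sc cp).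
exact: field_neq0 (chart_map_cod cp).
Qed.

(** Flow boxes of [b] itself provide a local quotient around every point, so the choice in the
    definition of the curvature never falls back on its default value. *)
Lemma adapted_local_quotient b d r : Sasaki_cone rho eta b -> @adapted R n.*2 N k rho b d r ->
  local_quotient S rho eta b d (fun z => rsubmx (z : 'rV[R]_(1 + n.*2))) (slice_metric b d).
Proof.
move=> cb ad; have sd : smooth_chart d by case: ad.
have od := @chart_open_cod _ _ _ d; have oT : open [set: E] by exact: openT.
pose q (z : E) : F := rsubmx (z : 'rV[R]_(1 + n.*2)).
have sq : smooth_on setT q.
  apply/smooth_mxP => // i j; rewrite ord1.
  apply: (smooth_ext oT (f := fun z : E => z 0 (rshift 1 j))) => //.
  by move=> z _; rewrite [RHS]mxE.
have Jq z : jac q z = col_mx (0 : 'M[R]_(1, n.*2)) 1%:M.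
  apply/matrixP => i j; rewrite jac_entry; last exact: (smooth_differentiable_row oT sq).
  rewrite (pd_ext (g := fun z : E => z 0 (rshift 1 j)) _ oT) ?pd_coord //; last by move=> w _; rewrite [LHS]mxE.
  case: (fintype.split_ordP (i : 'I_(1 + n.*2))) => i' ->.
    by rewrite (@col_mxEu R 1 n.*2) mxE -val_eqE /=; case: i' => -[].
  by rewrite (@col_mxEd R 1 n.*2) mxE -val_eqE /= eqn_add2l eq_sym.
have uJq z (u : E) : u *m jac q z = q u.
  by rewrite Jq -[in LHS](hsubmxK (u : 'rV[R]_(1 + n.*2))) (@mul_row_col R 1 1 n.*2 n.*2) mulmx0 add0r mulmx1.
split=> //.
- split; first exact: smooth_subset sq.
  move=> z _; rewrite jacE -/q Jq; apply/eqP; rewrite eqn_leq rank_leq_col /=.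
  have : (1%:M : 'M[R]_(n.*2)) = row_mx (0 : 'M[R]_(n.*2, 1)) 1%:M *m col_mx (0 : 'M[R]_(1, n.*2)) 1%:M.
    by rewrite mul_row_col mulmx0 add0r mulmx1.
  by move=> /(congr1 (@mxrank _ _ _)); rewrite mxrank1 => E1; rewrite {1}E1 mxrankM_maxr.
- move=> z z' dz dz'; have [t [y zE]] := pt_surj (z : 'rV[R]_(1 + n.*2)).
  have [t' [y' zE']] := pt_surj (z' : 'rV[R]_(1 + n.*2)); subst z z'; rewrite !row_mxKr.
  split=> [yy'|[s [path end_]]].
    subst y'; exists (t' - t); split; last exact: (adapted_flow ad dz dz').
    move=> w /andP[w0 w1]; have dw : ccod d (pt (t + w * (t' - t)) y).
      have [h1 h2] := (adapted_ccod ad t y).1 dz; have [h3 _] := (adapted_ccod ad t' y).1 dz'.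
      apply/(adapted_ccod ad); split=> //; rewrite (_ : t + _ = (1 - w) * t + w * t'); last by ring.
      apply: le_lt_trans (ler_normD _ _) _; rewrite !normrM (ger0_norm w0) ger0_norm ?subr_ge0 //.
      move: `|t| `|t'| h1 h3 => u v h1 h3.
      apply: (@le_lt_trans _ _ ((1 - w) * Num.max u v + w * Num.max u v)).
        by apply: lerD; apply: ler_wpM2l; rewrite ?subr_ge0 // le_max lexx ?orbT.
      by rewrite -mulrDl subrK mul1r gt_max h1.
    have := adapted_flow ad dz dw; rewrite addrC addKr => ->; exact: chart_inv_dom.
  (* While the orbit stays in the chart its transverse coordinates have zero derivative, and the
     path condition covers the whole time interval. *)
  apply/rowP => j; pose p := cinv d (pt t y).
  pose g (w : R) : R := d (rho ((w * s) *: b) p) 0 (rshift 1 j).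
  have dg (w : R) : 0 <= w <= 1 -> is_derive (w : R) (1 : R) g 0.
    move=> /path dw; have := curve_coord (rshift 1 j) (fundamental_field_orbit act sd dw).
    rewrite (adapted_field act ad (chart_map_cod dw)) (@row_mxEr R 1 1 n.*2) mxE => d1.
    have d2 : is_derive (w : R) (1 : R) (fun w : R => w * s) s.
      by have := is_deriveZ s (is_derive_id (w : R) (1 : R)); rewrite /GRing.scale /= mulr1 (_ : s \*: id = fun w : R => w * s) //; apply/funext => v; rewrite mulrC.
    by have := (@is_derive1_comp R (fun s => d (rho (s *: b) p) 0 (rshift 1 j)) (fun w => w * s) w 0 s d1 d2); rewrite mul0r.
  have [||w _] := @MVT R g (fun=> 0) 0 1 ltr01.
  - by move=> w /andP[w0 w1]; apply: dg; rewrite !ltW.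
  - apply: open_cont_within => w /=; rewrite in_itv /= => /dg[dw _].
    by apply: differentiable_continuous; apply/derivable1_diffP.
  rewrite mul0r /g mul0r mul1r scale0r (action0 act) end_ !chart_invK // !(@row_mxEr R 1 1 n.*2).
  by move=> /eqP; rewrite subr_eq0 => /eqP.
- move=> z u v dz Du Dv; rewrite jacE -/q !uJq (Sasaki_metric_dist cb cb sd dz Du Dv).
  have [t [y zE]] := pt_surj (z : 'rV[R]_(1 + n.*2)); subst z.
  rewrite (eta_xi_field cb sd dz) invr1 mul1r (adapted_metric cb ad dz).
  by rewrite (@bil_block R n.*2) row_mxKr.
Qed.

Theorem transverse_scalar_curvatureE b1 b d r p t0 y0 : Sasaki_cone rho eta b1 -> Sasaki_cone rho eta b ->
  @adapted R n.*2 N k rho b1 d r -> cdom d p -> d p = pt t0 y0 ->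
  transverse_scalar_curvature S rho eta b p =
    let h := slice_metric b1 d in let f := slice_potential b1 d b in
    f y0 * scalar_curvature h y0 + (n.*2%:R + 2) * laplacian h f y0
    - (n.*2%:R + 2) * (n.*2%:R + 4) / 4 * gradient_sqr h f y0 / f y0.
Proof.
move=> c1 cb ad dp pE; rewrite /transverse_scalar_curvature.
case: xgetP => [s _ [c [q [hq [lq cp ->]]]]|no].
  exact: (quotient_scalar_curvature cb lq c1 ad cp dp pE).
have [d' [r' [ad' dp' _]]] := adapted_at p cb.
have lq := adapted_local_quotient cb ad'.
by have := no _ (ex_intro _ d' (ex_intro _ _ (ex_intro _ _ (And3 lq dp' erefl)))).
Qed.
End TransverseScalarCurvature.

(** * Volume densities and orientation *)

Section ContactVolume.
Local Notation e b := (eta_xi rho eta b).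
Implicit Types (c d : chart R N n.*2.+1).

Lemma contact_volumeE (f : chart R N n.*2.+1 -> E -> 'cV[R]_(n.*2.+1)) c x :
  contact_volume f c x = (2 ^+ n)^-1 * volume_form (f c x) (exterior (f c) x).
Proof. by rewrite /contact_volume /ext_deriv pdE. Qed.

Lemma contact_volume_change b c d x : Sasaki_cone rho eta b -> smooth_chart c -> smooth_chart d ->
  local_dom idfun c d x -> contact_volume (e b) c x
    = \det (jac (local_map idfun c d) x) * contact_volume (e b) d (local_map idfun c d x).
Proof.
move=> cb sc sd; have [<- <-] := rho0_local act c d => Lx; rewrite !contact_volumeE.
rewrite (eta_xi_push cb sc sd Lx) (eta_xi_exterior_push cb sc sd Lx).
by rewrite volume_form_change mulrCA.
Qed.

(** The exterior derivative of g e is g de plus dg wedge e, and the second term dies in the product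
    with e. This is [volume_form_twist], whose nondegeneracy hypothesis follows from positivity on
    the distribution. *)
Lemma contact_volume_rescale b (f : chart R N n.*2.+1 -> E -> 'cV[R]_(n.*2.+1)) (g : E -> R) c x :
  Sasaki_cone rho eta b -> smooth_chart c -> ccod c x -> smooth_on (ccod c) g -> g x != 0 ->
  (forall y, ccod c y -> f c y = g y *: e b c y) ->
  contact_volume f c x = g x ^+ n.+1 * contact_volume (e b) c x.
Proof.
move=> cb sc cx sg g0 fE; have oc := @chart_open_cod _ _ _ c; have se := eta_xi_smooth cb sc.
rewrite !contact_volumeE fE // (exterior_ext oc cx fE) (exterior_scale oc cx sg se).
have -> : g x *: exterior (e b c) x + (gradient g x *m (e b c x)^T - e b c x *m (gradient g x)^T)
   = g x *: (exterior (e b c) x + (((g x)^-1 *: gradient g x) *m (e b c x)^T - e b c x *m ((g x)^-1 *: gradient g x)^T)).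
  rewrite (_ : (_ *: gradient g x)^T = (g x)^-1 *: (gradient g x)^T); last by apply/matrixP => i j; rewrite !mxE.
  by rewrite scalerDr scalerBr -scalemxAl -scalemxAr !scalerA mulfV ?scale1r.
rewrite volume_form_scale (@volume_form_twist _ _ _ _ _ (X b c x)) 1?mulrCA //.
- exact: exterior_antisym.
- exact: Reeb_exterior.
- exact: eta_xi_field.
move=> v ve vO; apply/eqP; apply: contrapT => /negP v0.
have Dv : cr_dist S c x v by apply/(eta_xi_kernel cb).
have := transverse_positive cb sc cx Dv v0.
by rewrite /bil vO mul0mx mxE ltxx.
Qed.

Lemma contact_volume_neq0 b c x : Sasaki_cone rho eta b -> smooth_chart c -> ccod c x ->
  contact_volume (e b) c x != 0.
Proof.
move=> cb sc cx; have [_ _] := eta_contact sc cx; apply: contraNneq => h.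
rewrite (@contact_volume_rescale b eta (fun y => pairing (X b c y) (eta c y))) // ?h ?mulr0 //.
- apply: smooth_pairing; [exact: chart_open_cod|exact: fundamental_field_smooth|exact: form_smooth].
- by rewrite gt_eqF // cb.
- by move=> y cy; rewrite /eta_xi scalerA mulfV ?scale1r // gt_eqF // cb.
Qed.

Lemma contact_volume_potential b1 b c x : Sasaki_cone rho eta b1 -> Sasaki_cone rho eta b ->
  smooth_chart c -> ccod c x -> contact_volume (e b) c x
    = (pairing (X b c x) (e b1 c x))^-1 ^+ n.+1 * contact_volume (e b1) c x.
Proof.
move=> c1 cb sc cx; have p0 y : ccod c y -> 0 < pairing (X b c y) (e b1 c y) by exact: potential_gt0.
apply: (@contact_volume_rescale b1 (e b) (fun y => (pairing (X b c y) (e b1 c y))^-1) c x c1 sc cx).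
- apply: smoothV; [exact: chart_open_cod|by move=> y cy; rewrite gt_eqF ?p0|].
  by apply: smooth_pairing; [exact: chart_open_cod|exact: fundamental_field_smooth|exact: eta_xi_smooth].
- by rewrite invr_eq0 gt_eqF ?p0.
- by move=> y cy; rewrite (eta_xi_change c1 cb sc cy).
Qed.

Lemma contact_volume_smooth b c : Sasaki_cone rho eta b -> smooth_chart c ->
  smooth_on (ccod c) (contact_volume (e b) c).
Proof.
move=> cb sc; have oc := @chart_open_cod _ _ _ c; have se := eta_xi_smooth cb sc.
apply: (smooth_ext oc (f := fun x => (2 ^+ n)^-1 * volume_form (e b c x) (exterior (e b c) x))).
  by move=> x _; rewrite contact_volumeE.
apply: smoothM => //.
apply: smooth_sum => // s; apply: smoothM => //.
by apply: smooth_prod => // i; apply: smooth_entry => //; exact: smooth_exterior.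
Qed.
End ContactVolume.

Section PositiveAdaptedCharts.
Local Notation e b := (eta_xi rho eta b).

(* The orientation of an adapted chart is corrected by reflecting the last
   coordinate, which is transverse to the flow as n > 0. *)
Lemma positive_adapted b p : (0 < n)%N -> Sasaki_cone rho eta b ->
  exists d r, [/\ @adapted R n.*2 N k rho b d r, positive_chart (contact_volume (e b)) d & cdom d p].
Proof.
move=> n0 cb; have [d [r [ad dp d0]]] := adapted_at p cb.
have [sd r0 dc fl] := ad; have od := @chart_open_cod _ _ _ d; pose V := contact_volume (e b) d.
have c0 : ccod d 0 by rewrite -d0; exact: chart_map_cod.
have v0 : V 0 != 0 := contact_volume_neq0 cb sd c0.
pose s := Num.sg (V 0); pose D : E := \row_j if j == ord_max then s else 1.
have Dn j : `|D 0 j| = 1 by rewrite mxE; case: ifP => _; rewrite ?normr1 // normr_sg v0.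
have D2 j : D 0 j * D 0 j = 1 by rewrite mxE; case: ifP => _; rewrite ?mulr1 // -expr2 sqr_sg v0.
pose u (x : E) := x *m diag_mx D.
have uE x j : u x 0 j = D 0 j * x 0 j by rewrite /u mul_mx_diag mxE mulrC.
have uK x : u (u x) = x by apply/rowP => j; rewrite !uE mulrA D2 mul1r.
have un x : `|u x| <= `|x|.
  by apply: norm_le_coord => // i j; rewrite ord1 uE normrM Dn mul1r coord_le_norm.
have su U : open U -> smooth_on U u by move=> oU; apply: smooth_mulmx => //.
have sV : smooth_on (ccod d) V := contact_volume_smooth cb sd.
have nV : \forall x \near (0 : E), 0 < s * V x.
  have cV : {for 0, continuous (fun x => s * V x)}.
    by apply: (smooth_cont (U := ccod d)) => //.
  apply: (cV [set t | 0 < t]); apply: open_nbhs_nbhs; split; first exact: open_gt.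
  by rewrite /= -normrEsg normr_gt0.
have [r1 /= r10 H1] := (nbhs_ballP _ _).1 nV.
pose r2 := Num.min r r1; have r20 : 0 < r2 by rewrite lt_min r0.
pose A := ball (0 : E) r2; have oA : open A by exact: ball_open.
have AE x : A x <-> `|x| < r2 by rewrite /A -ball_normE /= sub0r normrN.
have Au x : A x -> A (u x) by move=> /AE h; apply/AE; exact: le_lt_trans (un x) h.
have Ad x : A x -> ccod d x by rewrite dc; apply: le_ball; rewrite ge_min lexx.
have [| |d' [sd' dd' cd' md' id']] := rechart sd oA oA Ad (su A oA) (su A oA).
- by move=> x Ax; split=> //; exact: Au.
- by move=> x Ax; split=> //; exact: Au.
have upt t y : u (pt t y) = pt t (rsubmx (u (pt 0 y) : 'rV[R]_(1 + n.*2))).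
  apply/rowP => j; case: (fintype.split_ordP (j : 'I_(1 + n.*2))) => i ->.
    rewrite uE !(@row_mxEl R 1 1 n.*2) mxE (_ : _ == _ = false) ?mul1r //.
    by apply/negbTE; rewrite -val_eqE /= ord1 /= eq_sym -lt0n double_gt0.
  by rewrite (@row_mxEr R 1 1 n.*2) [RHS]mxE !uE !(@row_mxEr R 1 1 n.*2).
have fl' t y : A (pt t y) -> ccod d (pt t (rsubmx (u (pt 0 y) : 'rV[R]_(1 + n.*2)))).
  by move=> Bt; rewrite -(upt t y); exact/Ad/Au.
exists d', r2; split.
- split=> // t t' y; rewrite cd' => Bt Bt'; rewrite !id' (upt t y) (upt t' y); apply: fl; exact: fl'.
- split=> // x; rewrite cd' => Ax; have cx : ccod d' x by rewrite cd'.
  have TE y : A y -> local_map idfun d' d y = u y by move=> Ay; rewrite /local_map /= id' chart_invK //; exact/Ad/Au.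
  have L : A `<=` local_dom idfun d' d.
    by move=> y Ay; split; [rewrite cd'|rewrite /= id'; exact/chart_inv_dom/Ad/Au].
  rewrite (contact_volume_change cb sd' sd (L _ Ax)) TE //.
  have sT := smooth_subset L (smooth_transition sd' sd).
  rewrite (jac_ext oA Ax TE) //.
  rewrite (_ : jac u x = diag_mx D); last first.
    apply/matrixP => i j; rewrite jac_entry //.
    rewrite (pd_ext (g := fun y : E => D 0 j * y 0 j) _ oA Ax) => [|y _] //.
    rewrite (jet1M Ax) //.
    by rewrite pd_cst mul0r add0r pd_coord [RHS]mxE mulr_natr [j == i]eq_sym; case: (i =P j) => [->|].
  rewrite det_diag (bigD1 ord_max) //= big1 ?mulr1 => [|j jn]; last by rewrite mxE (negPf jn).
  by rewrite mxE eqxx; apply: H1; apply: le_ball (Au _ Ax); rewrite ge_min lexx orbT.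
- by rewrite dd' /=; split=> //; rewrite d0; exact: ballxx.
Qed.
End PositiveAdaptedCharts.

Section ReferenceField.
Variable b1 : 'rV[R]_k.
Hypothesis cone1 : Sasaki_cone rho eta b1.

(** * A torus field with vanishing 1-jet at a point is trivial *)

Section Rigidity.
Local Notation e b := (eta_xi rho eta b).
Variable a : 'rV[R]_k.
Implicit Types (c d : chart R N n.*2.+1).

Lemma Sasaki_metric_form c x : smooth_chart c -> ccod c x ->
  let g := Sasaki_metric S rho eta b1 c x in g^T = g /\ g \in unitmx.
Proof.
move=> sc cx g; pose Om := exterior (e b1 c) x; pose w v : E := v *m (1%:M - e b1 c x *m X b1 c x).
have Dw v : cr_dist S c x (w v) by exact: horizontal_dist.
have XO : X b1 c x *m Om = 0 by exact: Reeb_exterior.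
have gE u v : bil g u v = 2^-1 * bil Om (w u) (w v *m cr_J S c x) + pairing u (e b1 c x) * pairing v (e b1 c x).
  rewrite /g Sasaki_metricE /bil mulmxDr mulmxDl mxE; congr (_ + _).
    rewrite /transverse_metric -scalemxAr -scalemxAl mxE; congr (_ * _).
    rewrite !mulmxA -[_ *m _^T *m v^T]mulmxA -trmx_mul /Phi_xi [v *m _]mulmxA -/(w v).
    by rewrite {2}/w mulmxBr mulmx1 mul_outer mulmxBl -scalemxAl XO scaler0 subr0.
  by rewrite !mulmxA -mulmxA [u *m _]mx11_scalar mul_scalar_mx mxE -trmx_mul [X in _ * X]mxE.
have sym : g^T = g.
  apply: matrix_bil_ext => u v; rewrite bil_tr !gE; congr (_ * _ + _); last exact: mulrC.
  have := exterior_eta_xi_J cone1 sc cx (Dw u) (Dw v) => /eqP.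
  rewrite addr_eq0 => /eqP E1; rewrite -[RHS]opprK -E1 -bil_tr exterior_antisym.
  by rewrite /bil mulmxN mulNmx mxE.
split=> //; apply: positive_form_unit => // v v0; rewrite -/(bil _ _ _) gE -expr2.
have [w0|w0] := eqVneq (w v) 0.
  rewrite w0 /bil !mul0mx mxE mulr0 add0r exprn_even_gt0 //; apply: contra_neq v0 => h.
  by move: w0; rewrite /w mulmxBr mulmx1 mul_outer h scale0r subr0.
by rewrite ltr_pwDl ?sqr_ge0 // mulr_gt0 ?invr_gt0 //; exact: transverse_positive.
Qed.

Lemma field_vanish_near c p : smooth_chart c -> cdom c p -> X a c (c p) = 0 -> jac (X a c) (c p) = 0 ->
  exists2 r, 0 < r & forall z, ball (c p) r z -> X a c z = 0.
Proof.
move=> sc cp; apply: (killing_vanish (@chart_open_cod _ _ _ c) (chart_map_cod cp)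
  (fundamental_field_smooth act a sc) (Sasaki_metric_smooth cone1 sc)) => x cx.
  exact: Sasaki_metric_form.
apply: (lie_metric act sc (Sasaki_metric_smooth cone1 sc) cx) => s y Ly.
exact: Sasaki_metric_push.
Qed.

Lemma field_vanish_transfer c d p : smooth_chart c -> smooth_chart d -> cdom c p -> cdom d p ->
  X a c (c p) = 0 -> X a d (d p) = 0.
Proof.
move=> sc sd cp dp X0; have Lp : local_dom (rho 0) c d (c p).
  by split; [exact: chart_map_cod|rewrite /= chart_mapK // (action0 act)].
have := fundamental_field_push act a sc sd Lp; rewrite X0 mul0mx.
by rewrite (rho0_local act c d).1 /local_map /= chart_mapK.
Qed.

(** The interior of the zero set is also closed: at a limit point the 1-jet vanishes by continuity,
    and [field_vanish_near] makes the field zero around it. Connectedness concludes. *)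
Lemma field_vanish c0 p0 : smooth_chart c0 -> cdom c0 p0 -> X a c0 (c0 p0) = 0 -> jac (X a c0) (c0 p0) = 0 ->
  forall c p, smooth_chart c -> cdom c p -> X a c (c p) = 0.
Proof.
move=> sc0 cp0 X0 J0; pose V := [set q : N | forall c, smooth_chart c -> cdom c q -> X a c (c q) = 0].
have near0 c p : smooth_chart c -> cdom c p -> X a c (c p) = 0 -> jac (X a c) (c p) = 0 -> interior V p.
  move=> sc cp h1 h2; have [r r0 Hr] := field_vanish_near sc cp h1 h2.
  have oB := chart_image_open c (ball_open (c p) r).
  apply: (filterS _ (open_nbhs_nbhs (conj oB (conj cp (ballxx (c p) r0))))) => q [cq bq] d sd dq.
  by apply: field_vanish_transfer cq dq (Hr _ bq).
suff VT : interior V = setT.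
  by move=> c p sc cp; apply: (@interior_subset _ V p) => //; by rewrite VT.
apply: N_connected; first by exists p0; exact: near0 X0 J0.
  by exists (interior V); [exact: open_interior|rewrite setTI].
exists (interior V); last by rewrite setTI.
move=> p pV; have [c ac cp] := atlas_cover p; have sc := atlas_smooth_chart ac.
have oc := @chart_open_cod _ _ _ c; have sX := fundamental_field_smooth act a sc.
pose O := [set x | ccod c x /\ interior V (cinv c x)].
have oO : open O by apply: chart_preimage_open; exact: open_interior.
have XO x : O x -> X a c x = 0.
  move=> [cx Vx]; rewrite -(chart_invK cx); apply: (interior_subset Vx) => //; exact: chart_inv_dom.
have lim0 (f : E -> R) : smooth_on (ccod c) f -> (forall x, O x -> f x = 0) -> f (c p) = 0.
  move=> sf f0; apply/eqP; apply: contrapT => /negP h.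
  have cf : {for c p, continuous f} by exact: smooth_cont sf (chart_map_cod cp).
  have h' : 0 < `|f (c p)| by rewrite normr_gt0.
  have n1 := (cvgrPdist_lt _ _).1 cf _ h'.
  have n2 : \forall q \near p, `|f (c p) - f (c q)| < `|f (c p)| by exact: (chart_map_continuous cp (n1 _)).
  have [q [Vq [cq hq]]] := pV _ (filterI (open_nbhs_nbhs (conj (@chart_open_dom _ _ _ c) cp)) n2).
  have Oq : O (c q) by split; [exact: chart_map_cod|rewrite /= chart_mapK].
  by move: hq; rewrite (f0 _ Oq) subr0 ltxx.
have sXl l : smooth_on (ccod c) (fun x => X a c x 0 l : R) by [].
have XOl l x : O x -> X a c x 0 l = 0 by move=> /XO ->; rewrite mxE.
apply: (near0 c p) => //; first by apply/rowP => l; rewrite mxE (lim0 (fun x => X a c x 0 l)) // => x; exact: XOl.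
apply/matrixP => i l; rewrite mxE jac_entry; last exact: (smooth_differentiable_row oc sX (chart_map_cod cp)).
apply: lim0 => [|x Ox] //.
by rewrite (pd_ext (g := fun=> 0) _ oO Ox) ?pd_cst // => y; exact: XOl.
Qed.

(** As long as an orbit stays in one chart its coordinates have zero derivative, so short times fix
    the point; every time is a multiple of a short one. *)
Lemma orbit_trivial : (forall c p, smooth_chart c -> cdom c p -> X a c (c p) = 0) ->
  forall (t : R) p, rho (t *: a) p = p.
Proof.
move=> X0 t p; have [c ac cp] := atlas_cover p; have sc := atlas_smooth_chart ac.
have [d /= d0 Hd] := (nbhs_ballP _ _).1 (orbit_near act a sc cp).
have small (s : R) : `|s| < d -> rho (s *: a) p = p.
  have dom (w : R) : `|w| < d -> cdom c (rho (w *: a) p) by move=> h; apply: Hd; rewrite -ball_normE /= sub0r normrN.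
  move=> sd; rewrite -(chart_mapK (dom s sd)) -[RHS](chart_mapK cp); congr (cinv c _); apply/rowP => j.
  pose g (w : R) := c (rho (w *: a) p) 0 j.
  have dg (w : R) : `|w| < d -> is_derive w (1 : R) g 0.
    move=> /dom cw; have := curve_coord j (fundamental_field_orbit act sc cw).
    by rewrite (X0 c _ sc cw) mxE.
  have [w|w ws] := @line_MVT R R g 0 1 s.
    by move=> ws; rewrite add0r [w *: 1]mulr1; case: (dg w (le_lt_trans ws sd)).
  rewrite !add0r [w *: 1]mulr1 [s *: 1]mulr1; case: (dg w (le_lt_trans ws sd)) => _ ->.
  by rewrite mulr0 /g scale0r (action0 act) => /eqP; rewrite subr_eq0 => /eqP.
have iter (s : R) m : rho (s *: a) p = p -> rho ((m%:R * s) *: a) p = p.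
  move=> h; elim: m => [|m IH]; first by rewrite mul0r scale0r (action0 act).
  by rewrite mulrS mulrDl mul1r scalerDl (actionD act) IH.
pose m := Num.bound (`|t| / d); have h := archi_boundP (divr_ge0 (normr_ge0 t) (ltW d0)).
have m0 : 0 < m%:R :> R by [].
rewrite -(mulVKf (lt0r_neq0 m0) t).
by apply/iter/small; rewrite normrM normfV (gtr0_norm m0) mulrC ltr_pdivrMr // mulrC -ltr_pdivrMr.
Qed.
End Rigidity.

(** * The potentials f_b as functions on the manifold *)

Section Potentials.
Local Notation e b := (eta_xi rho eta b).
Local Notation adapted1 d r := (@adapted R n.*2 N k rho b1 d r).
Local Notation f d := (slice_potential b1 d).
Implicit Types (c d : chart R N n.*2.+1) (a b : 'rV[R]_k).

(** Read in an arbitrary chart, to obtain a function of the point; [potentialE] shows that the chart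
    does not matter. *)
Definition potential b (p : N) : R := xget 0 [set t | exists c,
  [/\ smooth_chart c, cdom c p & t = pairing (X b c (c p)) (e b1 c (c p))]].

Lemma potentialE b c p : smooth_chart c -> cdom c p -> potential b p = pairing (X b c (c p)) (e b1 c (c p)).
Proof.
move=> sc cp; rewrite /potential; case: xgetP => [_ _ [d [sd dp ->]]|/(_ _ (ex_intro _ c (And3 sc cp erefl)))] //.
have Lp : local_dom (rho 0) c d (c p) by split; [exact: chart_map_cod|rewrite /= chart_mapK // (action0 act)].
have mE : local_map (rho 0) c d (c p) = d p by rewrite (rho0_local act c d).1 /local_map /= chart_mapK.
rewrite (eta_xi_push cone1 sc sd Lp) pairing_mul.
by rewrite -(fundamental_field_push act b sc sd Lp) mE.
Qed.

Lemma potential_smooth_function b : smooth_function (potential b).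
Proof.
move=> c sc; have oc := @chart_open_cod _ _ _ c.
apply: (smooth_ext oc (f := fun x => pairing (X b c x) (e b1 c x))) => [x cx|].
  by rewrite (potentialE b sc (chart_inv_dom cx)) chart_invK.
by apply: smooth_pairing => //; [exact: fundamental_field_smooth|exact: eta_xi_smooth].
Qed.

Lemma field_sum b c x : smooth_chart c -> ccod c x -> X b c x = \sum_j b 0 j *: X (delta_mx 0 j) c x.
Proof.
move=> sc cx; have E1 a : X a c x = a *m (row_mx 1%:M 0 *m jac (action_map rho c c) (row_mx 0 x)).
  by rewrite (fundamental_fieldE act a sc cx) mulmxA mul_mx_row mulmx1 mulmx0.
rewrite E1 {1}(row_sum_delta b) mulmx_suml; apply: eq_bigr => j _; by rewrite E1 scalemxAl.
Qed.

Lemma potential_sum b p : potential b p = \sum_j b 0 j * potential (delta_mx 0 j) p.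
Proof.
have [c ac cp] := atlas_cover p; have sc := atlas_smooth_chart ac.
rewrite (potentialE b sc cp) (field_sum b sc (chart_map_cod cp)) /pairing mulmx_suml summxE.
by apply: eq_bigr => j _; rewrite -scalemxAl mxE (potentialE _ sc cp).
Qed.

Lemma potential_lipschitz : exists2 C, 0 < C & forall a b p, `|potential a p - potential b p| <= C * `|a - b|.
Proof.
have /choice[B BP] j : exists B, forall p, `|potential (delta_mx 0 j) p| <= B.
  by have [B _ HB] := smooth_function_bounded N_compact (potential_smooth_function (delta_mx 0 j)); exists B.
exists (\sum_j `|B j| + 1) => [|a b p]; first by rewrite ltr_wpDl // sumr_ge0.
rewrite (potential_sum a) (potential_sum b) -sumrB; apply: le_trans (ler_norm_sum _ _ _) _.
rewrite mulrDl mul1r ler_wpDr // mulr_suml; apply: ler_sum => j _.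
rewrite -mulrBl normrM mulrC ler_pM //; first exact: le_trans (BP j p) (ler_norm _).
by have := coord_le_norm (a - b) 0 j; rewrite !mxE.
Qed.

Lemma potential_cone b : Sasaki_cone rho eta b <-> forall p, 0 < potential b p.
Proof.
have E1 c x : smooth_chart c -> ccod c x -> (0 < pairing (X b c x) (e b1 c x)) = (0 < pairing (X b c x) (eta c x)).
  by move=> sc cx; rewrite /eta_xi pairingZr pmulr_rgt0 // invr_gt0; exact: cone1.
split=> [cb p|H c x sc cx].
  have [c ac cp] := atlas_cover p; have sc := atlas_smooth_chart ac.
  by rewrite (potentialE b sc cp) E1; [apply: cb| |] => //; exact: chart_map_cod.
by rewrite -E1 //; have := H (cinv c x); rewrite (potentialE b sc) ?chart_invK //; exact: chart_inv_dom.
Qed.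

Lemma potential_slice b d r t y : adapted1 d r -> ccod d (pt t y) -> potential b (cinv d (pt t y)) = f d b y.
Proof.
move=> ad dz; rewrite (potentialE b (adapted_smooth ad) (chart_inv_dom dz)) chart_invK //.
exact: (adapted_potential cone1 ad).
Qed.
End Potentials.

(** * Estimates in a flow box of the reference field *)

Section AdaptedChart.
Variables (d : chartN) (r : R).
Hypothesis ad : @adapted R n.*2 N k rho b1 d r.

Section PositivityAtZeros.
Variable a : 'rV[R]_k.
Local Notation f := (slice_potential b1 d a).
Local Notation K := (slice_field d a).
Local Notation al := (slice_form b1 d).
Local Notation h := (slice_metric b1 d).

Lemma adapted_slice_rsubmx (z : 'rV[R]_(1 + n.*2)) : ccod d z -> slice_dom r (rsubmx z).
Proof. by have [t [y ->]] := pt_surj z => /(adapted_slice ad); rewrite row_mxKr. Qed.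

(** The equation [slice_hamiltonian], with invertible d(al), turns the vanishing 2-jet of f into a
    vanishing 1-jet of the transverse part K; the time component is f minus the product of K and al.
    So the field has zero 1-jet, generates the trivial flow and contradicts the lattice kernel of
    the torus. *)
Theorem laplacian_gt0 y : a != 0 -> (forall z, slice_dom r z -> 0 <= f z) -> slice_dom r y -> f y = 0 ->
  0 < laplacian h f y.
Proof.
move=> a0 f0 Uy fy; rewrite ltNge; apply/negP => L0; have oU := @slice_dom_open r.
have [sh sal sK sf] := slice_smooth cone1 ad.
have hsym := slice_metric_sym cone1 ad Uy.
have hpos := slice_metric_positive cone1 ad Uy.
have H0 := laplacian_minimum_eq0 oU Uy (sf a) f0 fy hsym hpos L0.
have g0 i : pd i f y = 0 := minimum_gradient oU Uy (sf a) f0 fy i.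
have uO : exterior al y \in unitmx.
  have := slice_metric_unit cone1 ad Uy; rewrite -(unitmxZ _ (_ : (4 : R) \is a GRing.unit)) ?unitfE ?pnatr_eq0 //.
  by rewrite -(slice_almost_kahler cone1 ad Uy) !unitmx_mul => /andP[/andP[]].
have sO : smooth_on (slice_dom r) (exterior al) by exact: smooth_exterior.
have sKa : smooth_on (slice_dom r) K by [].
have Ky : K y = 0.
  rewrite -[K y](mulmxK uO) (slice_hamiltonian cone1 ad a Uy).
  by rewrite (_ : gradient f y = 0) ?trmx0 ?oppr0 ?mul0mx //; apply/colP => i; rewrite !mxE g0.
have dKy j : pd j K y = 0.
  have := (pd_mulmx (smooth_derivable sKa Uy) (smooth_derivable sO Uy) (i := j)).1.
  rewrite Ky mul0mx addr0 (pd_ext (g := fun z => - (gradient f z)^T) _ oU Uy) => [E1|z Uz]; last first.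
    exact: (slice_hamiltonian cone1 ad a Uz).
  rewrite -[LHS](mulmxK uO) -E1; apply/rowP => i; rewrite (_ : pd j _ y = 0) ?mul0mx //; apply/rowP => l.
  have sg : smooth_on (slice_dom r) (fun z => - (gradient f z)^T).
    apply: smoothNmx => //; apply: smooth_trmx => //; apply/smooth_mxP => // i' j'.
    by apply: (smooth_ext oU (f := pd i' f)) => [z _|]; [rewrite mxE|exact: smooth_on_pd].
  rewrite pd_mx //.
  rewrite (pd_ext (g := fun z => - pd l f z) _ oU Uy) => [|z _]; last by rewrite !mxE.
  by rewrite pdN ?H0 ?oppr0 ?mxE //.
pose X0 z := X a d (pt 0 z) 0 (lshift _ (0 : 'I_1)).
have X0E z : slice_dom r z -> X0 z = f z - \sum_i K z 0 i * al z i 0.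
  move=> Uz; have dz := slice_ccod ad Uz.
  have [s [v E1]] := pt_surj (X a d (pt 0 z) : 'rV[R]_(1 + n.*2)).
  rewrite /slice_potential (adapted_form cone1 ad dz) /X0 /slice_field E1.
  by rewrite (@pairing_pt R n.*2) row_mxKr (@row_mxEl R 1 1 n.*2) !mxE eqxx mulr1n addrK.
have sKi i : smooth_on (slice_dom r) (fun z => K z 0 i : R) by [].
have dKi j i : pd j (fun z => K z 0 i : R) y = 0 by rewrite -pd_mx ?dKy ?mxE //.
have sX0 : smooth_on (slice_dom r) X0.
  apply: (smooth_ext oU (f := fun z => f z - \sum_i K z 0 i * al z i 0)) => [z /X0E //|].
  by [].
have dX0 j : pd j X0 y = 0.
  rewrite (pd_ext (g := fun z => f z - \sum_i K z 0 i * al z i 0) _ oU Uy X0E).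
  have sKal i : smooth_on (slice_dom r) (fun z => K z 0 i * al z i 0) by [].
  rewrite (jet1B Uy) ?g0 ?sub0r //.
  rewrite (jet1_sum Uy) // big1 ?oppr0 // => i _; rewrite (jet1M Uy) ?dKi ?Ky ?mxE ?mul0r ?addr0 //.
have dz := slice_ccod ad Uy; have sd := adapted_smooth ad; have od := @chart_open_cod _ _ _ d.
have XE z : ccod d z -> X a d z = row_mx (X0 (rsubmx (z : 'rV[R]_(1 + n.*2))))%:M (K (rsubmx (z : 'rV[R]_(1 + n.*2)))).
  have [t [v ->]] := pt_surj (z : 'rV[R]_(1 + n.*2)) => dv; rewrite row_mxKr (adapted_fields ad a dv).
  rewrite -[LHS](@hsubmxK _ 1 1 n.*2) [lsubmx _]mx11_scalar /X0 mxE //.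
apply: (torus_field_neq0 torus a0); apply: orbit_trivial => //.
apply: (field_vanish sd (chart_inv_dom dz)); rewrite chart_invK //.
  rewrite XE // row_mxKr X0E // fy Ky big1 ?subr0 => [|i _]; last by rewrite mxE mul0r.
  by rewrite (_ : 0%:M = 0) ?row_mx0 //; apply/matrixP => i j; rewrite !mxE mul0rn.
apply/matrixP => i l; rewrite jac_entry ?mxE; last exact: (smooth_differentiable_row od (fundamental_field_smooth act a sd)).
have vanish (g : F -> R) : smooth_on (slice_dom r) g -> (forall j, pd j g y = 0) ->
    pd i (fun z => g (rsubmx (z : 'rV[R]_(1 + n.*2)))) (pt 0 y) = 0.
  move=> sg dg; have [d1 d0] := pd_space od oU adapted_slice_rsubmx dz sg.
  by case: (fintype.split_ordP (i : 'I_(1 + n.*2))) => j ->; rewrite ?ord1 ?d0 // d1 row_mxKr.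
case: (fintype.split_ordP (l : 'I_(1 + n.*2))) => j ->.
  rewrite (pd_ext (g := fun z => X0 (rsubmx (z : 'rV[R]_(1 + n.*2)))) _ od dz) ?vanish // => z /XE ->.
  by rewrite (@row_mxEl R 1 1 n.*2) ord1 mxE eqxx mulr1n.
rewrite (pd_ext (g := fun z => K (rsubmx (z : 'rV[R]_(1 + n.*2))) 0 j) _ od dz) ?(vanish (fun v => K v 0 j)) // => z /XE ->.
by rewrite (@row_mxEr R 1 1 n.*2).
Qed.
End PositivityAtZeros.

Section ChartEstimate.
Local Notation f := (slice_potential b1 d).
Local Notation h := (slice_metric b1 d).
Local Notation vol := (contact_volume (eta_xi rho eta b1)).
Local Notation U := (ccod d).

Let sd : smooth_chart d. Proof. exact: adapted_smooth ad. Qed.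
Let oU : open U. Proof. exact: chart_open_cod. Qed.
Let oD : open (slice_dom r). Proof. exact: slice_dom_open. Qed.
Let sl (x : E) : F := rsubmx (x : 'rV[R]_(1 + n.*2)).
Let dir (j : 'I_(n.*2)) : 'I_(n.*2.+1) := rshift 1 j.
Let H i j (y : F) : R := invmx (h y) i j.

Let slU x : U x -> slice_dom r (sl x). Proof. exact: adapted_slice_rsubmx. Qed.

Let smooth_sl (g : F -> R) : smooth_on (slice_dom r) g -> smooth_on U (fun z => g (sl z)).
Proof. exact: smooth_space oU oD slU g. Qed.

Let pd_sl (g : F -> R) i x : U x -> smooth_on (slice_dom r) g -> pd (dir i) (fun z => g (sl z)) x = pd i g (sl x).
Proof. by move=> Ux sg; have [->] := pd_space oU oD slU Ux sg. Qed.

Let sh : smooth_on (slice_dom r) h. Proof. by case: (slice_smooth cone1 ad). Qed.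
Let sf b : smooth_on (slice_dom r) (f b). Proof. by case: (slice_smooth cone1 ad). Qed.
Let hsym y : slice_dom r y -> (h y)^T = h y. Proof. exact: (slice_metric_sym cone1 ad). Qed.
Let hu y : slice_dom r y -> h y \in unitmx. Proof. exact: (slice_metric_unit cone1 ad). Qed.
Let sH i j : smooth_on (slice_dom r) (H i j).
Proof. by apply: smooth_entry => //. Qed.
Let f_gt0 b y : Sasaki_cone rho eta b -> slice_dom r y -> 0 < f b y.
Proof.
move=> cb Uy; rewrite -(potential_slice b ad (slice_ccod ad Uy)).
exact: ((potential_cone b).1 cb).
Qed.
Let svols c : smooth_chart c -> smooth_on (ccod c) (vol c). Proof. exact: contact_volume_smooth. Qed.
Let svol : smooth_on U (vol d). Proof. done. Qed.
Let vol0 x : U x -> vol d x != 0. Proof. exact: (contact_volume_neq0 cone1 sd). Qed.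

(** First order difference between the divergence of the gradient with respect to the contact volume
    and the Laplacian of the slice metric. The argument uses only that it is bounded on compact
    sets. *)
Let drift l x : R := (vol d x)^-1 * (\sum_j pd (dir j) (fun z => vol d z * H j l (sl z)) x)
  + \sum_i \sum_j H i j (sl x) * connection h i (sl x) j l.

Lemma smooth_drift l : smooth_on U (drift l).
Proof.
apply: smoothD => //.
  apply: smoothM => //; exact: smoothV.
do 2 (apply: smooth_sum => // ?); apply: smoothM => //.
exact: (smooth_sl (smooth_entry _ _ oD (smooth_connection _ oD sh hsym hu))).
Qed.

Let fld (chi : E -> R) b j x : R :=
  chi x * ((f b (sl x))^-1 ^+ n.+1 * \sum_l (vol d x * H j l (sl x)) * pd l (f b) (sl x)).

Lemma jet1X (g : E -> R) j m x : U x -> smooth_on U g -> pd j (fun z => g z ^+ m.+1) x = m.+1%:R * g x ^+ m * pd j g x.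
Proof.
move=> Ux sg; elim: m => [|m IH]; first by rewrite expr0 !mul1r.
rewrite (jet1M Ux _ sg (smoothX m.+1 oU sg)) IH exprS -[in RHS]natr1; ring.
Qed.

(** The cut-off contributes the first sum and the power of f the second term; the second derivatives
    form the slice Laplacian up to [drift]. The common factor is the volume density of [b], as in
    the curvature integral. *)
Lemma divergence (chi : E -> R) b x : Sasaki_cone rho eta b -> smooth_on U chi -> U x ->
  \sum_j pd (dir j) (fld chi b j) x = vol d x * (f b (sl x))^-1 ^+ n.+1 *
    (\sum_l (\sum_j pd (dir j) chi x * H j l (sl x)) * pd l (f b) (sl x)
     - n.+1%:R * chi x * (gradient_sqr h (f b) (sl x) / f b (sl x))
     + chi x * (laplacian h (f b) (sl x) + \sum_l drift l x * pd l (f b) (sl x))).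
Proof.
move=> cb sc Ux; set y := sl x.
have f0 z : U z -> f b (sl z) != 0 by move=> Uz; rewrite gt_eqF //; exact/f_gt0/slU.
have sfb := smooth_sl (sf b); have sV := smoothV oU f0 sfb; have sP := smoothX n.+1 oU sV.
have sq l := smooth_on_pd l (sf b); have sql l := smooth_sl (sq l).
have sB j l := smoothM oU svol (smooth_sl (sH j l)).
have sT j l := smoothM oU (sB j l) (sql l).
have Ej j : pd (dir j) (fld chi b j) x = vol d x * (f b y)^-1 ^+ n.+1 *
  (\sum_l (pd (dir j) chi x * H j l y) * pd l (f b) y
   - n.+1%:R * chi x * (\sum_l pd j (f b) y * H j l y * pd l (f b) y / f b y)
   + chi x * (\sum_l (H j l y * pd j (pd l (f b)) y + (vol d x)^-1 * pd (dir j) (fun z => vol d z * H j l (sl z)) x * pd l (f b) y))).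
  rewrite (jet1M Ux) //.
  rewrite (jet1M Ux) //.
  rewrite (jet1X _ _ Ux) // (jet1V Ux) // (pd_sl _ Ux) // (jet1_sum Ux) // -/y.
  have -> : \sum_l pd (dir j) (fun z => vol d z * H j l (sl z) * pd l (f b) (sl z)) x =
      vol d x * \sum_l (H j l y * pd j (pd l (f b)) y + (vol d x)^-1 * pd (dir j) (fun z => vol d z * H j l (sl z)) x * pd l (f b) y).
    rewrite mulr_sumr; apply: eq_bigr => l _; rewrite (jet1M Ux _ (sB j l) (sql l)).
    rewrite (pd_sl _ Ux (sq l)).
    move: (pd (dir j) _ x) (pd j _ _) (pd l _ _) (H j l _) => u v w z.
    by rewrite mulrDr !mulrA mulfV ?vol0 // mul1r addrC.
  have -> : \sum_l vol d x * H j l y * pd l (f b) y = vol d x * \sum_l H j l y * pd l (f b) y.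
    by rewrite mulr_sumr; apply: eq_bigr => l _; rewrite mulrA.
  have -> : \sum_l pd j (f b) y * H j l y * pd l (f b) y / f b y = pd j (f b) y * (\sum_l H j l y * pd l (f b) y) / f b y.
    by rewrite mulr_sumr mulr_suml; apply: eq_bigr => l _; rewrite !mulrA.
  have -> : \sum_l pd (dir j) chi x * H j l y * pd l (f b) y = pd (dir j) chi x * (\sum_l H j l y * pd l (f b) y).
    by rewrite mulr_sumr; apply: eq_bigr => l _; rewrite mulrA.
  have := f0 x Ux; rewrite -/y exprS; move: ((f b y)^-1 ^+ n) (\sum_l _) (\sum_l _) (pd (dir j) chi x) (pd j (f b) y) (f b y) => p s1 s2 a q g g0.
  by rewrite [_ ^+ 2]expr2; field.
rewrite (eq_bigr _ (fun j _ => Ej j)) -mulr_sumr; congr (_ * _); rewrite big_split /= sumrB -!mulr_sumr.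
congr (_ - _ * _ + _ * _).
- by rewrite exchange_big; apply: eq_bigr => l _ /=; rewrite mulr_suml.
- rewrite /gradient_sqr mxE mulr_suml exchange_big; apply: eq_bigr => l _ /=; rewrite !mxE !mulr_suml.
  by apply: eq_bigr => j _; rewrite !mxE.
rewrite (eq_bigr _ (fun j _ => big_split _ _ _ _ _)) /= big_split /= /laplacian /mxtrace.
have -> : \sum_i (invmx (h y) *m hessian h (f b) y) i i = \sum_i \sum_l H i l y * pd i (pd l (f b)) y
    - \sum_l (\sum_i \sum_j H i j y * connection h i y j l) * pd l (f b) y.
  have -> : \sum_l (\sum_i \sum_j H i j y * connection h i y j l) * pd l (f b) y =
      \sum_i \sum_j H i j y * \sum_l connection h i y j l * pd l (f b) y.
    under eq_bigr do rewrite mulr_suml.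
    rewrite exchange_big; apply: eq_bigr => i _ /=; under eq_bigr do rewrite mulr_suml.
    by rewrite exchange_big; apply: eq_bigr => j _ /=; rewrite mulr_sumr; apply: eq_bigr => l _; rewrite mulrA.
  rewrite -sumrB; apply: eq_bigr => i _; rewrite mxE -sumrB; apply: eq_bigr => j _.
  by rewrite mxE mulrBr.
rewrite -addrA; congr (_ + _); rewrite [RHS]addrC; apply/eqP; rewrite eq_sym subr_eq; apply/eqP.
rewrite [X in _ = X + _]exchange_big -big_split; apply: eq_bigr => l _ /=; rewrite /drift mulrDl; congr (_ + _).
by rewrite mulr_sumr mulr_suml.
Qed.

Lemma pd_combination (g : 'I_k -> F -> R) (a : 'I_k -> R) (G : F -> R) i y : slice_dom r y ->
  (forall j, smooth_on (slice_dom r) (g j)) -> (forall z, slice_dom r z -> G z = \sum_j a j * g j z) ->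
  pd i G y = \sum_j a j * pd i (g j) y.
Proof.
move=> Uy sg GE; rewrite (pd_ext i oD Uy GE) (jet1_sum Uy) => [|j].
  by apply: eq_bigr => j _; rewrite (jet1M Uy) ?pd_cst ?mul0r ?add0r //.
by [].
Qed.

Lemma laplacian_sum b y : slice_dom r y -> f b y = \sum_j b 0 j * f (delta_mx 0 j) y /\
  laplacian h (f b) y = \sum_j b 0 j * laplacian h (f (delta_mx 0 j)) y.
Proof.
have fE z : slice_dom r z -> f b z = \sum_j b 0 j * f (delta_mx 0 j) z.
  move=> Uz; have dz := slice_ccod ad Uz; rewrite -(potential_slice b ad dz).
  rewrite (potential_sum); apply: eq_bigr => j _.
  by rewrite (potential_slice _ ad dz).
move=> Uy; split; first exact: fE.
have E1 i z : slice_dom r z -> pd i (f b) z = \sum_j b 0 j * pd i (f (delta_mx 0 j)) z.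
  by move=> Uz; exact: pd_combination.
have E2 : hessian h (f b) y = \sum_j b 0 j *: hessian h (f (delta_mx 0 j)) y.
  apply/matrixP => i l; rewrite summxE mxE (pd_combination (g := fun j => pd i (f (delta_mx 0 j))) l Uy _ (E1 i)).
    under [in RHS]eq_bigr do rewrite !mxE mulrBr.
    rewrite sumrB; congr (_ - _); under [in RHS]eq_bigr do rewrite mulr_sumr.
    rewrite exchange_big; apply: eq_bigr => a _ /=; rewrite E1 // mulr_sumr; apply: eq_bigr => j _.
    by rewrite mulrCA.
  by [].
rewrite /laplacian E2 mulmx_sumr raddf_sum; apply: eq_bigr => j _ /=.
by rewrite -scalemxAr mxtraceZ.
Qed.

Lemma transverse_smooth_on b : Sasaki_cone rho eta b ->
  smooth_on U (fun x => transverse_scalar_curvature S rho eta b (cinv d x)).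
Proof.
move=> cb; pose g y := f b y * scalar_curvature h y + (n.*2%:R + 2) * laplacian h (f b) y
    - (n.*2%:R + 2) * (n.*2%:R + 4) / 4 * gradient_sqr h (f b) y / f b y.
apply: (smooth_ext oU (f := fun x => g (sl x))) => [x Ux|].
  have [t [y xE]] := pt_surj (x : 'rV[R]_(1 + n.*2)).
  have xE' : d (cinv d x) = pt t y by rewrite chart_invK.
  rewrite (transverse_scalar_curvatureE cone1 cb ad (chart_inv_dom Ux) xE').
  by rewrite /g /sl xE row_mxKr.
apply: smooth_sl; apply: smoothB => //.
  apply: smoothD => //; apply: smoothM => //; first exact: smooth_scalar_curvature.
  exact: smooth_laplacian.
apply: smoothM => //; last by apply: smoothV => // y Uy; rewrite gt_eqF //; exact: f_gt0.
by apply: smoothM => //; exact: smooth_gradient_sqr.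
Qed.

(** Where f_b0 > 0 the second term suffices for large C, and at a zero of f_b0 the Laplacian is
    positive. Both terms are linear in b, so the strict inequality at (x, b0) persists nearby, and
    compactness makes the constant uniform. *)
Lemma laplacian_gt0_near b0 (K : set E) : b0 != 0 -> (forall p, 0 <= potential b0 p) ->
  compact K -> K `<=` U -> \forall C \near +oo, \forall b \near b0, Sasaki_cone rho eta b ->
    forall x, K x -> 1 <= C * (laplacian h (f b) (sl x) + C * f b (sl x)).
Proof.
move=> b00 pot0 cK KU; pose L b x := laplacian h (f b) (sl x).
have f0 z : slice_dom r z -> 0 <= f b0 z.
  by move=> Uz; rewrite -(potential_slice b0 ad (slice_ccod ad Uz)).
pose P (C : R) b x := 0 < C /\ (U x -> Sasaki_cone rho eta b -> 1 <= C * (L b x + C * f b (sl x))).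
have mono (C C' : R) b x : P C b x -> C <= C' -> P C' b x.
  move=> [C0 PC] CC'; split=> [|Ux cb]; first exact: lt_le_trans CC'.
  have := PC Ux cb; have f1 := f_gt0 cb (slU Ux).
  have : C * f b (sl x) <= C' * f b (sl x) by rewrite ler_pM2r.
  move: (L b x) (C * f b _) (C' * f b _) => l u v uv h1.
  have lu : 0 < l + u by rewrite -(pmulr_rgt0 _ C0); exact: lt_le_trans ltr01 h1.
  by apply: le_trans h1 _; rewrite ler_pM ?lerD2l // ltW.
have [|C [C0 HC]] := @compact_uniform_near R _ _ (nbhs b0) K P _ cK mono.
- move=> x Kx; have Ux := KU x Kx; have Uy := slU Ux.
  have [C [C0 HC]] : exists C, 0 < C /\ 1 < C * (L b0 x + C * f b0 (sl x)).
    have [fy|] := eqVneq (f b0 (sl x)) 0.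
      have L0 : 0 < L b0 x by exact: (laplacian_gt0 b00 f0 Uy fy).
      exists (2 / L b0 x); rewrite divr_gt0 // fy mulr0 addr0 mulfVK ?gt_eqF //; lra.
    rewrite neq_lt ltNge f0 //= => f1; exists ((1 + `|L b0 x|) / f b0 (sl x) + 2).
    rewrite ltr_wpDl ?divr_ge0 ?addr_ge0 ?(ltW f1) //; split=> //.
    have E1 : ((1 + `|L b0 x|) / f b0 (sl x) + 2) * f b0 (sl x) = 1 + `|L b0 x| + 2 * f b0 (sl x).
      by rewrite mulrDl mulfVK ?gt_eqF.
    rewrite E1; have : 0 <= (1 + `|L b0 x|) / f b0 (sl x) by rewrite divr_ge0 ?addr_ge0 // ltW.
    have : - `|L b0 x| <= L b0 x by rewrite lerNl; apply: le_trans (ler_norm _) _; rewrite normrN.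
    by move: (_ / _) => q; nra.
  exists C; pose g (z : E * 'rV[R]_k) := \sum_j z.2 0 j * (laplacian h (f (delta_mx 0 j)) (sl z.1) + C * f (delta_mx 0 j) (sl z.1)).
  have gE z b : U z -> g (z, b) = L b z + C * f b (sl z).
    move=> Uz; have [-> LE] := laplacian_sum b (slU Uz); rewrite /L LE mulr_sumr -big_split; apply: eq_bigr => j _ /=.
    by rewrite mulrDr [C * (_ * _)]mulrCA.
  have cg : {for (x, b0), continuous g}.
    apply: continuous_sum => j; apply: (@cvgM _ _ (nbhs (x, b0))).
      apply: (@continuous_comp _ _ _ snd (fun b : 'rV[R]_k => b 0 j : R)); [exact: cvg_snd|exact: coord_continuous].
    apply: (@continuous_comp _ _ _ fst (fun z : E => laplacian h (f (delta_mx 0 j)) (sl z) + C * f (delta_mx 0 j) (sl z) : R)); first exact: cvg_fst.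
    apply: (smooth_cont _ Ux).
    apply: (smooth_sl (g := fun y => laplacian h (f (delta_mx 0 j)) y + C * f (delta_mx 0 j) y)).
    apply: smoothD => //; exact: smooth_laplacian.
  have : \near x & b0, 1 < C * g (x, b0).
    apply: (cg [set t | 1 < C * t]); apply: open_nbhs_nbhs; split; last by rewrite /= gE.
    rewrite (_ : [set t | _] = [set t | C^-1 < t]) //.
    by apply/seteqP; split=> t /=; rewrite -ltr_pdivrMl // mulr1.
  by apply: filterS => -[z b] /= h1; split=> // Uz cb; rewrite -gE // ltW.
near=> C'; have CC' : C <= C' by near: C'; exact: nbhs_pinfty_ge (num_real C).
by apply: filterS HC => b Hb cb x Kx; have [_] := mono _ _ _ _ (Hb x Kx) CC'; apply=> //; exact: KU.
Unshelve. all: by end_near.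
Qed.

Local Notation J g := (chart_integral vol d g).
Local Notation pot b p := (potential b p).

Lemma compact_bounded (T : topologicalType) (I : finType) (K : set T) (g : I -> T -> R) : compact K ->
  (forall i x, K x -> {for x, continuous (g i)}) -> \forall C \near +oo, forall x, K x -> forall i, `|g i x| <= C.
Proof.
move=> cK cg; have [||C [_ HC]] := @compact_uniform R T K (fun C x => forall i, `|g i x| <= C) cK.
- by move=> c c' x h cc' i; exact: le_trans (h i) cc'.
- by move=> x Kx; have [C _ h] := near_bounded (fun i => cg i x Kx); exists C.
by near=> C' => x Kx i; apply: le_trans (HC x Kx i) _.
Unshelve. all: by end_near.
Qed.

(** The integral of the cut-off divergence vanishes, so n + 5/2 times it may be subtracted. What
    remains is bounded from below by [pointwise_estimate], with constants that hold on the compact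
    support of [psi]. *)
Theorem chart_estimate b0 (psi tau : N -> R) : (0 < n)%N -> b0 != 0 -> (forall p, 0 <= pot b0 p) ->
  positive_chart vol d -> smooth_function psi -> smooth_function tau -> (forall p, 0 <= psi p <= 1) ->
  (forall p, 0 < tau p) -> supported_in d psi ->
  exists c D, [/\ 0 < c, 0 <= D & \forall b \near b0, Sasaki_cone rho eta b ->
    smooth_function (transverse_scalar_curvature S rho eta b) ->
    c * J (fun p => psi p ^+ 4 * tau p * (pot b p)^-1 ^+ n.+1) - D * J (fun p => psi p ^+ 2 * (pot b p)^-1 ^+ n)
    <= J (fun p => psi p ^+ 4 * tau p * (transverse_scalar_curvature S rho eta b p * (pot b p)^-1 ^+ n.+1))].
Proof.
move=> n0 b00 pot0 [_ vpos] sp st p01 t0 supp.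
have [K [cK HK1 HK2]] := chart_support_compact N_compact supp.
have KU : K `<=` U by move=> x /HK1[].
pose ps x := psi (cinv d x); pose ta x := tau (cinv d x).
have sps : smooth_on U ps := sp d sd; have sta : smooth_on U ta := st d sd.
pose al l x := \sum_j (4 * pd (dir j) ps x * ta x + ps x * pd (dir j) ta x) * H j l (sl x).
have sal l : smooth_on U (al l) by apply: smooth_sum.
have svi : smooth_on U (fun x => (ta x)^-1) by apply: smoothV => // x _; rewrite gt_eqF ?t0.
have bd (I : finType) (g : I -> E -> R) : (forall i, smooth_on U (g i)) ->
    \forall C \near +oo, forall x, K x -> forall i, `|g i x| <= C.
  by move=> sg; apply: compact_bounded => // i x /KU Ux; exact: smooth_cont (sg i) Ux.
have n1 := bd _ (fun u : unit => scalar_curvature h \o sl) (fun _ => smooth_sl (smooth_scalar_curvature oD sh hsym hu)).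
have n2 := bd _ (fun u : unit => ta) (fun _ => sta).
have n3 := bd _ (fun u : unit => fun x => (ta x)^-1) (fun _ => svi).
have n4 := bd _ _ sal.
have n5 := bd _ _ smooth_drift.
have n6 := bd _ (fun l x => h (sl x) l l) (fun l => smooth_sl (smooth_entry l l oD sh)).
have n7 := laplacian_gt0_near b00 pot0 cK KU.
(* Each bound holds for all large constants, so one constant satisfies them all. *)
have [C [C1 [h1 [h2 [h3 [h4 [h5 [h6 h7]]]]]]]] := @filter_ex _ (pinfty_nbhs R) _ _ (filterI (nbhs_pinfty_ge (num_real 1))
  (filterI n1 (filterI n2 (filterI n3 (filterI n4 (filterI n5 (filterI n6 n7))))))).
have C0 : 0 < C by exact: lt_le_trans ltr01 C1.
have nu1 : 1 <= n%:R :> R by rewrite ler1n.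
have [c [D [c0 D0 est]]] := pointwise_estimate n.*2 nu1 C1.
exists c, D; split=> //; apply: filterS h7 => b lapC cb ss.
have {lapC} := lapC cb => lapC.
have potE x : U x -> pot b (cinv d x) = f b (sl x).
  have [t [y ->]] := pt_surj (x : 'rV[R]_(1 + n.*2)) => Ux.
  by rewrite (potential_slice b ad Ux) /sl row_mxKr.
have pp p : 0 < pot b p by exact: ((potential_cone b).1 cb).
have sP m : smooth_function (fun p => (pot b p)^-1 ^+ m).
  move=> c' sc'; have oc := @chart_open_cod _ _ _ c'; apply: smoothX => //.
  apply: smoothV => // [x _|]; first by rewrite gt_eqF.
  exact: (potential_smooth_function b).
have sX m (g : N -> R) : smooth_function g -> smooth_function (fun p => g p ^+ m).
  by move=> sg c' sc'; apply: smoothX; [exact: chart_open_cod|exact: sg].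
pose X4 p := psi p ^+ 4 * tau p; have sX4 : smooth_function X4 by apply: smooth_functionM => //; exact: sX.
pose sv p := transverse_scalar_curvature S rho eta b p * (pot b p)^-1 ^+ n.+1.
have ssv : smooth_function sv by exact: smooth_functionM.
pose g1 p := X4 p * sv p; pose g2 p := X4 p * (pot b p)^-1 ^+ n.+1; pose g3 p := psi p ^+ 2 * (pot b p)^-1 ^+ n.
have s1 : smooth_function g1 by exact: smooth_functionM.
have s2 : smooth_function g2 by apply: smooth_functionM.
have s3 : smooth_function g3 by apply: smooth_functionM => //; exact: sX.
have X40 p : psi p = 0 -> X4 p = 0 by move=> p0; rewrite /X4 p0 expr0n mul0r.
have u1 : supported_in d g1 by apply: supported_in_sub supp => p /X40; rewrite /g1 => ->; rewrite mul0r.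
have u2 : supported_in d g2 by apply: supported_in_sub supp => p /X40; rewrite /g2 => ->; rewrite mul0r.
have u3 : supported_in d g3 by apply: supported_in_sub supp => p p0; rewrite /g3 p0 expr0n mul0r.
have u4 : supported_in d X4 by apply: supported_in_sub supp.
have s12 := smooth_function_linear (- c) s1 s2.
have u12 := supported_inD (a := - c) u1 u2.
pose G p := (g1 p + - c * g2 p) + D * g3 p.
have sG : smooth_function G := smooth_function_linear D s12 s3.
have uG : supported_in d G := supported_inD (a := D) u12 u3.
suff : 0 <= J G.
  rewrite /G (chart_integral_linear N_compact svols) //.
  rewrite (chart_integral_linear N_compact svols) //.
  by rewrite /g1 /g2 /g3 /X4 /sv; move: (J _) (J _) (J _) => j1 j2 j3; lra.
have f0 x : U x -> f b (sl x) != 0 by move=> Ux; rewrite gt_eqF // -potE.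
(* The vector density vol psi^4 tau f^(-n-1) grad f, extended by zero. It has no time component
   because f is constant along the flow of b1. *)
pose W j := zero_extension d X4 (fun x => (f b (sl x))^-1 ^+ n.+1 * \sum_l (vol d x * H j l (sl x)) * pd l (f b) (sl x)).
have cW j : compact_smooth (W j).
  by apply: zero_extension_smooth => //; apply: smoothM => //; apply: smoothX => //; apply: smoothV.
have W0 j x : ~ K x -> pd (dir j) (W j) x = 0.
  move=> Kx; have oK : open (~` K) by apply: closed_openC; exact: compact_closed (@norm_hausdorff _ _) cK.
  rewrite (pd_ext (g := fun=> 0) _ oK Kx) ?pd_cst // => z Kz.
  apply: (zero_extension_out (K := K)) Kz => z' Uz' X4z; apply: HK2 => //.
  by apply: contraNneq X4z => /X40 ->.
have [A A0 KA] := compact_bound cK.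
have sW j : supported A (pd (dir j) (W j)).
  split=> [x|x Ax]; first by apply: (smooth_cont (U := setT)) => //; apply: smooth_on_pd; case: (cW j).
  by apply: W0 => /KA; rewrite ltNge Ax.
have [I0 sD] := iterated_integral_sum sW.
have [sGv [B [B0 HB]]] : compact_smooth (zero_extension d G (vol d)) by exact: zero_extension_smooth.
have sGB : supported B (zero_extension d G (vol d)) by split=> // x; exact: smooth_cont sGv _.
have {}I0 : iterated_integral (fun x => (n%:R + 5 / 2) * \sum_j pd (dir j) (W j) x) = 0.
  rewrite (iterated_integral_scale _ sD) I0 big1 ?mulr0 // => j _.
  by have [sWj [B' [B'0 HB']]] := cW j; exact: iterated_integral_pd B'0 sWj HB'.
rewrite -[leLHS]I0 /chart_integral; apply: (@iterated_integral_mono _ _ (Num.max A B)).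
- apply: (supported_le (A := A)); first by rewrite le_max lexx.
  split=> [x|x Ax]; first by apply: (@cvgM _ _ (nbhs x)); [exact: cvg_cst|exact: (sD.1 x)].
  by rewrite sD.2 // mulr0.
- by apply: supported_le sGB; rewrite le_max lexx orbT.
move=> x; have [Kx|Kx] := pselect (K x); last first.
  rewrite big1 => [|j _]; last exact: W0.
  rewrite mulr0 /zero_extension; case: asboolP => // Ux.
  have p0 : psi (cinv d x) = 0 by apply/eqP; apply: contrapT => /negP h; apply: Kx; exact: HK2.
  by rewrite /G /g1 /g2 /g3 X40 // p0 expr0n !mul0r !mulr0 !addr0 mul0r.
have Ux := KU x Kx; rewrite /zero_extension asboolT //.
pose ch z := ps z ^+ 4 * ta z; have sch : smooth_on U ch by apply: smoothM => //; exact: smoothX.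
have -> : \sum_j pd (dir j) (W j) x = \sum_j pd (dir j) (fld ch b j) x.
  apply: eq_bigr => j _; apply: (pd_ext _ oU Ux) => z Uz.
  by rewrite /W /zero_extension asboolT.
rewrite divergence //; set y := sl x; have Uy : slice_dom r y := slU Ux.
have -> : \sum_l (\sum_j pd (dir j) ch x * H j l y) * pd l (f b) y = ps x ^+ 3 * \sum_l al l x * pd l (f b) y.
  rewrite mulr_sumr; apply: eq_bigr => l _; rewrite mulrA; congr (_ * _); rewrite mulr_sumr; apply: eq_bigr => j _.
  rewrite mulrA; congr (_ * _); rewrite (jet1M Ux) //.
  by rewrite (jet1X _ _ Ux) //; move: (pd _ ps x) (pd _ ta x) => u v; ring.
have -> : G (cinv d x) * vol d x = vol d x * (f b y)^-1 ^+ n.+1 *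
   (ch x * (transverse_scalar_curvature S rho eta b (cinv d x)) - c * ch x + D * (ps x ^+ 2 * f b y)).
  rewrite /G /g1 /g2 /g3 /sv /X4 potE // -/y -/(ps x) -/(ta x) /ch; have := f0 x Ux; rewrite -/y (exprSr _ n).
  move: ((f b y)^-1 ^+ n) (transverse_scalar_curvature _ _ _ _ _) (f b y) => P s g g0; by field.
have V0 : 0 <= vol d x * (f b y)^-1 ^+ n.+1.
  by apply: mulr_ge0; [exact: (ltW (vpos x Ux))|rewrite exprn_ge0 // invr_ge0 ltW // f_gt0].
rewrite mulrCA (ler_wpM2l V0) //.
have [t [y' xE]] := pt_surj (x : 'rV[R]_(1 + n.*2)).
have yE : y' = y by rewrite /y /sl xE row_mxKr.
have xE' : d (cinv d x) = pt t y by rewrite chart_invK // xE yE.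
rewrite (transverse_scalar_curvatureE cone1 cb ad (chart_inv_dom Ux) xE') /=.
have [g0 qg] := gradient_sqr_bound hsym hu (f b) Uy (slice_metric_positive cone1 ad Uy).
have fp := f_gt0 cb Uy.
have tC : 1 <= C * ta x by have := le_trans (ler_norm _) (h3 x Kx tt); rewrite -ler_pdivrMr ?mul1r // t0.
have qC l : (pd l (f b) y) ^+ 2 <= C * gradient_sqr h (f b) y.
  by apply: le_trans (qg l) _; rewrite ler_wpM2r // (le_trans (ler_norm _)) ?h6.
have := est (fun l => pd l (f b) y) (al^~ x) (drift^~ x) (ps x) (ta x) (f b y) (gradient_sqr h (f b) y)
  (laplacian h (f b) y) (scalar_curvature h y) (p01 _) (le_trans (ler_norm _) (h2 x Kx tt)) tC fp g0 (h1 x Kx tt)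
  qC (h4 x Kx) (h5 x Kx) (lapC x Kx).
rewrite (_ : n.*2%:R = 2 * n%:R) -?(natr1 n) /ch; last by rewrite -mul2n natrM.
move: (\sum_l _) (\sum_l _) (scalar_curvature h y) (laplacian _ _ _) (gradient_sqr _ _ _ / _) => s1' s2' s L g.
by lra.
Qed.
End ChartEstimate.
End AdaptedChart.

(** * Divergence of the total curvature at the boundary *)

Section Divergence.
Hypothesis n_gt0 : (0 < n)%N.
Local Notation vol := (contact_volume (eta_xi rho eta b1)).
Local Notation J d g := (chart_integral vol d g).
Local Notation pot b p := (potential b p).
Local Notation cone := (Sasaki_cone rho eta).
Local Notation scal b p := (transverse_scalar_curvature S rho eta b p).

Let svol c : smooth_chart c -> smooth_on (ccod c) (vol c). Proof. exact: contact_volume_smooth. Qed.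
Let vol_change c d x : smooth_chart c -> smooth_chart d -> local_dom idfun c d x ->
  vol c x = \det (jac (local_map idfun c d) x) * vol d (local_map idfun c d x).
Proof. exact: (contact_volume_change cone1). Qed.
Let pot_smooth b : smooth_function (potential b).
Proof. exact: (potential_smooth_function). Qed.
Let pot_gt0 b p : cone b -> 0 < pot b p.
Proof. by move=> cb; exact: ((potential_cone b).1 cb). Qed.

Lemma chart_integral_mono d g g' : positive_chart vol d -> smooth_function g -> smooth_function g' ->
  supported_in d g -> supported_in d g' -> (forall p, g p <= g' p) -> J d g <= J d g'.
Proof.
move=> pd_ sg sg' ug ug' gg; have [sd _] := pd_.
have := chart_integral_ge0 pd_ (fun p => _ : 0 <= g' p + -1 * g p); rewrite (chart_integral_linear N_compact svol) //.
by move=> h; have := h _; rewrite mulN1r subr_ge0; apply=> p; rewrite mulN1r subr_ge0.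
Qed.

Lemma chart_integral_scale d g a : positive_chart vol d -> smooth_function g -> supported_in d g ->
  J d (fun p => a * g p) = a * J d g.
Proof.
move=> [sd _] sg ug; have s0 : smooth_function (fun _ : N => 0 : R) by move=> c sc.
have := chart_integral_linear N_compact svol a sd s0 sg (@supported_in0 _ _ _ d) ug.
by rewrite chart_integral0 add0r => <-; congr chart_integral; apply/funext => p; rewrite add0r.
Qed.

Lemma transverse_smooth b : cone b -> smooth_function (transverse_scalar_curvature S rho eta b).
Proof.
move=> cb; apply: smooth_function_local => p; have [d [r [ad dp _]]] := adapted_at p cone1.
exists d, setT; split=> //; [exact: adapted_smooth ad|exact: openT|].
by rewrite setTI; exact: (transverse_smooth_on ad cb).
Qed.

(** The density of [b] is f_b^(-n-1) times that of b1, so one partition of unity and one family of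
    positive charts serve all elements of the cone. *)
Lemma total_curvatureE b r (c : 'I_r -> chart R N n.*2.+1) chi : cone b -> positive_partition vol c chi ->
  total_transverse_scalar_curvature S rho eta b
    = (n`!%:R)^-1 * \sum_i J (c i) (fun p => chi i p * (scal b p * (pot b p)^-1 ^+ n.+1)).
Proof.
move=> cb pp; have [posc hchi _] := pp.
have P0 p : 0 < (pot b p)^-1 ^+ n.+1 by rewrite exprn_gt0 // invr_gt0 pot_gt0.
have sP : smooth_function (fun p => (pot b p)^-1 ^+ n.+1).
  by apply/smooth_functionX/smooth_functionV => // p; rewrite gt_eqF // pot_gt0.
have sF : smooth_function (fun p => scal b p / n`!%:R).
  move=> d sd; apply: smoothM; [exact: chart_open_cod|exact: (transverse_smooth cb)|exact: smooth_cst].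
have volE d x : smooth_chart d -> ccod d x ->
    contact_volume (eta_xi rho eta b) d x = (pot b (cinv d x))^-1 ^+ n.+1 * vol d x.
  move=> sd dx; rewrite (potentialE b sd (chart_inv_dom dx)) (chart_invK dx).
  exact: (contact_volume_potential cone1 cb sd dx).
rewrite /total_transverse_scalar_curvature (integral_overE N_compact svol vol_change volE P0 sP sF pp) mulr_sumr.
apply: eq_bigr => i _; have [si c0 ui] := hchi i; rewrite -chart_integral_scale //.
- by congr chart_integral; apply/funext => p; ring.
- by apply: smooth_functionM => //; apply: smooth_functionM => //; exact: transverse_smooth.
- by apply: supported_in_sub ui => p ->; rewrite mul0r.
Qed.

Lemma potential_near b0 (e : R) : 0 < e -> \forall b \near b0, forall p, `|pot b p - pot b0 p| < e.
Proof.
move=> e0; have [C C0 lip] := potential_lipschitz.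
have eC : 0 < e / C by rewrite divr_gt0.
apply: filterS (nbhsx_ballx b0 _ eC) => b bb p; apply: le_lt_trans (lip _ _ _) _.
by move: bb; rewrite -ball_normE /= distrC ltr_pdivlMr // mulrC.
Qed.

Lemma potential_limit_ge0 b0 p : closure cone b0 -> 0 <= pot b0 p.
Proof.
move=> cl; rewrite leNgt; apply/negP => p0; have [|b [cb /(_ p)]] := cl _ (@potential_near b0 (- pot b0 p) _).
  by rewrite oppr_gt0.
have := pot_gt0 p cb; rewrite ltr_norml; move: (pot b p) (pot b0 p) p0 => u v v0 u0 /andP[_]; lra.
Qed.

(** Without a zero, compactness bounds f_b0 below by a positive constant, and then nearby potentials
    are positive too: [b0] would be interior. *)
Lemma potential_limit_zero b0 : closure cone b0 -> ~ interior cone b0 -> exists p, pot b0 p = 0.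
Proof.
move=> cl ni; apply: contrapT => nz; apply: ni.
have p0 p : 0 < pot b0 p.
  rewrite lt_neqAle potential_limit_ge0 // andbT eq_sym; apply: contra_notN (nz) => /eqP; by exists p.
have [B B0 hB] := smooth_function_bounded N_compact (smooth_functionV (fun p => negbT (gt_eqF (p0 p))) (@pot_smooth b0)).
have B1 : 0 < B^-1 by rewrite invr_gt0.
apply: filterS (potential_near b0 B1) => b hb; apply/(potential_cone) => p.
have := le_trans (ler_norm _) (hB p); rewrite -lef_pV2 ?posrE ?invr_gt0 // invrK => h1.
by have := hb p; rewrite ltr_norml; move: (pot b p) (pot b0 p) h1 => u v h1 /andP[h2 _]; lra.
Qed.

(** Only a small cube around the zero is used: there the weight is at least [a], and the side of the
    cube is chosen according to [A] before b approaches b0. *)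
Lemma chart_integral_unbounded b0 p d chi A : closure cone b0 -> pot b0 p = 0 -> positive_chart vol d ->
  smooth_function chi -> (forall q, 0 <= chi q) -> 0 < chi p -> supported_in d chi ->
  \forall b \near b0, cone b -> A <= J d (fun q => chi q * (pot b q)^-1 ^+ n.+1).
Proof.
move=> cl pp [sd vpos] sc c0 cp ud; have od := @chart_open_cod _ _ _ d; have scd := sc d sd.
have dp : cdom d p by apply: ud; apply: subset_closure; rewrite /= gt_eqF.
pose x0 := d p; have Ux : ccod d x0 by exact: chart_map_cod.
have xK : cinv d x0 = p by rewrite /x0 chart_mapK.
have [L [r [L0 r0 quad]]] := quadratic_at_minimum od Ux (@pot_smooth b0 d sd) (fun x _ => potential_limit_ge0 _ cl) (etrans (congr1 _ xK) pp).
pose w x := chi (cinv d x) * vol d x; have sw : smooth_on (ccod d) w by apply: smoothM => //; exact: svol.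
pose a := w x0 / 2; have w0 : 0 < w x0 by rewrite /w xK mulr_gt0 // vpos.
have a0 : 0 < a by rewrite divr_gt0.
have nw : \forall x \near x0, ccod d x /\ a < w x.
  apply: filterI; first exact: open_nbhs_nbhs.
  have cw : {for x0, continuous w} := smooth_cont sw Ux.
  apply: (cw [set t : R | a < t]); apply: open_nbhs_nbhs; split; first exact: open_gt.
  by rewrite /= /a ltr_pdivrMr // ltr_pMr // ltr1n.
have [r1 /= r10 H1] := (nbhs_ballP _ _).1 nw.
(* On the cube of side s the integrand is at least a (2 L s^2)^(-n-1) and the volume is s^(2n+1),
   which gives D / s; the choice of [s] makes this at least [A]. *)
pose D := a * (2 * L)^-1 ^+ n.+1; have D0 : 0 < D by rewrite mulr_gt0 // exprn_gt0 // invr_gt0 mulr_gt0.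
pose s := Num.min (Num.min r r1) (D / (`|A| + 1)).
have A1 : 0 < `|A| + 1 by [].
have s0 : 0 < s by rewrite !lt_min r0 r10 divr_gt0.
have sr : s <= r by rewrite !ge_min lexx.
have sr1 : s <= r1 by rewrite !ge_min lexx orbT.
have sA : A <= D / s.
  rewrite ler_pdivlMr //; apply: le_trans (_ : `|A| * s <= _); first by rewrite ler_wpM2r ?ler_norm // ltW.
  apply: le_trans (_ : (`|A| + 1) * s <= _); first by rewrite ler_wpM2r ?lerDl // ltW.
  by rewrite mulrC -ler_pdivlMr // !ge_min lexx !orbT.
(* Within this distance of f_b0, which is at most L s^2 on the cube, the potential of b is at most 2
   L s^2. *)
have e0 : 0 < L * s ^+ 2 by rewrite mulr_gt0 // exprn_gt0.
apply: filterS (potential_near b0 e0) => b bb cb; apply: le_trans sA _.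
pose g q := chi q * (pot b q)^-1 ^+ n.+1.
have sP : smooth_function (fun q => (pot b q)^-1 ^+ n.+1).
  by apply/smooth_functionX/smooth_functionV => // q; rewrite gt_eqF // pot_gt0.
have sg : smooth_function g by exact: smooth_functionM.
have ug : supported_in d g by apply: supported_in_sub ud => q; rewrite /g => ->; rewrite mul0r.
have g0 q : 0 <= g q by rewrite mulr_ge0 // exprn_ge0 // invr_ge0 ltW // pot_gt0.
have [sz [B [B0 HB]]] := zero_extension_smooth N_compact sd sg ug (svol sd).
have sup : supported B (zero_extension d g (vol d)) by split=> // x; exact: smooth_cont sz _.
have := @iterated_integral_lower R _ B (zero_extension d g (vol d)) (a * (2 * L * s ^+ 2)^-1 ^+ n.+1) (s / 2) x0 B0 sup.
have -> : a * (2 * L * s ^+ 2)^-1 ^+ n.+1 * (2 * (s / 2)) ^+ n.*2.+1 = D / s.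
  rewrite (_ : 2 * (s / 2) = s); last by field.
  rewrite /D invfM exprMn mulrA -mulrA; congr (_ * _).
  by rewrite exprVn -exprM mul2n doubleS -addn2 -addSnnS exprD invfM; field; rewrite !expf_neq0 ?gt_eqF.
apply; first by rewrite divr_ge0 // ltW.
  by move=> x; apply: zero_extension_ge0 => // z /vpos /ltW.
move=> x xs; have bx : ball x0 s x.
  rewrite -ball_normE /= distrC; apply: le_lt_trans xs _; by rewrite ltr_pdivrMr // ltr_pMr // ltr1n.
have [dx ax] := H1 x (le_ball sr1 bx).
have -> : zero_extension d g (vol d) x = w x * (pot b (cinv d x))^-1 ^+ n.+1.
  by rewrite /zero_extension (asboolT dx); exact: mulrAC.
apply: ler_pM (ltW a0) _ (ltW ax) _.
  by rewrite exprn_ge0 // invr_ge0 !mulr_ge0 // ?exprn_ge0 // ltW.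
rewrite lerXn2r ?nnegrE ?invr_ge0 ?(ltW (pot_gt0 _ cb)) //.
  by rewrite !mulr_ge0 // ?exprn_ge0 // ltW.
rewrite lef_pV2 ?posrE ?pot_gt0 //; last by rewrite !mulr_gt0 // exprn_gt0.
have := quad s x s0 sr bx; have := bb (cinv d x); rewrite ltr_norml => /andP[_].
by rewrite -mulrA; move: (L * s ^+ 2) (pot b _) (pot b0 _) => e u v h1 h2; lra.
Qed.

(** With t = 1 / f this trades the error of order f^(-n) for a small part of the main term and a
    constant. *)
Lemma powers_interpolation (t e : R) m : 0 < e -> 0 <= t -> t ^+ m <= e * t ^+ m.+1 + e^-1 ^+ m.
Proof.
move=> e0 t0; have [h|h] := lerP 1 (e * t).
  rewrite exprS mulrA; apply: le_trans (_ : e * t * t ^+ m <= _); first by rewrite ler_peMl // exprn_ge0.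
  by rewrite lerDl exprn_ge0 // invr_ge0 ltW.
apply: ler_wpDl; first by rewrite mulr_ge0 ?exprn_ge0 // ltW.
by rewrite lerXn2r ?nnegrE ?invr_ge0 ?(ltW e0) // -[e^-1]mul1r ler_pdivlMr // mulrC ltW.
Qed.

(** The partition consists of fourth powers of cut-offs, normalised by the common factor [tau], so
    that its derivatives carry the third powers that [chart_estimate] relies on. *)
Lemma positive_partition_exists : exists r (c : 'I_r -> chart R N n.*2.+1) (psi : 'I_r -> N -> R) (tau : N -> R),
  [/\ forall i, (exists e, @adapted R n.*2 N k rho b1 (c i) e) /\ positive_chart vol (c i),
      forall i, [/\ smooth_function (psi i), forall p, 0 <= psi i p <= 1 & supported_in (c i) (psi i)],
      smooth_function tau, forall p, 0 < tau p & forall p, \sum_i psi i p ^+ 4 * tau p = 1].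
Proof.
have [p|r [c [psi [hc hpsi psi1]]]] := partition_of_unity (Q := fun c => (exists e, @adapted R n.*2 N k rho b1 c e) /\ positive_chart vol c) N_compact.
  have [d [e [ad pd_ dp]]] := positive_adapted p n_gt0 cone1.
  by exists d; split=> //; [exact: adapted_smooth ad|split=> //; exists e].
pose T p := \sum_i psi i p ^+ 4.
have T0 p : 0 < T p.
  rewrite lt_neqAle sumr_ge0 ?andbT => [|i _]; last by rewrite exprn_ge0; case: (hpsi i).
  apply/eqP => /esym /eqP; rewrite psumr_eq0 => [/allP h|i _]; last by rewrite exprn_ge0; case: (hpsi i).
  have := psi1 p; rewrite big1 => [/eqP|i _]; first by rewrite eq_sym oner_eq0.
  by have := h i (mem_index_enum i); rewrite expf_eq0 /= => /eqP.
exists r, c, psi, (fun p => (T p)^-1); split=> [i|i||p|p].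
- by case: (hc i).
- have [sp p0 up] := hpsi i; split=> // p; rewrite p0 -(psi1 p) (bigD1 i) //= lerDl sumr_ge0 // => j _.
  by case: (hpsi j).
- apply: smooth_functionV => [p|]; first by rewrite gt_eqF.
  by apply: smooth_function_sum => i; apply: smooth_functionX; case: (hpsi i).
- by rewrite invr_gt0.
- by rewrite -mulr_suml -/(T p) mulfV // gt_eqF.
Qed.

Theorem total_curvature_unbounded b0 A : b0 != 0 -> closure cone b0 -> ~ interior cone b0 ->
  \forall b \near b0, cone b -> A <= total_transverse_scalar_curvature S rho eta b.
Proof.
move=> b00 cl ni; have pot0 p := potential_limit_ge0 p cl; have [p0 pp0] := potential_limit_zero cl ni.
have [r [c [psi [tau [hc hpsi st t0 chi1]]]]] := positive_partition_exists.
pose chi i p := psi i p ^+ 4 * tau p.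
have schi i : smooth_function (chi i) by apply: smooth_functionM => //; apply: smooth_functionX; case: (hpsi i).
have chi0 i p : 0 <= chi i p.
  by apply: mulr_ge0 (ltW (t0 p)); apply: exprn_ge0; have [_ /(_ p) /andP[]] := hpsi i.
have uchi i : supported_in (c i) (chi i).
  by have [_ _ u] := hpsi i; apply: supported_in_sub u => p; rewrite /chi => ->; rewrite expr0n mul0r.
have pp : positive_partition vol c chi by split=> // i; case: (hc i).
have /choice[cc ccP] i : exists cD : R * R, [/\ 0 < cD.1, 0 <= cD.2 & \forall b \near b0, cone b ->
    cD.1 * J (c i) (fun p => chi i p * (pot b p)^-1 ^+ n.+1) - cD.2 * J (c i) (fun p => psi i p ^+ 2 * (pot b p)^-1 ^+ n)
    <= J (c i) (fun p => chi i p * (scal b p * (pot b p)^-1 ^+ n.+1))].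
  have [[e ad] pc] := hc i; have [sp p01 up] := hpsi i.
  have [a [D [a0 D0 est]]] := chart_estimate ad n_gt0 b00 pot0 pc sp st p01 t0 up.
  by exists (a, D); split=> //; apply: filterS est => b h cb; apply: h => //; exact: transverse_smooth.
have est : \forall b \near b0, forall i, cone b ->
    (cc i).1 * J (c i) (fun p => chi i p * (pot b p)^-1 ^+ n.+1) - (cc i).2 * J (c i) (fun p => psi i p ^+ 2 * (pot b p)^-1 ^+ n)
    <= J (c i) (fun p => chi i p * (scal b p * (pot b p)^-1 ^+ n.+1)).
  by apply: (filter_forall (F := nbhs b0) (nbhs_filter b0)) => i; case: (ccP i).
(* A common lower bound of the constants of the charts, positive whatever their number. *)
pose a := (\sum_i (cc i).1^-1 + 1)^-1; pose D := \sum_i (cc i).2.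
have aV : 0 < \sum_i (cc i).1^-1 + 1.
  by rewrite ltr_wpDl // sumr_ge0 // => i _; rewrite invr_ge0 ltW //; case: (ccP i).
have a0 : 0 < a by rewrite invr_gt0.
have ai i : a <= (cc i).1.
  have [ci0 _ _] := ccP i; rewrite /a -[leRHS]invrK lef_pV2 ?posrE ?invr_gt0 //.
  rewrite (bigD1 i) //= -addrA lerDl addr_ge0 // sumr_ge0 // => j _; by rewrite invr_ge0 ltW //; case: (ccP j).
have D0 : 0 <= D by apply: sumr_ge0 => i _; case: (ccP i).
have Di i : (cc i).2 <= D.
  by rewrite /D (bigD1 i) //= lerDl sumr_ge0 // => j _; case: (ccP j).
(* With this [e] the total error D r e is at most a / 2, so half of the main term pays for it. *)
pose I0 := \sum_i J (c i) (chi i); pose e := a / (2 * (D * r%:R + 1)).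
have Dr : 0 < D * r%:R + 1 by rewrite ltr_wpDl // mulr_ge0.
have e0 : 0 < e by rewrite divr_gt0 // mulr_gt0.
have [i0 chi_p0] : exists i, 0 < chi i p0.
  apply: contrapT => h; have := chi1 p0; rewrite big1 => [/eqP|i _]; first by rewrite eq_sym oner_eq0.
  by apply/eqP; rewrite eq_le chi0 andbT leNgt; apply/negP => h'; apply: h; exists i.
(* The size of the main term at which its other half exceeds the constants from interpolation by n!
   |A|; the factorial is that of the volume form. *)
pose B := 2 / a * (n`!%:R * `|A| + D * r%:R * (e^-1 ^+ n * I0)).
have pc i : positive_chart vol (c i) by case: (hc i).
have big := chart_integral_unbounded B cl pp0 (pc i0) (schi i0) (chi0 i0) chi_p0 (uchi i0).
apply: filterS2 big est => b big est cb; have {}big := big cb; have {}est i := est i cb.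
rewrite (total_curvatureE cb pp).
have sP m : smooth_function (fun p => (pot b p)^-1 ^+ m).
  by apply/smooth_functionX/smooth_functionV => // p; rewrite gt_eqF // pot_gt0.
have P0 m p : 0 <= (pot b p)^-1 ^+ m by rewrite exprn_ge0 // invr_ge0 ltW // pot_gt0.
have sw (w : N -> R) m : smooth_function w -> smooth_function (fun p => w p * (pot b p)^-1 ^+ m).
  by move=> sw; exact: smooth_functionM.
have uw i m : supported_in (c i) (fun p => chi i p * (pot b p)^-1 ^+ m).
  by apply: supported_in_sub (uchi i) => p ->; rewrite mul0r.
pose JB := \sum_i J (c i) (fun p => chi i p * (pot b p)^-1 ^+ n.+1).
have young j : J (c j) (fun p => chi j p * (pot b p)^-1 ^+ n) <= e * J (c j) (fun p => chi j p * (pot b p)^-1 ^+ n.+1) + e^-1 ^+ n * J (c j) (chi j).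
  have sc : smooth_chart (c j) by case: (pc j).
  rewrite -chart_integral_scale //.
  have u1 : supported_in (c j) (fun p => e * (chi j p * (pot b p)^-1 ^+ n.+1)).
    by apply: supported_in_sub (uchi j) => p ->; rewrite mul0r mulr0.
  have s1 : smooth_function (fun p => e * (chi j p * (pot b p)^-1 ^+ n.+1)).
    by apply: smooth_functionM; [move=> c' sc'; exact: smooth_cst|exact: sw].
  rewrite -(chart_integral_linear N_compact svol _ sc s1 (schi j) u1 (uchi j)).
  apply: (chart_integral_mono (pc j) (sw _ n (schi j)) (smooth_function_linear _ s1 (schi j)) (uw j n) (supported_inD u1 (uchi j))).
  move=> p; rewrite [e * _]mulrCA [e^-1 ^+ n * _]mulrC -mulrDr ler_wpM2l // powers_interpolation //.
  by rewrite invr_ge0 ltW // pot_gt0.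
(* Near the zeros of psi_i the weight psi_i^2 is not controlled by chi_i, so its integral is
   distributed over the whole partition; summing over the charts gives the factor r. *)
have lower i : J (c i) (fun p => psi i p ^+ 2 * (pot b p)^-1 ^+ n) <= e * JB + e^-1 ^+ n * I0.
  have [sp p01 up] := hpsi i; have s2 := smooth_functionX 2 sp.
  rewrite (chart_integral_partition N_compact svol vol_change pp (pc i)) //.
  - rewrite /JB /I0 !mulr_sumr -big_split; apply: ler_sum => j _ /=; apply: le_trans (young j).
    apply: chart_integral_mono => //.
      by apply: supported_in_sub (uchi j) => p ->; rewrite mul0r.
    by move=> p; have /andP[p0' p1] := p01 p; rewrite mulrA ler_wpM2r // ler_piMr // expr_le1.
  - by apply: supported_in_sub up => p ->; rewrite expr0n mul0r.
have J0 i : 0 <= J (c i) (fun p => chi i p * (pot b p)^-1 ^+ n.+1).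
  by apply: chart_integral_ge0 => // p; rewrite mulr_ge0.
have JB0 : 0 <= JB by apply: sumr_ge0 => i _; exact: J0.
have I00 : 0 <= I0 by apply: sumr_ge0 => i _; exact: chart_integral_ge0.
pose X := e * JB + e^-1 ^+ n * I0.
have X0 : 0 <= X.
  by apply: addr_ge0; [exact: mulr_ge0 (ltW e0) JB0|apply: mulr_ge0 I00; rewrite exprn_ge0 // invr_ge0 ltW].
have S1 : a * JB - D * r%:R * X <= \sum_i J (c i) (fun p => chi i p * (scal b p * (pot b p)^-1 ^+ n.+1)).
  apply: (@le_trans _ _ (\sum_i (a * J (c i) (fun p => chi i p * (pot b p)^-1 ^+ n.+1) - D * X))).
    rewrite sumrB -mulr_sumr sumr_const card_ord -[D * X *+ r]mulr_natr -/JB; by rewrite (mulrAC D X).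
  apply: ler_sum => i _; apply: le_trans (est i); apply: lerB; first exact: (ler_wpM2r (J0 i) (ai i)).
  have [_ d0 _] := ccP i; exact: le_trans (ler_wpM2l d0 (lower i)) (ler_wpM2r X0 (Di i)).
have S2 : B <= JB.
  by apply: le_trans big _; rewrite /JB (bigD1 i0) //= lerDl; apply: sumr_ge0 => i _; exact: J0.
rewrite ler_pdivlMl ?ltr0n ?fact_gt0 //; apply: le_trans S1.
have De : D * r%:R * e <= a / 2.
  rewrite (_ : a / 2 = (D * r%:R + 1) * e); first by rewrite ler_wpM2r ?(ltW e0) // lerDl.
  by rewrite /e; field; rewrite gt_eqF.
apply: (@le_trans _ _ (n`!%:R * `|A|)); first by rewrite ler_wpM2l ?ler_norm.
have S3 : n`!%:R * `|A| + D * r%:R * (e^-1 ^+ n * I0) <= a / 2 * JB.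
  by rewrite -ler_pdivrMl ?divr_gt0 // invf_div.
have S4 : D * r%:R * e * JB <= a / 2 * JB by rewrite ler_wpM2r.
have combine (u v q t h : R) : u + v <= h -> q <= h -> t = h + h -> u <= t - (q + v) by lra.
by rewrite /X mulrDr [_ * (e * JB)]mulrA; apply: combine S3 S4 _; rewrite -mulrDl -splitr.
Qed.
End Divergence.
End ReferenceField.
End SasakiCone.

Theorem corollary1p5 (R : realType) (n : nat) (hn : (0 < n)%N)
    (N : manifold R n.*2.+1)
    (N_compact : compact [set: N]) (N_connected : connected [set: N])
    (S : CR_structure N) (S_Sasaki : Sasaki_type S)
    (k : nat) (rho : 'rV[R]_k -> N -> N) (rho_max : maximal_CR_torus S rho)
    (eta : one_form N) (eta_contact : CR_contact_form S eta)
    (b0 : 'rV[R]_k) (b0_neq0 : b0 != 0)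
    (b0_boundary :
      (closure (Sasaki_cone rho eta) `\` interior (Sasaki_cone rho eta)) b0) :
  total_transverse_scalar_curvature S rho eta b
    @[b --> within (Sasaki_cone rho eta) (nbhs b0)] --> +oo.
Proof.
case: b0_boundary => cl ni; have [torus _] := rho_max.
(* The reference Reeb field can be any element of the cone, which is not empty because [b0] lies in
   its closure. *)
have [b1 [cone1 _]] := cl setT filterT.
apply/cvgryPge => A; rewrite near_withinE.
exact: (total_curvature_unbounded torus eta_contact S_Sasaki N_compact N_connected cone1 hn A b0_neq0 cl ni).
Qed.
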